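(* Let $\kappa>0$, $a=\sqrt{2/\kappa}$, $b=\sqrt{\kappa/8}-\sqrt{2/\kappa}$. For every rooted vertex field $\mathcal O=\mathcal O^{(\boldsymbol\sigma,\boldsymbol\sigma_*;\tau,\tau_* )}$ satisfying the neutrality condition $\tau+\tau_*+\sum_{j=1}^n(\sigma_j+\sigma_{j*})=0$, the non-random field $$\widehat{\mathbf E}\,\mathcal O=\frac{\mathbf E[\Psi(p,q)\star\mathcal O]}{\mathbf E[\Psi(p,q)]}$$ is a martingale-observable for radial $\mathrm{SLE}_\kappa$ in $(D,p,q)$.
   Context: Setting. $D\subsetneq\mathbb C$ is a simply connected domain with marked points $p\in\partial D$ and $q\in D$; $w:(D,p,q)\to(\mathbb D,1,0)$ is the conformal map onto the unit disc; $w_j=w(z_j)$, $w_j'=w'(z_j)$, $w_q'=w'(q)$. Radial SLE. Let $B_t$ be a standard Brownian motion, $B_0=0$, $\xi_t=e^{i\sqrt\kappa B_t}$. Let $g_0=w$ and for $z\in D$ let $g_t(z)$ solve $\partial_tg_t(z)=g_t(z)\frac{\xi_t+g_t(z)}{\xi_t-g_t(z)}$ up to its lifetime $\tau_z$. Put $D_t=\{z\in D:\tau_z>t\}$ and $w_t=g_t/\xi_t$, a conformal map of $D_t$ onto $\mathbb D$ with $w_t(q)=0$. The radial $\mathrm{SLE}_\kappa$ curve is $\gamma_t=\lim_{z\to1}w_t^{-1}(z)$, so $w_t:(D_t,\gamma_t,q)\to(\mathbb D,1,0)$. Martingale-observable. A conformally invariant non-random field $M$ (a function $M_{D,p,q}(z_1,\dots,z_n)$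 for every $(D,p,q)$, evaluated in the identity chart of $D$ both at the $z_j$ and at $q$, multivalued fields being followed along continuous branches) is a martingale-observable for $\mathrm{SLE}_\kappa$ if for all $z_1,\dots,z_n\in D$ the process $M_t=M_{D_t,\gamma_t,q}(z_1,\dots,z_n)$, stopped when any $z_j$ exits $D_t$, is a local martingale. Rooted vertex fields. $\Phi^+_{(0)}$ and $\Phi^-_{(0)}=\overline{\Phi^+_{(0)}}$ are formal centered Gaussian fields with $\Phi^+_{(0)}+\Phi^-_{(0)}=\Phi_{(0)}$ (the Gaussian free field), $\mathbf E[\Phi^+_{(0)}(z)\Phi^+_{(0)}(z_0)]=\log\frac1{w(z)-w(z_0)}$ and $\mathbf E[\Phi^+_{(0)}(z)\Phi^-_{(0)}(z_0)]=\log(1-w(z)\overline{w(z_0)})$. For distinct $z_1,\dots,z_n\in D\setminus\{q\}$ and complex numbers $\sigma_j,\sigma_{j*},\tau,\tau_*$, $$\mathcal O^{(\boldsymbol\sigma,\boldsymbol\sigma_*;\tau,\tau_* )}(\boldsymbol z)=(w_q')^{h_q}(\overline{w_q'})^{h_{q*}}\prod_jM_j\prod_{j<k}I_{jk}\;e^{\odot i(\tau\Phi^+_{(0)}(q)-\tau_*\Phi^-_{(0)}(q)+\sum_j\sigma_j\Phi^+_{(0)}(z_j)-\sigma_{j*}\Phi^-_{(0)}(z_j))},$$ $$M_j=(w_j')^{h_j}(\overline{w_j'})^{h_{j*}}w_j^{(b+\tau)\sigma_j}\bar w_j^{(b+\tau_* )\sigma_{j*}}(1-|w_j|^2)^{\sigma_j\sigma_{j*}},$$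 $$I_{jk}=(w_j-w_k)^{\sigma_j\sigma_k}(\bar w_j-\bar w_k)^{\sigma_{j*}\sigma_{k*}}(1-w_j\bar w_k)^{\sigma_j\sigma_{k*}}(1-\bar w_jw_k)^{\sigma_{j*}\sigma_k},$$ with $h_j=\sigma_j^2/2-b\sigma_j$, $h_{j*}=\sigma_{j*}^2/2-b\sigma_{j*}$, $h_q=\tau^2/2$, $h_{q*}=\tau_*^2/2$. The Wick exponential $e^{\odot\cdots}$ has expectation $1$, so the expectation of a rooted vertex field is its non-random prefactor. The product $\star$. $\boldsymbol\sigma,\boldsymbol\sigma_*$ are viewed as finitely supported functions (divisors) on $D\setminus\{q\}$, and $\mathcal O^{(\boldsymbol\sigma_1,\boldsymbol\sigma_{1*};\tau_1,\tau_{1*})}\star\mathcal O^{(\boldsymbol\sigma_2,\boldsymbol\sigma_{2*};\tau_2,\tau_{2*})}=\mathcal O^{(\boldsymbol\sigma_1+\boldsymbol\sigma_2,\boldsymbol\sigma_{1*}+\boldsymbol\sigma_{2*};\tau_1+\tau_2,\tau_{1*}+\tau_{2*})}$. One-leg operator. $\Psi=\mathcal O^{(a,0;-a/2,-a/2)}$ (one node); $\Psi(p,q)$ is its evaluation at the boundary node $p$, the ratio being understood through boundary values. Explicitly, $\widehat{\mathbf E}\,\mathcal O=(w_q')^{\hat h_q}(\overline{w_q'})^{\hat h_{q*}}\prod_j\widehat M_j\prod_{j<k}I_{jk}$, where $\hat h_q=\tau(\tau-a)/2$, $\hat h_{q*}=\tau_*(\tau_*-a)/2$ and $\widehat M_j=(w_j')^{h_j}(\overline{w_j'})^{h_{j*}}w_j^{(b-a/2+\tau)\sigma_j}\bar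 w_j^{(b-a/2+\tau_* )\sigma_{j*}}(1-w_j)^{a\sigma_j}(1-\bar w_j)^{a\sigma_{j*}}(1-|w_j|^2)^{\sigma_j\sigma_{j*}}$. *)

(* Defs.v *)
From HB Require Import structures.
From mathcomp Require Import all_boot all_order all_algebra complex.
From mathcomp Require Import all_classical all_reals all_analysis.

Set Implicit Arguments.
Unset Strict Implicit.
Unset Printing Implicit Defensive.

Import Order.TTheory GRing.Theory Num.Theory.
Import numFieldNormedType.Exports.

Local Open Scope classical_set_scope.
Local Open Scope ring_scope.

(* Naming R[i] as a numClosedFieldType gives it its topology and makes
   [derivable] and [derive1] complex differentiation. *)
Definition Cplx (R : realType) : numClosedFieldType := R[i].

Section ComplexAnalysis.
Variable R : realType.
Local Notation C := (Cplx R).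

Definition cst_of (x : R) : C := (x%:C)%C.

Definition expC (z : C) : C :=
  (expR (complex.Re z) * cos (complex.Im z) +i*
   (expR (complex.Re z) * sin (complex.Im z)))%C.

Definition unit_disc : set C := [set z | `|z| < 1].

Definition boundary (D : set C) : set C := closure D `\` D.

Definition simply_connected (D : set C) : Prop :=
  connected D /\
  forall c : R -> C, {within `[0, 1], continuous c} ->
    c @` `[0, 1] `<=` D -> c 0 = c 1 ->
    exists H : R * R -> C,
      [/\ {within `[0, 1] `*` `[0, 1], continuous H},
          H @` (`[0, 1] `*` `[0, 1]) `<=` D,
          forall s, s \in `[0, 1] -> H (0, s) = c s,
          forall t, t \in `[0, 1] -> H (t, 0) = H (t, 1) &
          exists z, forall s, s \in `[0, 1] -> H (1, s) = z].

(* (D, p, q) is carried by D, q and the conformal map w onto the unit disc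
   with w(q) = 0 and w(p) = 1.  The map determines p, as the boundary point
   (prime end) w^{-1}(1); see [tip] and [conformal_to_disc]. *)
Record marked_domain := MarkedDomain {
  dom : set C;
  root : C;
  unif : C -> C }.

(* The filter of the approaches to p inside D, that is, w(zeta) --> 1. *)
Definition tip (W : marked_domain) : set_system C :=
  [set U | exists2 V, nbhs (1 : C) V & dom W `&` unif W @^-1` V `<=` U].

Definition conformal_to_disc (D : set C) (p q : C) (w : C -> C) : Prop :=
  [/\ forall z, D z -> derivable w z 1,
      {in D &, injective w},
      w @` D = unit_disc,
      w q = 0 &
      tip (MarkedDomain D q w) --> p].

End ComplexAnalysis.

Section RootedVertexFields.
Variable R : realType.
Local Notation C := (Cplx R).

(* [chg] and [chgs] are divisors supported in [nodes]; the order of [nodes]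
   only matters up to the branches of (-1)^s in the factors I_jk. *)
Record rooted_vertex := RootedVertex {
  nodes : seq C;
  chg : C -> C;
  chgs : C -> C;
  rtau : C;
  rtaus : C }.

Definition vertex n (z : 'I_n -> C) (sigma sigmas : 'I_n -> C)
    (tau taus : C) : rooted_vertex :=
  {| nodes := [seq z j | j <- enum 'I_n];
     chg := fun x => \sum_(j | z j == x) sigma j;
     chgs := fun x => \sum_(j | z j == x) sigmas j;
     rtau := tau;
     rtaus := taus |}.

Definition star (X Y : rooted_vertex) : rooted_vertex :=
  {| nodes := undup (nodes X ++ nodes Y);
     chg := fun x => chg X x + chg Y x;
     chgs := fun x => chgs X x + chgs Y x;
     rtau := rtau X + rtau Y;
     rtaus := rtaus X + rtaus Y |}.

(* A choice of logarithms for the bases of the multivalued powers. *)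
Record branches := Branches {
  log_dq : C;
  log_d : C -> C;
  log_w : C -> C;
  log_sub : C -> C -> C;
  log_refl : C -> C -> C }.

Definition branches_of (W : marked_domain R) (s : seq C) (L : branches) :=
  let w := unif W in
  [/\ expC (log_dq L) = derive1 w (root W),
      {in s, forall x, expC (log_d L x) = derive1 w x},
      {in s, forall x, expC (log_w L x) = w x},
      {in s &, forall x y, x != y -> expC (log_sub L x y) = w x - w y} &
      {in s &, forall x y, x != y ->
          expC (log_refl L x y) = 1 - w x * (w y)^*}].

(* u^s * (conj u)^t, where l is a logarithm of u. *)
Definition pow2 (l s t : C) : C := expC (s * l + t * l^*).

Definition dimension (b : R) (s : C) : C := s ^+ 2 / 2 - cst_of b * s.

Definition one_point (b : R) (W : marked_domain R) (X : rooted_vertex)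
    (L : branches) (x : C) : C :=
  pow2 (log_d L x) (dimension b (chg X x)) (dimension b (chgs X x)) *
  pow2 (log_w L x) ((cst_of b + rtau X) * chg X x)
                   ((cst_of b + rtaus X) * chgs X x) *
  expC (chg X x * chgs X x * cst_of (ln (1 - Normc.normc (unif W x) ^+ 2))).

Definition two_point (X : rooted_vertex) (L : branches) (x y : C) : C :=
  pow2 (log_sub L x y) (chg X x * chg X y) (chgs X x * chgs X y) *
  pow2 (log_refl L x y) (chg X x * chgs X y) (chgs X x * chg X y).

Definition root_factor (X : rooted_vertex) (L : branches) : C :=
  pow2 (log_dq L) (rtau X ^+ 2 / 2) (rtaus X ^+ 2 / 2).

(* The set of all the values of the multivalued function E[X] on (D, p, q).
   The Wick exponential of X has expectation 1, so this is the non-random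
   prefactor of X. *)
Definition expectation (b : R) (W : marked_domain R) (X : rooted_vertex) :
    set C :=
  [set v | let s := nodes X in
    [/\ uniq s, {in s, forall x, dom W x /\ x <> root W} &
    exists2 L, branches_of W s L &
      v = root_factor X L * \prod_(x <- s) one_point b W X L x *
          \prod_(j < size s) \prod_(k < size s | (j < k)%N)
            two_point X L (nth 0 s j) (nth 0 s k)]].

(* The values at p of a multivalued function on D: limits at p of its
   continuous branches near p. *)
Definition boundary_values (W : marked_domain R) (f : C -> set C) : set C :=
  [set v | exists (g : C -> C) (U : set C),
    [/\ tip W U, U `<=` dom W, {within U, continuous g},
        forall zeta, U zeta -> f zeta (g zeta) & g @ tip W --> v]].

Definition sle_a (kappa : R) : R := Num.sqrt (2 / kappa).

Definition sle_b (kappa : R) : R :=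
  Num.sqrt (kappa / 8) - Num.sqrt (2 / kappa).

Definition one_leg (kappa : R) (zeta : C) : rooted_vertex :=
  let a := cst_of (sle_a kappa) in
  vertex (fun _ : 'I_1 => zeta) (fun=> a) (fun=> 0) (- a / 2) (- a / 2).

Definition Ehat (kappa : R) (W : marked_domain R) (X : rooted_vertex) :
    set C :=
  let b := sle_b kappa in
  boundary_values W (fun zeta =>
    [set x / y | x in expectation b W (star (one_leg kappa zeta) X)
               & y in expectation b W (one_leg kappa zeta)]).

End RootedVertexFields.

Section StochasticProcesses.
Variables (R : realType) (d : measure_display) (Omega : measurableType d).
Variables (P : probability Omega R) (F : R -> set (set Omega)).
Local Notation C := (Cplx R).

(* Time is [0, +oo[; values at negative times are irrelevant throughout. *)
Definition filtration : Prop :=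
  [/\ forall t, 0 <= t -> sigma_algebra setT (F t),
      forall t, 0 <= t -> F t `<=` measurable &
      forall s t, 0 <= s -> s <= t -> F s `<=` F t].

Definition adapted (X : R -> Omega -> R) : Prop :=
  forall t, 0 <= t -> forall A, measurable A -> F t (X t @^-1` A).

(* [normal_prob m s] has standard deviation s. *)
Definition brownian_motion (B : R -> Omega -> R) : Prop :=
  [/\ forall omega, B 0 omega = 0,
      forall omega, {within `[0, +oo[, continuous (B ^~ omega)},
      adapted B,
      forall s t, 0 <= s -> s < t -> forall A, measurable A ->
        P [set omega | A (B t omega - B s omega)] =
        normal_prob 0 (Num.sqrt (t - s)) A &
      forall s t, 0 <= s -> s < t -> forall A E, measurable A -> F s E ->
        P (E `&` [set omega | A (B t omega - B s omega)]) =
        (P E * P [set omega | A (B t omega - B s omega)%R])%E].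

Definition martingale (X : R -> Omega -> R) : Prop :=
  [/\ adapted X,
      forall t, 0 <= t -> P.-integrable setT (EFin \o X t) &
      forall s t, 0 <= s -> s <= t -> forall E, F s E ->
        (\int[P]_(omega in E) (X t omega)%:E =
         \int[P]_(omega in E) (X s omega)%:E)%E].

Definition cmartingale (X : R -> Omega -> C) : Prop :=
  martingale (fun t omega => complex.Re (X t omega)) /\
  martingale (fun t omega => complex.Im (X t omega)).

Definition stopping_time (T : Omega -> R) : Prop :=
  (forall omega, 0 <= T omega) /\
  (forall t, 0 <= t -> F t [set omega | T omega <= t]).

(* X need only make sense on [0, tau[. *)
Definition local_martingale (tau : Omega -> \bar R) (X : R -> Omega -> C) :
    Prop :=
  exists T : nat -> Omega -> R,
    [/\ forall n, stopping_time (T n),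
        forall n omega, T n omega <= T n.+1 omega,
        forall n omega, ((T n omega)%:E < tau omega)%E,
        {ae P, forall omega, (T n omega)%:E @[n --> \oo] --> tau omega} &
        forall n, cmartingale (fun t omega => X (Num.min t (T n omega)) omega)].

End StochasticProcesses.

Section RadialSLE.
Variable R : realType.
Local Notation C := (Cplx R).

(* u solves the radial Loewner equation driven by xi on [0, T[. *)
Definition loewner_solution (xi : R -> C) (z : C) (T : R) (u : R -> C) :
    Prop :=
  [/\ u 0 = z,
      {within `[0, T[, continuous u},
      forall t, 0 <= t < T -> u t != xi t &
      forall t, 0 < t < T ->
        let v := u t * ((xi t + u t) / (xi t - u t)) in
        is_derive t 1 (fun s => complex.Re (u s)) (complex.Re v) /\
        is_derive t 1 (fun s => complex.Im (u s)) (complex.Im v)].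

Definition lifetime (xi : R -> C) (z : C) : \bar R :=
  ereal_sup [set T%:E | T in
    [set T : R | 0 < T /\ exists u, loewner_solution xi z T u]].

(* g_t as a function of the initial point g_0(z) = w(z). *)
Definition loewner_flow (xi : R -> C) (t : R) (z : C) : C :=
  xget 0 [set v | exists T u,
    [/\ t < T, loewner_solution xi z T u & u t = v]].

Definition driving (kappa x : R) : C := expC (0 +i* (Num.sqrt kappa * x))%C.

(* (D_t, gamma_t, q), carried by w_t = g_t / xi_t. *)
Definition evolved (xi : R -> C) (t : R) (W : marked_domain R) :
    marked_domain R :=
  {| dom := [set z | dom W z /\ (t%:E < lifetime xi (unif W z))%E];
     root := root W;
     unif := fun z => loewner_flow xi t (unif W z) / xi t |}.

Definition exit_time n (xi : R -> C) (W : marked_domain R) (z : 'I_n -> C) :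
    \bar R :=
  \big[mine/+oo%E]_(j < n) lifetime xi (unif W (z j)).

Section Observable.
Variables (n : nat) (M : marked_domain R -> ('I_n -> C) -> set C).
Variables (kappa : R) (W : marked_domain R) (z : 'I_n -> C).
Variables (Omega : Type) (B : R -> Omega -> R).

Let xi omega t := driving kappa (B t omega).

(* X is the process M_{D_t, gamma_t, q}(z), followed along the continuous
   branch with the (deterministic) initial value v. *)
Definition follows (v : C) (X : R -> Omega -> C) : Prop :=
  forall omega, let tau := exit_time (xi omega) W z in
    [/\ X 0 omega = v,
        {within [set t | 0 <= t /\ (t%:E < tau)%E], continuous (X ^~ omega)} &
        forall t, 0 <= t -> (t%:E < tau)%E ->
          M (evolved (xi omega) t W) z (X t omega)].

End Observable.

(* A non-random field assigns to each marked domain and each z the set of its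
   values, which is empty at the z where the field is not defined. *)
Definition martingale_observable (kappa : R) (W : marked_domain R) n
    (M : marked_domain R -> ('I_n -> C) -> set C) : Prop :=
  forall (d : measure_display) (Omega : measurableType d)
    (P : probability Omega R) (F : R -> set (set Omega)) (B : R -> Omega -> R),
  filtration F -> brownian_motion P F B ->
  forall (z : 'I_n -> C) (v : C), (forall j, dom W (z j)) -> M W z v ->
    (exists X, follows M kappa W z B v X) /\
    (forall X, follows M kappa W z B v X ->
       local_martingale P F
         (fun omega => exit_time (fun t => driving kappa (B t omega)) W z) X).

End RadialSLE.

(* Main.v *)
(* Put w_t = g_t / xi_t, xi_t = exp(i theta_t).  The Loewner equation gives
   logarithms for all the factors of the observable as explicit time integrals:
   with r_j = 1/(1 - w_t(z_j)), d log(g_t(z_j) - g_t(z_k)) = (2 r_j r_k - 1) dt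
   and d log(1 - w_j conj(w_k)) = - 2 (r_j - 1) conj(r_k - 1) dt.  So the
   observable is N_t = exp(Lambda_t) times one of countably many constants,
   hence a continuous branch along a path is v exp(Lambda_t - Lambda_0).  Over a
   time h with increment x of theta, N_{t+h}/N_t = 1 + Z x + G (x^2 - kappa h)
   + O(|x|^3 + h eta), eta being the oscillation of the driving function: the
   remaining coefficient of h vanishes by an identity between polynomials in the
   r_j that uses neutrality.  Since x is a centered Gaussian of variance kappa h
   independent of the past, summing over a grid, with the increments truncated
   at a level that tends to 0 last, makes N a martingale up to the exit times
   from { |1 - w_j| > 2 eps, |theta| < m, t < m }, without stochastic integrals.
   Up to such a time the Loewner equation agrees with one where 1/(1 - w) is
   replaced by a globally Lipschitz function; Picard iteration solves the
   latter and shows that its solution is adapted. *)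

Require Import Defs.
From mathcomp Require Import all_boot all_order all_algebra complex.
From mathcomp Require Import all_classical all_reals all_analysis.
From mathcomp Require Import measurable_realfun probability_measure.
From mathcomp Require Import ring lra.

Import Order.TTheory GRing.Theory Num.Theory.
Import numFieldNormedType.Exports.

Local Open Scope classical_set_scope.
Local Open Scope ring_scope.

Set Implicit Arguments.
Unset Strict Implicit.
Unset Printing Implicit Defensive.

Local Notation Re := complex.Re.
Local Notation Im := complex.Im.

(** * Complex numbers, exponential and logarithm *)

Section ComplexBasics.
Variable R : realType.
Local Notation C := (Cplx R).
Implicit Types (x y z l : C) (r e : R).

(** Three facts tame the boundary values. Near the tip the bases y, y - w(z_j) and 1 - y
    conj(w(z_j)), with y close to 1, lie in the right half-plane, where one explicit logarithm
    serves; the factor w'(zeta), which need not extend to p, cancels between numerator and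
    denominator. Two choices of logarithms differ by multiples of 2 pi i, so only countably many
    phases occur. A continuous function on an interval with countably many values is constant: this
    fixes the branch near p as well as the branch in time. To describe the values on (D_t, gamma_t,
    q), w_t must be onto the disc with continuous inverse, which comes from the time-reversed flow,
    and w' must not vanish, which comes from mean values of holomorphic functions. The expansion
    over a time step needs a small increment. Its constants are uniform over all paths, but the size
    of its o(h) term depends on the modulus of continuity of the path. Hence the truncation, and two
    bounds on the remainder: a uniform one for domination and a pathwise one for the limit. A cubic
    error is at most eta x^2, whose sum has mean O(eta). *)

Definition nm (z : C) : R := Normc.normc z.
Definition iu : C := (0 +i* 1)%C.

Lemma eqcx z z' : Re z = Re z' -> Im z = Im z' -> z = z'.
Proof. by case: z z' => a b [c d] /= -> ->. Qed.

Lemma cReD x y : Re (x + y) = Re x + Re y. Proof. by case: x y => a b []. Qed.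
Lemma cImD x y : Im (x + y) = Im x + Im y. Proof. by case: x y => a b []. Qed.
Lemma cReN x : Re (- x) = - Re x. Proof. by case: x. Qed.
Lemma cImN x : Im (- x) = - Im x. Proof. by case: x. Qed.
Lemma cReB x y : Re (x - y) = Re x - Re y. Proof. by rewrite cReD cReN. Qed.
Lemma cImB x y : Im (x - y) = Im x - Im y. Proof. by rewrite cImD cImN. Qed.
Lemma cReM x y : Re (x * y) = Re x * Re y - Im x * Im y.
Proof. by case: x y => a b []. Qed.
Lemma cImM x y : Im (x * y) = Re x * Im y + Im x * Re y.
Proof. by case: x y => a b []. Qed.
Lemma cRe_conj x : Re x^* = Re x. Proof. by case: x. Qed.
Lemma cIm_conj x : Im x^* = - Im x. Proof. by case: x. Qed.
Lemma Re_cst r : Re (cst_of r) = r. Proof. by []. Qed.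
Lemma Im_cst r : Im (cst_of r) = 0. Proof. by []. Qed.
Lemma Re0 : Re (0 : C) = 0. Proof. by []. Qed.
Lemma Im0 : Im (0 : C) = 0. Proof. by []. Qed.
Lemma Re1 : Re (1 : C) = 1. Proof. by []. Qed.
Lemma Im1 : Im (1 : C) = 0. Proof. by []. Qed.
Lemma Re_iu : Re iu = 0. Proof. by []. Qed.
Lemma Im_iu : Im iu = 1. Proof. by []. Qed.
Lemma Re_exp z : Re (expC z) = expR (Re z) * cos (Im z). Proof. by []. Qed.
Lemma Im_exp z : Im (expC z) = expR (Re z) * sin (Im z). Proof. by []. Qed.
Definition ReImE := (Re_iu, Im_iu, cReD, cImD, cReN, cImN, cReM, cImM, cRe_conj, cIm_conj, Re_cst,
  Im_cst, Re0, Im0, Re1, Im1).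

Lemma cstD r e : cst_of (r + e) = cst_of r + cst_of e.
Proof. by apply: eqcx; rewrite !ReImE ?addr0. Qed.
Lemma cstN r : cst_of (- r) = - cst_of r.
Proof. by apply: eqcx; rewrite !ReImE ?oppr0. Qed.
Lemma cstB r e : cst_of (r - e) = cst_of r - cst_of e.
Proof. by rewrite cstD cstN. Qed.
Lemma cstM r e : cst_of (r * e) = cst_of r * cst_of e.
Proof. by apply: eqcx; rewrite !ReImE ?mulr0 ?mul0r ?addr0 ?subr0. Qed.
Lemma cst0 : cst_of 0 = 0 :> C. Proof. by []. Qed.
Lemma cst1 : cst_of 1 = 1 :> C. Proof. by []. Qed.
Lemma cst_inj : injective (@cst_of R). Proof. by move=> a b []. Qed.
Lemma cst_eq0 r : (cst_of r == 0 :> C) = (r == 0).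
Proof. by apply/eqP/eqP => [[]//|->]. Qed.
Lemma cstV r : cst_of r^-1 = (cst_of r)^-1.
Proof.
have [->|r0] := eqVneq r 0; first by rewrite invr0 cst0 invr0.
apply: (@mulfI _ (cst_of r)); first by rewrite cst_eq0.
by rewrite -cstM !divff ?cst_eq0.
Qed.
Lemma cst_nat (n : nat) : cst_of n%:R = n%:R :> C.
Proof. by elim: n => // n IH; rewrite -!natr1 cstD IH. Qed.
Lemma cst_int (n : int) : cst_of n%:~R = n%:~R :> C.
Proof. by case: n => n; rewrite ?NegzE ?mulrNz ?cstN -!pmulrn ?cst_nat. Qed.
Lemma conj_cst r : (cst_of r)^* = cst_of r :> C.
Proof. by apply: eqcx; rewrite !ReImE ?oppr0. Qed.
Lemma conj_iu : iu^* = - iu :> C.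
Proof. by apply: eqcx; rewrite !ReImE /= ?oppr0. Qed.
Lemma iu2 : iu * iu = -1 :> C.
Proof. by apply: eqcx; rewrite !ReImE /=; ring. Qed.
Lemma CE z : z = cst_of (Re z) + iu * cst_of (Im z).
Proof. by apply: eqcx; rewrite !ReImE /=; ring. Qed.

Lemma nm2 z : nm z ^+ 2 = Re z ^+ 2 + Im z ^+ 2.
Proof. by case: z => a b; rewrite sqr_sqrtr // addr_ge0 ?sqr_ge0. Qed.
Lemma nm_ge0 z : 0 <= nm z. Proof. by case: z => a b; rewrite sqrtr_ge0. Qed.
Lemma nm0 : nm 0 = 0. Proof. exact: Normc.normc0. Qed.
Lemma nm1 : nm 1 = 1. Proof. exact: Normc.normc1. Qed.
Lemma nm_eq0 z : (nm z == 0) = (z == 0).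
Proof. by apply/eqP/eqP => [/Normc.eq0_normc//|->]; rewrite nm0. Qed.
Lemma nm_gt0 z : (0 < nm z) = (z != 0).
Proof. by rewrite lt_def nm_ge0 andbT nm_eq0. Qed.
Lemma nmM x y : nm (x * y) = nm x * nm y. Proof. exact: Normc.normcM. Qed.
Lemma nmX x n : nm (x ^+ n) = nm x ^+ n.
Proof. by elim: n => [|n IH]; rewrite ?expr0 ?nm1 // !exprS nmM IH. Qed.
Lemma nmV x : nm x^-1 = (nm x)^-1. Proof. exact: Normc.normcV. Qed.
Lemma nmD x y : nm (x + y) <= nm x + nm y. Proof. exact: le_normcD. Qed.
Lemma nmN x : nm (- x) = nm x. Proof. exact: normcN. Qed.
Lemma nmBC x y : nm (x - y) = nm (y - x). Proof. by rewrite -nmN opprB. Qed.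
Lemma nmB x y : nm (x - y) <= nm x + nm y. Proof. by rewrite -(nmN y) nmD. Qed.
Lemma nmDB x y : nm x - nm y <= nm (x - y).
Proof. by rewrite lerBlDr; apply: le_trans (nmD _ _); rewrite subrK. Qed.
Lemma nm_dist x y : `|nm x - nm y| <= nm (x - y).
Proof. by rewrite ler_norml nmDB andbT lerNl opprB nmBC nmDB. Qed.
Lemma nm_tri y x z : nm (x - z) <= nm (x - y) + nm (y - z).
Proof. by apply: le_trans (nmD _ _); rewrite addrA subrK. Qed.
Lemma nm_conj z : nm z^* = nm z.
Proof. by case: z => a b; rewrite /nm /= sqrrN. Qed.
Lemma nm_cst r : nm (cst_of r) = `|r|.
Proof. by rewrite /nm /= expr0n /= addr0 sqrtr_sqr. Qed.
Lemma nm_iu : nm iu = 1.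
Proof. by rewrite /nm /= expr0n /= add0r expr1n sqrtr1. Qed.
(** The norm of [Cplx R] is itself complex-valued; [nm] is its real version, in which the modulus
    estimates below are written. *)
Lemma normE z : `|z| = cst_of (nm z). Proof. by []. Qed.
Lemma normC_lt z r : (`|z| < cst_of r) = (nm z < r).
Proof. by rewrite normE /cst_of ltcR. Qed.
Lemma Re_le_nm z : `|Re z| <= nm z.
Proof.
by rewrite -ler_sqr ?nnegrE ?nm_ge0 // real_normK ?num_real // nm2 lerDl sqr_ge0.
Qed.
Lemma Im_le_nm z : `|Im z| <= nm z.
Proof.
by rewrite -ler_sqr ?nnegrE ?nm_ge0 // real_normK ?num_real // nm2 lerDr sqr_ge0.
Qed.
Lemma nm_le_ReIm z : nm z <= `|Re z| + `|Im z|.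
Proof.
by rewrite {1}(CE z) (le_trans (nmD _ _))// nmM nm_iu mul1r !nm_cst.
Qed.
Lemma conjM_nm z : z * z^* = cst_of (nm z ^+ 2).
Proof. by apply: eqcx; rewrite !ReImE ?nm2; ring. Qed.
Lemma conjCM x y : (x * y)^* = x^* * y^* :> C. Proof. exact: rmorphM. Qed.
Lemma conjCD x y : (x + y)^* = x^* + y^* :> C. Proof. exact: rmorphD. Qed.
Lemma conjCB x y : (x - y)^* = x^* - y^* :> C. Proof. exact: rmorphB. Qed.
Lemma conjCN x : (- x)^* = - x^* :> C. Proof. exact: rmorphN. Qed.
Lemma conjC1' : 1^* = 1 :> C. Proof. exact: rmorph1. Qed.
Lemma conjCK' x : x^*^* = x. Proof. by apply: eqcx; rewrite !ReImE ?opprK. Qed.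
Lemma conjC_nat' (k : nat) : k%:R^* = k%:R :> C. Proof. exact: rmorph_nat. Qed.

Lemma expC0 : expC 0 = 1 :> C.
Proof. by apply: eqcx; rewrite ?Re_exp ?Im_exp expR0 ?cos0 ?sin0 !ReImE; ring. Qed.
Lemma expCD x y : expC (x + y) = expC x * expC y :> C.
Proof. by apply: eqcx; rewrite ?cReM ?cImM ?Re_exp ?Im_exp cReD cImD expRD ?cosD ?sinD; ring. Qed.
Lemma nm_expC z : nm (expC z) = expR (Re z).
Proof.
apply/eqP; rewrite -(@eqrXn2 _ 2) ?nm_ge0 ?expR_ge0 // nm2 Re_exp Im_exp.
by rewrite !exprMn -mulrDr cos2Dsin2 mulr1.
Qed.
Lemma expC_neq0 z : expC z != 0 :> C.
Proof. by rewrite -nm_eq0 nm_expC gt_eqF ?expR_gt0. Qed.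
Lemma expCN z : expC (- z) = (expC z)^-1 :> C.
Proof.
apply: (@mulfI _ (expC z)); first exact: expC_neq0.
by rewrite -expCD subrr expC0 divff ?expC_neq0.
Qed.
Lemma expCB x y : expC (x - y) = expC x / expC y :> C.
Proof. by rewrite expCD expCN. Qed.
Lemma expC_conj z : expC z^* = (expC z)^* :> C.
Proof. by apply: eqcx; rewrite ?cRe_conj ?cIm_conj ?Re_exp ?Im_exp cRe_conj cIm_conj ?cosN ?sinN ?mulrN. Qed.
Lemma expC_sum (I : Type) (s : seq I) (P : pred I) (F : I -> C) :
  expC (\sum_(i <- s | P i) F i) = \prod_(i <- s | P i) expC (F i) :> C.
Proof. exact: (big_morph _ expCD expC0). Qed.
Lemma expC_iu r : expC (iu * cst_of r) = (cos r +i* sin r)%C :> C.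
Proof.
have e : iu * cst_of r = (0 +i* r)%C by apply: eqcx; rewrite !ReImE /=; ring.
by rewrite e; apply: eqcx; rewrite ?Re_exp ?Im_exp /= expR0 mul1r.
Qed.
Lemma nm_expC_iu r : nm (expC (iu * cst_of r)) = 1.
Proof. by rewrite nm_expC !ReImE /= !(mul0r, mulr0, subr0) expR0. Qed.
Definition twopii : C := iu * cst_of (pi *+ 2).
Lemma expC_2pii : expC twopii = 1 :> C.
Proof. by rewrite expC_iu cos2pi sin2pi. Qed.
Lemma expC_2piik (k : int) : expC (twopii * k%:~R) = 1 :> C.
Proof.
have H (n : nat) : expC (twopii * n%:R) = 1 :> C.
  elim: n => [|n IH]; first by rewrite mulr0 expC0.
  by rewrite -natr1 mulrDr expCD IH mulr1 mul1r expC_2pii.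
by case: k => n; rewrite ?NegzE ?mulrNz -!pmulrn ?H // mulrN expCN H invr1.
Qed.

(** The arctangent of Im/Re is the argument only when Re z > 0, so this is a logarithm on the right
    half-plane alone. Elsewhere it is a total extension whose imaginary part still stays between
    -pi/2 and pi/2. *)
Definition LogC z : C := (ln (nm z) +i* atan (Im z / Re z))%C.

Lemma expC_LogC z : 0 < Re z -> expC (LogC z) = z.
Proof.
move=> z0; have nz : 0 < nm z by apply: lt_le_trans (Re_le_nm z); rewrite gtr0_norm.
(* cos(atan u) = 1/sqrt(1 + u^2); for u = Im z / Re z and Re z > 0 the root is |z| / Re z. *)
have E : Num.sqrt (1 + (Im z / Re z) ^+ 2) = nm z / Re z.
  apply/eqP; rewrite -(@eqrXn2 _ 2) ?sqrtr_ge0 ?divr_ge0 ?nm_ge0 ?(ltW z0) //.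
  rewrite sqr_sqrtr; last by rewrite addr_ge0 ?sqr_ge0.
  rewrite !expr_div_n nm2 mulrDl divff // expf_neq0 // gt_eqF //.
have cosE : cos (atan (Im z / Re z)) = Re z / nm z by rewrite cos_atan E invf_div.
have sinE : sin (atan (Im z / Re z)) = Im z / nm z.
  have c0 : cos (atan (Im z / Re z)) != 0.
    by rewrite cosE mulf_neq0 ?invr_eq0 ?gt_eqF.
  have := atanK (Im z / Re z); rewrite /tan => /(canRL (mulfVK c0)) ->.
  by rewrite cosE; field; rewrite !gt_eqF.
by apply: eqcx; rewrite /= lnK ?posrE // ?cosE ?sinE; field; rewrite gt_eqF.
Qed.
Lemma Re_LogC z : Re (LogC z) = ln (nm z). Proof. by []. Qed.
Lemma Im_LogC z : Im (LogC z) = atan (Im z / Re z). Proof. by []. Qed.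
Lemma LogC_conj z : LogC z^* = (LogC z)^*.
Proof.
apply: eqcx; rewrite ?cRe_conj ?cIm_conj ?Re_LogC ?Im_LogC ?nm_conj //.
by rewrite cRe_conj cIm_conj mulNr atanN.
Qed.

(** Subtracting a multiple of 2 pi moves r to s in [0, 2 pi). The cosine is injective only on
    [0, pi], so an s beyond pi is reflected to 2 pi - s, which would have to be 0. *)
Lemma cos1_2pik r : cos r = 1 -> exists k : int, r = pi *+ 2 * k%:~R.
Proof.
move=> c1; set T := pi *+ 2.
have T0 : 0 < T by rewrite mulrn_wgt0 ?pi_gt0.
pose k := Num.floor (r / T); pose s := r - T * k%:~R.
have perZ (j : int) (x : R) : cos (x + T * j%:~R) = cos x.
  case: j => n; rewrite ?NegzE ?mulrNz -!pmulrn ?mulr_natr.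
    exact: (periodicn (@cosD2pi R)).
  by rewrite mulrN mulr_natr -[in RHS](subrK (T *+ n.+1) x) (periodicn (@cosD2pi R)).
have cs : cos s = 1 by rewrite /s -mulrN -mulrNz perZ.
have s0 : 0 <= s.
  by rewrite /s subr_ge0 mulrC -ler_pdivlMr //; exact: Num.Theory.floor_le_tmp.
have sT : s < T.
  rewrite /s ltrBlDr -[X in X + _]mulr1 -mulrDr mulrC -ltr_pdivrMr //.
  by rewrite addrC -[1]/(1%:~R) -intrD; exact: Num.Theory.floorD1_gt.
suff s00 : s = 0 by exists k; rewrite -[LHS](subrK (T * k%:~R)) -/s s00 add0r.
have pT : T - pi = pi :> R by rewrite /T mulr2n addrK.
have [sp|sp] := leP s pi.
  apply: (@cos_inj R); rewrite ?cos0 ?in_itv /= ?s0 ?lexx ?pi_ge0 ?sp //.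
have : T - s = 0.
  apply: (@cos_inj R); rewrite ?in_itv /= ?lexx ?pi_ge0 //.
    by rewrite subr_ge0 (ltW sT) /= -pT lerB // ltW.
  by rewrite -cosN opprB /T cos0 -cs -[in RHS](subrK T s) cosD2pi.
by move=> /eqP; rewrite subr_eq0 gt_eqF.
Qed.

Lemma expC_inj x y : expC x = expC y -> exists k : int, x = y + twopii * k%:~R.
Proof.
move=> E; have E1 : expC (x - y) = 1 by rewrite expCB E divff ?expC_neq0.
have re0 : Re (x - y) = 0.
  by have := nm_expC (x - y); rewrite E1 nm1 => /esym; rewrite -{1}expR0 => /expR_inj.
have : cos (Im (x - y)) = 1.
  by have := congr1 (@complex.Re R) E1; rewrite Re_exp re0 expR0 mul1r.
move=> /cos1_2pik[k kE]; exists k; rewrite -[LHS](subrK y) addrC; congr (_ + _).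
rewrite -cst_int /twopii -mulrA -cstM -kE.
by apply: eqcx; rewrite ?re0 !ReImE /=; ring.
Qed.

(** [LogC] serves the right half-plane; a half-turn or a quarter-turn brings every other nonzero
    point there. *)
Lemma expC_log z : z != 0 -> exists l : C, expC l = z.
Proof.
move=> z0; have nz : 0 < nm z by rewrite nm_gt0.
have [p|] := ltP 0 (Re z); first by exists (LogC z); rewrite expC_LogC.
rewrite le_eqVlt => /orP[/eqP rz|n]; last first.
  exists (LogC (- z) + iu * cst_of pi).
  rewrite expCD expC_LogC ?cReN ?oppr_gt0 // expC_iu cospi sinpi.
  by apply: eqcx; rewrite !ReImE /=; ring.
have [p|] := ltP 0 (Re (- iu * z)).
  exists (LogC (- iu * z) + iu * cst_of (pi / 2)).
  rewrite expCD expC_LogC // expC_iu cos_pihalf sin_pihalf.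
  by apply: eqcx; rewrite !ReImE /=; ring.
rewrite le_eqVlt => /orP[/eqP|n].
  rewrite !ReImE /= rz => H; case/eqP: z0; apply: eqcx => //; move: H.
  by rewrite oppr0 mul0r add0r mulNr opprK mul1r.
exists (LogC (iu * z) + iu * cst_of (- (pi / 2))).
rewrite expCD expC_LogC.
  rewrite expC_iu cosN sinN cos_pihalf sin_pihalf.
  by apply: eqcx; rewrite !ReImE /=; ring.
by move: n; rewrite mulNr cReN oppr_lt0.
Qed.

(** The radius of a ball in [Cplx R] is a complex number; its positivity forces a zero imaginary
    part, which yields real epsilons. *)
Lemma nbhsCP z (P : set C) :
  nbhs z P <-> exists2 e : R, 0 < e & forall y, nm (y - z) < e -> P y.
Proof.
rewrite -nbhs_nbhs_norm; split=> [[e /= e0 H]|[e e0 H]].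
  move: e0 H; rewrite ltcE /= => /andP[/eqP ei er] H.
  exists (Re e) => // y ye; apply: H; rewrite /= distrC.
  suff -> : e = cst_of (Re e) by rewrite normC_lt.
  by apply: eqcx => //=.
exists (cst_of e); first by rewrite /= ltcE /= eqxx.
by move=> y /=; rewrite distrC normC_lt; exact: H.
Qed.

Lemma cvgCP {T : Type} (F : set_system T) {FF : Filter F} (f : T -> C) l :
  f @ F --> l <-> forall e : R, 0 < e -> \forall t \near F, nm (f t - l) < e.
Proof.
split=> [H e e0|H P /nbhsCP[e e0 He]].
  have : nbhs l [set y | nm (y - l) < e] by apply/nbhsCP; exists e.
  exact: H.
by have := H e e0; apply: filterS => t; exact: He.
Qed.

End ComplexBasics.

Arguments iu {R} : simpl never.
Arguments twopii {R} : simpl never.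
Arguments nm {R} z : simpl never.
Arguments LogC {R} z : simpl never.
Arguments expC {R} z : simpl never.
Arguments cst_of {R} x : simpl never.

(** * Complex-valued functions of a real variable *)

Section RealCalculus.
Variable R : realType.
Local Notation C := (Cplx R).

Lemma continuous_Re : continuous (fun z : C => Re z : R).
Proof.
move=> z; apply/(@cvgrPdist_lt _ _ _ _ (nbhs_filter z)) => e e0; apply/nbhsCP; exists e => // y ye.
by rewrite -cReB; apply: le_lt_trans (Re_le_nm _) _; rewrite nmBC.
Qed.
Lemma continuous_Im : continuous (fun z : C => Im z : R).
Proof.
move=> z; apply/(@cvgrPdist_lt _ _ _ _ (nbhs_filter z)) => e e0; apply/nbhsCP; exists e => // y ye.
by rewrite -cImB; apply: le_lt_trans (Im_le_nm _) _; rewrite nmBC.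
Qed.
Lemma cvgC_ReIm {T : Type} (F : set_system T) {FF : Filter F} (f : T -> C) (l : C) :
  f @ F --> l <-> (Re (f t) @[t --> F] --> (Re l : R)) /\ (Im (f t) @[t --> F] --> (Im l : R)).
Proof.
split=> [H|[H1 H2]].
  by split; [apply: (cvg_comp _ (fun z : C => Re z) H); exact: continuous_Re
            |apply: (cvg_comp _ (fun z : C => Im z) H); exact: continuous_Im].
apply/cvgCP => e e0; have e2 : 0 < e / 2 by rewrite divr_gt0.
move/cvgrPdist_lt: H1 => /(_ _ e2) H1; move/cvgrPdist_lt: H2 => /(_ _ e2) H2.
near=> t; rewrite nmBC; apply: le_lt_trans (nm_le_ReIm _) _.
rewrite [e]splitr cReB cImB ltrD //; near: t; [exact: H1|exact: H2].
Unshelve. all: by end_near. Qed.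

Lemma continuousC_ReIm {T : topologicalType} (f : T -> C) :
  continuous f <-> continuous (fun t => Re (f t) : R) /\ continuous (fun t => Im (f t) : R).
Proof.
split=> [H|[H1 H2] t]; last by apply/cvgC_ReIm; split; [exact: H1|exact: H2].
by split=> t; have /cvgC_ReIm[] := H t.
Qed.

Lemma continuousCD {T : topologicalType} (f g : T -> C) :
  continuous f -> continuous g -> continuous (fun t => f t + g t).
Proof. by move=> cf cg t; apply: cvgD; [exact: cf|exact: cg]. Qed.
Lemma continuousCM {T : topologicalType} (f g : T -> C) :
  continuous f -> continuous g -> continuous (fun t => f t * g t).
Proof. by move=> cf cg t; apply: cvgM; [exact: cf|exact: cg]. Qed.
Lemma continuousRM {T : topologicalType} (f g : T -> R) :
  continuous f -> continuous g -> continuous (fun t => f t * g t).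
Proof. by move=> cf cg t; apply: cvgM; [exact: cf|exact: cg]. Qed.
Lemma continuousCcst {T : topologicalType} (f : T -> R) :
  continuous f -> continuous (fun t => cst_of (f t)).
Proof. by move=> cf; apply/continuousC_ReIm; split => // t; exact: cvg_cst. Qed.
Lemma continuous_conj : continuous (fun z : C => z^*).
Proof.
move=> z; apply/(@cvgCP _ _ _ (nbhs_filter z)) => e e0; apply/nbhsCP; exists e => // y.
by rewrite -conjCB nm_conj.
Qed.
Lemma continuous_nm : continuous (fun z : C => nm z).
Proof.
move=> z; apply/(@cvgrPdist_lt _ _ _ _ (nbhs_filter z)) => e e0; apply/nbhsCP; exists e => // y ye.
by apply: le_lt_trans ye; rewrite nmBC nm_dist.
Qed.
Lemma continuous_comp' {T U V : topologicalType} (f : T -> U) (g : U -> V) :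
  continuous f -> continuous g -> continuous (fun t => g (f t)).
Proof. by move=> cf cg t; apply: (cvg_comp _ g (cf t)); exact: cg. Qed.

Lemma continuous_expC : continuous (@expC R).
Proof.
have e : continuous (fun z : C => expR (Re z) : R) := continuous_comp' continuous_Re (@continuous_expR R).
have c : continuous (fun z : C => cos (Im z) : R) := continuous_comp' continuous_Im (@continuous_cos R).
have s : continuous (fun z : C => sin (Im z) : R) := continuous_comp' continuous_Im (@continuous_sin R).
have ec : continuous (fun z : C => expR (Re z) * cos (Im z) : R).
  exact: continuousRM e c.
have es : continuous (fun z : C => expR (Re z) * sin (Im z) : R).
  exact: continuousRM e s.
by apply/continuousC_ReIm.
Qed.

(** Componentwise, in the same form as the equation in [loewner_solution], so that real calculus
    applies to each part. *)
Definition dC (f : R -> C) (t : R) (l : C) :=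
  is_derive t 1 (fun s => Re (f s)) (Re l) /\ is_derive t 1 (fun s => Im (f s)) (Im l).

Lemma dC_eq f t l l' : dC f t l -> l = l' -> dC f t l'.
Proof. by move=> ? <-. Qed.
Lemma dC_ext f g t l : (forall s, f s = g s) -> dC f t l -> dC g t l.
Proof. by move=> /funext ->. Qed.
Lemma dC_cst c t : dC (fun _ => c) t 0.
Proof. by split; exact: is_derive_cst. Qed.
Lemma dCD f g t l k : dC f t l -> dC g t k -> dC (fun s => f s + g s) t (l + k).
Proof.
move=> [a b] [c d]; split.
  rewrite (_ : (fun s => _) = (fun s => Re (f s)) + (fun s => Re (g s))); last by apply/funext => s; rewrite cReD.
  by rewrite cReD; exact: is_deriveD.
rewrite (_ : (fun s => _) = (fun s => Im (f s)) + (fun s => Im (g s))); last by apply/funext => s; rewrite cImD.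
by rewrite cImD; exact: is_deriveD.
Qed.
Lemma dCN f t l : dC f t l -> dC (fun s => - f s) t (- l).
Proof.
move=> [a b]; split.
  rewrite (_ : (fun s => _) = - (fun s => Re (f s))); last by apply/funext => s; rewrite cReN.
  by rewrite cReN; exact: is_deriveN.
rewrite (_ : (fun s => _) = - (fun s => Im (f s))); last by apply/funext => s; rewrite cImN.
by rewrite cImN; exact: is_deriveN.
Qed.
Lemma dCB f g t l k : dC f t l -> dC g t k -> dC (fun s => f s - g s) t (l - k).
Proof. by move=> a /dCN b; exact: (dCD a b). Qed.
Lemma is_deriveM' (f g : R -> R) (t df dg : R) : is_derive t 1 f df -> is_derive t 1 g dg ->
  is_derive t 1 (fun s => f s * g s) (df * g t + f t * dg).
Proof.
move=> a b; have := @is_deriveM _ _ f g t 1 df dg a b.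
by move/is_derive_eq; apply; rewrite /GRing.scale /=; ring.
Qed.
Lemma is_deriveD' (f g : R -> R) (t df dg : R) : is_derive t 1 f df -> is_derive t 1 g dg ->
  is_derive t 1 (fun s => f s + g s) (df + dg).
Proof. by move=> a b; exact: is_deriveD. Qed.
Lemma is_deriveB' (f g : R -> R) (t df dg : R) : is_derive t 1 f df -> is_derive t 1 g dg ->
  is_derive t 1 (fun s => f s - g s) (df - dg).
Proof. by move=> a b; exact: is_deriveB. Qed.
Lemma dCM f g t l k : dC f t l -> dC g t k -> dC (fun s => f s * g s) t (l * g t + f t * k).
Proof.
move=> [a b] [c d]; split.
  rewrite (_ : (fun s => _) = (fun s => Re (f s) * Re (g s) - Im (f s) * Im (g s))); last by apply/funext => s; rewrite cReM.
  have := is_deriveB' (is_deriveM' a c) (is_deriveM' b d).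
  by move/is_derive_eq; apply; rewrite cReD !cReM; ring.
rewrite (_ : (fun s => _) = (fun s => Re (f s) * Im (g s) + Im (f s) * Re (g s))); last by apply/funext => s; rewrite cImM.
have := is_deriveD' (is_deriveM' a d) (is_deriveM' b c).
by move/is_derive_eq; apply; rewrite cImD !cImM; ring.
Qed.
Lemma dCZ c f t l : dC f t l -> dC (fun s => c * f s) t (c * l).
Proof.
by move=> a; apply: (dC_eq (dCM (dC_cst c t) a)); rewrite mul0r add0r.
Qed.
Lemma is_derive_ext (f g : R -> R) (t df : R) : (forall s, f s = g s) ->
  is_derive t 1 f df -> is_derive t 1 g df.
Proof. by move=> /funext ->. Qed.
Lemma dC_conj f t l : dC f t l -> dC (fun s => (f s)^*) t l^*.
Proof.
move=> [a b]; split.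
  by rewrite cRe_conj; apply: (is_derive_ext _ a) => s; rewrite cRe_conj.
rewrite cIm_conj; apply: (is_derive_ext _ (is_deriveN b)).
by move=> s; rewrite cIm_conj.
Qed.
Lemma dC_real (f : R -> R) (t l : R) : is_derive t 1 f l -> dC (fun s => cst_of (f s)) t (cst_of l).
Proof. by move=> a; split => //; exact: is_derive_cst. Qed.
Lemma dC_Re f t l : dC f t l -> is_derive t 1 (fun s => Re (f s)) (Re l).
Proof. by case. Qed.
Lemma is_derive_comp' (f g : R -> R) (t df dg : R) : is_derive (g t) 1 f df -> is_derive t 1 g dg ->
  is_derive t 1 (fun s => f (g s)) (df * dg).
Proof. by move=> a b; have := @is_derive1_comp _ f g t df dg a b. Qed.
Lemma dC_exp f t l : dC f t l -> dC (fun s => expC (f s)) t (l * expC (f t)).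
Proof.
move=> [a b].
have e := is_derive_comp' (is_derive_expR _) a.
have c := is_derive_comp' (is_derive_cos _) b.
have s := is_derive_comp' (is_derive_sin _) b.
split; [have := is_deriveM' e c|have := is_deriveM' e s];
move/is_derive_eq; apply; rewrite ?cReM ?cImM ?Re_exp ?Im_exp /=; ring.
Qed.

Lemma is_derive_eps (f : R -> R) (t l : R) : (forall e : R, 0 < e -> exists2 d : R, 0 < d &
    forall s, `|s - t| < d -> `|f s - f t - (s - t) * l| <= e * `|s - t|) -> is_derive t 1 f l.
Proof.
move=> H; have cv : (fun h : R => h^-1 *: ((f \o shift t) (h *: (1 : R)) - f t)) @ 0^' --> l.
  apply/cvgrPdist_le => e e0; have [d d0 Hd] := H e e0.
  exists d => //= h; rewrite /ball_ /= sub0r normrN => hd h0.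
  have := Hd (h + t); rewrite addrK => /(_ hd).
  have n0 : 0 < `|h| by rewrite normr_gt0.
  rewrite -ler_pdivrMr // -[X in _ / X]normr_id -normf_div; apply: le_trans.
  rewrite /GRing.scale /= mulr1 distrC normf_div normr_id -normfV -normrM.
  by rewrite le_eqVlt; apply/orP; left; apply/eqP; congr (`|_|); field.
apply: DeriveDef; first by apply/cvg_ex; exists l.
exact: cvg_lim cv.
Qed.
Lemma dC_eps (f : R -> C) (t : R) (l : C) : (forall e : R, 0 < e -> exists2 d : R, 0 < d &
    forall s, `|s - t| < d -> nm (f s - f t - cst_of (s - t) * l) <= e * `|s - t|) -> dC f t l.
Proof.
move=> H; split; apply: is_derive_eps => e e0; have [d d0 Hd] := H e e0; exists d => // s /Hd; apply: le_trans.
  by have := Re_le_nm (f s - f t - cst_of (s - t) * l); rewrite !ReImE mul0r subr0.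
by have := Im_le_nm (f s - f t - cst_of (s - t) * l); rewrite !ReImE mul0r addr0.
Qed.
Lemma archi_nat (x : R) : exists n : nat, x < n%:R.
Proof.
exists (Num.bound `|x|); apply: le_lt_trans (ler_norm _) _.
exact: archi_boundP.
Qed.

Lemma is_derive_cvg (f : R -> R) (t df : R) : is_derive t 1 f df -> f s @[s --> t] --> f t.
Proof.
move=> H; apply: differentiable_continuous; apply/derivable1_diffP.
exact: ex_derive.
Qed.
Lemma dC_cvg f t l : dC f t l -> f s @[s --> t] --> f t.
Proof.
by move=> [a b]; apply/cvgC_ReIm; split; [exact: is_derive_cvg a|exact: is_derive_cvg b].
Qed.

Lemma within_Re (A : set R) (f : R -> C) : {within A, continuous f} -> {within A, continuous (fun s => Re (f s) : R)}.
Proof. by move=> H s; have /cvgC_ReIm[] := H s. Qed.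
Lemma within_Im (A : set R) (f : R -> C) : {within A, continuous f} -> {within A, continuous (fun s => Im (f s) : R)}.
Proof. by move=> H s; have /cvgC_ReIm[] := H s. Qed.
Lemma within_cont (A : set R) (T : topologicalType) (f : R -> T) : continuous f -> {within A, continuous f}.
Proof. by move=> H; exact: continuous_subspaceT. Qed.

Lemma le_of_derive (f df : R -> R) (a b : R) : a <= b ->
  (forall x, a < x < b -> is_derive x 1 f (df x)) -> {within `[a, b], continuous f} ->
  (forall x, a < x < b -> df x <= 0) -> f b <= f a.
Proof.
rewrite le_eqVlt => /orP[/eqP ->//|ab] d c n.
have d' x : x \in `]a, b[ -> is_derive x 1 f (df x) by rewrite in_itv; exact: d.
have [c0 cab E] := MVT ab d' c.
rewrite -subr_le0 E; apply: mulr_le0_ge0; last by rewrite subr_ge0 ltW.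
by apply: n; move: cab; rewrite in_itv.
Qed.

(** A complex-valued function has no mean value equality. Projecting on the direction of the total
    increment w gives the real function Re(conj(w) f) - |w| p, which is nonincreasing; the final
    division by |w| needs w <> 0. *)
Lemma mvt_nm (f df : R -> C) (p dp : R -> R) (a b : R) : a <= b ->
  (forall x, a < x < b -> dC f x (df x)) -> {within `[a, b], continuous f} ->
  (forall x, a < x < b -> is_derive x 1 p (dp x)) -> {within `[a, b], continuous p} ->
  (forall x, a < x < b -> nm (df x) <= dp x) -> nm (f b - f a) <= p b - p a.
Proof.
move=> ab Df cf Dp cp H; set w := f b - f a.
have cfr := within_Re cf; have cfi := within_Im cf.
have [->|w0] := eqVneq w 0.
  rewrite nm0 subr_ge0 -lerN2.
  apply: (@le_of_derive (- p) (- dp)) => // [x xab|x|x xab].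
  - by apply: is_deriveN; exact: Dp.
  - by apply: cvgN; exact: cp.
  - by rewrite oppr_le0 (le_trans (nm_ge0 _) (H x xab)).
pose g x := Re (w^* * f x) - nm w * p x.
pose dg x := Re (w^* * df x) - nm w * dp x.
have gle : g b <= g a.
  apply: (@le_of_derive g dg) => // [x xab|x|x xab].
  - apply: is_deriveB'; first exact: (dC_Re (dCZ _ (Df x xab))).
    have := is_deriveM' (is_derive_cst (nm w) x 1) (Dp x xab).
    by move/is_derive_eq; apply; rewrite mul0r add0r.
  - apply: cvgB; last by apply: cvgM; [exact: cvg_cst|exact: cp].
    have : (fun t => w^* * f t) @ (nbhs (x : subspace `[a, b])) --> w^* * f x.
      by apply: cvgM; [exact: cvg_cst|exact: cf].
    by case/cvgC_ReIm.
  - rewrite /dg subr_le0 (le_trans (ler_norm _))// (le_trans (Re_le_nm _))//.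
    by rewrite nmM nm_conj ler_wpM2l ?nm_ge0 ?H.
have n0 : 0 < nm w by rewrite nm_gt0.
rewrite -(ler_pM2l n0) mulrBr.
have : nm w * nm w = Re (w^* * f b) - Re (w^* * f a).
  by rewrite -cReB -mulrBr -/w [w^* * w]mulrC conjM_nm Re_cst expr2.
by move=> ->; move: gle; rewrite /g; lra.
Qed.

Lemma mvt_nm_cst (f df : R -> C) (a b K : R) : a <= b ->
  (forall x, a < x < b -> dC f x (df x)) -> {within `[a, b], continuous f} ->
  (forall x, a < x < b -> nm (df x) <= K) -> nm (f b - f a) <= K * (b - a).
Proof.
move=> ab Df cf H; rewrite mulrBr.
apply: (@mvt_nm f df (fun x => K * x) (fun=> K)) => // [x _|].
  have := is_deriveM' (is_derive_cst K x 1) (is_derive_id x 1).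
  by move/is_derive_eq; apply; rewrite mul0r add0r mulr1.
by apply: within_cont => x; apply: cvgM; [exact: cvg_cst|exact: cvg_id].
Qed.

Lemma within_comp (T U : topologicalType) (A : set R) (f : R -> T) (g : T -> U) :
  {within A, continuous f} -> continuous g -> {within A, continuous (fun s => g (f s))}.
Proof. by move=> cf cg x; apply: (cvg_comp _ g (cf x)); exact: cg. Qed.

(** |D| need not be differentiable where D vanishes, so the monotone quantity is |D|^2 exp(-2 L (x -
    a)). *)
Lemma gronwall (D dD : R -> C) (L a b : R) : a <= b ->
  (forall x, a < x < b -> dC D x (dD x)) -> {within `[a, b], continuous D} ->
  (forall x, a < x < b -> nm (dD x) <= L * nm (D x)) ->
  nm (D b) <= nm (D a) * expR (L * (b - a)).
Proof.
move=> ab dd cd H.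
pose E x := expR (- (2 * L) * (x - a)).
pose g x := Re (D x * (D x)^*) * E x.
pose dg x := Re (dD x * (D x)^* + D x * (dD x)^*) * E x
   + Re (D x * (D x)^*) * (E x * (- (2 * L))).
have dE (x : R) : is_derive x 1 E (E x * (- (2 * L))).
  apply: (@is_derive_comp' expR (fun x => - (2 * L) * (x - a))).
  have := is_deriveM' (is_derive_cst (- (2 * L)) x 1) (is_deriveB' (is_derive_id x 1) (is_derive_cst a x 1)).
  by move/is_derive_eq; apply; rewrite /cst; ring.
have : g b <= g a.
  apply: (@le_of_derive g dg) => // [x xab| |x xab].
  - apply: is_deriveM' => //.
    exact: dC_Re (dCM (dd x xab) (dC_conj (dd x xab))).
  - have cE : {within `[a, b], continuous E}.
      by apply: within_cont => x; exact: is_derive_cvg (dE x).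
    move=> x; apply: cvgM; last exact: cE.
    have : (fun t => D t * (D t)^*) @ (nbhs (x : subspace `[a, b])) --> D x * (D x)^*.
      by apply: cvgM; [exact: cd|exact: (within_comp cd continuous_conj)].
    by case/cvgC_ReIm.
  - rewrite /dg.
    have -> : Re (dD x * (D x)^* + D x * (dD x)^*) = 2 * Re (dD x * (D x)^*).
      by rewrite cReD !cReM !cRe_conj !cIm_conj; ring.
    have -> : Re (D x * (D x)^*) = nm (D x) ^+ 2 by rewrite conjM_nm Re_cst.
    have E0 : 0 < E x by exact: expR_gt0.
    have : Re (dD x * (D x)^*) <= L * nm (D x) ^+ 2.
      rewrite (le_trans (ler_norm _))// (le_trans (Re_le_nm _))// nmM nm_conj.
      by rewrite expr2 mulrA ler_wpM2r ?nm_ge0 ?H.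
    move=> h; have : 0 <= E x * (L * nm (D x) ^+ 2 - Re (dD x * (D x)^*)).
      by rewrite mulr_ge0 ?(ltW E0) ?subr_ge0.
    by move=> h'; lra.
rewrite /g !conjM_nm !Re_cst /E subrr mulr0 expR0 mulr1 => h.
rewrite -ler_sqr ?nnegrE ?nm_ge0 ?mulr_ge0 ?nm_ge0 ?expR_ge0 // exprMn.
rewrite -expRM_natl.
have -> : 2 * (L * (b - a)) = - (- (2 * L) * (b - a)) by ring.
by rewrite expRN -ler_pdivrMr ?invr_gt0 ?expR_gt0 // invrK.
Qed.

Local Notation mu := (@lebesgue_measure R).
(* The integral starts at a - 1 so that the derivative at a is two-sided. *)
Definition prim (a : R) (f : R -> R) (x : R) : R :=
  \int[mu]_(t in `[a - 1, x]) f t - \int[mu]_(t in `[a - 1, a]) f t.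
Lemma prim0 a f : prim a f a = 0. Proof. exact: subrr. Qed.
Lemma prim_derive (a : R) (f : R -> R) (x : R) : continuous f -> a - 1 < x -> is_derive x 1 (prim a f) (f x).
Proof.
move=> cf ax.
have xu : x < x + 1 by rewrite ltrDl.
have i : mu.-integrable `[a - 1, x + 1] (EFin \o f).
  apply: continuous_compact_integrable; first exact: segment_compact.
  exact: continuous_subspaceT.
have [d1 d2] := continuous_FTC1_closed xu i ax (cf x).
have H : is_derive x 1 (fun x0 : R => \int[lebesgue_measure]_(t in `[a - 1, x0]) f t) (f x).
  by apply: DeriveDef; [exact: d1|rewrite -derive1E; exact: d2].
have := is_deriveB' H (is_derive_cst (\int[mu]_(t in `[a - 1, a]) f t) x 1).
by move/is_derive_eq; apply; rewrite subr0.
Qed.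

Definition primC (a : R) (f : R -> C) (x : R) : C :=
  (prim a (fun t => Re (f t)) x +i* prim a (fun t => Im (f t)) x)%C.
Lemma primC0 a f : primC a f a = 0.
Proof. by apply: (@eqcx R); rewrite /= prim0. Qed.
Lemma primC_derive (a : R) (f : R -> C) (x : R) : continuous f -> a - 1 < x -> dC (primC a f) x (f x).
Proof. by move=> /continuousC_ReIm[c1 c2] ax; split; exact: prim_derive. Qed.
Opaque prim primC.
Lemma primC_within a f b : continuous f -> {within `[a, b], continuous (primC a f)}.
Proof.
move=> cf; apply: continuous_in_subspaceT => x; rewrite inE /= in_itv /= => /andP[ax _].
apply: (dC_cvg (primC_derive cf _)); apply: lt_le_trans ax; by rewrite ltrBlDr ltrDl.
Qed.

Lemma dC_zero_cst (f : R -> C) (a b : R) : a <= b -> (forall x, a < x < b -> dC f x 0) ->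
  {within `[a, b], continuous f} -> f b = f a.
Proof.
move=> ab d c; apply/eqP; rewrite -subr_eq0 -nm_eq0 eq_le nm_ge0 andbT.
rewrite -(mul0r (b - a)); apply: (mvt_nm_cst ab d c) => x _; by rewrite nm0.
Qed.

Lemma prim_add a b c (f : R -> C) : continuous f -> a <= b -> b <= c ->
  primC a f c = primC a f b + primC b f c.
Proof.
move=> cf ab bc.
have := @dC_zero_cst (fun t => primC a f t - primC b f t) b c bc.
rewrite primC0 subr0 => <-; first by rewrite subrK.
- move=> x /andP[bx xc].
  have h y : y <= b -> y - 1 < x by move=> yb; rewrite ltrBlDr (le_lt_trans yb)// (lt_le_trans bx)// lerDl.
  apply: dC_eq (subrr (f x)); apply: dCB; apply: primC_derive => //; exact: h.
- move=> x; apply: cvgB; last exact: primC_within.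
  apply: (@continuous_in_subspaceT _ _ `[b, c]%classic (primC a f)) => {}x.
  rewrite inE /= in_itv /= => /andP[bx _]; apply: (dC_cvg (primC_derive cf _)).
  by rewrite ltrBlDr (le_lt_trans ab)// (le_lt_trans bx)// ltrDl.
Qed.

Lemma primC_le (f : R -> C) a b K : continuous f -> a <= b ->
  (forall t, a <= t <= b -> nm (f t) <= K) -> nm (primC a f b) <= K * (b - a).
Proof.
move=> cf ab H; rewrite -[primC a f b]subr0 -(primC0 a f).
apply: (@mvt_nm_cst _ f); [exact: ab| |exact: primC_within|by move=> x /andP[h1 h2]; apply: H; rewrite !ltW].
by move=> x /andP[ax _]; apply: primC_derive => //; rewrite ltrBlDr (lt_le_trans ax)// lerDl.
Qed.

Lemma dC_line (y : C) (s : R) : dC (fun s => cst_of s * y) s y.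
Proof.
apply: (dC_eq (dCM (dC_real (is_derive_id s 1)) (dC_cst y s))).
by rewrite cst1 mul1r mulr0 addr0.
Qed.
Lemma dC_id_exp (y : C) (s : R) : dC (fun s => expC (cst_of s * y)) s (y * expC (cst_of s * y)).
Proof. exact: dC_exp (dC_line y s). Qed.

Lemma nm_line_exp (y : C) (s : R) : nm y <= 1 -> 0 < s < 1 -> nm (expC (cst_of s * y)) <= 4.
Proof.
move=> y1 /andP[s0 s1]; rewrite nm_expC !ReImE mul0r subr0.
have e1 : expR (s * Re y) <= expR 1.
  rewrite ler_expR (le_trans (ler_norm _))// normrM gtr0_norm //.
  rewrite -[1]mulr1 ler_pM // ?(ltW s0) ?(ltW s1) //; exact: le_trans (Re_le_nm _) y1.
apply: le_trans e1 _.
(* exp(-1/2) >= 1/2 gives exp(1/2) <= 2 and e <= 4, the constant of the Taylor bounds that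
   follow. *)
have H : 1 + (- 2^-1) <= expR (- 2^-1) :> R by exact: expR_ge1Dx.
have e0 : 0 < expR 2^-1 :> R by exact: expR_gt0.
have h2 : expR 2^-1 <= 2 :> R.
  have : 0 <= expR 2^-1 * ((expR (2^-1))^-1 - (1 - 2^-1)) :> R.
    by rewrite mulr_ge0 ?(ltW e0)// subr_ge0 -expRN.
  by rewrite mulrBr divff ?gt_eqF // => ?; lra.
have -> : expR 1 = expR 2^-1 * expR 2^-1 :> R by rewrite -expRD; congr expR; field.
have -> : 4 = 2 * 2 :> R by ring.
by rewrite ler_pM // ltW.
Qed.

(** Integration along the segment from 0 to y. Each use raises the order of the Taylor remainder of
    exp by one; the conclusion is for all s in (0, 1] because the next use integrates it again. *)
Lemma line_mvt (f df : R -> C) K : (forall s, dC f s (df s)) ->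
  (forall s, 0 < s < 1 -> nm (df s) <= K) -> f 0 = 0 -> forall s, 0 < s <= 1 -> nm (f s) <= K.
Proof.
move=> d H f0 s /andP[s0 s1].
have K0 : 0 <= K by apply: le_trans (nm_ge0 _) (H 2^-1 _); apply/andP; split; lra.
rewrite -[f s]subr0 -f0.
have := @mvt_nm_cst f df 0 s K (ltW s0); rewrite subr0 => h.
apply: le_trans (h _ _ _) _.
- by move=> x _; exact: d.
- by apply: within_cont => x; exact: dC_cvg (d x).
- by move=> x /andP[x0 xs]; apply: H; rewrite x0 (lt_le_trans xs).
- by rewrite -[leRHS]mulr1 ler_wpM2l.
Qed.

Lemma expC_taylor1 (y : C) : nm y <= 1 -> forall s, 0 < s <= 1 -> nm (expC (cst_of s * y) - 1) <= 4 * nm y.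
Proof.
move=> y1; apply: (@line_mvt _ (fun s => y * expC (cst_of s * y) - 0)) => [s|s s01|].
- by apply: dCB; [exact: dC_id_exp|exact: dC_cst].
- by rewrite subr0 nmM mulrC ler_wpM2r ?nm_ge0 // nm_line_exp.
- by rewrite cst0 mul0r expC0 subrr.
Qed.
Lemma expC_taylor2 (y : C) : nm y <= 1 -> forall s, 0 < s <= 1 ->
  nm (expC (cst_of s * y) - 1 - cst_of s * y) <= 4 * nm y ^+ 2.
Proof.
move=> y1; apply: (@line_mvt _ (fun s => y * expC (cst_of s * y) - 0 - y)) => [s|s /andP[s0 s1]|].
- apply: dCB; last exact: dC_line.
  by apply: dCB; [exact: dC_id_exp|exact: dC_cst].
- have -> : y * expC (cst_of s * y) - 0 - y = y * (expC (cst_of s * y) - 1) by ring.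
  rewrite nmM expr2 mulrA [leRHS]mulrC ler_wpM2l ?nm_ge0 //.
  by apply: expC_taylor1 => //; rewrite s0 ltW.
- by rewrite cst0 mul0r expC0 subrr subr0.
Qed.
Lemma expC_taylor3 (y : C) : nm y <= 1 ->
  nm (expC y - 1 - y - y ^+ 2 / 2) <= 4 * nm y ^+ 3.
Proof.
move=> y1.
have := @line_mvt (fun s => expC (cst_of s * y) - 1 - cst_of s * y - cst_of s * cst_of s * (y * y / 2))
  (fun s => y * expC (cst_of s * y) - 0 - y - (1 * cst_of s + cst_of s * 1) * (y * y / 2)) (4 * nm y ^+ 3).
move=> H; have {H} H := H _ _ _ 1; move: H; rewrite !cst1 !mul1r -expr2; apply; rewrite ?lexx ?ltr01 //.
- move=> s; apply: dCB.
    by apply: dCB; [apply: dCB; [exact: dC_id_exp|exact: dC_cst]|exact: dC_line].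
  apply: (dC_eq (dCM (dCM (dC_real (is_derive_id s 1)) (dC_real (is_derive_id s 1))) (dC_cst _ s))).
  by rewrite mulr0 addr0 cst1.
- move=> s /andP[s0 s1].
  have -> : y * expC (cst_of s * y) - 0 - y - (1 * cst_of s + cst_of s * 1) * (y * y / 2) =
    y * (expC (cst_of s * y) - 1 - cst_of s * y) by field.
  rewrite nmM exprS mulrCA ler_wpM2l ?nm_ge0 //.
  by apply: expC_taylor2 => //; rewrite s0 ltW.
- by rewrite cst0 !mul0r expC0 subrr !subr0.
Qed.
Lemma expC_sub1 (y : C) : nm y <= 1 -> nm (expC y - 1) <= 4 * nm y.
Proof. by move=> y1; have := expC_taylor1 y1 (s := 1); rewrite cst1 mul1r; apply; rewrite ltr01 lexx. Qed.
Lemma expC_sub2 (y : C) : nm y <= 1 -> nm (expC y - 1 - y) <= 4 * nm y ^+ 2.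
Proof. by move=> y1; have := expC_taylor2 y1 (s := 1); rewrite cst1 mul1r; apply; rewrite ltr01 lexx. Qed.

End RealCalculus.

(** * Mean values and injective holomorphic maps *)

Section ComplexDerivative.
Variable R : realType.
Local Notation C := (Cplx R).
Implicit Types (f g F : C -> C) (z l k c : C).

(** First-order approximation without division, so the case y = z needs no exception in the calculus
    rules; [cdiffP_cvg] links it to difference quotients. *)
Definition cdiff F z l := forall e : R, 0 < e ->
  exists2 d : R, 0 < d & forall y, nm (y - z) < d -> nm (F y - F z - l * (y - z)) <= e * nm (y - z).

Definition ccont F z := forall e : R, 0 < e ->
  exists2 d : R, 0 < d & forall y, nm (y - z) < d -> nm (F y - F z) < e.

Lemma ccontP F z : F y @[y --> z] --> F z <-> ccont F z.
Proof.
split=> [/(@cvgCP _ _ _ (nbhs_filter z)) H e e0|H].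
  by have /nbhsCP := H e e0.
by apply/(@cvgCP _ _ _ (nbhs_filter z)) => e e0; apply/nbhsCP; exact: H.
Qed.

Lemma ccontM F G z : ccont F z -> ccont G z -> ccont (fun y => F y * G y) z.
Proof. by move=> /ccontP a /ccontP b; apply/ccontP; exact: cvgM a b. Qed.

Lemma cdiff_cont F z l : cdiff F z l -> ccont F z.
Proof.
move=> H e e0; have [d d0 Hd] := H 1 ltr01.
have L0 : 0 < 1 + nm l by rewrite ltr_pwDl ?nm_ge0.
exists (Num.min d (e / (1 + nm l))); first by rewrite lt_min d0 divr_gt0.
move=> y; rewrite lt_min => /andP[yd ye].
have -> : F y - F z = (F y - F z - l * (y - z)) + l * (y - z) by rewrite subrK.
apply: le_lt_trans (nmD _ _) _; rewrite nmM.
apply: le_lt_trans (lerD (Hd y yd) (lexx _)) _; rewrite -mulrDl mulrC.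
by rewrite -ltr_pdivlMr.
Qed.

Lemma dnbhsC_near (P : C -> Prop) : (\forall h \near (0 : C)^', P h) <->
  exists2 d : R, 0 < d & forall h, nm h < d -> h != 0 -> P h.
Proof.
split.
  move=> /nbhsCP[d d0 H]; exists d => // h hd h0; apply: H => //; by rewrite subr0.
by move=> [d d0 H]; apply/nbhsCP; exists d => // y; rewrite subr0; exact: H.
Qed.

Lemma cdiffP_cvg F z l : cdiff F z l <->
  (fun h : C => h^-1 *: (F (h + z) - F z)) @ (0 : C)^' --> l.
Proof.
split=> [H|/cvgCP H e e0].
  apply/cvgCP => e e0; have e2 : 0 < e / 2 by rewrite divr_gt0.
  have [d d0 Hd] := H _ e2; apply/dnbhsC_near; exists d => // h hd h0.
  have := Hd (h + z); rewrite addrK => /(_ hd) {}Hd.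
  have -> : h^-1 *: (F (h + z) - F z) - l = h^-1 * (F (h + z) - F z - l * h).
    by rewrite /GRing.scale /=; field.
  rewrite nmM nmV; have n0 : 0 < nm h by rewrite nm_gt0.
  rewrite mulrC ltr_pdivrMr // (le_lt_trans Hd)// ltr_pM2r //; lra.
have /dnbhsC_near[d d0 Hd] := H e e0; exists d => // y yd.
have [->|yz] := eqVneq y z; first by rewrite !subrr mulr0 subr0 nm0 mulr0.
have h0 : y - z != 0 by rewrite subr_eq0.
have := Hd _ yd h0; rewrite subrK => {}Hd.
have n0 : 0 < nm (y - z) by rewrite nm_gt0.
have E : F y - F z - l * (y - z) = ((y - z)^-1 *: (F y - F z) - l) * (y - z).
  by rewrite /GRing.scale /=; field.
by rewrite E nmM ler_wpM2r ?nm_ge0 // ltW.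
Qed.

Lemma cdiff_derive1 F z : derivable F z 1 -> cdiff F z (derive1 F z).
Proof.
move=> H; apply/cdiffP_cvg; rewrite derive1E /derive.
have -> : (fun h : C => h^-1 *: (F (h + z) - F z)) =
  (fun h => h^-1 *: ((F \o shift z) (h *: (1 : C)) - F z)).
  by apply/funext => h; rewrite /= /GRing.scale /= mulr1.
exact: H.
Qed.
Lemma derive1_cdiff F z l : cdiff F z l -> derive1 F z = l.
Proof. by move=> /cdiffP_cvg H; rewrite /derive1; apply: cvg_lim. Qed.

Lemma cdiff_near F G z l r : 0 < r -> (forall y, nm (y - z) < r -> F y = G y) ->
  cdiff F z l -> cdiff G z l.
Proof.
move=> r0 E H e e0; have [d d0 Hd] := H e e0.
exists (Num.min d r); first by rewrite lt_min d0.
move=> y; rewrite lt_min => /andP[yd yr]; rewrite -!E ?subrr ?nm0 //; exact: Hd.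
Qed.
Lemma cdiff_id z : cdiff (fun y => y) z 1.
Proof. by move=> e e0; exists 1 => // y _; rewrite mul1r subrr nm0 mulr_ge0 ?nm_ge0 ?ltW. Qed.
Lemma cdiff_cst c z : cdiff (fun _ => c) z 0.
Proof. by move=> e e0; exists 1 => // y _; rewrite mul0r subrr subr0 nm0 mulr_ge0 ?nm_ge0 ?ltW. Qed.
Lemma cdiffD f g z l k : cdiff f z l -> cdiff g z k -> cdiff (fun y => f y + g y) z (l + k).
Proof.
move=> Hf Hg e e0; have e2 : 0 < e / 2 by rewrite divr_gt0.
have [d d0 Hd] := Hf _ e2; have [d' d0' Hd'] := Hg _ e2.
exists (Num.min d d'); first by rewrite lt_min d0.
move=> y; rewrite lt_min => /andP[/Hd h1 /Hd' h2].
have -> : f y + g y - (f z + g z) - (l + k) * (y - z) =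
  (f y - f z - l * (y - z)) + (g y - g z - k * (y - z)) by ring.
by apply: le_trans (nmD _ _) _; apply: le_trans (lerD h1 h2) _; rewrite -mulrDl -splitr.
Qed.
Lemma cdiffM f g z l k : cdiff f z l -> cdiff g z k ->
  cdiff (fun y => f y * g y) z (l * g z + f z * k).
Proof.
move=> Hf Hg e e0.
have L0 : 0 < 1 + nm (g z) + nm l + nm (f z).
  by rewrite -!addrA ltr_pwDl ?ltr01 ?addr_ge0 ?nm_ge0.
set L := _ + nm (f z) in L0; have e1 : 0 < e / L by rewrite divr_gt0.
have e2 : 0 < Num.min 1 (e / L) by rewrite lt_min ltr01.
have [d d0 Hd] := Hf _ e1; have [d' d0' Hd'] := Hg _ e1.
have [d'' d0'' Hd''] := cdiff_cont Hg e2.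
exists (Num.min (Num.min d d') d''); first by rewrite !lt_min d0 d0'.
move=> y; rewrite !lt_min => /andP[/andP[/Hd h1 /Hd' h2] /Hd'' ].
rewrite lt_min => /andP[h3 h4].
have -> : f y * g y - f z * g z - (l * g z + f z * k) * (y - z) =
  (f y - f z - l * (y - z)) * (g y - g z) + (f y - f z - l * (y - z)) * g z
  + l * (y - z) * (g y - g z) + f z * (g y - g z - k * (y - z)) by ring.
have n := nm_ge0 (y - z); set N := nm (y - z) in n h1 h2 *.
have E : e * N = (e / L * N) * L by rewrite mulrAC divfK ?gt_eqF.
have eL := ltW e1; have eLN : 0 <= e / L * N by rewrite mulr_ge0.
rewrite E; set A := e / L * N in eLN *.
have -> : A * L = A + A * nm (g z) + A * nm l + A * nm (f z) by rewrite /L; ring.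
apply: le_trans (nmD _ _) _; apply: lerD.
  apply: le_trans (nmD _ _) _; apply: lerD.
    apply: le_trans (nmD _ _) _; apply: lerD.
      by rewrite nmM -[leRHS]mulr1; apply: ler_pM; rewrite ?nm_ge0 // ltW.
    by rewrite nmM ler_wpM2r ?nm_ge0.
  rewrite !nmM -/N; have -> : A * nm l = nm l * N * (e / L) by rewrite /A; ring.
  by rewrite ler_wpM2l ?mulr_ge0 ?nm_ge0 // ltW.
by rewrite nmM mulrC ler_wpM2r ?nm_ge0.
Qed.
Lemma cdiff_comp f g z l k : cdiff f z l -> cdiff g (f z) k -> cdiff (fun y => g (f y)) z (k * l).
Proof.
move=> Hf Hg e e0.
have L0 : 0 < 1 + nm k + nm l by rewrite -!addrA ltr_pwDl ?ltr01 ?addr_ge0 ?nm_ge0.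
set L := _ + nm l in L0; have e1 : 0 < Num.min 1 (e / L) by rewrite lt_min ltr01 divr_gt0.
set e' := Num.min _ _ in e1.
have [d d0 Hd] := Hf _ e1; have [d' d0' Hd'] := Hg _ e1.
have [d'' d0'' Hd''] := cdiff_cont Hf d0'.
exists (Num.min d d''); first by rewrite !lt_min d0.
move=> y; rewrite !lt_min => /andP[/Hd h1 /Hd'' /Hd' h2].
have -> : g (f y) - g (f z) - k * l * (y - z) =
  (g (f y) - g (f z) - k * (f y - f z)) + k * (f y - f z - l * (y - z)) by ring.
have n := nm_ge0 (y - z); set N := nm (y - z) in n h1 h2 *.
have fyz : nm (f y - f z) <= (1 + nm l) * N.
  have -> : f y - f z = (f y - f z - l * (y - z)) + l * (y - z) by rewrite subrK.
  rewrite mulrDl; apply: le_trans (nmD _ _) _; apply: lerD; last by rewrite nmM.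
  by apply: le_trans h1 _; rewrite ler_wpM2r // ge_min lexx.
have e'0 := ltW e1.
apply: le_trans (nmD _ _) _; rewrite nmM.
apply: (@le_trans _ _ (e' * ((1 + nm l) * N) + nm k * (e' * N))).
  by apply: lerD; [apply: le_trans h2 _; rewrite ler_wpM2l|rewrite ler_wpM2l ?nm_ge0].
have -> : e' * ((1 + nm l) * N) + nm k * (e' * N) = e' * L * N by rewrite /L; ring.
by rewrite ler_wpM2r // -ler_pdivlMr // ge_min lexx orbT.
Qed.
Lemma cdiff_inv z : z != 0 -> cdiff (fun y => y^-1) z (- (z^-1 ^+ 2)).
Proof.
move=> z0 e e0; have n0 : 0 < nm z by rewrite nm_gt0.
exists (Num.min (nm z / 2) (e * nm z ^+ 3 / 2)).
  by rewrite lt_min !divr_gt0 // mulr_gt0 // exprn_gt0.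
move=> y; rewrite lt_min => /andP[h1 h2].
have ny : nm z / 2 < nm y.
  by have := nmDB z y; rewrite nmBC => h; lra.
have y0 : y != 0 by rewrite -nm_gt0; lra.
have -> : y^-1 - z^-1 - - (z^-1 ^+ 2) * (y - z) = (y - z) * (y - z) / (y * z ^+ 2).
  by field; rewrite z0 y0.
rewrite !nmM nmV nmM nmX -mulrA mulrC ler_wpM2r ?nm_ge0 //.
have ny0 : 0 < nm y by rewrite nm_gt0.
rewrite ler_pdivrMr ?mulr_gt0 ?exprn_gt0 //.
apply: le_trans (ltW h2) _.
have -> : e * nm z ^+ 3 / 2 = e * (nm z / 2 * nm z ^+ 2) by rewrite exprS; field.
by rewrite ler_wpM2l ?(ltW e0) // ler_wpM2r ?exprn_ge0 ?nm_ge0 // ltW.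
Qed.
Lemma cdiff_exp z : cdiff expC z (expC z).
Proof.
move=> e e0; have E0 : 0 < nm (expC z) by rewrite nm_gt0 expC_neq0.
exists (Num.min 1 (e / (4 * nm (expC z)))); first by rewrite lt_min ltr01 divr_gt0 // mulr_gt0.
move=> y; rewrite lt_min => /andP[/ltW h1 h2].
have -> : expC y - expC z - expC z * (y - z) = expC z * (expC (y - z) - 1 - (y - z)).
  by rewrite expCB; field; exact: expC_neq0.
rewrite nmM; apply: le_trans (ler_wpM2l (nm_ge0 _) (expC_sub2 h1)) _.
rewrite expr2 !mulrA ler_wpM2r ?nm_ge0 //.
have -> : nm (expC z) * 4 * nm (y - z) = nm (y - z) * (4 * nm (expC z)) by ring.
by apply/ltW; move: h2; rewrite ltr_pdivlMr ?mulr_gt0.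
Qed.

Lemma cdiff_dC_line F z h l (t : R) : cdiff F (z + cst_of t * h) l -> dC (fun s => F (z + cst_of s * h)) t (l * h).
Proof.
move=> H; apply: dC_eps => e e0.
have h0 : 0 < 1 + nm h by rewrite ltr_pwDl ?nm_ge0.
have [d d0 Hd] := H (e / (1 + nm h)) ltac:(by rewrite divr_gt0).
exists (d / (1 + nm h)); first by rewrite divr_gt0.
move=> s sd; have E : z + cst_of s * h - (z + cst_of t * h) = cst_of (s - t) * h by rewrite cstB; ring.
have le : `|s - t| * nm h <= `|s - t| * (1 + nm h) by rewrite ler_wpM2l // lerDr.
have := Hd (z + cst_of s * h); rewrite E nmM nm_cst => H1.
have -> : cst_of (s - t) * (l * h) = l * (cst_of (s - t) * h) by ring.
apply: le_trans (H1 _) _; first by apply: le_lt_trans le _; rewrite -ltr_pdivlMr.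
rewrite -mulrA ler_wpM2l ?(ltW e0) // mulrC ler_pdivrMr //.
Qed.

Definition pt (x y : R) : C := cst_of x + iu * cst_of y.
Lemma Re_pt x y : Re (pt x y) = x.
Proof. by rewrite /pt !ReImE; ring. Qed.
Lemma pt_ReIm z : pt (Re z) (Im z) = z. Proof. by rewrite /pt -CE. Qed.
Lemma ptB x y x' y' : pt x y - pt x' y' = pt (x - x') (y - y').
Proof. by rewrite /pt !cstB; ring. Qed.
Lemma nm_pt x y : nm (pt x y) <= `|x| + `|y|.
Proof. by apply: le_trans (nmD _ _) _; rewrite nmM nm_iu mul1r !nm_cst. Qed.
Lemma continuous_ptx y : continuous (fun x => pt x y).
Proof. by apply: continuousCD; [apply: continuousCcst => x; exact: cvg_id|move=> x; exact: cvg_cst]. Qed.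
Lemma continuous_pty x : continuous (fun y => pt x y).
Proof.
apply: continuousCD; first exact: cst_continuous.
by apply: continuousCM; [exact: cst_continuous|apply: continuousCcst => y; exact: cvg_id].
Qed.

(** * Cauchy's theorem for rectangles *)

Section Goursat.
Variables (G : C -> C) (rho : R).
Hypothesis cG : continuous G.
Hypothesis dG : forall s, Re s < rho -> exists l, cdiff G s l.

Definition hz (y a b : R) : C := primC a (fun x => G (pt x y)) b.
Definition vt (x a b : R) : C := primC a (fun y => G (pt x y)) b.
(** The contour integral of G over the boundary, counterclockwise; the factor [iu] is dz = i dy on
    the vertical sides. *)
Definition rect (x0 x1 y0 y1 : R) : C :=
  hz y0 x0 x1 + iu * vt x1 y0 y1 - hz y1 x0 x1 - iu * vt x0 y0 y1.

Lemma cGx y : continuous (fun x => G (pt x y)).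
Proof. exact: continuous_comp' (@continuous_ptx y) cG. Qed.
Lemma cGy x : continuous (fun y => G (pt x y)).
Proof. exact: continuous_comp' (@continuous_pty x) cG. Qed.

Lemma rect_x m x0 x1 y0 y1 : x0 <= m -> m <= x1 ->
  rect x0 x1 y0 y1 = rect x0 m y0 y1 + rect m x1 y0 y1.
Proof.
move=> a b; rewrite /rect /hz (prim_add (@cGx y0) a b) (prim_add (@cGx y1) a b); ring.
Qed.
Lemma rect_y m x0 x1 y0 y1 : y0 <= m -> m <= y1 ->
  rect x0 x1 y0 y1 = rect x0 x1 y0 m + rect x0 x1 m y1.
Proof.
move=> a b; rewrite /rect /vt (prim_add (@cGy x0) a b) (prim_add (@cGy x1) a b); ring.
Qed.

Lemma prim_sub_le (f q : R -> C) (a b K : R) : continuous f -> a <= b ->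
  (forall t, exists2 l, dC q t l & a <= t <= b -> nm (f t - l) <= K) ->
  nm (primC a f b - (q b - q a)) <= K * (b - a).
Proof.
move=> cf ab H.
have H' t : exists l, dC q t l /\ (a <= t <= b -> nm (f t - l) <= K).
  by have [l] := H t; exists l.
have [dq Hq] := boolp.choice H'.
have := @mvt_nm_cst _ (fun t => primC a f t - q t) (fun t => f t - dq t) a b K ab.
rewrite primC0 sub0r opprK.
have -> : primC a f b - q b + q a = primC a f b - (q b - q a) by ring.
apply.
- move=> x /andP[ax xb]; apply: dCB; last by have [] := Hq x.
  by apply: primC_derive => //; rewrite ltrBlDr (lt_le_trans ax)// lerDl.
- move=> x; apply: cvgB; first exact: primC_within.
  have : continuous q by move=> {}x; have [d _] := Hq x; exact: dC_cvg d.
  by move/(@within_cont _ `[a, b]%classic) => h; exact: h.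
- by move=> x /andP[ax xb]; have [_] := Hq x; apply; rewrite !ltW.
Qed.

Lemma dC_quad (g0 l c v : C) (t : R) :
  dC (fun t => g0 * (c + v * cst_of t) + l * ((c + v * cst_of t) * (c + v * cst_of t) / 2)) t
     (v * (g0 + l * (c + v * cst_of t))).
Proof.
have d : dC (fun t => c + v * cst_of t) t v.
  apply: (dC_eq (dCD (dC_cst c t) (dCZ v (dC_real (is_derive_id t 1))))).
  by rewrite cst1 mulr1 add0r.
apply: (dC_eq (dCD (dCZ g0 d) (dCZ l (dCM (dCM d d) (dC_cst 2^-1 t))))).
by field.
Qed.

(** The affine function G z + l (s - z) has the primitive Q, whose increments around the boundary
    cancel. What is left on each side is at most K times its length. *)
Lemma rect_le x0 x1 y0 y1 z l K : x0 <= x1 -> y0 <= y1 ->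
  (forall x y, x0 <= x <= x1 -> y0 <= y <= y1 -> nm (G (pt x y) - G z - l * (pt x y - z)) <= K) ->
  nm (rect x0 x1 y0 y1) <= 2 * K * ((x1 - x0) + (y1 - y0)).
Proof.
move=> x01 y01 H.
pose Q s := G z * (s - z) + l * ((s - z) * (s - z) / 2).
have qx y t : dC (fun x => Q (pt x y)) t (G z + l * (pt t y - z)).
  have := dC_quad (G z) l (iu * cst_of y - z) 1 t.
  move/dC_eq; rewrite mul1r; have E s : iu * cst_of y - z + 1 * cst_of s = pt s y - z.
    by rewrite /pt; ring.
  rewrite E => /(_ _ erefl); apply: dC_ext => s; by rewrite !E.
(* Along a vertical side the derivative of Q carries a factor i, which -i removes. *)
have qy x t : dC (fun y => - iu * Q (pt x y)) t (G z + l * (pt x t - z)).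
  have := dCZ (- iu) (dC_quad (G z) l (cst_of x - z) (iu) t).
  have E s : cst_of x - z + iu * cst_of s = pt x s - z.
    by rewrite /pt; ring.
  rewrite E mulrA mulNr iu2 opprK mul1r; apply: dC_ext => s; by rewrite !E.
have hx y : y0 <= y <= y1 -> nm (hz y x0 x1 - (Q (pt x1 y) - Q (pt x0 y))) <= K * (x1 - x0).
  move=> yy; apply: (@prim_sub_le (fun x => G (pt x y)) (fun x => Q (pt x y))) => //; first exact: cGx.
  move=> t; exists (G z + l * (pt t y - z)); first exact: qx.
  by move=> tt; rewrite opprD addrA; exact: H.
have hy x : x0 <= x <= x1 -> nm (iu * vt x y0 y1 - (Q (pt x y1) - Q (pt x y0))) <= K * (y1 - y0).
  move=> xx.
  have -> : iu * vt x y0 y1 - (Q (pt x y1) - Q (pt x y0)) =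
     iu * (vt x y0 y1 - (- iu * Q (pt x y1) - (- iu * Q (pt x y0)))).
    set a := Q _; set b := Q _; set c := vt _ _ _.
    have -> : iu * (c - (- iu * a - - iu * b)) = iu * c + (iu * iu) * (a - b) by ring.
    by rewrite iu2; ring.
  rewrite nmM nm_iu mul1r.
  apply: (@prim_sub_le (fun y => G (pt x y)) (fun y => - iu * Q (pt x y))) => //; first exact: cGy.
  move=> t; exists (G z + l * (pt x t - z)); first exact: qy.
  by move=> tt; rewrite opprD addrA; exact: H.
have -> : rect x0 x1 y0 y1 = (hz y0 x0 x1 - (Q (pt x1 y0) - Q (pt x0 y0)))
   + (iu * vt x1 y0 y1 - (Q (pt x1 y1) - Q (pt x1 y0)))
   - (hz y1 x0 x1 - (Q (pt x1 y1) - Q (pt x0 y1)))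
   - (iu * vt x0 y0 y1 - (Q (pt x0 y1) - Q (pt x0 y0))) by rewrite /rect; ring.
have := hx y0; rewrite lexx y01 => /(_ isT) h1; have := hx y1; rewrite lexx y01 => /(_ isT) h2.
have := hy x0; rewrite lexx x01 => /(_ isT) h3; have := hy x1; rewrite lexx x01 => /(_ isT) h4.
apply: le_trans (nmB _ _) _; apply: (@le_trans _ _ (K * (x1 - x0) + K * (y1 - y0) + K * (x1 - x0) + K * (y1 - y0))); last by lra.
apply: lerD => //; apply: le_trans (nmB _ _) _; apply: lerD => //.
by apply: le_trans (nmD _ _) _; exact: lerD.
Qed.

(* Repeated bisection: the derivative at the limit point contradicts K > 0. *)
Lemma goursat x0 x1 y0 y1 : x0 < x1 -> y0 < y1 -> x1 < rho -> rect x0 x1 y0 y1 = 0.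
Proof.
move=> x01 y01 x1r; apply/eqP; rewrite -nm_eq0; apply/negPn/negP => K0'.
set K := nm _ in K0'; have K0 : 0 < K by rewrite lt_def K0' nm_ge0.
pose a := x1 - x0; pose b := y1 - y0.
have a0 : 0 < a by rewrite subr_gt0. have b0 : 0 < b by rewrite subr_gt0.
pose an (n : nat) := a / 2 ^+ n; pose bn (n : nat) := b / 2 ^+ n.
have p2 n : 0 < 2 ^+ n :> R by rewrite exprn_gt0.
have an0 n : 0 < an n by rewrite divr_gt0.
have bn0 n : 0 < bn n by rewrite divr_gt0.
have anS n : an n = an n.+1 + an n.+1 by rewrite /an exprS; field; rewrite expf_neq0.
have bnS n : bn n = bn n.+1 + bn n.+1 by rewrite /bn exprS; field; rewrite expf_neq0.
(* The invariant of the bisection: among four quarters of a rectangle, one keeps at least a quarter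
   of the integral. The point p is the lower left corner. *)
pose P n (p : R * R) := K / 4 ^+ n <= nm (rect p.1 (p.1 + an n) p.2 (p.2 + bn n)).
pose sub n (p q : R * R) := [/\ p.1 <= q.1, q.1 + an n.+1 <= p.1 + an n, p.2 <= q.2 & q.2 + bn n.+1 <= p.2 + bn n].
have step n p : P n p -> exists q, P n.+1 q /\ sub n p q.
  case: p => x y; rewrite /P /= => H.
  have Ex : x + an n = x + an n.+1 + an n.+1 by rewrite anS addrA.
  have Ey : y + bn n = y + bn n.+1 + bn n.+1 by rewrite bnS addrA.
  move: H; rewrite Ex Ey.
  have lex u : u <= u + an n.+1 by rewrite lerDl ltW.
  have ley u : u <= u + bn n.+1 by rewrite lerDl ltW.
  rewrite (rect_x _ _ (lex _) (lex _)).
  rewrite (rect_y x _ (ley _) (ley _)) (rect_y (x + an n.+1) _ (ley _) (ley _)).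
  set A := rect _ _ _ _; set B := rect _ _ _ _; set D := rect _ _ _ _; set E := rect _ _ _ _.
  have [hA _|hA] := leP (K / 4 ^+ n.+1) (nm A).
    exists (x, y); split; first exact: hA.
    by rewrite /sub /= Ex Ey !lexx !lerDl !ltW.
  have [hB _|hB] := leP (K / 4 ^+ n.+1) (nm B).
    exists (x, y + bn n.+1); split; first exact: hB.
    by rewrite /sub /= Ex Ey !lexx !lerDl !ltW.
  have [hD _|hD] := leP (K / 4 ^+ n.+1) (nm D).
    exists (x + an n.+1, y); split; first exact: hD.
    by rewrite /sub /= Ex Ey !lexx !lerDl !ltW.
  have [hE _|hE] := leP (K / 4 ^+ n.+1) (nm E).
    exists (x + an n.+1, y + bn n.+1); split; first exact: hE.
    by rewrite /sub /= Ex Ey !lexx !lerDl !ltW.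
  rewrite leNgt => /negP[].
  have -> : K / 4 ^+ n = K / 4 ^+ n.+1 + K / 4 ^+ n.+1 + (K / 4 ^+ n.+1 + K / 4 ^+ n.+1).
    by rewrite exprS; field; rewrite expf_neq0.
  apply: le_lt_trans (nmD _ _) _; apply: ltrD; apply: le_lt_trans (nmD _ _) _; exact: ltrD.
pose nxt n p := xget p [set q | P n.+1 q /\ sub n p q].
pose sq := fix sq n := if n is m.+1 then nxt m (sq m) else (x0, y0).
have nxtP n p : P n p -> P n.+1 (nxt n p) /\ sub n p (nxt n p).
  by move=> /step h; exact: (@xgetPex _ p [set q | P n.+1 q /\ sub n p q] h).
have Psq n : P n (sq n).
  elim: n => [|n IH]; last by have [] := nxtP _ _ IH.
  by rewrite /P /= /an /bn expr0 !divr1 /a /b !(addrC x0) !(addrC y0) !subrK.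
have Ssq n : sub n (sq n) (sq n.+1) by have [] := nxtP _ _ (Psq n).
have mono n m : [/\ (sq n).1 <= (sq (n + m)%N).1, (sq (n + m)%N).1 + an (n + m)%N <= (sq n).1 + an n,
    (sq n).2 <= (sq (n + m)%N).2 & (sq (n + m)%N).2 + bn (n + m)%N <= (sq n).2 + bn n].
  elim: m => [|m [h1 h2 h3 h4]]; first by rewrite addn0 !lexx.
  have [g1 g2 g3 g4] := Ssq (n + m)%N; rewrite addnS.
  by split; [exact: le_trans g1|exact: le_trans h2|exact: le_trans g3|exact: le_trans h4].
have ub n m : (sq m).1 <= (sq n).1 + an n /\ (sq m).2 <= (sq n).2 + bn n.
  have [nm_|mn] := leqP n m.
    have [_ h1 _ h2] := mono n (m - n)%N; rewrite subnKC // in h1 h2.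
    by split; [apply: le_trans h1|apply: le_trans h2]; rewrite lerDl ltW.
  have [h1 _ h2 _] := mono m (n - m)%N; rewrite subnKC 1?ltnW // in h1 h2.
  by split; [apply: le_trans h1 _|apply: le_trans h2 _]; rewrite lerDl ltW.
pose X := sup [set (sq n).1 | n in [set: nat]]; pose Y := sup [set (sq n).2 | n in [set: nat]].
have hX n : (sq n).1 <= X <= (sq n).1 + an n.
  apply/andP; split.
    apply: ub_le_sup; last by exists n.
    by exists ((sq 0%N).1 + an 0%N) => _ [m _ <-]; have [] := ub 0%N m.
  apply: ge_sup; first by exists (sq 0%N).1, 0%N.
  by move=> _ [m _ <-]; have [] := ub n m.
have hY n : (sq n).2 <= Y <= (sq n).2 + bn n.
  apply/andP; split.
    apply: ub_le_sup; last by exists n.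
    by exists ((sq 0%N).2 + bn 0%N) => _ [m _ <-]; have [] := ub 0%N m.
  apply: ge_sup; first by exists (sq 0%N).2, 0%N.
  by move=> _ [m _ <-]; have [] := ub n m.
have Xr : X < rho.
  apply: le_lt_trans x1r; have /andP[_] := hX 0%N; rewrite /= /an expr0 divr1 /a.
  by rewrite addrC subrK.
have [l dl] := dG (s := pt X Y) ltac:(by rewrite Re_pt).
pose c := a + b; have c0 : 0 < c by rewrite addr_gt0.
(* With this precision the estimate of [rect_le] on the n-th rectangle, of half-perimeter c / 2^n,
   is half of K / 4^n. *)
have e0 : 0 < K / (4 * c ^+ 2) by rewrite divr_gt0 // mulr_gt0 // exprn_gt0.
have [d d0 Hd] := dl _ e0.
have [n cn] : exists n : nat, c / 2 ^+ n < d.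
  have [n hn] := archi_nat (c / d).
  exists n; rewrite ltr_pdivrMr // mulrC -ltr_pdivrMr //; apply: lt_trans hn _.
  by rewrite -natrX ltr_nat ltn_expl.
have H : nm (rect (sq n).1 ((sq n).1 + an n) (sq n).2 ((sq n).2 + bn n)) <=
    2 * (K / (4 * c ^+ 2) * (c / 2 ^+ n)) * (((sq n).1 + an n - (sq n).1) + ((sq n).2 + bn n - (sq n).2)).
  apply: (@rect_le _ _ _ _ (pt X Y) l); rewrite ?lerDl ?(ltW (an0 _)) ?(ltW (bn0 _)) //.
  move=> x y hx hy.
  have dist : nm (pt x y - pt X Y) <= c / 2 ^+ n.
    rewrite ptB; apply: le_trans (nm_pt _ _) _.
    rewrite /c mulrDl -/(an n) -/(bn n); apply: lerD; rewrite ler_distl.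
      by have := hX n; move: hx => /andP[? ?] /andP[? ?]; apply/andP; split; lra.
    by have := hY n; move: hy => /andP[? ?] /andP[? ?]; apply/andP; split; lra.
  apply: le_trans (Hd _ (le_lt_trans dist cn)) _.
  by rewrite ler_wpM2l // ltW.
have := le_trans (Psq n) H; rewrite leNgt => /negP; apply.
have -> : (sq n).1 + an n - (sq n).1 + ((sq n).2 + bn n - (sq n).2) = c / 2 ^+ n.
  by rewrite /c mulrDl -/(an n) -/(bn n); ring.
have -> : 2 * (K / (4 * c ^+ 2) * (c / 2 ^+ n)) * (c / 2 ^+ n) = K / 4 ^+ n / 2.
  have -> : 4 ^+ n = 2 ^+ n * 2 ^+ n :> R by rewrite -exprMn; congr (_ ^+ _); ring.
  by field; rewrite expf_neq0 // gt_eqF.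
have : 0 < K / 4 ^+ n by rewrite divr_gt0 // exprn_gt0.
by move=> ?; lra.
Qed.
End Goursat.

Definition circ z0 (r y : R) : C := z0 + cst_of r * expC (iu * cst_of y).

Lemma continuous_circ z0 r : continuous (circ z0 r).
Proof.
apply: continuousCD; first exact: cst_continuous.
apply: continuousCM; first exact: cst_continuous.
apply: (@continuous_comp' _ _ _ (fun y : R => iu * cst_of y : C) expC) => //; last exact: continuous_expC.
apply: continuousCM; first exact: cst_continuous.
by apply: continuousCcst => t; exact: cvg_id.
Qed.

(* F is allowed a puncture at the centre, where mere continuity suffices *)
Lemma mean_value_le F z0 (r r' M : R) : 0 < r -> r < r' ->
  (forall z, 0 < nm (z - z0) < r' -> exists l, cdiff F z l) -> ccont F z0 ->
  (forall y, nm (F (circ z0 r y)) <= M) -> nm (F z0) <= M.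
Proof.
move=> r0 rr' dF cF HM.
have rp : 0 < (r + r') / 2 by lra.
pose rho := ln ((r + r') / 2).
have erho : expR rho = (r + r') / 2 by rewrite lnK.
(* In the coordinate s with z = z0 + exp s, circles become vertical segments of length 2 pi. Capping
   Re s at rho keeps z in the punctured disc for every s, so that G is continuous on the whole
   plane, as [goursat] demands. *)
pose cl (s : C) : C := pt (Num.min (Re s) rho) (Im s).
pose G (s : C) : C := F (z0 + expC (cl s)).
have inD s : 0 < nm (z0 + expC (cl s) - z0) < r'.
  rewrite addrAC subrr add0r nm_expC expR_gt0 andTb; have -> : Re (cl s) = Num.min (Re s) rho by exact: Re_pt.
  have : expR (Num.min (Re s) rho) <= expR rho by rewrite ler_expR ge_min lexx orbT.
  by rewrite erho => ?; lra.
have ccl : continuous cl.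
  apply: continuousCD.
    apply: continuousCcst => s; apply: (@continuous_min _ _ (fun s : C => Re s : R) (fun _ => rho)).
      exact: continuous_Re.
    exact: cst_continuous.
  apply: continuousCM; first exact: cst_continuous.
  by apply: continuousCcst; exact: continuous_Im.
have cE : continuous (fun s : C => z0 + expC (cl s)).
  apply: continuousCD; first exact: cst_continuous.
  exact: continuous_comp' ccl (@continuous_expC R).
have cG : continuous G.
  move=> s; have [l dl] := dF _ (inD s).
  by apply: (cvg_comp _ F (cE s)); apply/ccontP; exact: cdiff_cont dl.
have dG s : Re s < rho -> exists l, cdiff G s l.
  move=> sr; have [l dl] := dF _ (inD s).
  exists (l * (0 + expC s)).
  apply: (@cdiff_near (fun s => F (z0 + expC s)) _ s _ (rho - Re s)); first by rewrite subr_gt0.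
    move=> y hy; rewrite /G /cl.
    have : Re y < rho.
      have := le_lt_trans (Re_le_nm _) hy; rewrite cReB => /(le_lt_trans (ler_norm _)); lra.
    by move=> /ltW/min_idPl ->; rewrite pt_ReIm.
  apply: (@cdiff_comp (fun s => z0 + expC s) F); first by apply: cdiffD; [exact: cdiff_cst|exact: cdiff_exp].
  by move: dl; rewrite /cl; move: sr => /ltW/min_idPl ->; rewrite pt_ReIm.
have T0 : 0 < pi *+ 2 :> R by rewrite mulrn_wgt0 ?pi_gt0.
set T := pi *+ 2 in T0.
have rlr : ln r < rho by rewrite ltr_ln ?posrE //; lra.
have Gpt x y : x < rho -> G (pt x y) = F (z0 + cst_of (expR x) * expC (iu * cst_of y)).
  move=> xr; rewrite /G /cl Re_pt; have -> : Im (pt x y) = y by rewrite /pt !ReImE; ring.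
  move/ltW/min_idPl: xr => ->; rewrite /pt expCD; congr (F (_ + _ * _)).
  by apply: eqcx; rewrite ?Re_exp ?Im_exp Re_cst Im_cst ?sin0 ?cos0 ?mulr1 ?mulr0 ?Re_cst ?Im_cst.
apply/ler_addgt0Pr => e e0.
have [d d0 Hd] := cF e e0.
(* The inner circle has radius exp x0 < d, so F differs from F z0 by less than e on it. *)
pose x0 := Num.min (ln r - 1) (ln (d / 2)).
have x0r : x0 < ln r by rewrite /x0 gt_min ltrBlDr ltrDl ltr01.
have ex0 : expR x0 < d.
  apply: (@le_lt_trans _ _ (expR (ln (d / 2)))); first by rewrite ler_expR ge_min lexx orbT.
  rewrite lnK ?posrE ?divr_gt0 //; lra.
have := goursat cG dG x0r T0 rlr.
(* G has period 2 pi i, so the horizontal sides cancel and the vertical integrals over the two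
   circles agree. *)
have hzE : hz G T x0 (ln r) = hz G 0 x0 (ln r).
  rewrite /hz; congr (primC _ _ _); apply/funext => x.
  rewrite /G /cl !Re_pt.
  have I y : Im (pt x y) = y by rewrite /pt !ReImE; ring.
  rewrite !I; congr (F (_ + _)); rewrite /pt !expCD cst0 mulr0 expC0; congr (_ * _).
  exact: expC_2pii.
rewrite /rect hzE => H.
have {H} vE : vt G (ln r) 0 T = vt G x0 0 T.
  have key (A B E : C) : E + iu * A - E - iu * B = 0 -> A = B.
    move=> h; have : iu * (A - B) = 0 by rewrite -h; ring.
    by move/eqP; rewrite mulf_eq0 -nm_eq0 nm_iu oner_eq0 /= subr_eq0 => /eqP.
  exact: key H.
have v1 : nm (vt G (ln r) 0 T) <= M * T.
  rewrite -[X in M * X]subr0; apply: (@primC_le _ (fun y => G (pt (ln r) y))); [exact: cGy|exact: ltW|].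
  move=> t _; rewrite (Gpt _ _ rlr) (lnK r0); exact: (HM t).
have v0 : nm (vt G x0 0 T - (cst_of T * F z0 - cst_of 0 * F z0)) <= e * T.
  rewrite -[X in e * X]subr0.
  apply: (@prim_sub_le (fun y => G (pt x0 y)) (fun y => cst_of y * F z0)); [exact: cGy|exact: ltW|].
  move=> t; exists (F z0); first exact: dC_line.
  move=> _; rewrite (Gpt _ _ (lt_trans x0r rlr)); apply: ltW; apply: Hd.
  by rewrite addrAC subrr add0r nmM nm_expC_iu mulr1 nm_cst ger0_norm ?expR_ge0.
rewrite -(ler_pM2l T0) mulrC.
have -> : nm (F z0) * T = nm (cst_of T * F z0) by rewrite nmM nm_cst (gtr0_norm T0) mulrC.
have -> : cst_of T * F z0 = vt G x0 0 T - (vt G x0 0 T - (cst_of T * F z0 - cst_of 0 * F z0)).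
  move: (vt G x0 0 T) (cst_of T * F z0) => A B; rewrite cst0; ring.
apply: le_trans (nmB _ _) _; rewrite mulrDr ![T * _]mulrC.
by apply: lerD; [rewrite -vE; exact: v1|exact: v0].
Qed.

Lemma circ_nm z0 r y : 0 <= r -> nm (circ z0 r y - z0) = r.
Proof. by move=> r0; rewrite /circ addrAC subrr add0r nmM nm_expC_iu mulr1 nm_cst ger0_norm. Qed.

(** One period is compact, so a minimum over the circle exists by the extreme value theorem on an
    interval. *)
Lemma circ_per z0 (r y : R) : exists2 y', 0 <= y' <= pi *+ 2 & circ z0 r y = circ z0 r y'.
Proof.
have T0 : 0 < pi *+ 2 :> R by rewrite mulrn_wgt0 ?pi_gt0.
set T := pi *+ 2 in T0 *.
pose k := Num.floor (y / T); exists (y - T * k%:~R).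
  apply/andP; split; first by rewrite subr_ge0 mulrC -ler_pdivlMr // Num.Theory.floor_le_tmp.
  rewrite lerBlDr -[X in X + _]mulr1 -mulrDr mulrC -ler_pdivrMr // addrC -[1]/(1%:~R) -intrD.
  by rewrite ltW // Num.Theory.floorD1_gt.
rewrite /circ; congr (_ + _ * _).
have -> : iu * cst_of (y - T * k%:~R) = iu * cst_of y - twopii * k%:~R :> C.
  by rewrite cstB cstM cst_int /twopii -/T; ring.
by rewrite expCB expC_2piik divr1.
Qed.

Lemma circ_min (g : C -> C) z0 r : (forall y, ccont g (circ z0 r y)) ->
  (forall y, g (circ z0 r y) != 0) -> exists2 m : R, 0 < m & forall y, m <= nm (g (circ z0 r y)).
Proof.
move=> cg g0; have T0 : 0 <= pi *+ 2 :> R by rewrite mulrn_wge0 ?pi_ge0.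
have cf : continuous (fun y => nm (g (circ z0 r y))).
  apply: (@continuous_comp' _ _ _ (fun y => g (circ z0 r y)) nm); last exact: continuous_nm.
  move=> y; apply: (cvg_comp _ g (@continuous_circ z0 r y)).
  by apply/ccontP; exact: cg.
have [c cI H] := EVT_min T0 (continuous_subspaceT cf).
exists (nm (g (circ z0 r c))); first by rewrite nm_gt0.
by move=> y; have [y' hy' ->] := circ_per z0 r y; apply: H; rewrite in_itv.
Qed.

(** * Injective holomorphic maps: continuity of the inverse and nonvanishing derivative *)

Section Injective.
Variables (D : set C) (w : C -> C) (dw : C -> C).
Hypothesis oD : forall z, D z -> exists2 r : R, 0 < r & forall y, nm (y - z) < r -> D y.
Hypothesis dwP : forall z, D z -> cdiff w z (dw z).
Hypothesis winj : forall x y, D x -> D y -> w x = w y -> x = y.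

Lemma inj_circ_min z0 (r : R) : 0 < r -> D z0 -> (forall y, nm (y - z0) <= r -> D y) ->
  exists2 m : R, 0 < m & forall y, m <= nm (w (circ z0 r y) - w z0).
Proof.
move=> r0 D0 Dr; have Dc y : D (circ z0 r y) by apply: Dr; rewrite circ_nm // ltW.
apply: (@circ_min (fun z => w z - w z0)) => y.
  move=> e e0; have [d d0 Hd] := cdiff_cont (dwP (Dc y)) e0.
  exists d => // z zd; have -> : w z - w z0 - (w (circ z0 r y) - w z0) = w z - w (circ z0 r y) by ring.
  exact: Hd.
rewrite subr_eq0; apply/eqP => /(winj (Dc y) D0) E.
by have := circ_nm z0 y (ltW r0); rewrite E subrr nm0 => h; move: r0; rewrite -h ltxx.
Qed.

(** Were z far from z0 with w z close to w z0, then 1/(w y - w z) would be holomorphic in y near z0,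
    at most 2/m on a small circle and larger than 2/m at the centre, against the mean value
    bound. *)
Lemma inj_inv_cont z0 (e : R) : D z0 -> 0 < e ->
  exists2 d : R, 0 < d & forall z, D z -> nm (w z - w z0) < d -> nm (z - z0) < e.
Proof.
move=> D0 e0; have [r r0 Hr] := oD D0.
pose s := Num.min (r / 2) (e / 2).
have s0 : 0 < s by rewrite lt_min !divr_gt0.
have sr : s <= r / 2 by rewrite ge_min lexx.
have se : s <= e / 2 by rewrite ge_min lexx orbT.
have Ds y : nm (y - z0) <= s -> D y by move=> hy; apply: Hr; apply: le_lt_trans hy _; lra.
have [m m0 Hm] := inj_circ_min s0 D0 Ds.
exists (m / 2); first by rewrite divr_gt0.
move=> z Dz zd; rewrite ltNge; apply/negP => ze.
have wn y : nm (y - z0) < s * 3 / 2 -> w y - w z != 0.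
  move=> ys; rewrite subr_eq0; apply/eqP => /winj E.
  have yD : D y by apply: Hr; lra.
  move: ys; rewrite E //; lra.
have s32 : s < s * 3 / 2 by lra.
have := @mean_value_le (fun y => (w y - w z)^-1) z0 s (s * 3 / 2) (m / 2)^-1 s0 s32 _ _ _.
have diffat y : nm (y - z0) < s * 3 / 2 -> cdiff (fun y => (w y - w z)^-1) y (- ((w y - w z)^-1 ^+ 2) * (dw y + - 0)).
  move=> ys; apply: (@cdiff_comp (fun y => w y - w z) (fun y => y^-1)); last exact: cdiff_inv (wn _ ys).
  have dy := dwP (Hr y ltac:(lra)).
  have := cdiffD dy (@cdiff_cst (- w z) y).
  by rewrite oppr0.
move=> H; have : nm (w z0 - w z)^-1 <= (m / 2)^-1.
  apply: H.
  - by move=> y /andP[_ ys]; exists (- ((w y - w z)^-1 ^+ 2) * (dw y + - 0)); exact: diffat.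
  - by apply: cdiff_cont; apply: diffat; rewrite subrr nm0; lra.
  - move=> y; rewrite nmV lef_pV2 ?posrE ?divr_gt0 ?nm_gt0 ?wn ?circ_nm //; try lra.
    have := nm_tri (w z) (w (circ z0 s y)) (w z0); have := Hm y; lra.
rewrite nmV nmBC lef_pV2 ?posrE ?divr_gt0 //; first by rewrite leNgt zd.
by rewrite nmBC nm_gt0 wn // subrr nm0; lra.
Qed.

Lemma bernoulli_pow (h : R) n : 0 <= h -> 1 + n%:R * h <= (1 + h) ^+ n.
Proof.
move=> h0; elim: n => [|n IH]; first by rewrite mul0r addr0 expr0.
rewrite exprS; apply: (@le_trans _ _ ((1 + h) * (1 + n%:R * h))).
  have : 0 <= n%:R * h * h by rewrite !mulr_ge0.
  by rewrite -natr1; lra.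
by rewrite ler_wpM2l // addr_ge0.
Qed.
(** By Bernoulli's inequality (x/B)^n grows at least linearly when x > B, hence passes c/a. *)
Lemma pow_limit (x B a c : R) : 0 < a -> 0 < B -> (forall n, a * x ^+ n <= c * B ^+ n) -> x <= B.
Proof.
move=> a0 B0 H; rewrite leNgt; apply/negP => xB.
pose h := x / B - 1.
have h0 : 0 < h by rewrite subr_gt0 ltr_pdivlMr // mul1r.
have [n hn] := archi_nat (c / a / h).
have := H n; rewrite leNgt => /negP; apply.
have Bn : 0 < B ^+ n by rewrite exprn_gt0.
have xE : x ^+ n = (1 + h) ^+ n * B ^+ n.
  by rewrite -exprMn /h addrC subrK divfK ?gt_eqF.
rewrite xE mulrA ltr_pM2r // mulrC -ltr_pdivrMr //.
apply: lt_le_trans (bernoulli_pow n (ltW h0)).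
by move: hn; rewrite ltr_pdivrMr // => ?; lra.
Qed.

(* For zeta close to z0 with w'(zeta) <> 0, F(z) = (z - zeta)/(w z - w zeta) is
   bounded on a circle around z0, hence at z0 (the factor z - zeta makes
   (z - zeta) F^n differentiable at zeta, and n tends to infinity); but
   w'(z0) = 0 makes F(z0) large. *)
Lemma inj_deriv_neq0 z0 : D z0 -> dw z0 != 0.
Proof.
move=> D0; apply/eqP => dw0; have [r1 r10 Hr1] := oD D0.
pose r := r1 / 4; have r0 : 0 < r by rewrite divr_gt0.
have rr1 : r < r1 by rewrite /r; lra.
have Ds y : nm (y - z0) <= r -> D y by move=> hy; apply: Hr1; exact: le_lt_trans hy _.
have [m m0 Hm] := inj_circ_min r0 D0 Ds.
(* On the circle |z - zeta| <= 2 r and |w z - w zeta| >= m/2, so |F| <= B. The slope 1/(2 B) chosen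
   next makes |F(z0)| at least 2 B. *)
pose B := 4 * r / m; have B0 : 0 < B by rewrite divr_gt0 // mulr_gt0.
have [d d0 Hd] := dwP D0 (e := (2 * B)^-1) ltac:(by rewrite invr_gt0 mulr_gt0).
have [d' d'0 Hd'] := cdiff_cont (dwP D0) (e := m / 2) ltac:(by rewrite divr_gt0).
pose dd := Num.min (Num.min d d') r.
have dd0 : 0 < dd by rewrite !lt_min d0 d'0.
have [zeta [zd zz0 dz]] : exists zeta, [/\ nm (zeta - z0) < dd, zeta != z0 & dw zeta != 0].
  (* If w' vanished at all points near z0, w would be constant on the segment from z0 to z0 + h,
     against injectivity. *)
  apply/not_existsP => Hn.
  pose h : C := cst_of (dd / 2).
  have hE : nm h = dd / 2 by rewrite nm_cst gtr0_norm // divr_gt0.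
  have seg s : 0 <= s <= 1 -> nm (z0 + cst_of s * h - z0) < dd.
    move=> /andP[s0 s1]; rewrite addrAC subrr add0r nmM nm_cst ger0_norm // hE.
    apply: (@le_lt_trans _ _ (1 * (dd / 2))); last lra.
    by rewrite ler_wpM2r // divr_ge0 // ltW.
  have segD s : 0 <= s <= 1 -> D (z0 + cst_of s * h).
    move=> /seg h1; apply: Hr1; apply: lt_le_trans h1 _; rewrite /dd ge_min; apply/orP; right; rewrite /r; lra.
  have dw0s s : 0 <= s <= 1 -> dw (z0 + cst_of s * h) = 0.
    move=> s01; have [->|ne] := eqVneq (z0 + cst_of s * h) z0; first exact: dw0.
    apply/eqP/negPn/negP => nz; apply: (Hn (z0 + cst_of s * h)); split => //; exact: seg.
  have der s : 0 <= s <= 1 -> dC (fun s => w (z0 + cst_of s * h)) s 0.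
    move=> s01; apply: (dC_eq (cdiff_dC_line (dwP (segD s s01)))).
    by rewrite dw0s // mul0r.
  have := @dC_zero_cst _ (fun s => w (z0 + cst_of s * h)) 0 1 ler01.
  rewrite cst0 cst1 mul0r mul1r addr0 => E.
  have : w (z0 + h) = w z0.
    apply: E; first by move=> x /andP[x0 x1]; apply: der; rewrite !ltW.
    by apply: continuous_in_subspaceT => x; rewrite inE /= in_itv /= => /der; exact: dC_cvg.
  have h1 : (0 <= 1 :> R) && (1 <= 1 :> R) by rewrite ler01 lexx.
  have D1 := segD 1 h1; rewrite cst1 mul1r in D1.
  move=> /(winj D1 D0) /eqP; rewrite -subr_eq0 addrAC subrr add0r -nm_eq0 hE => /eqP h0.
  have : 0 < dd / 2 by rewrite divr_gt0.
  by rewrite h0 ltxx.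
have zd' : nm (zeta - z0) < r by apply: lt_le_trans zd _; rewrite /dd ge_min lexx orbT.
have zd1 : nm (zeta - z0) < d by apply: lt_le_trans zd _; rewrite /dd !ge_min lexx.
have zd2 : nm (zeta - z0) < d' by apply: lt_le_trans zd _; rewrite /dd !ge_min lexx orbT.
have Dz : D zeta by apply: Ds; exact: ltW.
have n0 : 0 < nm (zeta - z0) by rewrite nm_gt0 subr_eq0.
have wz : nm (w zeta - w z0) <= (2 * B)^-1 * nm (zeta - z0).
  by have := Hd _ zd1; rewrite dw0 mul0r subr0.
have wzm : nm (w zeta - w z0) < m / 2 by exact: Hd' zd2.
have winj' z : D z -> z != zeta -> w z - w zeta != 0.
  by move=> Dz' ne; rewrite subr_eq0; apply/eqP => /(winj Dz' Dz) E; move: ne; rewrite E eqxx.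
pose F z := if z == zeta then (dw zeta)^-1 else (z - zeta) / (w z - w zeta).
have dF z : D z -> z != zeta -> exists l, cdiff F z l.
  move=> Dz' ne.
  have di : cdiff (fun y => (w y - w zeta)^-1) z (- ((w z - w zeta)^-1 ^+ 2) * (dw z + - 0)).
    apply: (@cdiff_comp (fun y => w y - w zeta) (fun y => y^-1)); last exact: cdiff_inv (winj' _ Dz' ne).
    by have := cdiffD (dwP Dz') (@cdiff_cst (- w zeta) z); rewrite oppr0.
  have d1 := cdiffD (@cdiff_id z) (@cdiff_cst (- zeta) z).
  have nn : 0 < nm (z - zeta) by rewrite nm_gt0 subr_eq0.
  eexists; apply: (cdiff_near nn _ (cdiffM d1 di)) => y hy.
  rewrite /F; case: eqP => // E; by move: hy; rewrite E nmBC ltxx.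
have cF : ccont F zeta.
  move=> e e0; have ni : 0 < nm (dw zeta) by rewrite nm_gt0.
  have [d1 d10 H1] := cdiff_cont (cdiff_inv dz) e0.
  have [d2 d20 H2] := dwP Dz (e := d1 / 2) ltac:(by rewrite divr_gt0).
  have [r2 r20 Hr2] := oD Dz.
  exists (Num.min d2 r2); first by rewrite lt_min d20.
  move=> y; rewrite lt_min => /andP[hy yr]; rewrite /F eqxx; case: eqP => [_|/eqP ne].
    by rewrite subrr nm0.
  have nyz : 0 < nm (y - zeta) by rewrite nm_gt0 subr_eq0.
  have -> : (y - zeta) / (w y - w zeta) = ((w y - w zeta) / (y - zeta))^-1 by rewrite invf_div.
  apply: H1; have yz : y - zeta != 0 by rewrite subr_eq0.
  have -> : (w y - w zeta) / (y - zeta) - dw zeta = (w y - w zeta - dw zeta * (y - zeta)) / (y - zeta).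
    by field.
  rewrite nmM nmV ltr_pdivrMr //; apply: le_lt_trans (H2 _ hy) _; rewrite ltr_pM2r //; lra.
have DB y : nm (y - z0) < 3 * r -> D y by move=> hy; apply: Hr1; apply: lt_trans hy _; rewrite /r; lra.
have dFn n z : D z -> exists l, cdiff (fun z => (z - zeta) * F z ^+ n) z l.
  move=> Dz'; have d1 : cdiff (fun z => z - zeta) z 1.
    by have := cdiffD (@cdiff_id z) (@cdiff_cst (- zeta) z); rewrite addr0.
  have [->|ne] := eqVneq z zeta.
    exists (F zeta ^+ n) => e e0.
    have cFn : ccont (fun z => F z ^+ n) zeta.
      elim: n => [|n IH]; first by move=> e1 e10; exists 1 => // y _; rewrite !expr0 subrr nm0.
      rewrite (_ : (fun z => F z ^+ n.+1) = (fun z => F z * F z ^+ n)); last by apply/funext => ?; rewrite exprS.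
      exact: ccontM.
    have [d3 d30 H3] := cFn e e0; exists d3 => // y hy.
    rewrite subrr mul0r subr0 [F zeta ^+ n * _]mulrC -mulrBr nmM mulrC ler_wpM2r ?nm_ge0 // ltW //; exact: H3.
  have [l dl] : exists l, cdiff (fun z => F z ^+ n) z l.
    elim: n => [|n [l IH]].
      by exists 0; rewrite (_ : (fun z => F z ^+ 0) = (fun=> 1)) //; exact: cdiff_cst.
    have [k dk] := dF z Dz' ne; eexists.
    rewrite (_ : (fun z => F z ^+ n.+1) = (fun z => F z * F z ^+ n)); last by apply/funext => ?; rewrite exprS.
    exact: cdiffM dk IH.
  by eexists; exact: cdiffM d1 dl.
have FB y : nm (F (circ z0 r y)) <= B.
  have ny := circ_nm z0 y (ltW r0).
  have ne : circ z0 r y != zeta by apply/eqP => E; move: zd'; rewrite -E ny ltxx.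
  rewrite /F (negbTE ne) nmM nmV.
  have h1 : m / 2 <= nm (w (circ z0 r y) - w zeta).
    have := nm_tri (w zeta) (w (circ z0 r y)) (w z0); have := Hm y; lra.
  have h2 : nm (circ z0 r y - zeta) <= 2 * r.
    have := nm_tri z0 (circ z0 r y) zeta; rewrite ny [nm (z0 - _)]nmBC; lra.
  have m2 : 0 < m / 2 by rewrite divr_gt0.
  rewrite ler_pdivrMr; last exact: lt_le_trans h1.
  apply: le_trans h2 _; apply: (@le_trans _ _ (B * (m / 2))).
    by rewrite /B le_eqVlt; apply/orP; left; apply/eqP; field; rewrite gt_eqF.
  by rewrite ler_wpM2l // ltW.
have r3 : r < 3 * r by lra.
(* The mean value bound for (z - zeta) F^n reads |z0 - zeta| |F(z0)|^n <= 2 r B^n for every n; the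
   factors independent of n disappear in the limit. *)
have Fz0 : nm (F z0) <= B.
  apply: (@pow_limit _ _ (nm (z0 - zeta)) (2 * r)) => //; first by rewrite nmBC.
  move=> n; rewrite -nmX -nmM.
  apply: (@mean_value_le (fun z => (z - zeta) * F z ^+ n) z0 r (3 * r)) => //.
  - by move=> z /andP[_ /DB Dz']; exact: dFn.
  - by have [l dl] := dFn n z0 D0; exact: cdiff_cont dl.
  - move=> y; rewrite nmM nmX; apply: ler_pM; rewrite ?nm_ge0 ?exprn_ge0 ?nm_ge0 //.
      have := nm_tri z0 (circ z0 r y) zeta; rewrite (circ_nm z0 y (ltW r0)) [nm (z0 - _)]nmBC; lra.
    by rewrite lerXn2r ?nnegrE ?nm_ge0 // ltW.
have z0z : z0 != zeta by rewrite eq_sym.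
move: Fz0; rewrite /F (negbTE z0z) nmM nmV nmBC [nm (w z0 - _)]nmBC.
have wn : 0 < nm (w zeta - w z0) by rewrite nmBC nm_gt0 winj'.
rewrite ler_pdivrMr // => h.
have : B * nm (w zeta - w z0) <= B * ((2 * B)^-1 * nm (zeta - z0)) by rewrite ler_wpM2l // ltW.
have -> : B * ((2 * B)^-1 * nm (zeta - z0)) = nm (zeta - z0) / 2 by field; rewrite gt_eqF.
move=> h2; suff : 0 < 0 :> R by rewrite ltxx.
lra.
Qed.

End Injective.
End ComplexDerivative.

(** * Picard iteration *)

Section Picard.
Variable R : realType.
Local Notation C := (Cplx R).

Implicit Types (f g : R -> C) (p dp : R -> R) (a b t s K : R) (n m : nat).

(** The primitive from 0, extended by 0 to negative times: it is continuous on the whole line, so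
    Picard iterates compose without subspace topologies. *)
Definition ppos (f : R -> C) (t : R) : C := primC 0 f (Num.max t 0).

Lemma dC_near_eq f g t (l : C) : (\near t, f t = g t) -> dC f t l -> dC g t l.
Proof.
move=> H [d1 d2]; split.
  by apply: near_eq_is_derive d1; apply: filterS H => s ->.
by apply: near_eq_is_derive d2; apply: filterS H => s ->.
Qed.

Lemma ppos0 f : ppos f 0 = 0. Proof. by rewrite /ppos maxxx primC0. Qed.

Lemma ppos_neg f t : t <= 0 -> ppos f t = 0.
Proof. by move=> t0; rewrite /ppos max_r // primC0. Qed.

Lemma ppos_derive f (t : R) : continuous f -> 0 < t -> dC (ppos f) t (f t).
Proof.
move=> cf t0; have d : dC (primC 0 f) t (f t).
  by apply: primC_derive => //; rewrite sub0r (lt_trans _ t0) // oppr_lt0.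
have near_eq : \near t, primC 0 f t = ppos f t.
  near=> s; rewrite /ppos max_l // ltW //; near: s; exact: lt_nbhsr.
exact: dC_near_eq near_eq d.
Unshelve. all: by end_near. Qed.

Lemma ppos_continuous f : continuous f -> continuous (ppos f).
Proof.
move=> cf.
have cm : continuous (fun t : R => Num.max t 0).
  by move=> t; apply: (@continuous_max _ _ (fun t : R => t) (fun _ => 0)); [exact: cvg_id|exact: cst_continuous].
move=> t; apply: (cvg_comp _ (primC 0 f) (cm t)).
have d : dC (primC 0 f) (Num.max t 0) (f (Num.max t 0)).
  by apply: primC_derive => //; rewrite sub0r lt_max [-1 < 0]oppr_lt0 ltr01 orbT.
exact: dC_cvg d.
Qed.

#[local] Opaque ppos.

Lemma ppos_diff_le f g p dp b : continuous f -> continuous g -> 0 <= b ->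
  (forall x, 0 < x < b -> is_derive x 1 p (dp x)) -> {within `[0, b], continuous p} ->
  (forall x, 0 < x < b -> nm (f x - g x) <= dp x) ->
  nm (ppos f b - ppos g b) <= p b - p 0.
Proof.
move=> cf cg b0 dP cp H.
rewrite -[X in nm X]subr0 -[X in _ - X](subrr (0 : C)) -{1}(ppos0 f) -{1}(ppos0 g).
have h1 x : 0 < x < b -> dC (fun t => ppos f t - ppos g t) x (f x - g x).
  by move=> /andP[x0 _]; apply: dCB; exact: ppos_derive.
have h2 : {within `[0, b], continuous (fun t => ppos f t - ppos g t)}.
  by move=> x; apply: cvgB; apply: continuous_subspaceT; exact: ppos_continuous.
exact: (mvt_nm b0 h1 h2 dP cp H).
Qed.

Lemma ppos_diff_le_cst f g K b : continuous f -> continuous g -> 0 <= b ->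
  (forall x, 0 < x < b -> nm (f x - g x) <= K) -> nm (ppos f b - ppos g b) <= K * b.
Proof.
move=> cf cg b0 H; rewrite -[K * b]subr0 -(mulr0 K).
apply: (@ppos_diff_le f g (fun x => K * x) (fun _ => K)) => //.
- move=> x _; have := is_deriveM' (is_derive_cst K x 1) (is_derive_id x 1).
  by move/is_derive_eq; apply; rewrite mul0r add0r mulr1.
- by apply: within_cont => x; apply: cvgM; [exact: cvg_cst|exact: cvg_id].
Qed.

Lemma ppos_cst0 b : ppos (fun _ => 0) b = 0.
Proof.
have [b0|b0] := leP 0 b; last by rewrite ppos_neg // ltW.
apply/eqP; rewrite -nm_eq0 eq_le nm_ge0 andbT.
have := @dC_zero_cst _ (ppos (fun _ => 0)) 0 b b0.
rewrite ppos0 => ->; rewrite ?nm0 //.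
- by move=> x /andP[x0 _]; apply: ppos_derive => //; exact: cst_continuous.
- by apply: within_cont; apply: ppos_continuous; exact: cst_continuous.
Qed.

Lemma ppos_le_cst f K b : continuous f -> 0 <= b ->
  (forall x, 0 < x < b -> nm (f x) <= K) -> nm (ppos f b) <= K * b.
Proof.
move=> cf b0 H; rewrite -[ppos f b]subr0 -(ppos_cst0 b).
apply: ppos_diff_le_cst; [exact: cf|exact: cst_continuous|exact: b0|].
by move=> x /H; rewrite subr0.
Qed.

(** The sequence x n - 2 K / 2^n increases and x n + 2 K / 2^n decreases; the supremum of the first
    is the limit and comes with the rate. *)
Lemma geo_limit_real (x : nat -> R) K : (forall n, `|x n.+1 - x n| <= K / 2 ^+ n) ->
  exists l, forall n, `|x n - l| <= 2 * K / 2 ^+ n.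
Proof.
move=> H.
pose A := [set x n - 2 * K / 2 ^+ n | n in [set: nat]].
have p2 n : 0 < 2 ^+ n :> R by rewrite exprn_gt0.
have S n : 2 * K / 2 ^+ n = 2 * K / 2 ^+ n.+1 + K / 2 ^+ n.
  by rewrite exprS; field; rewrite expf_neq0.
have K0 n : 0 <= K / 2 ^+ n by apply: le_trans (H n).
have up m n : x (m + n)%N <= x m + 2 * K / 2 ^+ m - 2 * K / 2 ^+ (m + n) /\
              x m - 2 * K / 2 ^+ m + 2 * K / 2 ^+ (m + n) <= x (m + n)%N.
  elim: n => [|n [I1 I2]]; first by rewrite addn0; split; lra.
  rewrite addnS; have := H (m + n)%N; rewrite ler_norml => /andP[h1 h2].
  have := S (m + n)%N; move: (2 * K / 2 ^+ (m + n).+1) I1 I2 => Y I1 I2 Sn; split; lra.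
have K2 n : 0 <= 2 * K / 2 ^+ n by rewrite -mulrA mulr_ge0.
have ub m n : x n - 2 * K / 2 ^+ n <= x m + 2 * K / 2 ^+ m.
  have [mn|nm_] := leqP m n.
    have [h _] := up m (n - m)%N; rewrite subnKC // in h; have := K2 n; lra.
  have [_ h] := up n (m - n)%N; rewrite subnKC 1?ltnW // in h; have := K2 m; lra.
exists (sup A) => n; rewrite ler_distl; apply/andP; split.
  rewrite lerBlDr; apply: ge_sup; first by exists (x 0%N - 2 * K / 2 ^+ 0), 0%N.
  by move=> _ [m _ <-]; exact: ub.
rewrite -lerBlDr; apply: ub_le_sup; last by exists n.
by exists (x 0%N + 2 * K / 2 ^+ 0) => _ [m _ <-]; exact: ub.
Qed.

Lemma geo_limit (x : nat -> C) K : (forall n, nm (x n.+1 - x n) <= K / 2 ^+ n) ->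
  exists l, forall n, nm (x n - l) <= 4 * K / 2 ^+ n.
Proof.
move=> H.
have [n|lr hr] := @geo_limit_real (fun n => Re (x n)) K; first by rewrite -cReB (le_trans (Re_le_nm _)).
have [n|li hi] := @geo_limit_real (fun n => Im (x n)) K; first by rewrite -cImB (le_trans (Im_le_nm _)).
exists (lr +i* li)%C => n; apply: le_trans (nm_le_ReIm _) _.
rewrite cReB cImB /=; have := hr n; have := hi n.
have -> : 4 * K / 2 ^+ n = 2 * K / 2 ^+ n + 2 * K / 2 ^+ n by lra.
by move=> h1 h2; exact: lerD.
Qed.

Lemma small_geo K e : 0 < e -> exists n, K / 2 ^+ n < e.
Proof.
move=> e0; have [n hn] := archi_nat (K / e).
exists n; rewrite ltr_pdivrMr ?exprn_gt0 // mulrC -ltr_pdivrMr //.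
by apply: lt_trans hn _; rewrite -natrX ltr_nat ltn_expl.
Qed.

Lemma geo_mono K n m : 0 <= K -> (n <= m)%N -> K / 2 ^+ m <= K / 2 ^+ n.
Proof.
move=> K0 nm_; rewrite ler_wpM2l // lef_pV2 ?posrE ?exprn_gt0 //.
by rewrite -!natrX ler_nat leq_exp2l.
Qed.

Section Solution.
Variables (V : R -> C -> C) (L : R).
Hypothesis L0 : 0 < L.
Hypothesis VL : forall t x y, nm (V t x - V t y) <= L * nm (x - y).
Hypothesis Vc : forall u : R -> C, continuous u -> continuous (fun t => V t (u t)).
Variable z : C.

Fixpoint pic (n : nat) : R -> C :=
  if n is m.+1 then fun t => z + ppos (fun s => V s (pic m s)) t else fun _ => z.

Lemma pic_continuous n : continuous (pic n).
Proof.
elim: n => [|n IH] /=; first exact: cst_continuous.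
apply: continuousCD; first exact: cst_continuous.
by apply: ppos_continuous; exact: Vc.
Qed.

(** In the norm weighted by exp(-2 L t) the Picard map contracts by the factor 1/2 on any interval,
    so no restriction to short times is needed: L exp(2 L s) integrates to at most half of exp(2 L
    t). *)
Lemma pic_step T : 0 <= T -> exists2 K, 0 <= K & forall n t, 0 <= t <= T ->
  nm (pic n.+1 t - pic n t) <= K * expR (2 * L * t) / 2 ^+ n.
Proof.
move=> T0.
have cV : continuous (fun t => nm (V t z)).
  apply: (@continuous_comp' _ _ _ (fun t => V t z) nm); last exact: continuous_nm.
  by apply: (@Vc (fun _ => z)); exact: cst_continuous.
have [c cT Hc] := EVT_max T0 (continuous_subspaceT cV).
pose K := nm (V c z) * T; have K0 : 0 <= K by rewrite mulr_ge0 ?nm_ge0.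
exists K => // n; elim: n => [|n IH] t /andP[t0 tT].
  rewrite /= addrAC subrr add0r expr0 divr1.
  apply: (@le_trans _ _ (nm (V c z) * t)).
    apply: ppos_le_cst => //; first by apply: (@Vc (fun _ => z)); exact: cst_continuous.
    by move=> x /andP[x0 xt]; apply: Hc; rewrite in_itv /= (ltW x0) (le_trans (ltW xt)).
  rewrite /K -[leLHS]mulr1; apply: ler_pM => //; rewrite ?mulr_ge0 ?nm_ge0 //.
    by rewrite ler_wpM2l ?nm_ge0.
  by rewrite -expR0 ler_expR !mulr_ge0 // ltW.
have -> : pic n.+2 t - pic n.+1 t = ppos (fun s => V s (pic n.+1 s)) t - ppos (fun s => V s (pic n s)) t.
  by rewrite /=; ring.
pose p s := K / 2 ^+ n.+1 * expR (2 * L * s).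
apply: (@le_trans _ _ (p t - p 0)); last first.
  rewrite /p lerBlDr [leRHS](_ : _ = K / 2 ^+ n.+1 * expR (2 * L * t) + p 0); last by rewrite /p; ring.
  by rewrite lerDl /p mulr_ge0 ?expR_ge0 // divr_ge0 ?exprn_ge0.
have dp (x : R) : is_derive x 1 p (K / 2 ^+ n.+1 * (expR (2 * L * x) * (2 * L))).
  have h : is_derive x 1 (fun s => 2 * L * s) (2 * L).
    have := is_deriveM' (is_derive_cst (2 * L) x 1) (is_derive_id x 1).
    by move/is_derive_eq; apply; rewrite mul0r add0r mulr1.
  have := is_deriveM' (is_derive_cst (K / 2 ^+ n.+1) x 1) (is_derive_comp' (is_derive_expR _) h).
  by move/is_derive_eq; apply; rewrite mul0r add0r.
apply: (@ppos_diff_le _ _ p (fun x => K / 2 ^+ n.+1 * (expR (2 * L * x) * (2 * L)))) => //.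
- by apply: Vc; exact: pic_continuous.
- by apply: Vc; exact: pic_continuous.
- by apply: within_cont => x; exact: is_derive_cvg (dp x).
- move=> x /andP[x0 xt]; apply: le_trans (VL _ _ _) _.
  have -> : K / 2 ^+ n.+1 * (expR (2 * L * x) * (2 * L)) = L * (K * expR (2 * L * x) / 2 ^+ n).
    by rewrite exprS; field; rewrite expf_neq0.
  by rewrite ler_wpM2l ?(ltW L0) // IH // (ltW x0) (le_trans (ltW xt)).
Qed.

Definition psol (t : R) : C := xget 0 [set l | forall e, 0 < e -> exists N : nat, forall n, (N <= n)%N -> nm (pic n t - l) < e].

Lemma psol_unif T : 0 <= T -> exists2 K, 0 <= K & forall n t, t <= T -> nm (pic n t - psol t) <= K / 2 ^+ n.
Proof.
move=> T0; have [K K0 HK] := pic_step T0.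
pose K' := K * expR (2 * L * T); have K'0 : 0 <= K' by rewrite mulr_ge0 ?expR_ge0.
have st n t : t <= T -> nm (pic n.+1 t - pic n t) <= K' / 2 ^+ n.
  move=> tT; have [t0|t0] := leP 0 t; last first.
    have E m : pic m t = z by case: m => //= m; rewrite ppos_neg ?addr0 // ltW.
    by rewrite !E subrr nm0 divr_ge0 ?exprn_ge0.
  apply: le_trans (HK n t _) _; first by rewrite t0.
  rewrite ler_wpM2r ?invr_ge0 ?exprn_ge0 // ler_wpM2l // ler_expR ler_wpM2l //.
  by rewrite mulr_ge0 // ltW.
exists (4 * K'); first by rewrite mulr_ge0.
move=> n t tT; have [l Hl] := geo_limit (fun n => st n t tT).
have K4 : 0 <= 4 * K' by rewrite mulr_ge0.
have Pl : forall e, 0 < e -> exists N : nat, forall n, (N <= n)%N -> nm (pic n t - l) < e.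
  move=> e e0; have [N HN] := small_geo (4 * K') e0.
  exists N => m Nm; apply: le_lt_trans (Hl m) _; apply: le_lt_trans HN.
  exact: geo_mono.
have : forall e, 0 < e -> exists N : nat, forall n, (N <= n)%N -> nm (pic n t - psol t) < e.
  exact: (@xgetPex _ 0 [set l | forall e, 0 < e -> exists N : nat, forall n, (N <= n)%N -> nm (pic n t - l) < e] (ex_intro _ l Pl)).
move=> Ps; suff -> : psol t = l by exact: Hl.
apply/eqP; rewrite -subr_eq0 -nm_eq0 eq_le nm_ge0 andbT.
apply/ler_addgt0Pr => e e0; rewrite add0r.
have [N1 h1] := Ps _ (ltac:(by rewrite divr_gt0) : 0 < e / 2).
have [N2 h2] := Pl _ (ltac:(by rewrite divr_gt0) : 0 < e / 2).
have := h1 (maxn N1 N2) (leq_maxl _ _); have := h2 (maxn N1 N2) (leq_maxr _ _).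
rewrite [nm (pic _ t - psol t)]nmBC => a b; apply: le_trans (nm_tri (pic (maxn N1 N2) t) _ _) _; lra.
Qed.

Lemma psol_continuous : continuous psol.
Proof.
move=> t; apply/cvgCP => e e0.
have T0 : 0 <= Num.max t 0 + 1 by rewrite addr_ge0 // le_max lexx orbT.
have [K K0 HK] := psol_unif T0.
have [n hn] := small_geo K (ltac:(by rewrite divr_gt0) : 0 < e / 3).
have tT : t < Num.max t 0 + 1.
  by apply: (@le_lt_trans _ _ (Num.max t 0)); rewrite ?le_max ?lexx // ltrDl.
have /cvgCP/(_ (e / 3) (ltac:(by rewrite divr_gt0))) H := @pic_continuous n t.
near=> s.
have sT : s <= Num.max t 0 + 1 by apply: ltW; near: s; exact: lt_nbhsl.
have h : nm (pic n s - pic n t) < e / 3 by near: s; exact: H.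
have := HK n s sT; have := HK n t (ltW tT) => a b.
apply: le_lt_trans (nm_tri (pic n t) _ _) _.
apply: le_lt_trans (lerD (nm_tri (pic n s) _ _) (lexx _)) _.
move: b; rewrite nmBC => b; lra.
Unshelve. all: by end_near. Qed.

Lemma psolE t : 0 <= t -> psol t = z + ppos (fun s => V s (psol s)) t.
Proof.
move=> t0; apply/eqP; rewrite -subr_eq0 -nm_eq0 eq_le nm_ge0 andbT.
have [K K0 HK] := psol_unif t0.
apply/ler_addgt0Pr => e e0; rewrite add0r.
have [n hn] := small_geo ((1 + L * t) * K) e0.
apply: le_trans (ltW hn).
have h1 := HK n.+1 t (lexx _).
have h2 : nm (pic n.+1 t - (z + ppos (fun s => V s (psol s)) t)) <= L * (K / 2 ^+ n) * t.
  have -> : pic n.+1 t - (z + ppos (fun s => V s (psol s)) t) =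
    ppos (fun s => V s (pic n s)) t - ppos (fun s => V s (psol s)) t by rewrite /=; ring.
  apply: ppos_diff_le_cst => //; [by apply: Vc; exact: pic_continuous|by apply: Vc; exact: psol_continuous|].
  move=> x /andP[_ xt]; apply: le_trans (VL _ _ _) _.
  by rewrite ler_wpM2l ?(ltW L0) // HK // ltW.
apply: le_trans (nm_tri (pic n.+1 t) _ _) _; rewrite [nm (psol t - _)]nmBC.
have h3 : K / 2 ^+ n.+1 <= K / 2 ^+ n by exact: geo_mono.
have -> : (1 + L * t) * K / 2 ^+ n = K / 2 ^+ n + L * (K / 2 ^+ n) * t by field; rewrite expf_neq0.
by apply: lerD => //; exact: le_trans h3.
Qed.

Lemma psol0 : psol 0 = z. Proof. by rewrite psolE // ppos0 addr0. Qed.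

Lemma psol_derive t : 0 < t -> dC psol t (V t (psol t)).
Proof.
move=> t0.
have d : dC (fun t => z + ppos (fun s => V s (psol s)) t) t (0 + V t (psol t)).
  apply: dCD; first exact: dC_cst.
  by apply: ppos_derive => //; apply: Vc; exact: psol_continuous.
rewrite add0r in d.
have near_eq : \near t, z + ppos (fun s => V s (psol s)) t = psol t.
  near=> s; rewrite -psolE // ltW //; near: s; exact: lt_nbhsr.
exact: dC_near_eq near_eq d.
Unshelve. all: by end_near. Qed.

End Solution.
End Picard.

(** * The regularised Loewner flow *)

Section Regularised.
Variable R : realType.
Local Notation C := (Cplx R).
Implicit Types (z u : C) (t s e T : R) (f g : R -> C).

Lemma ppos_uniq f F t : continuous f -> continuous F -> 0 <= t ->
  (forall s, 0 < s < t -> dC F s (f s)) -> F t = F 0 + ppos f t.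
Proof.
move=> cf cF t0 H.
have h1 s : 0 < s < t -> dC (fun s => F s - ppos f s) s 0.
  move=> /andP[s0 st]; apply: (dC_eq (dCB (H s _) (ppos_derive cf s0))); first by rewrite s0.
  by rewrite subrr.
have h2 : {within `[0, t], continuous (fun s => F s - ppos f s)}.
  by move=> x; apply: cvgB; apply: continuous_subspaceT; [exact: cF|exact: ppos_continuous].
by have := dC_zero_cst t0 h1 h2; rewrite ppos0 subr0 => <-; rewrite subrK.
Qed.

Lemma ppos_conj f t : continuous f -> 0 <= t -> (ppos f t)^* = ppos (fun s => (f s)^*) t.
Proof.
move=> cf t0.
have cc : continuous (fun s => (f s)^*).
  by apply: (@continuous_comp' _ _ _ f (fun z : C => z^*)) => //; exact: continuous_conj.
have cp : continuous (fun s => (ppos f s)^*).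
  apply: (@continuous_comp' _ _ _ (ppos f) (fun z : C => z^*)); first exact: ppos_continuous.
  exact: continuous_conj.
rewrite (@ppos_uniq _ (fun s => (ppos f s)^*) t cc cp t0) ?ppos0 ?conjC0 ?add0r // => s /andP[s0 _].
exact: dC_conj (ppos_derive cf s0).
Qed.

(** Q times exp of minus the integral of k has zero derivative. This is how logarithms of the
    observable's bases arise as time integrals. *)
Lemma linear_ode (Q k : R -> C) t : continuous Q -> continuous k -> 0 <= t ->
  (forall s, 0 < s < t -> dC Q s (Q s * k s)) -> Q t = Q 0 * expC (ppos k t).
Proof.
move=> cQ ck t0 H.
have h1 s : 0 < s < t -> dC (fun s => Q s * expC (- ppos k s)) s 0.
  move=> /andP[s0 st]; apply: (dC_eq (dCM (H s _) (dC_exp (dCN (ppos_derive ck s0))))); first by rewrite s0.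
  by ring.
have h2 : {within `[0, t], continuous (fun s => Q s * expC (- ppos k s))}.
  apply: within_cont; apply: continuousCM; first exact: cQ.
  apply: (@continuous_comp' _ _ _ (fun s => - ppos k s) expC); last exact: continuous_expC.
  by move=> s; apply: cvgN; exact: ppos_continuous.
have := dC_zero_cst t0 h1 h2; rewrite ppos0 oppr0 expC0 mulr1 => <-.
by rewrite -mulrA -expCD addNr expC0 mulr1.
Qed.

(* 1/(1 - w), made globally Lipschitz by a modification in |1 - w| < e. *)
Definition Rg (e : R) (w : C) : C := (1 - w)^* / cst_of (Num.max (nm (1 - w) ^+ 2) (e ^+ 2)).

Lemma Rg_max_gt0 e w : 0 < e -> 0 < Num.max (nm (1 - w) ^+ 2) (e ^+ 2).
Proof. by move=> e0; rewrite lt_max; apply/orP; right; exact: exprn_gt0. Qed.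

Lemma RgE e w : 0 < e -> e <= nm (1 - w) -> Rg e w = (1 - w)^-1.
Proof.
move=> e0 ew; rewrite /Rg max_l; last by rewrite lerXn2r ?nnegrE ?nm_ge0 // ltW.
have n0 : 1 - w != 0 by rewrite -nm_gt0 (lt_le_trans e0).
have n1 : (1 - w)^* != 0 by rewrite -nm_gt0 nm_conj nm_gt0.
move: (1 - w) n0 n1 => v n0 n1.
by rewrite -conjM_nm; field; rewrite ?n0 ?n1.
Qed.

Lemma Rg_bound e w : 0 < e -> nm (Rg e w) <= e^-1.
Proof.
move=> e0; rewrite nmM nm_conj nmV nm_cst gtr0_norm ?Rg_max_gt0 //.
rewrite ler_pdivrMr ?Rg_max_gt0 // mulrC ler_pdivlMr //.
have [h|h] := leP e (nm (1 - w)).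
  apply: (@le_trans _ _ (nm (1 - w) ^+ 2)); last by rewrite le_max lexx.
  by rewrite expr2 ler_wpM2l ?nm_ge0.
apply: (@le_trans _ _ (e ^+ 2)); last by rewrite le_max lexx orbT.
by rewrite expr2 ler_wpM2r // ltW.
Qed.

Lemma Rg_lip e x y : 0 < e -> nm (Rg e x - Rg e y) <= 3 / e ^+ 2 * nm (x - y).
Proof.
move=> e0.
wlog xy : x y / nm (1 - y) <= nm (1 - x).
  move=> H; have [|h] := leP (nm (1 - y)) (nm (1 - x)); first exact: H.
  by rewrite nmBC [nm (x - y)]nmBC; apply: H; exact: ltW.
have e2 : 0 < e ^+ 2 by rewrite exprn_gt0.
have nd : nm (1 - x - (1 - y)) = nm (x - y) by rewrite -nmN; congr nm; ring.
have dn : nm (1 - x) - nm (1 - y) <= nm (x - y) by rewrite -nd nmDB.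
have n := nm_ge0 (x - y).
have [hy|hy] := leP e (nm (1 - y)).
  have hx := le_trans hy xy; rewrite !RgE //.
  have x0 : 1 - x != 0 by rewrite -nm_gt0 (lt_le_trans e0).
  have y0 : 1 - y != 0 by rewrite -nm_gt0 (lt_le_trans e0).
  have -> : (1 - x)^-1 - (1 - y)^-1 = (x - y) / ((1 - x) * (1 - y)) by field; rewrite x0 y0.
  rewrite nmM nmV nmM mulrC ler_wpM2r //.
  apply: (@le_trans _ _ (e ^+ 2)^-1); last by rewrite ler_peMl ?invr_ge0 ?(ltW e2) //; lra.
  rewrite lef_pV2 ?posrE ?mulr_gt0 ?nm_gt0 // expr2; apply: ler_pM => //; exact: ltW.
have Ey : Rg e y = (1 - y)^* / cst_of (e ^+ 2).
  by rewrite /Rg max_r // lerXn2r ?nnegrE ?nm_ge0 // ltW.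
have [hx|hx] := leP e (nm (1 - x)); last first.
  rewrite Ey /Rg max_r; last by rewrite lerXn2r ?nnegrE ?nm_ge0 // ltW.
  rewrite -mulrBl -conjCB nmM nm_conj nmV nm_cst gtr0_norm // nd.
  by rewrite mulrC ler_wpM2r // ler_peMl ?invr_ge0 ?(ltW e2) //; lra.
have Ex : Rg e x = (1 - x)^* / cst_of (nm (1 - x) ^+ 2).
  by rewrite /Rg max_l // lerXn2r ?nnegrE ?nm_ge0 // ltW.
set X := nm (1 - x) in xy hx Ex dn; set Y := nm (1 - y) in xy hy dn.
have X0 : 0 < X by apply: lt_le_trans hx.
have X2 : 0 < X ^+ 2 by rewrite exprn_gt0.
(* In the mixed case Y < e <= X the change of numerator costs 1/e^2 and the change of denominator
   2/e^2, whence the constant 3. *)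
have -> : Rg e x - Rg e y = ((1 - x) - (1 - y))^* / cst_of (X ^+ 2)
    + (1 - y)^* * cst_of ((X ^+ 2)^-1 - (e ^+ 2)^-1).
  rewrite Ex Ey conjCB cstB !cstV; ring.
apply: le_trans (nmD _ _) _; rewrite !nmM !nm_conj nmV !nm_cst -/Y.
rewrite (gtr0_norm X2) nd.
have iX : (X ^+ 2)^-1 <= (e ^+ 2)^-1.
  by rewrite lef_pV2 ?posrE // lerXn2r ?nnegrE // ltW.
rewrite ler0_norm ?subr_le0 // opprB.
have Y0 : 0 <= Y by exact: nm_ge0.
have h1 : nm (x - y) / X ^+ 2 <= (e ^+ 2)^-1 * nm (x - y) by rewrite mulrC ler_wpM2r.
have h2 : Y * ((e ^+ 2)^-1 - (X ^+ 2)^-1) <= 2 * ((e ^+ 2)^-1 * nm (x - y)).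
  have -> : (e ^+ 2)^-1 - (X ^+ 2)^-1 = (X - e) * (X + e) / (X ^+ 2 * e ^+ 2).
    by field; rewrite !gt_eqF.
  have a1 : X - e <= nm (x - y) by apply: le_trans dn; rewrite lerB // ltW.
  have a2 : Y * (X + e) <= 2 * X ^+ 2.
    have : Y * (X + e) <= X * (X + X) by apply: ler_pM => //; rewrite ?addr_ge0 ?lerD // ltW.
    by move=> h; apply: le_trans h _; rewrite expr2; lra.
  have -> : Y * ((X - e) * (X + e) / (X ^+ 2 * e ^+ 2)) = ((Y * (X + e)) / (X ^+ 2 * e ^+ 2)) * (X - e).
    by field; rewrite !gt_eqF.
  rewrite mulrA; apply: ler_pM => //.
  - by rewrite divr_ge0 ?mulr_ge0 ?addr_ge0 // ltW.
  - by rewrite subr_ge0.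
  - rewrite ler_pdivrMr ?mulr_gt0 //; apply: le_trans a2 _.
    by rewrite le_eqVlt; apply/orP; left; apply/eqP; field; rewrite gt_eqF.
have -> : 3 / e ^+ 2 * nm (x - y) = (e ^+ 2)^-1 * nm (x - y) + 2 * ((e ^+ 2)^-1 * nm (x - y)) by ring.
exact: lerD.
Qed.

Lemma Rg_continuous e : 0 < e -> continuous (Rg e).
Proof.
move=> e0 w; apply/(@cvgCP _ _ _ (nbhs_filter w)) => d d0; apply/nbhsCP.
have K0 : 0 < 3 / e ^+ 2 by rewrite divr_gt0 // exprn_gt0.
exists (d / (3 / e ^+ 2)); first by rewrite divr_gt0.
move=> y; rewrite ltr_pdivlMr // mulrC => h; exact: le_lt_trans (Rg_lip _ _ e0) h.
Qed.

(** * The regularised flow for a given driving angle *)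

Section Driving.
Variable th : R -> R.
Hypothesis cth : continuous th.

Definition xi t : C := expC (iu * cst_of (th t)).
Lemma nm_xi t : nm (xi t) = 1. Proof. exact: nm_expC_iu. Qed.
Lemma xi_neq0 t : xi t != 0. Proof. exact: expC_neq0. Qed.
Lemma xi_conj t : xi t * (xi t)^* = 1.
Proof. by rewrite conjM_nm nm_xi expr1n. Qed.
Lemma xi_continuous : continuous xi.
Proof.
apply: (@continuous_comp' _ _ _ (fun s => iu * cst_of (th s) : C) expC); last exact: continuous_expC.
by apply: continuousCM; [exact: cst_continuous|exact: continuousCcst].
Qed.
Lemma xiV_continuous : continuous (fun t => (xi t)^-1).
Proof.
have -> : (fun t => (xi t)^-1) = (fun t => (xi t)^*).
  apply/funext => t; apply: (mulfI (xi_neq0 t)).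
  by rewrite xi_conj divff // xi_neq0.
apply: (@continuous_comp' _ _ _ xi (fun z : C => z^*)); first exact: xi_continuous.
exact: continuous_conj.
Qed.

(** With w = u / xi and r = 1/(1 - w), w r = r - 1 turns u (xi + u)/(xi - u) into 2 xi (r - 1) - u,
    an affine function of r and u; then r is replaced by [Rg e w]. *)
Definition fld e t u : C := 2 * xi t * (Rg e (u / xi t) - 1) - u.
Definition Lc e : R := 6 / e ^+ 2 + 1.
Lemma Lc_gt0 e : 0 < e -> 0 < Lc e.
Proof. by move=> e0; rewrite addr_gt0 // divr_gt0 // exprn_gt0. Qed.

Lemma nm2C : nm (2 : C) = 2.
Proof. by rewrite -(cst_nat R 2) nm_cst ger0_norm. Qed.

Lemma fld_lip e t x y : 0 < e -> nm (fld e t x - fld e t y) <= Lc e * nm (x - y).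
Proof.
move=> e0; have -> : fld e t x - fld e t y =
   2 * xi t * (Rg e (x / xi t) - Rg e (y / xi t)) - (x - y) by rewrite /fld; ring.
have -> : Lc e * nm (x - y) = 6 / e ^+ 2 * nm (x - y) + nm (x - y) by rewrite /Lc; ring.
apply: le_trans (nmB _ _) _; apply: lerD; last exact: lexx.
rewrite nmM nmM nm_xi nm2C mulr1.
have -> : 6 / e ^+ 2 * nm (x - y) = 2 * (3 / e ^+ 2 * nm (x / xi t - y / xi t)).
  by rewrite -mulrBl nmM nmV nm_xi; field; rewrite gt_eqF.
by rewrite ler_wpM2l // Rg_lip.
Qed.

Lemma fld_cont e (u : R -> C) : 0 < e -> continuous u -> continuous (fun t => fld e t (u t)).
Proof.
move=> e0 cu; apply: continuousCD; last by move=> t; apply: cvgN; exact: cu.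
apply: continuousCM; first by apply: continuousCM; [exact: cst_continuous|exact: xi_continuous].
apply: continuousCD; last exact: cst_continuous.
apply: (@continuous_comp' _ _ _ (fun t => u t / xi t) (Rg e)); last exact: Rg_continuous.
by apply: continuousCM; [exact: cu|exact: xiV_continuous].
Qed.

Definition Ue e z : R -> C := psol (fld e) z.
Definition We e z t : C := Ue e z t / xi t.
Definition re e z t : C := Rg e (We e z t).

Section Eps.
Variable e : R.
Hypothesis e0 : 0 < e.

Lemma Ue_continuous z : continuous (Ue e z).
Proof.
apply: (@psol_continuous _ _ (Lc e)); first exact: Lc_gt0.
  by move=> t x y; exact: fld_lip.
by move=> u; exact: fld_cont.
Qed.
Lemma We_continuous z : continuous (We e z).
Proof. by apply: continuousCM; [exact: Ue_continuous|exact: xiV_continuous]. Qed.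
Lemma re_continuous z : continuous (re e z).
Proof.
by apply: (@continuous_comp' _ _ _ (We e z) (Rg e)); [exact: We_continuous|exact: Rg_continuous].
Qed.
Lemma Ue0 z : Ue e z 0 = z.
Proof.
apply: (@psol0 _ _ (Lc e)); first exact: Lc_gt0.
  by move=> t x y; exact: fld_lip.
by move=> u; exact: fld_cont.
Qed.
Lemma Ue_derive z t : 0 < t -> dC (Ue e z) t (fld e t (Ue e z t)).
Proof.
move=> t0; apply: (@psol_derive _ _ (Lc e)); [exact: Lc_gt0| | |exact: t0].
  by move=> s x y; exact: fld_lip.
by move=> u; exact: fld_cont.
Qed.
Lemma nm_re z t : nm (re e z t) <= e^-1. Proof. exact: Rg_bound. Qed.

Lemma Ue_lip z z' t : 0 <= t -> nm (Ue e z t - Ue e z' t) <= nm (z - z') * expR (Lc e * t).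
Proof.
move=> t0.
have h1 s : 0 < s < t -> dC (fun s => Ue e z s - Ue e z' s) s (fld e s (Ue e z s) - fld e s (Ue e z' s)).
  by move=> /andP[s0 _]; apply: dCB; exact: Ue_derive.
have h2 : {within `[0, t], continuous (fun s => Ue e z s - Ue e z' s)}.
  by move=> x; apply: cvgB; apply: continuous_subspaceT; exact: Ue_continuous.
have := gronwall t0 h1 h2; rewrite !Ue0 subr0; apply.
by move=> s _; exact: fld_lip.
Qed.

Lemma We_lip z z' t : 0 <= t -> nm (We e z t - We e z' t) <= nm (z - z') * expR (Lc e * t).
Proof.
move=> t0; rewrite /We -mulrBl nmM nmV nm_xi invr1 mulr1; exact: Ue_lip.
Qed.

(** Up to t the regularisation is not felt. The strict inequality makes this an open condition in t
    and in z. *)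
Definition alive z t := forall s, 0 <= s <= t -> e < nm (1 - We e z s).

Lemma reE z t s : alive z t -> 0 <= s <= t -> re e z s = (1 - We e z s)^-1.
Proof. by move=> al /al /ltW; exact: RgE. Qed.

Lemma alive_neq1 z t s : alive z t -> 0 <= s <= t -> 1 - We e z s != 0.
Proof. by move=> al /al h; rewrite -nm_gt0 (lt_trans e0). Qed.

Lemma re_rel z t s : alive z t -> 0 <= s <= t -> We e z s * re e z s = re e z s - 1.
Proof.
move=> al st; rewrite (reE al st); have := alive_neq1 al st => n.
by field.
Qed.

Lemma Ue_dt z t s : alive z t -> 0 < s < t -> dC (Ue e z) s (Ue e z s * (2 * re e z s - 1)).
Proof.
move=> al /andP[s0 st]; apply: (dC_eq (Ue_derive z s0)).
have st' : 0 <= s <= t by rewrite !ltW.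
have rl := re_rel al st'; rewrite /fld -/(We e z s) -/(re e z s) -rl /We.
by field; exact: xi_neq0.
Qed.

(** The logarithmic derivatives in time of U_z - U_z' ([kA]) and of 1 - W_z conj(W_z') ([kB]). The
    diagonal of [kA] gives log g_t', the case z' = 0 gives log g_t, and the diagonal of [kB] gives
    log(1 - |w_t|^2). *)
Definition kA z z' s : C := 2 * re e z s * re e z' s - 1.
Definition kB z z' s : C := - 2 * (re e z s - 1) * (re e z' s - 1)^*.
Lemma kA_continuous z z' : continuous (kA z z').
Proof.
apply: continuousCD; last exact: cst_continuous.
apply: continuousCM; last exact: re_continuous.
by apply: continuousCM; [exact: cst_continuous|exact: re_continuous].
Qed.
Lemma kB_continuous z z' : continuous (kB z z').
Proof.
have c y : continuous (fun s => re e y s - 1).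
  by apply: continuousCD; [exact: re_continuous|exact: cst_continuous].
apply: continuousCM; first by apply: continuousCM; [exact: cst_continuous|exact: c].
by apply: (@continuous_comp' _ _ _ (fun s => re e z' s - 1) (fun z : C => z^*)) => //; exact: continuous_conj.
Qed.

Lemma Ue_diff z z' t : 0 <= t -> alive z t -> alive z' t ->
  Ue e z t - Ue e z' t = (z - z') * expC (ppos (kA z z') t).
Proof.
move=> t0 al al'.
rewrite (@linear_ode (fun s => Ue e z s - Ue e z' s) (kA z z') t) ?Ue0 //.
- by move=> s; apply: cvgB; exact: Ue_continuous.
- exact: kA_continuous.
move=> s st; apply: (dC_eq (dCB (Ue_dt al st) (Ue_dt al' st))).
have st' : 0 <= s <= t by move: st => /andP[? ?]; rewrite !ltW.
rewrite /kA (reE al st') (reE al' st').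
have -> : Ue e z s = We e z s * xi s by rewrite /We divfK ?xi_neq0.
have -> : Ue e z' s = We e z' s * xi s by rewrite /We divfK ?xi_neq0.
field; by rewrite (alive_neq1 al st') (alive_neq1 al' st').
Qed.

Lemma We_conjM z z' s : We e z s * (We e z' s)^* = Ue e z s * (Ue e z' s)^*.
Proof.
rewrite /We; have -> : (xi s)^-1 = (xi s)^*.
  by apply: (mulfI (xi_neq0 s)); rewrite xi_conj divff // xi_neq0.
rewrite conjCM conjCK'.
have -> : Ue e z s * (xi s)^* * ((Ue e z' s)^* * xi s) = Ue e z s * (Ue e z' s)^* * (xi s * (xi s)^*) by ring.
by rewrite xi_conj mulr1.
Qed.

Lemma Ue_refl z z' t : 0 <= t -> alive z t -> alive z' t ->
  1 - We e z t * (We e z' t)^* = (1 - z * z'^*) * expC (ppos (kB z z') t).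
Proof.
move=> t0 al al'; rewrite We_conjM.
have cj y : continuous (fun s => (Ue e y s)^*).
  by apply: (@continuous_comp' _ _ _ (Ue e y) (fun z : C => z^*)); [exact: Ue_continuous|exact: continuous_conj].
rewrite (@linear_ode (fun s => 1 - Ue e z s * (Ue e z' s)^*) (kB z z') t) ?Ue0 //.
- move=> s; apply: cvgB; first exact: cvg_cst.
  exact: (continuousCM (@Ue_continuous z) (cj z')).
- exact: kB_continuous.
move=> s st; apply: (dC_eq (dCB (dC_cst 1 s) (dCM (Ue_dt al st) (dC_conj (Ue_dt al' st))))).
have st' : 0 <= s <= t by move: st => /andP[? ?]; rewrite !ltW.
rewrite conjCM conjCB conjCM conjC1' conjC_nat'.
have -> : 0 - (Ue e z s * (2 * re e z s - 1) * (Ue e z' s)^* + Ue e z s * ((Ue e z' s)^* * (2 * (re e z' s)^* - 1)))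
  = - (2 * (re e z s + (re e z' s)^* - 1)) * (Ue e z s * (Ue e z' s)^*) by ring.
rewrite -We_conjM /kB conjCB conjC1' (reE al st') (reE al' st').
have a := alive_neq1 al st'; have a' := alive_neq1 al' st'.
have cV : ((1 - We e z' s)^-1)^* = (1 - (We e z' s)^*)^-1 by rewrite fmorphV rmorphB rmorph1.
rewrite cV; have b' : 1 - (We e z' s)^* != 0 by rewrite -conjC1' -conjCB conjC_eq0.
by field; rewrite a b'.
Qed.

(** On the diagonal [kB] is real, so the exponential in [Ue_refl] is a positive real number; in
    particular the disc is preserved. *)
Lemma nm_Ue_eq z t : 0 <= t -> alive z t ->
  1 - nm (We e z t) ^+ 2 = (1 - nm z ^+ 2) * expR (Re (ppos (kB z z) t)).
Proof.
move=> t0 al.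
have kr s : (kB z z s)^* = kB z z s.
  by rewrite /kB !conjCM conjCN conjC_nat' conjCK'; ring.
have pr : (ppos (kB z z) t)^* = ppos (kB z z) t.
  rewrite ppos_conj //; last exact: kB_continuous.
  by congr (ppos _ t); apply/funext => s; rewrite kr.
have im0 : Im (ppos (kB z z) t) = 0.
  by have := congr1 (@complex.Im R) pr; rewrite cIm_conj => h; lra.
have := Ue_refl t0 al al; rewrite !conjM_nm -[1 in LHS]cst1 -[1 in RHS]cst1 -!cstB.
have -> : expC (ppos (kB z z) t) = cst_of (expR (Re (ppos (kB z z) t))).
  by apply: eqcx; rewrite ?Re_exp ?Im_exp im0 ?cos0 ?sin0 ?mulr1 ?mulr0.
by rewrite -cstM => /cst_inj.
Qed.

Lemma nm_We z t : nm (We e z t) = nm (Ue e z t).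
Proof. by rewrite /We nmM nmV nm_xi invr1 mulr1. Qed.

Lemma nm_We_lt1 z t : 0 <= t -> alive z t -> nm z < 1 -> nm (We e z t) < 1.
Proof.
move=> t0 al z1; have := nm_Ue_eq t0 al.
have : 0 < (1 - nm z ^+ 2) * expR (Re (ppos (kB z z) t)).
  by rewrite mulr_gt0 ?expR_gt0 // subr_gt0 expr_lt1 ?nm_ge0.
move=> h E; rewrite -E subr_gt0 in h; by move: h; rewrite expr_lt1 ?nm_ge0.
Qed.

Lemma alive_open z t : 0 <= t -> alive z t ->
  exists2 d : R, 0 < d & forall z', nm (z' - z) < d -> alive z' t.
Proof.
move=> t0 al.
have cm : continuous (fun s => nm (1 - We e z s)).
  apply: (@continuous_comp' _ _ _ (fun s => 1 - We e z s) nm); last exact: continuous_nm.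
  by move=> s; apply: cvgB; [exact: cvg_cst|exact: We_continuous].
have [c cI Hc] := EVT_min t0 (continuous_subspaceT cm).
have ec : e < nm (1 - We e z c) by apply: al; move: cI; rewrite in_itv.
set m := nm (1 - We e z c) in ec Hc.
have E0 := expR_gt0 (Lc e * t).
exists ((m - e) / expR (Lc e * t)); first by rewrite divr_gt0 // subr_gt0.
move=> z'; rewrite ltr_pdivlMr // => h s /andP[s0 st].
have hs : m <= nm (1 - We e z s) by apply: Hc; rewrite in_itv /= s0.
have hl : nm (We e z' s - We e z s) < m - e.
  apply: le_lt_trans (We_lip z' z s0) (le_lt_trans _ h).
  by rewrite ler_wpM2l ?nm_ge0 // ler_expR ler_wpM2l // ltW // Lc_gt0.
have := nmDB (1 - We e z s) (We e z' s - We e z s).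
have -> : 1 - We e z s - (We e z' s - We e z s) = 1 - We e z' s by ring.
lra.
Qed.

(** [Ue_diff] makes the difference quotient exactly the exponential of the integral of [kA y z], so
    continuity in y suffices and no variational equation is solved. *)
Lemma Ue_cdiff z t : 0 <= t -> alive z t ->
  cdiff (fun y => Ue e y t) z (expC (ppos (kA z z) t)).
Proof.
move=> t0 al d d0; have [d1 d10 H1] := alive_open t0 al.
have [d2 d20 H2] := cdiff_cont (@cdiff_exp R (ppos (kA z z) t)) d0.
pose K := 2 * e^-1 * (3 / e ^+ 2 * expR (Lc e * t)) * t.
have K0 : 0 <= K by rewrite /K !mulr_ge0 ?invr_ge0 ?(ltW e0) ?expR_ge0 ?divr_ge0 ?exprn_ge0 ?(ltW e0).
exists (Num.min d1 (d2 / (1 + K))); first by rewrite lt_min d10 divr_gt0 // ltr_pwDl.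
move=> y; rewrite lt_min => /andP[h1 h2].
rewrite (Ue_diff t0 (H1 _ h1) al).
rewrite mulrC -mulrBl nmM ler_wpM2r ?nm_ge0 // ltW //; apply: H2.
apply: (@le_lt_trans _ _ (2 * e^-1 * (3 / e ^+ 2 * (nm (y - z) * expR (Lc e * t))) * t)).
  apply: ppos_diff_le_cst => //; [exact: kA_continuous|exact: kA_continuous|].
  move=> s /andP[s0 st]; have -> : kA y z s - kA z z s = 2 * re e z s * (re e y s - re e z s) by rewrite /kA; ring.
  rewrite nmM nmM nm2C; apply: ler_pM; rewrite ?mulr_ge0 ?nm_ge0 //.
    by rewrite ler_wpM2l // nm_re.
  apply: le_trans (Rg_lip _ _ e0) _; rewrite ler_wpM2l ?divr_ge0 ?exprn_ge0 ?(ltW e0) //.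
  apply: le_trans (We_lip _ _ (ltW s0)) _.
  by rewrite ler_wpM2l ?nm_ge0 // ler_expR ler_wpM2l ?(ltW (Lc_gt0 e0)) // ltW.
have -> : 2 * e^-1 * (3 / e ^+ 2 * (nm (y - z) * expR (Lc e * t))) * t = K * nm (y - z) by rewrite /K; ring.
move: h2; rewrite ltr_pdivlMr ?ltr_pwDl // => h2; apply: le_lt_trans h2.
by rewrite mulrC ler_wpM2l ?nm_ge0 // lerDr.
Qed.

End Eps.

End Driving.
End Regularised.

(** * Lifetimes and the Loewner flow *)

Lemma half_gap_lt (R : realType) (rho N M : R) : rho < 1 -> N <= rho -> 1 - N <= M -> (1 - rho) / 2 < M.
Proof. by move=> a b c; lra. Qed.

Section LoewnerFlow.
Variable R : realType.
Local Notation C := (Cplx R).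
Implicit Types (z : C) (t s e T : R).
Variable th : R -> R.
Hypothesis cth : continuous th.
Local Notation xi := (xi th).
Local Notation Ue := (Ue th).
Local Notation We := (We th).
Local Notation alive := (alive th).

(* the driving function is only meaningful on nonnegative times *)
Variable x : R -> C.
Hypothesis xE : forall t, 0 <= t -> x t = xi t.

Lemma within_sub (A B : set R) (T : topologicalType) (f : R -> T) : A `<=` B ->
  {within B, continuous f} -> {within A, continuous f}.
Proof. by move=> AB; exact: continuous_subspaceW. Qed.

Lemma field_fld e t u : 0 < e -> e <= nm (1 - u / xi t) ->
  u * ((xi t + u) / (xi t - u)) = fld th e t u.
Proof.
move=> e0 h; rewrite /fld RgE //.
have n : 1 - u / xi t != 0 by rewrite -nm_gt0 (lt_le_trans e0).
have x0 := xi_neq0 th t.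
have n' : xi t - u != 0.
  have -> : xi t - u = (1 - u / xi t) * xi t by field.
  by rewrite mulf_neq0.
by field; rewrite n' x0.
Qed.

Lemma sol_reg z T u e t : loewner_solution x z T u -> 0 < e -> 0 <= t < T ->
  (forall s, 0 <= s <= t -> e <= nm (1 - u s / xi s)) ->
  forall s, 0 <= s <= t -> u s = Ue e z s.
Proof.
move=> [u0 uc un ud] e0 /andP[t0 tT] H s /andP[s0 st].
have h1 r : 0 < r < s -> dC (fun s => u s - Ue e z s) r (fld th e r (u r) - fld th e r (Ue e z r)).
  move=> /andP[r0 rs]; apply: dCB; last exact: Ue_derive.
  have rT : 0 < r < T by rewrite r0 (lt_trans rs) // (le_lt_trans st).
  have := ud r rT; rewrite /= (xE (ltW r0)) (@field_fld e); first by [].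
    exact: e0.
  by apply: H; rewrite (ltW r0) (le_trans (ltW rs)).
have sub : `[0, s] `<=` `[0, T[.
  by move=> r /=; rewrite !in_itv /= => /andP[-> rs]; rewrite (le_lt_trans (le_trans rs st)).
have h2 : {within `[0, s], continuous (fun s => u s - Ue e z s)}.
  move=> r; apply: cvgB; first exact: (within_sub sub uc).
  by apply: continuous_subspaceT; exact: Ue_continuous.
have := @gronwall _ _ _ (Lc e) _ _ s0 h1 h2.
rewrite u0 Ue0 // subrr nm0 mul0r => h.
apply/eqP; rewrite -subr_eq0 -nm_eq0 eq_le nm_ge0 andbT; apply: h.
by move=> r _; exact: fld_lip.
Qed.

(** The distance to the singularity attains a positive minimum on [0, t]; half of it gives the
    strict inequality of [alive]. *)
Lemma sol_min z T u t : loewner_solution x z T u -> 0 <= t < T ->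
  exists2 e, 0 < e & forall s, 0 <= s <= t -> e < nm (1 - u s / xi s).
Proof.
move=> [u0 uc un ud] /andP[t0 tT].
have sub : `[0, t] `<=` `[0, T[.
  by move=> r /=; rewrite !in_itv /= => /andP[-> rs]; rewrite (le_lt_trans rs).
have c1 : {within `[0, t], continuous (fun s => nm (1 - u s / xi s))}.
  apply: (@within_comp _ _ _ _ (fun s => 1 - u s / xi s) nm); last exact: continuous_nm.
  move=> r; apply: cvgB; first exact: cvg_cst.
  apply: cvgM; first exact: (within_sub sub uc).
  by apply: continuous_subspaceT; exact: xiV_continuous.
have [c cI Hc] := EVT_min t0 c1.
have cT : 0 <= c < T by move: cI; rewrite in_itv /= => /andP[-> ct]; rewrite (le_lt_trans ct).
have c0 : 0 <= c by case/andP: cT.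
have m0 : 0 < nm (1 - u c / xi c).
  rewrite nm_gt0; apply/eqP => h; have := un c cT; rewrite (xE c0) => /eqP; apply.
  have : u c / xi c = 1 by apply/eqP; rewrite -subr_eq0 -oppr_eq0 opprB h.
  by move/(canRL (divfK (xi_neq0 th c))); rewrite mul1r.
exists (nm (1 - u c / xi c) / 2); first by rewrite divr_gt0.
move=> s st; apply: (@lt_le_trans _ _ (nm (1 - u c / xi c))).
  by rewrite ltr_pdivrMr // ltr_pMr // ltr1n.
by apply: Hc; rewrite in_itv.
Qed.

Lemma alive_extend e z t : 0 < e -> 0 <= t -> alive e z t -> exists2 T, t < T & alive e z T.
Proof.
move=> e0 t0 al.
have cm : continuous (fun s => nm (1 - We e z s)).
  apply: (@continuous_comp' _ _ _ (fun s => 1 - We e z s) nm); last exact: continuous_nm.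
  by move=> s; apply: cvgB; [exact: cvg_cst|exact: We_continuous].
have h : e < nm (1 - We e z t) by apply: al; rewrite t0 lexx.
have g0 : 0 < nm (1 - We e z t) - e by rewrite subr_gt0.
have /cvgrPdist_lt/(_ _ g0) [d /= d0 Hd] := cm t.
exists (t + d / 2); first by rewrite ltrDl divr_gt0.
move=> s /andP[s0 st]; have [sle|tlt] := leP s t; first by apply: al; rewrite s0.
have := Hd s; rewrite /ball_ /= => /(_ _).
have dd : `|t - s| < d by rewrite distrC gtr0_norm ?subr_gt0 //; lra.
by move=> /(_ dd); rewrite ltr_norml => /andP[_]; lra.
Qed.

Lemma alive_sol e z t : 0 < e -> 0 <= t -> alive e z t ->
  exists2 T, t < T & loewner_solution x z T (Ue e z).
Proof.
move=> e0 t0 al; have [T tT alT] := alive_extend e0 t0 al.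
exists T => //; split.
- exact: Ue0.
- by apply: continuous_subspaceT; exact: Ue_continuous.
- move=> s /andP[s0 sT]; rewrite xE //; apply/eqP => E.
  have sT' : 0 <= s <= T by rewrite s0 ltW.
  by have := alT s sT'; rewrite /We E divff ?xi_neq0 // subrr nm0 => /(lt_trans e0); rewrite ltxx.
- move=> s /andP[s0 sT]; have sT' : 0 <= s <= T by rewrite !ltW.
  have := Ue_derive cth e0 z s0; rewrite -field_fld //; last by have := alT s sT'; exact: ltW.
  by rewrite xE ?ltW.
Qed.

(** The flow at level e is a genuine Loewner solution up to t, and uniqueness at the finer level e'
    applies to it. All levels are thus compatible. *)
Lemma alive_mono e e' z t : 0 < e' -> e' <= e -> 0 <= t -> alive e z t ->
  alive e' z t /\ forall s, 0 <= s <= t -> Ue e' z s = Ue e z s.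
Proof.
move=> e'0 ee t0 al; have e0 := lt_le_trans e'0 ee.
have [T tT sol] := alive_sol e0 t0 al.
have tT' : 0 <= t < T by rewrite t0.
have H : forall s, 0 <= s <= t -> e' <= nm (1 - Ue e z s / xi s).
  by move=> s st; apply: le_trans ee (ltW (al s st)).
have E := sol_reg sol e'0 tT' H.
split=> s st; last by rewrite E.
by rewrite /We -E // (le_lt_trans ee) //; exact: al.
Qed.

Lemma lifetime_alive z t : 0 <= t -> (t%:E < lifetime x z)%E ->
  exists2 e, 0 < e & alive e z t.
Proof.
move=> t0 /ereal_sup_gt[_ [T [T0 [u sol]] <-]]; rewrite lte_fin => tT.
have tT' : 0 <= t < T by rewrite t0.
have [e e0 H] := sol_min sol tT'.
exists e => // s st; rewrite /We -(sol_reg sol e0 tT') //; first exact: H.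
by move=> r rt; exact: ltW (H r rt).
Qed.

Lemma alive_lifetime e z t : 0 < e -> 0 <= t -> alive e z t -> (t%:E < lifetime x z)%E.
Proof.
move=> e0 t0 al; have [T tT sol] := alive_sol e0 t0 al.
apply: (@lt_le_trans _ _ T%:E); first by rewrite lte_fin.
apply: ereal_sup_ubound; exists T => //; split; last by exists (Ue e z).
exact: le_lt_trans tT.
Qed.

(** [loewner_flow] picks some solution. Whichever it is, it has its own distance e1 to the
    singularity, and at the level min e e1 both flows coincide. *)
Lemma flowE e z t : 0 < e -> 0 <= t -> alive e z t -> loewner_flow x t z = Ue e z t.
Proof.
move=> e0 t0 al; rewrite /loewner_flow; case: xgetP => [v _ [T [u [tT sol <-]]]|H].
  have tT' : 0 <= t < T by rewrite t0.
  have [e1 e10 H1] := sol_min sol tT'.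
  pose e2 := Num.min e e1; have e20 : 0 < e2 by rewrite lt_min e0.
  have [al2 E2] : _ := alive_mono e20 (ltac:(by rewrite ge_min lexx) : e2 <= e) t0 al.
  rewrite -(E2 t) ?t0 ?lexx //; apply: (sol_reg sol e20 tT'); last by rewrite t0 lexx.
  by move=> s st; apply: le_trans (ltW (H1 s st)); rewrite ge_min lexx orbT.
have [T tT sol] := alive_sol e0 t0 al.
by case: (H (Ue e z t)); exists T, (Ue e z).
Qed.

(** 0 = w(q) is a fixed point at distance 1 from the singularity; the condition e < 1, which recurs
    below, keeps it alive. *)
Lemma Ue_at0 e t : 0 < e -> e < 1 -> 0 <= t -> Ue e 0 t = 0 /\ alive e 0 t.
Proof.
move=> e0 e1 t0.
have sol : loewner_solution x 0 (t + 1) (fun _ => 0).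
  split=> //; first by apply: continuous_subspaceT; exact: cst_continuous.
    by move=> s /andP[s0 _]; rewrite xE // eq_sym xi_neq0.
  by move=> s _ /=; rewrite mul0r; split; exact: is_derive_cst.
have tT : 0 <= t < t + 1 by rewrite t0 ltrDl ltr01.
have E := sol_reg sol e0 tT.
have H : forall s, 0 <= s <= t -> e <= nm (1 - (0 : C) / xi s) by move=> s _; rewrite mul0r subr0 nm1 ltW.
split; first by rewrite -(E H t) // t0 lexx.
by move=> s st; rewrite /We -(E H s st) mul0r subr0 nm1.
Qed.

Lemma flow_inj e z z' t : 0 < e -> 0 <= t -> alive e z t -> alive e z' t ->
  Ue e z t = Ue e z' t -> z = z'.
Proof.
move=> e0 t0 al al' /eqP; rewrite -subr_eq0 (Ue_diff cth e0 t0 al al') mulf_eq0.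
by rewrite (negbTE (expC_neq0 _)) orbF subr_eq0 => /eqP.
Qed.

(** * The time-reversed flow and surjectivity onto the disc *)

Section Backward.
Variables (rho t e : R).
Hypothesis eE : e = (1 - rho) / 2.
Hypotheses (rho0 : 0 <= rho) (rho1 : rho < 1) (t0 : 0 <= t).
Let e0 : 0 < e. Proof. by rewrite eE divr_gt0 // subr_gt0. Qed.
Let bfld (s : R) (u : C) := - fld th e (t - s) u.

Let bL s a b : nm (bfld s a - bfld s b) <= Lc e * nm (a - b).
Proof.
have -> : bfld s a - bfld s b = - (fld th e (t - s) a - fld th e (t - s) b) by rewrite /bfld; ring.
by rewrite nmN; exact: fld_lip.
Qed.
Let rev_cont : continuous (fun s : R => t - s).
Proof. by move=> s; apply: cvgB; [exact: cvg_cst|exact: cvg_id]. Qed.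
Let bc (u : R -> C) : continuous u -> continuous (fun s => bfld s (u s)).
Proof.
move=> cu s; apply: cvgN.
have cu' : continuous (fun s : R => u (t - s)) by exact: (@continuous_comp' _ _ _ (fun s : R => t - s) u).
have := (@continuous_comp' _ _ _ (fun s : R => t - s) _ rev_cont (fld_cont cth e0 cu')) s.
have -> : (fun s : R => fld th e (t - s) (u (t - (t - s)))) = (fun s => fld th e (t - s) (u s)).
  by apply/funext => r; rewrite subKr.
exact.
Qed.
Let bu y := psol bfld y.
Let bu_cont y : continuous (bu y).
Proof. by apply: (psol_continuous (Lc_gt0 e0) bL bc). Qed.
Let bu0 y : bu y 0 = y.
Proof. by apply: (psol0 (Lc_gt0 e0) bL bc). Qed.
Let bu_derive y s : 0 < s -> dC (bu y) s (bfld s (bu y s)).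
Proof. by move=> s0; apply: (psol_derive (Lc_gt0 e0) bL bc). Qed.

(** The Poisson kernel, as 2/(1 - w) - 1 = (1 + w)/(1 - w). Its positivity in the disc makes the
    modulus decrease along the backward flow. *)
Lemma Re_inv1B (w : C) : w != 1 -> Re (2 * (1 - w)^-1 - 1) = (1 - nm w ^+ 2) / nm (1 - w) ^+ 2.
Proof.
move=> w1; have n : 1 - w != 0 by rewrite subr_eq0 eq_sym.
have n2 : 0 < nm (1 - w) ^+ 2 by rewrite exprn_gt0 // nm_gt0.
have E : (1 - w)^-1 = (1 - w)^* * cst_of (nm (1 - w) ^+ 2)^-1.
  rewrite cstV -conjM_nm; have n1 : (1 - w)^* != 0 by rewrite -nm_gt0 nm_conj nm_gt0.
  by move: (1 - w) n n1 => v n n1; field; rewrite ?n ?n1.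
have two : (2 : C) = cst_of 2 by rewrite cst_nat.
rewrite E two !ReImE !nm2 !ReImE.
have n3 : (1 - Re w) ^+ 2 + (0 - Im w) ^+ 2 != 0.
  by rewrite gt_eqF //; move: n2; rewrite nm2 !ReImE.
move: n3; set D := (1 - Re w) ^+ 2 + (0 - Im w) ^+ 2 => n3.
have -> : 1 - (Re w ^+ 2 + Im w ^+ 2) = 2 * (1 - Re w) - D by rewrite /D; ring.
by clearbody D; field.
Qed.

(** Let q be the last time before s with modulus at most rho. Just after q the modulus lies between
    rho and (1 + rho)/2, where |1 - w| >= (1 - rho)/2 = e: the field is the true one, the Poisson
    kernel is nonnegative, and the modulus cannot have increased. *)
Let bu_bound y s : nm y <= rho -> 0 <= s <= t -> nm (bu y s) <= rho.
Proof.
have rm : rho < (1 + rho) / 2 by rewrite ltr_pdivlMr // mulr_natr mulr2n ltrD2r.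
move=> yr /andP[s0 st]; rewrite leNgt; apply/negP => hs1.
have cn : continuous (fun r => nm (bu y r)).
  by apply: (@continuous_comp' _ _ _ (bu y) nm); [exact: bu_cont|exact: continuous_nm].
pose A := [set r | 0 <= r <= s /\ nm (bu y r) <= rho].
have A0 : A 0 by rewrite /A /= lexx s0 bu0.
have Aub : ubound A s by move=> r [/andP[]].
have hsA : has_sup A by split; [exists 0|exists s].
pose q := sup A.
have q0 : 0 <= q by apply: ub_le_sup => //; exists s.
have qs : q <= s by apply: ge_sup => //; exists 0.
have qr : nm (bu y q) <= rho.
  rewrite leNgt; apply/negP => h.
  have g0 : 0 < nm (bu y q) - rho by rewrite subr_gt0.
  have /cvgrPdist_lt/(_ _ g0) [d /= d0 Hd] := cn q.
  have [r [Ar1 Ar2] rq] := sup_adherent d0 hsA.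
  have rq' : r <= q by apply: ub_le_sup; [exists s|].
  have := Hd r; rewrite /ball_ /= ger0_norm ?subr_ge0 // => /(_ (ltac:(rewrite -/q in rq; lra))).
  by rewrite ltr_norml => /andP[_]; lra.
have qs' : q < s by rewrite lt_neqAle qs andbT; apply/eqP => E; move: hs1; rewrite -E ltNge qr.
have g0 : 0 < (1 + rho) / 2 - nm (bu y q) by rewrite subr_gt0 (le_lt_trans qr).
have /cvgrPdist_lt/(_ _ g0) [d /= d0 Hd] := cn q.
pose p := Num.min s (q + d / 2).
have qp : q < p by rewrite lt_min qs' ltrDl divr_gt0.
have ps : p <= s by rewrite ge_min lexx.
have pd : p <= q + d / 2 by rewrite ge_min lexx orbT.
have hin r : q < r <= p -> rho < nm (bu y r) < (1 + rho) / 2.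
  move=> /andP[qr' rp]; apply/andP; split.
    rewrite ltNge; apply/negP => h; have : r <= q.
      apply: ub_le_sup; first by exists s.
      by split=> //; rewrite (le_trans q0 (ltW qr')) (le_trans rp).
    by rewrite leNgt qr'.
  have := Hd r; rewrite /ball_ /= distrC gtr0_norm ?subr_gt0 // => /(_ (ltac:(lra))).
  by rewrite ltr_norml => /andP[]; lra.
have : nm (bu y p) ^+ 2 <= nm (bu y q) ^+ 2.
  have E r : nm (bu y r) ^+ 2 = Re (bu y r * (bu y r)^*) by rewrite conjM_nm Re_cst.
  rewrite !E.
  have dg r : q < r < p -> is_derive r 1 (fun r => Re (bu y r * (bu y r)^*))
     (Re (bfld r (bu y r) * (bu y r)^* + bu y r * (bfld r (bu y r))^*)).
    move=> /andP[qr' _]; have r0 : 0 < r by apply: le_lt_trans qr'.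
    exact: dC_Re (dCM (bu_derive y r0) (dC_conj (bu_derive y r0))).
  apply: (le_of_derive (ltW qp) dg).
    apply: within_cont => r.
    have cc : continuous (fun r => bu y r * (bu y r)^*).
      apply: continuousCM; first exact: bu_cont.
      by apply: (@continuous_comp' _ _ _ (bu y) (fun z : C => z^*)); [exact: bu_cont|exact: continuous_conj].
    by have /cvgC_ReIm[] := cc r.
  move=> r /andP[qr' rp]; have /andP[h1 h2] : rho < nm (bu y r) < (1 + rho) / 2.
    by apply: hin; rewrite qr' ltW.
  set u := bu y r in h1 h2 *; set x0 := xi (t - r).
  have nw : nm (u / x0) = nm u by rewrite nmM nmV nm_xi invr1 mulr1.
  have ew : e <= nm (1 - u / x0).
    have := nmDB 1 (u / x0); rewrite nm1 nw eE; lra.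
  have w1 : u / x0 != 1.
    by apply: contraTneq ew => ->; rewrite subrr nm0 -ltNge.
  have bE : bfld r u = - (u * (2 * (1 - u / x0)^-1 - 1)).
    rewrite /bfld -field_fld //; congr (- (_ * _)).
    have x00 := xi_neq0 th (t - r); rewrite -/x0 in x00 *.
    have n1 : x0 - u != 0.
      apply: contra w1; rewrite subr_eq0 => /eqP <-; by rewrite divff.
    by field; rewrite n1 x00.
  have -> : Re (bfld r u * u^* + u * (bfld r u)^*) = - 2 * nm u ^+ 2 * Re (2 * (1 - u / x0)^-1 - 1).
    rewrite bE; move: (2 * _ - 1) => q1; rewrite !ReImE nm2; ring.
  rewrite (Re_inv1B w1) nw !mulNr oppr_le0; apply: mulr_ge0; first by rewrite mulr_ge0 ?sqr_ge0.
  apply: divr_ge0; last exact: sqr_ge0.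
  by rewrite subr_ge0 expr_le1 ?nm_ge0 // (le_trans (ltW h2))// ler_pdivrMr // mul1r -[leRHS]/(1 + 1) lerD2l ltW.
move=> h; have /andP[h1 _] := hin p (ltac:(by rewrite qp lexx)).
have : nm (bu y q) ^+ 2 < nm (bu y p) ^+ 2.
  by rewrite ltrXn2r ?nnegrE ?nm_ge0 // (le_lt_trans qr).
by rewrite ltNge h.
Qed.

(** Read backwards, s -> bu y (t - s) solves the forward equation from z = bu y t to y. It stays in
    |u| <= rho, hence |1 - w| >= 1 - rho > e. *)
Lemma backward_flow y : nm y <= rho -> exists z, [/\ nm z <= rho, alive e z t, Ue e z t = y & z = bu y t].
Proof.
move=> yr; pose z := bu y t.
have bb s : 0 <= s <= t -> nm (bu y (t - s)) <= rho.
  by move=> /andP[s0 st]; apply: bu_bound => //; rewrite subr_ge0 st lerBlDr lerDl s0.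
have E s : 0 <= s <= t -> bu y (t - s) = Ue e z s.
  move=> /andP[s0 st].
  have drev r : 0 < t - r -> dC (fun r => bu y (t - r)) r (fld th e r (bu y (t - r))).
    move=> tr; have [d1 d2] := bu_derive y tr.
    have dr : is_derive r 1 (fun r : R => t - r) (- 1).
      by have := is_deriveB' (is_derive_cst t r 1) (is_derive_id r 1); move/is_derive_eq; apply; rewrite sub0r.
    have bfE : bfld (t - r) (bu y (t - r)) = - fld th e r (bu y (t - r)).
      by rewrite /bfld subKr.
    rewrite bfE in d1 d2; split.
      by have := @is_derive_comp' R (fun s => Re (bu y s)) (fun r => t - r) r _ _ d1 dr; move/is_derive_eq; apply; rewrite cReN mulrN1 opprK.
    by have := @is_derive_comp' R (fun s => Im (bu y s)) (fun r => t - r) r _ _ d2 dr; move/is_derive_eq; apply; rewrite cImN mulrN1 opprK.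
  have h1 r : 0 < r < s -> dC (fun r => bu y (t - r) - Ue e z r) r (fld th e r (bu y (t - r)) - fld th e r (Ue e z r)).
    move=> /andP[r0 rs]; apply: dCB; last exact: Ue_derive.
    by apply: drev; rewrite subr_gt0 (lt_le_trans rs).
  have h2 : {within `[0, s], continuous (fun r => bu y (t - r) - Ue e z r)}.
    have cc : continuous (fun r : R => bu y (t - r)) := continuous_comp' rev_cont (@bu_cont y).
    apply: within_cont => r; apply: cvgB; last exact: Ue_continuous.
    exact: cc.
  have := @gronwall _ _ _ (Lc e) _ _ s0 h1 h2.
  rewrite subr0 Ue0 // subrr nm0 mul0r => h.
  apply/eqP; rewrite -subr_eq0 -nm_eq0 eq_le nm_ge0 andbT; apply: h.
  by move=> r _; exact: fld_lip.
exists z; split; last by [].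
- by have := bb 0; rewrite lexx t0 subr0 => /(_ isT).
- move=> s st; have := bb s st; rewrite (E s st) => hb.
  have nw : nm (We e z s) <= rho by rewrite nm_We.
  have h := nmDB 1 (We e z s); rewrite nm1 in h.
  by rewrite [X in X < _]eE; exact: (half_gap_lt rho1 nw h).
- by rewrite -(E t) ?subrr ?bu0 // t0 lexx.
Qed.

Lemma bu_lip y y' : nm (bu y t - bu y' t) <= nm (y - y') * expR (Lc e * t).
Proof.
have h1 r : 0 < r < t -> dC (fun r => bu y r - bu y' r) r (bfld r (bu y r) - bfld r (bu y' r)).
  by move=> /andP[r0 rs]; apply: dCB; exact: bu_derive.
have h2 : {within `[0, t], continuous (fun r => bu y r - bu y' r)}.
  by apply: within_cont => r; apply: cvgB; exact: bu_cont.
have := @gronwall _ _ _ (Lc e) _ _ t0 h1 h2; rewrite !bu0 subr0; apply.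
by move=> r _; exact: bL.
Qed.

(** Two points are treated together because the Lipschitz bound on the inverse flow is what makes
    w_t^{-1} continuous later. *)
Lemma flow_surj : exists2 K, 0 < K & forall y y', nm y <= rho -> nm y' <= rho ->
  exists z z', [/\ nm z <= rho /\ nm z' <= rho, alive e z t /\ alive e z' t,
    Ue e z t = y /\ Ue e z' t = y' & nm (z - z') <= K * nm (y - y')].
Proof.
exists (expR (Lc e * t)); first exact: expR_gt0.
move=> y y' yr yr'.
have [z [z1 z2 z3 z4]] := backward_flow yr; have [z' [z1' z2' z3' z4']] := backward_flow yr'.
by exists z, z'; split => //; rewrite z4 z4' mulrC; exact: bu_lip.
Qed.
End Backward.

End LoewnerFlow.

(** * Values of the multivalued observable *)

Section CountableValues.
Variable R : realType.
Local Notation C := (Cplx R).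

(* Otherwise f takes an interval of values, of positive Lebesgue measure. *)
Lemma countable_const_real (f : R -> R) (a b : R) (S : set R) : a <= b ->
  {within `[a, b], continuous f} -> countable S -> (forall s, a <= s <= b -> S (f s)) -> f a = f b.
Proof.
move=> ab cf cS H; apply/eqP/negPn/negP => ne.
pose m := Num.min (f a) (f b); pose M := Num.max (f a) (f b).
have mM : m < M.
  move: ne; rewrite /m /M neq_lt => /orP[h|h].
    by rewrite (min_l (ltW h)) (max_r (ltW h)).
  by rewrite (min_r (ltW h)) (max_l (ltW h)).
have sub : `[m, M] `<=` S.
  move=> v; rewrite /= in_itv /= => vI.
  have [c cI <-] := IVT ab cf vI.
  by apply: H; move: cI; rewrite in_itv.
have c2 : countable `[m, M]%classic by apply: sub_countable cS; exact: subset_card_le.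
have := countable_lebesgue_measure0 c2.
rewrite lebesgue_measure_itv /= lte_fin mM -EFinB => /eqP.
by rewrite eqe subr_eq0 gt_eqF.
Qed.

Lemma countable_const (f : R -> C) (a b : R) (S : set C) : a <= b ->
  {within `[a, b], continuous f} -> countable S -> (forall s, a <= s <= b -> S (f s)) -> f a = f b.
Proof.
move=> ab cf cS H; apply: eqcx.
  apply: (@countable_const_real _ a b [set (Re z : R) | z in S] ab (within_Re cf)).
    exact: sub_countable (card_image_le _ _) cS.
  by move=> s /H; exists (f s).
apply: (@countable_const_real _ a b [set (Im z : R) | z in S] ab (within_Im cf)).
  exact: sub_countable (card_image_le _ _) cS.
by move=> s /H; exists (f s).
Qed.

Lemma LogC_ccont (z : C) : 0 < Re z -> ccont (@LogC R) z.
Proof.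
move=> z0; apply/ccontP.
have nz : 0 < nm z by apply: lt_le_trans (Re_le_nm z); rewrite gtr0_norm.
apply/(@cvgC_ReIm _ _ _ (nbhs_filter z)); split.
  rewrite (_ : (fun t : C => Re (LogC t)) = (fun t => ln (nm t))) //.
  apply: (cvg_comp _ (@ln R) (@continuous_nm R z)).
  by apply: continuous_ln.
rewrite (_ : (fun t : C => Im (LogC t)) = (fun t => atan (Im t / Re t))) //.
apply: (cvg_comp _ (@atan R) (_ : (fun y : C => Im y / Re y) @ nbhs z --> Im z / Re z)); last exact: continuous_atan.
apply: cvgM; first exact: continuous_Im.
by apply: cvgV; [rewrite gt_eqF|exact: continuous_Re].
Qed.

Definition p2 (l s t : C) : C := s * l + t * l^*.
Lemma pow2E (l s t : C) : pow2 l s t = expC (p2 l s t). Proof. by []. Qed.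
Lemma p2D l l' s t : p2 (l + l') s t = p2 l s t + p2 l' s t.
Proof. by rewrite /p2 conjCD; ring. Qed.

Definition sumpairs (s : seq C) (f : C -> C -> C) : C :=
  \sum_(j < size s) \sum_(k < size s | (j < k)%N) f (nth 0 s j) (nth 0 s k).

Lemma sumpairs_cons x s f : sumpairs (x :: s) f = \sum_(y <- s) f x y + sumpairs s f.
Proof.
rewrite /sumpairs /= big_ord_recl; congr (_ + _).
  rewrite big_mkcond big_ord_recl /= add0r (big_nth 0) big_mkord.
  by apply: eq_bigr => i _.
apply: eq_bigr => j _; rewrite big_mkcond big_ord_recl /= add0r [RHS]big_mkcond.
by apply: eq_bigr => k _; rewrite /bump /= !add1n ltnS.
Qed.

Lemma eq_sumpairs s f g : uniq s -> (forall x y, x \in s -> y \in s -> x != y -> f x y = g x y) ->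
  sumpairs s f = sumpairs s g.
Proof.
move=> us H; apply: eq_bigr => j _; apply: eq_bigr => k jk; apply: H; rewrite ?mem_nth //.
by rewrite nth_uniq // neq_ltn jk.
Qed.

Lemma sumpairsD s f g : sumpairs s (fun x y => f x y + g x y) = sumpairs s f + sumpairs s g.
Proof.
by rewrite /sumpairs -big_split; apply: eq_bigr => j _; rewrite -big_split.
Qed.

End CountableValues.

(** * The quotient of expectations at an interior node of Psi *)

Section EhatValues.
Variable R : realType.
Local Notation C := (Cplx R).
Variables (kappa : R) (X : rooted_vertex R).
Local Notation a := (cst_of (sle_a kappa) : C).
Local Notation b := (cst_of (sle_b kappa) : C).
Local Notation tau := (rtau X).
Local Notation taus := (rtaus X).
Local Notation sg := (chg X).
Local Notation sgs := (chgs X).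
Local Notation ns := (undup (nodes X)).
Hypothesis sg0 : forall x, x \notin nodes X -> sg x = 0 /\ sgs x = 0.

(* logarithms for the bases in the quotient E[Psi * X] / E[Psi]: the primed
   ones belong to the denominator, those with z involve the node of Psi *)
Record logs := Logs {
  lq : C; lq' : C; lz : C; lz' : C; lwz : C; lwz' : C;
  ld : C -> C; lw : C -> C; lsz : C -> C; lrz : C -> C;
  ls : C -> C -> C; lr : C -> C -> C }.

Definition cdim (s : C) : C := dimension (sle_b kappa) s.

(** A logarithm of E[Psi * X] / E[Psi] without the powers of 1 - |w|^2, which are single-valued and
    kept in [rexpo]. It is additive in the logarithms (conjugates occur), so changes of branch and
    increments in time are handled alike. *)
Definition expo (L : logs) : C :=
  p2 (lq L) ((- a / 2 + tau) ^+ 2 / 2) ((- a / 2 + taus) ^+ 2 / 2)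
  - p2 (lq' L) ((- a / 2) ^+ 2 / 2) ((- a / 2) ^+ 2 / 2)
  + p2 (lz L) (cdim a) (cdim 0) - p2 (lz' L) (cdim a) (cdim 0)
  + p2 (lwz L) ((b + (- a / 2 + tau)) * a) ((b + (- a / 2 + taus)) * 0)
  - p2 (lwz' L) ((b + - a / 2) * a) ((b + - a / 2) * 0)
  + \sum_(x <- ns) (p2 (ld L x) (cdim (sg x)) (cdim (sgs x))
      + p2 (lw L x) ((b + (- a / 2 + tau)) * sg x) ((b + (- a / 2 + taus)) * sgs x))
  + \sum_(x <- ns) (p2 (lsz L x) (a * sg x) 0 + p2 (lrz L x) (a * sgs x) 0)
  + sumpairs ns (fun x y => p2 (ls L x y) (sg x * sg y) (sgs x * sgs y)
      + p2 (lr L x y) (sg x * sgs y) (sgs x * sg y)).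

Definition rexpo (w : C -> C) : C :=
  \sum_(x <- ns) sg x * sgs x * cst_of (ln (1 - nm (w x) ^+ 2)).

Definition logs_of (W : marked_domain R) (zeta : C) (L : logs) :=
  let w := unif W in
  [/\ expC (lq L) = derive1 w (Defs.root W) /\ expC (lq' L) = derive1 w (Defs.root W),
      expC (lz L) = derive1 w zeta /\ expC (lz' L) = derive1 w zeta,
      expC (lwz L) = w zeta /\ expC (lwz' L) = w zeta,
      (forall x, x \in ns -> [/\ expC (ld L x) = derive1 w x, expC (lw L x) = w x,
         expC (lsz L x) = w zeta - w x & expC (lrz L x) = 1 - w zeta * (w x)^*]) &
      forall x y, x \in ns -> y \in ns -> x != y ->
         expC (ls L x y) = w x - w y /\ expC (lr L x y) = 1 - w x * (w y)^*].

Definition quotient_values (W : marked_domain R) (zeta : C) : set C :=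
  [set x / y | x in Defs.expectation (sle_b kappa) W (star (one_leg kappa zeta) X)
             & y in Defs.expectation (sle_b kappa) W (one_leg kappa zeta)].

Lemma prod_pairs (s : seq C) (f : C -> C -> C) :
  \prod_(j < size s) \prod_(k < size s | (j < k)%N) expC (f (nth 0 s j) (nth 0 s k)) = expC (sumpairs s f).
Proof. by rewrite /sumpairs expC_sum; apply: eq_bigr => j _; rewrite expC_sum. Qed.

Lemma one_leg_chg zeta x : chg (one_leg kappa zeta) x = if zeta == x then a else 0.
Proof.
rewrite /=; case: eqP => _; last by rewrite big_pred0.
by rewrite big_ord1.
Qed.
Lemma one_leg_chgs zeta x : chgs (one_leg kappa zeta) x = 0.
Proof. by rewrite /= big1. Qed.

Lemma star_nodes zeta : zeta \notin nodes X -> nodes (star (one_leg kappa zeta) X) = zeta :: ns.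
Proof. by move=> zn; rewrite /= enum_ordSl /= enum_ord0 /= (negbTE zn). Qed.
Lemma leg_nodes zeta : nodes (one_leg kappa zeta) = [:: zeta].
Proof. by rewrite /= enum_ordSl /= enum_ord0. Qed.

(** A node zeta outside the support leaves the charges of X as they are. Its charges are a and 0, so
    it brings no factor 1 - |w|^2 and no conjugate powers in the pairs. *)
Lemma star_value (W : marked_domain R) zeta (L : branches R) : zeta \notin nodes X ->
  let Y := star (one_leg kappa zeta) X in let s := nodes Y in
  root_factor Y L * (\prod_(x <- s) one_point (sle_b kappa) W Y L x) *
    (\prod_(j < size s) \prod_(k < size s | (j < k)%N) two_point Y L (nth 0 s j) (nth 0 s k))
  = expC (p2 (log_dq L) ((- a / 2 + tau) ^+ 2 / 2) ((- a / 2 + taus) ^+ 2 / 2)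
   + (p2 (log_d L zeta) (cdim a) (cdim 0)
      + p2 (log_w L zeta) ((b + (- a / 2 + tau)) * a) ((b + (- a / 2 + taus)) * 0))
   + \sum_(x <- ns) (p2 (log_d L x) (cdim (sg x)) (cdim (sgs x))
      + p2 (log_w L x) ((b + (- a / 2 + tau)) * sg x) ((b + (- a / 2 + taus)) * sgs x))
   + rexpo (unif W)
   + \sum_(x <- ns) (p2 (log_sub L zeta x) (a * sg x) 0 + p2 (log_refl L zeta x) (a * sgs x) 0)
   + sumpairs ns (fun x y => p2 (log_sub L x y) (sg x * sg y) (sgs x * sgs y)
      + p2 (log_refl L x y) (sg x * sgs y) (sgs x * sg y))).
Proof.
move=> zn Y s.
have sE : s = zeta :: ns by exact: star_nodes.
have un : uniq (zeta :: ns) by rewrite /= mem_undup zn undup_uniq.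
have [sz szs] := sg0 zn.
have cz : chg Y zeta = a by rewrite -[LHS]/(chg (one_leg kappa zeta) zeta + sg zeta) one_leg_chg eqxx sz addr0.
have czs : chgs Y zeta = 0 by rewrite -[LHS]/(chgs (one_leg kappa zeta) zeta + sgs zeta) one_leg_chgs szs addr0.
have cx x : x \in ns -> chg Y x = sg x.
  rewrite mem_undup => xn; rewrite -[LHS]/(chg (one_leg kappa zeta) x + sg x) one_leg_chg; case: eqP => [E|_]; last by rewrite add0r.
  by move: zn; rewrite E xn.
have cxs x : chgs Y x = sgs x by rewrite -[LHS]/(chgs (one_leg kappa zeta) x + sgs x) one_leg_chgs add0r.
have -> : \prod_(j < size s) \prod_(k < size s | (j < k)%N) two_point Y L (nth 0 s j) (nth 0 s k) =
   expC (sumpairs s (fun x y => p2 (log_sub L x y) (chg Y x * chg Y y) (chgs Y x * chgs Y y)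
      + p2 (log_refl L x y) (chg Y x * chgs Y y) (chgs Y x * chg Y y))).
  rewrite -prod_pairs; apply: eq_bigr => j _; apply: eq_bigr => k _.
  by rewrite /two_point !pow2E -expCD.
have -> : \prod_(x <- s) one_point (sle_b kappa) W Y L x = expC (\sum_(x <- s) (
    p2 (log_d L x) (cdim (chg Y x)) (cdim (chgs Y x)) +
    p2 (log_w L x) ((b + rtau Y) * chg Y x) ((b + rtaus Y) * chgs Y x) +
    chg Y x * chgs Y x * cst_of (ln (1 - nm (unif W x) ^+ 2)))).
  rewrite expC_sum; apply: eq_bigr => x _.
  by rewrite /one_point !pow2E -!expCD.
rewrite /root_factor pow2E -!expCD; congr expC.
rewrite sE sumpairs_cons big_cons cz czs.
have -> : rtau Y = - a / 2 + tau by []. have -> : rtaus Y = - a / 2 + taus by [].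
have -> : \sum_(j <- ns) (p2 (log_d L j) (cdim (chg Y j)) (cdim (chgs Y j)) +
    p2 (log_w L j) ((b + (- a / 2 + tau)) * chg Y j) ((b + (- a / 2 + taus)) * chgs Y j) +
    chg Y j * chgs Y j * cst_of (ln (1 - nm (unif W j) ^+ 2))) =
  \sum_(x <- ns) (p2 (log_d L x) (cdim (sg x)) (cdim (sgs x))
      + p2 (log_w L x) ((b + (- a / 2 + tau)) * sg x) ((b + (- a / 2 + taus)) * sgs x))
   + rexpo (unif W).
  rewrite /rexpo -big_split; apply: eq_big_seq => x xn.
  by rewrite (cx _ xn) cxs.
have -> : \sum_(y <- ns) (p2 (log_sub L zeta y) (a * chg Y y) (0 * chgs Y y) +
     p2 (log_refl L zeta y) (a * chgs Y y) (0 * chg Y y)) =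
   \sum_(x <- ns) (p2 (log_sub L zeta x) (a * sg x) 0 + p2 (log_refl L zeta x) (a * sgs x) 0).
  apply: eq_big_seq => x xn.
  by rewrite (cx _ xn) cxs !mul0r.
have -> : sumpairs ns (fun x y => p2 (log_sub L x y) (chg Y x * chg Y y) (chgs Y x * chgs Y y)
      + p2 (log_refl L x y) (chg Y x * chgs Y y) (chgs Y x * chg Y y)) =
  sumpairs ns (fun x y => p2 (log_sub L x y) (sg x * sg y) (sgs x * sgs y)
      + p2 (log_refl L x y) (sg x * sgs y) (sgs x * sg y)).
  apply: eq_sumpairs; first exact: undup_uniq.
  by move=> x y xn yn _; rewrite (cx _ xn) (cx _ yn) !cxs.
rewrite [a * 0]mulr0 [0 * cst_of _]mul0r; ring.
Qed.

Lemma leg_value (W : marked_domain R) zeta (L : branches R) :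
  let Y := one_leg kappa zeta in let s := nodes Y in
  root_factor Y L * (\prod_(x <- s) one_point (sle_b kappa) W Y L x) *
    (\prod_(j < size s) \prod_(k < size s | (j < k)%N) two_point Y L (nth 0 s j) (nth 0 s k))
  = expC (p2 (log_dq L) ((- a / 2) ^+ 2 / 2) ((- a / 2) ^+ 2 / 2)
   + (p2 (log_d L zeta) (cdim a) (cdim 0) + p2 (log_w L zeta) ((b + - a / 2) * a) ((b + - a / 2) * 0))).
Proof.
move=> Y s; have sE : s = [:: zeta] by exact: leg_nodes.
have cz : chg Y zeta = a by rewrite one_leg_chg eqxx.
have czs : chgs Y zeta = 0 by rewrite one_leg_chgs.
rewrite sE big_seq1 /= [X in _ * X]big1 ?mulr1; last first.
  by move=> j _; rewrite big1 // => k; rewrite (ord1 j) (ord1 k).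
rewrite /root_factor /one_point cz czs !pow2E -!expCD; congr expC.
by rewrite [a * 0]mulr0 [X in _ + (_ + X)]mul0r addr0.
Qed.

(** Numerator and denominator choose their logarithms independently, which is why some fields of
    [logs] come in two copies. *)
Lemma quotient_valuesP (W : marked_domain R) zeta v : zeta \notin nodes X ->
  Defs.dom W zeta -> zeta <> Defs.root W -> (forall x, x \in ns -> Defs.dom W x /\ x <> Defs.root W) ->
  quotient_values W zeta v <-> exists2 L, logs_of W zeta L & v = expC (expo L + rexpo (unif W)).
Proof.
move=> zn Wz zr Wn; have un : uniq (zeta :: ns) by rewrite /= mem_undup zn undup_uniq.
have zne x : x \in ns -> (x == zeta) = false.
  by rewrite mem_undup => xn; apply: contraNF zn => /eqP <-.
split.
  move=> [_ [_ _ [L [L1 L2 L3 L4 L5] ->]]] [_ [_ _ [L' [L1' L2' L3' L4' L5'] ->]] <-].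
  rewrite star_nodes // in L2 L3 L4 L5; rewrite leg_nodes in L2' L3' L4' L5'.
  have mz : zeta \in zeta :: ns by rewrite inE eqxx.
  have mx x : x \in ns -> x \in zeta :: ns by rewrite inE orbC => ->.
  exists (Logs (log_dq L) (log_dq L') (log_d L zeta) (log_d L' zeta) (log_w L zeta) (log_w L' zeta)
    (log_d L) (log_w L) (log_sub L zeta) (log_refl L zeta) (log_sub L) (log_refl L)).
    split; rewrite /=.
    - by split.
    - by split; [apply: L2; exact: mz|apply: L2'; rewrite inE; exact: eqxx].
    - by split; [apply: L3; exact: mz|apply: L3'; rewrite inE; exact: eqxx].
    - move=> x xn; have ne : zeta != x by rewrite eq_sym (zne _ xn).
      by split; [apply: L2|apply: L3|apply: L4|apply: L5]; rewrite ?(mx _ xn) ?mz ?ne.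
    - by move=> x y xn yn ne; split; [apply: L4|apply: L5]; rewrite ?(mx _ xn) ?(mx _ yn).
  by rewrite star_value // leg_value -expCB; congr expC; rewrite /expo /=; ring.
move=> [L [[q1 q2] [z1 z2] [wz1 wz2] H1 H2] ->].
(* [branches_of] demands logarithms for the pairs (x, zeta) too, although zeta stands first in the
   product and only (zeta, x) occurs there. They are supplied here and, for the reflections, by
   conjugation. *)
have [nl nlP] : exists nl : C -> C, forall x, x \in ns -> expC (nl x) = - (unif W zeta - unif W x).
  have : forall x, exists l : C, x \in ns -> expC l = - (unif W zeta - unif W x).
    move=> x; have [xn|_] := boolP (x \in ns); last by exists 0.
    have [l Hl] : exists l : C, expC l = - (unif W zeta - unif W x).
      by apply: expC_log; have [_ _ <- _] := H1 _ xn; rewrite oppr_eq0 expC_neq0.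
    by exists l.
  by case/boolp.choice => nl; exists nl.
pose LX := @Branches R (lq L) (fun x => if x == zeta then lz L else ld L x)
  (fun x => if x == zeta then lwz L else lw L x)
  (fun x y => if x == zeta then lsz L y else if y == zeta then nl x else ls L x y)
  (fun x y => if x == zeta then lrz L y else if y == zeta then (lrz L x)^* else lr L x y).
pose LY := @Branches R (lq' L) (fun _ => lz' L) (fun _ => lwz' L) (fun _ _ => 0) (fun _ _ => 0).
have wzx x : x \in zeta :: ns -> x == zeta = false -> x \in ns.
  by rewrite inE => /orP[-> //|].
set Y := star (one_leg kappa zeta) X; set Y' := one_leg kappa zeta.
exists (root_factor Y LX * (\prod_(x <- nodes Y) one_point (sle_b kappa) W Y LX x) *
    (\prod_(j < size (nodes Y)) \prod_(k < size (nodes Y) | (j < k)%N) two_point Y LX (nth 0 (nodes Y) j) (nth 0 (nodes Y) k))).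
  rewrite /Defs.expectation; split; rewrite ?star_nodes //.
    by move=> x; rewrite inE => /orP[/eqP ->|/Wn].
  exists LX; last by [].
  split; rewrite /LX /=; first exact: q1.
  - by move=> x xn; case: eqP => [->//|/eqP/negbTE xz]; have [] := H1 _ (wzx _ xn xz).
  - by move=> x xn; case: eqP => [->//|/eqP/negbTE xz]; have [] := H1 _ (wzx _ xn xz).
  - move=> x y xn yn ne; case: (boolP (x == zeta)) => [/eqP xz|/negbTE xz].
      by rewrite xz in ne *; have [] := H1 y (wzx _ yn _) => //; rewrite eq_sym (negbTE ne).
    case: (boolP (y == zeta)) => [/eqP ->|/negbTE yz].
      by rewrite nlP ?opprB // wzx.
    by have [] := H2 _ _ (wzx _ xn xz) (wzx _ yn yz) ne.
  - move=> x y xn yn ne; case: (boolP (x == zeta)) => [/eqP xz|/negbTE xz].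
      by rewrite xz in ne *; have [] := H1 y (wzx _ yn _) => //; rewrite eq_sym (negbTE ne).
    case: (boolP (y == zeta)) => [/eqP ->|/negbTE yz].
      have [_ _ _ E] := H1 _ (wzx _ xn xz); rewrite expC_conj E conjCB conjC1' conjCM conjCK'.
      by rewrite mulrC.
    by have [] := H2 _ _ (wzx _ xn xz) (wzx _ yn yz) ne.
exists (root_factor Y' LY * (\prod_(x <- nodes Y') one_point (sle_b kappa) W Y' LY x) *
    (\prod_(j < size (nodes Y')) \prod_(k < size (nodes Y') | (j < k)%N) two_point Y' LY (nth 0 (nodes Y') j) (nth 0 (nodes Y') k))).
  rewrite /Defs.expectation; split; rewrite ?leg_nodes //.
    by move=> x; rewrite inE => /eqP ->.
  exists LY; last by [].
  split; rewrite /LY /=; first exact: q2.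
  - by move=> x; rewrite inE => /eqP ->.
  - by move=> x; rewrite inE => /eqP ->.
  - by move=> x y; rewrite !inE => /eqP -> /eqP ->; rewrite eqxx.
  - by move=> x y; rewrite !inE => /eqP -> /eqP ->; rewrite eqxx.
rewrite star_value // leg_value -expCB; congr expC.
rewrite /expo /= eqxx.
have -> : \sum_(x <- ns) (p2 (if x == zeta then lz L else ld L x) (cdim (sg x)) (cdim (sgs x)) +
    p2 (if x == zeta then lwz L else lw L x) ((b + (- a / 2 + tau)) * sg x) ((b + (- a / 2 + taus)) * sgs x)) =
  \sum_(x <- ns) (p2 (ld L x) (cdim (sg x)) (cdim (sgs x)) +
    p2 (lw L x) ((b + (- a / 2 + tau)) * sg x) ((b + (- a / 2 + taus)) * sgs x)).
  by apply: eq_big_seq => x xn; rewrite zne.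
have -> : sumpairs ns (fun x y =>
     p2 (if x == zeta then lsz L y else if y == zeta then nl x else ls L x y) (sg x * sg y) (sgs x * sgs y) +
     p2 (if x == zeta then lrz L y else if y == zeta then (lrz L x)^* else lr L x y) (sg x * sgs y) (sgs x * sg y)) =
  sumpairs ns (fun x y => p2 (ls L x y) (sg x * sg y) (sgs x * sgs y) + p2 (lr L x y) (sg x * sgs y) (sgs x * sg y)).
  by apply: eq_sumpairs; [exact: undup_uniq|move=> x y xn yn _; rewrite !zne].
ring.
Qed.

End EhatValues.

Section PointwiseContinuity.
Variable R : realType.
Local Notation C := (Cplx R).
Implicit Types (F G : C -> C) (z : C).

Lemma ccont_cst (c : C) z : ccont (fun _ => c) z.
Proof. by move=> e e0; exists 1 => // y _; rewrite subrr nm0. Qed.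
Lemma ccont_id z : ccont (fun y : C => y) z.
Proof. by move=> e e0; exists e. Qed.
Lemma ccontD F G z : ccont F z -> ccont G z -> ccont (fun y => F y + G y) z.
Proof. by move=> /ccontP a /ccontP b; apply/ccontP; exact: cvgD a b. Qed.
Lemma ccontN F z : ccont F z -> ccont (fun y => - F y) z.
Proof. by move=> /ccontP a; apply/ccontP; exact: cvgN a. Qed.
Lemma ccont_conj F z : ccont F z -> ccont (fun y => (F y)^*) z.
Proof.
by move=> H e e0; have [d d0 Hd] := H e e0; exists d => // y yd; rewrite -conjCB nm_conj; exact: Hd.
Qed.
Lemma ccont_comp F G z : ccont F z -> ccont G (F z) -> ccont (fun y => G (F y)) z.
Proof.
move=> cF cG e e0; have [d d0 Hd] := cG e e0; have [d' d'0 Hd'] := cF d d0.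
by exists d' => // y /Hd' /Hd.
Qed.
Lemma ccont_sum (s : seq C) (F : C -> C -> C) z : (forall x, x \in s -> ccont (F x) z) ->
  ccont (fun y => \sum_(x <- s) F x y) z.
Proof.
elim: s => [|x s IH] H.
  by rewrite (_ : (fun y => _) = (fun _ => 0)); [exact: ccont_cst|apply/funext => y; rewrite big_nil].
rewrite (_ : (fun y => _) = (fun y => F x y + \sum_(x <- s) F x y)); last by apply/funext => y; rewrite big_cons.
by apply: ccontD; [apply: H; rewrite inE eqxx|apply: IH => y ys; apply: H; rewrite inE ys orbT].
Qed.
Lemma ccont_p2 F (s t : C) z : ccont F z -> ccont (fun y => p2 (F y) s t) z.
Proof.
move=> cF; apply: ccontD; apply: ccontM; try exact: ccont_cst; first exact: cF.
exact: ccont_conj.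
Qed.
Lemma ccont_exp z : ccont (@expC R) z.
Proof. exact: cdiff_cont (@cdiff_exp R z). Qed.

Lemma within_eps (A : set R) (f : R -> C) :
  (forall s, A s -> forall e : R, 0 < e -> exists2 d : R, 0 < d &
     forall s', A s' -> `|s' - s| < d -> nm (f s' - f s) < e) -> {within A, continuous f}.
Proof.
move=> H; apply/subspace_continuousP => s As; apply/cvgCP => e e0.
have [d d0 Hd] := H s As e e0; exists d => //= s' /=; rewrite distrC => ss As'.
exact: Hd.
Qed.

Lemma within_ccont (U : set C) (g : C -> C) :
  (forall z, U z -> ccont g z) -> {within U, continuous g}.
Proof.
move=> H; apply/subspace_continuousP => z Uz; apply/cvgCP => e e0.
have [d d0 Hd] := H z Uz e e0; apply/nbhsCP; exists d => // y yd _; exact: Hd.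
Qed.

Lemma within_ccontP (U : set C) (g : C -> C) z : {within U, continuous g} -> U z ->
  forall e : R, 0 < e -> exists2 d : R, 0 < d & forall y, U y -> nm (y - z) < d -> nm (g y - g z) < e.
Proof.
move=> /subspace_continuousP H Uz e e0; have /cvgCP/(_ e e0)/nbhsCP[d d0 Hd] := H z Uz.
by exists d => // y Uy yd; exact: Hd.
Qed.

Lemma seq_min_pos (T : eqType) (s : seq T) (f : T -> R) : (forall x, x \in s -> 0 < f x) ->
  exists2 r : R, 0 < r & forall x, x \in s -> r <= f x.
Proof.
elim: s => [|x s IH] H; first by exists 1.
have [y ys|r r0 Hr] := IH; first by apply: H; rewrite inE ys orbT.
exists (Num.min r (f x)); first by rewrite lt_min r0 H // inE eqxx.
move=> y; rewrite inE => /orP[/eqP ->|ys]; first by rewrite ge_min lexx orbT.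
by rewrite ge_min Hr.
Qed.

Lemma min_half_lt (c d : R) : 0 < c -> 0 < d -> Num.min c d / 2 < c /\ Num.min c d / 2 < d.
Proof.
move=> c0 d0; have m0 : 0 < Num.min c d by rewrite lt_min c0.
have h : Num.min c d / 2 < Num.min c d by rewrite ltr_pdivrMr // ltr_pMr // ltr1n.
by split; apply: lt_le_trans h _; rewrite ge_min lexx ?orbT.
Qed.

End PointwiseContinuity.

(** * Boundary values at the tip: one value up to countably many phases *)

Section EhatSet.
Variable R : realType.
Local Notation C := (Cplx R).
Variables (kappa : R) (X : rooted_vertex R).
Local Notation a := (cst_of (sle_a kappa) : C).
Local Notation b := (cst_of (sle_b kappa) : C).
Local Notation tau := (rtau X).
Local Notation taus := (rtaus X).
Local Notation sg := (chg X).
Local Notation sgs := (chgs X).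
Local Notation ns := (undup (nodes X)).
Hypothesis sg0 : forall x, x \notin nodes X -> sg x = 0 /\ sgs x = 0.
Local Notation expo := (expo kappa X).
Local Notation rexpo := (rexpo X).

Definition addl (L M : logs R) : logs R :=
  Logs (lq L + lq M) (lq' L + lq' M) (lz L + lz M) (lz' L + lz' M) (lwz L + lwz M) (lwz' L + lwz' M)
    (fun x => ld L x + ld M x) (fun x => lw L x + lw M x)
    (fun x => lsz L x + lsz M x) (fun x => lrz L x + lrz M x)
    (fun x y => ls L x y + ls M x y) (fun x y => lr L x y + lr M x y).

Lemma expo_add L M : expo (addl L M) = expo L + expo M.
Proof.
rewrite /expo /= !p2D.
have E1 : \sum_(x <- ns) (p2 (ld L x + ld M x) (cdim kappa (sg x)) (cdim kappa (sgs x)) +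
    p2 (lw L x + lw M x) ((b + (- a / 2 + tau)) * sg x) ((b + (- a / 2 + taus)) * sgs x)) =
  \sum_(x <- ns) (p2 (ld L x) (cdim kappa (sg x)) (cdim kappa (sgs x)) +
    p2 (lw L x) ((b + (- a / 2 + tau)) * sg x) ((b + (- a / 2 + taus)) * sgs x)) +
  \sum_(x <- ns) (p2 (ld M x) (cdim kappa (sg x)) (cdim kappa (sgs x)) +
    p2 (lw M x) ((b + (- a / 2 + tau)) * sg x) ((b + (- a / 2 + taus)) * sgs x)).
  by rewrite -big_split; apply: eq_bigr => x _; rewrite !p2D addrACA.
have E2 : \sum_(x <- ns) (p2 (lsz L x + lsz M x) (a * sg x) 0 + p2 (lrz L x + lrz M x) (a * sgs x) 0) =
  \sum_(x <- ns) (p2 (lsz L x) (a * sg x) 0 + p2 (lrz L x) (a * sgs x) 0) +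
  \sum_(x <- ns) (p2 (lsz M x) (a * sg x) 0 + p2 (lrz M x) (a * sgs x) 0).
  by rewrite -big_split; apply: eq_bigr => x _; rewrite !p2D addrACA.
have E3 : sumpairs ns (fun x y => p2 (ls L x y + ls M x y) (sg x * sg y) (sgs x * sgs y)
      + p2 (lr L x y + lr M x y) (sg x * sgs y) (sgs x * sg y)) =
  sumpairs ns (fun x y => p2 (ls L x y) (sg x * sg y) (sgs x * sgs y)
      + p2 (lr L x y) (sg x * sgs y) (sgs x * sg y)) +
  sumpairs ns (fun x y => p2 (ls M x y) (sg x * sg y) (sgs x * sgs y)
      + p2 (lr M x y) (sg x * sgs y) (sgs x * sg y)).
  rewrite -sumpairsD; congr sumpairs; apply/funext => x; apply/funext => y.
  by rewrite !p2D addrACA.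
rewrite E1 E2 E3; ring.
Qed.

Lemma expo_ext L M : [/\ lq L = lq M /\ lq' L = lq' M, lz L = lz M /\ lz' L = lz' M,
   lwz L = lwz M /\ lwz' L = lwz' M,
   (forall x, x \in ns -> [/\ ld L x = ld M x, lw L x = lw M x, lsz L x = lsz M x & lrz L x = lrz M x]) &
   forall x y, x \in ns -> y \in ns -> x != y -> ls L x y = ls M x y /\ lr L x y = lr M x y] ->
  expo L = expo M.
Proof.
move=> [[q q'] [z z'] [w w'] H1 H2]; rewrite /expo q q' z z' w w'; congr (_ + _ + _ + _).
- by apply: eq_big_seq => x xn; have [-> -> _ _] := H1 _ xn.
- by apply: eq_big_seq => x xn; have [_ _ -> ->] := H1 _ xn.
- by apply: eq_sumpairs; [exact: undup_uniq|move=> x y xn yn ne; have [-> ->] := H2 _ _ xn yn ne].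
Qed.

Record ints := Ints {
  kq : int; kq' : int; kz : int; kz' : int; kwz : int; kwz' : int;
  kd : C -> int; kw : C -> int; ksz : C -> int; krz : C -> int;
  ks : C -> C -> int; kr : C -> C -> int }.

Local Notation "'tp' k" := (twopii * k%:~R) (at level 10).
Definition logs_int (K : ints) : logs R :=
  Logs (tp (kq K)) (tp (kq' K)) (tp (kz K)) (tp (kz' K)) (tp (kwz K)) (tp (kwz' K))
    (fun x => tp (kd K x)) (fun x => tp (kw K x)) (fun x => tp (ksz K x)) (fun x => tp (krz K x))
    (fun x y => tp (ks K x y)) (fun x y => tp (kr K x y)).

(* the ambiguity in the value of E[Psi * X] / E[Psi] *)
Definition phases : set C := [set g | exists K, g = expC (expo (logs_int K))].

(** [expo] reads its arguments only on the finite list of nodes, so the integer-valued functions can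
    be replaced by finite tables of integers, decoded by [dec]. *)
Lemma phases_countable : countable phases.
Proof.
pose T := (int * int * int * int * int * int * seq int * seq int * seq int * seq int * seq (seq int) * seq (seq int))%type.
pose dec (p : T) : ints :=
  let: (q, q', z, z', w, w', d, ww, sz, rz, s, r) := p in
  Ints q q' z z' w w' (fun x => nth 0 d (index x ns)) (fun x => nth 0 ww (index x ns))
   (fun x => nth 0 sz (index x ns)) (fun x => nth 0 rz (index x ns))
   (fun x y => nth 0 (nth [::] s (index x ns)) (index y ns))
   (fun x y => nth 0 (nth [::] r (index x ns)) (index y ns)).
have sub : phases `<=` [set expC (expo (logs_int (dec p))) | p in [set: T]].
  move=> _ [K ->].
  exists (kq K, kq' K, kz K, kz' K, kwz K, kwz' K, [seq kd K x | x <- ns], [seq kw K x | x <- ns],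
    [seq ksz K x | x <- ns], [seq krz K x | x <- ns],
    [seq [seq ks K x y | y <- ns] | x <- ns], [seq [seq kr K x y | y <- ns] | x <- ns]) => //.
  have e1 (f : C -> int) x : x \in ns -> nth 0 [seq f y | y <- ns] (index x ns) = f x.
    by move=> xn; rewrite (nth_map x) ?index_mem ?nth_index.
  have e2 (f : C -> C -> int) x y : x \in ns -> y \in ns ->
      nth 0 (nth [::] [seq [seq f u v | v <- ns] | u <- ns] (index x ns)) (index y ns) = f x y.
    by move=> xn yn; rewrite (nth_map x) ?index_mem // nth_index // e1.
  congr expC; apply: expo_ext; split; try by split.
    by move=> x xn; split; rewrite /dec /= e1.
  by move=> x y xn yn _; split; rewrite /dec /= e2.
apply: (sub_countable (subset_card_le sub)).
apply: sub_countable (card_image_le _ _) _; exact: countableP.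
Qed.

Record node_logs := NodeLogs {
  nq : C; nd : C -> C; nw : C -> C; nsb : C -> C -> C; nr : C -> C -> C }.

Definition node_logs_of (W : marked_domain R) (K : node_logs) :=
  let w := unif W in
  [/\ expC (nq K) = derive1 w (Defs.root W),
      (forall x, x \in ns -> expC (nd K x) = derive1 w x /\ expC (nw K x) = w x) &
      forall x y, x \in ns -> y \in ns -> x != y ->
         expC (nsb K x y) = w x - w y /\ expC (nr K x y) = 1 - w x * (w y)^*].

(* the logarithms at a node zeta of Psi with w(zeta) = y close to 1 *)
Definition tip_logs (w : C -> C) (K : node_logs) (l y : C) : logs R :=
  Logs (nq K) (nq K) l l (LogC y) (LogC y) (nd K) (nw K)
    (fun x => LogC (y - w x)) (fun x => LogC (1 - y * (w x)^*)) (nsb K) (nr K).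

(** The derivative at zeta has the same power in numerator and denominator, so a common logarithm
    cancels. The boundary value thus needs no limit of w' at p. *)
Lemma expo_tip_l w K l y : expo (tip_logs w K l y) = expo (tip_logs w K 0 y).
Proof.
rewrite /expo /=.
have E l0 : p2 l0 (cdim kappa a) (cdim kappa 0) - p2 l0 (cdim kappa a) (cdim kappa 0) = 0 by exact: subrr.
congr (_ + _ + _ + _); congr (_ + _ - _).
have A (m u v : C) : m + u - u = m + v - v by rewrite !addrK.
exact: A.
Qed.

Definition tip_value (w : C -> C) (K : node_logs) (y : C) : C :=
  expo (tip_logs w K 0 y) + rexpo w.

(** What the computation of the values needs from a domain, psi being the inverse of its map. It
    will be met both by the initial domain and by each evolved one. *)
Record good_domain (W : marked_domain R) (psi : C -> C) : Prop := GoodDomain {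
  gd_disc : forall z, Defs.dom W z -> nm (unif W z) < 1;
  gd_der : forall z, Defs.dom W z -> derive1 (unif W) z != 0;
  gd_psi : forall y, nm y < 1 -> Defs.dom W (psi y) /\ unif W (psi y) = y;
  gd_psi_cont : forall y, nm y < 1 -> forall e : R, 0 < e -> exists2 d : R, 0 < d &
     forall y', nm y' < 1 -> nm (y' - y) < d -> nm (psi y' - psi y) < e;
  gd_psiK : forall z, Defs.dom W z -> psi (unif W z) = z;
  gd_cont : forall z, Defs.dom W z -> ccont (unif W) z;
  gd_root : unif W (Defs.root W) = 0 }.

Section Good.
Variables (W : marked_domain R) (psi : C -> C) (K : node_logs).
Hypothesis gW : good_domain W psi.
Hypothesis nW : forall x, x \in ns -> Defs.dom W x /\ x <> Defs.root W.
Hypothesis KW : node_logs_of W K.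
Let w := unif W.

(** At y = 1 the bases are 1, 1 - w x and its conjugate, of positive real part as |w x| < 1;
    finitely many nodes leave a common margin. Inside this radius [LogC] is a continuous logarithm
    of each. *)
Lemma tip_radius : exists2 r0 : R, 0 < r0 & forall y, nm (y - 1) < r0 ->
  0 < Re y /\ forall x, x \in ns -> 0 < Re (y - w x) /\ 0 < Re (1 - y * (w x)^*).
Proof.
have [x xn|r r0 Hr] := @seq_min_pos R _ ns (fun x => 1 - nm (w x)).
  by rewrite subr_gt0; apply: (gd_disc gW); have [] := nW xn.
exists (Num.min 1 r); first by rewrite lt_min ltr01.
move=> y; rewrite lt_min => /andP[y1 yr].
have Rey : 1 - nm (y - 1) <= Re y.
  have := Re_le_nm (y - 1); rewrite cReB Re1 ler_norml => /andP[h _]; lra.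
split; first by lra.
move=> x xn; have h := Hr _ xn.
have Rewx : Re (w x) <= nm (w x) by apply: le_trans (ler_norm _) (Re_le_nm _).
split; first by rewrite cReB; lra.
have n : Re (y * (w x)^*) <= nm (w x) + nm (y - 1) * nm (w x).
  apply: le_trans (ler_norm _) (le_trans (Re_le_nm _) _); rewrite nmM nm_conj.
  have : nm y <= 1 + nm (y - 1).
    by have := nmD (y - 1) 1; rewrite subrK nm1; lra.
  move=> hy; have := ler_wpM2r (nm_ge0 (w x)) hy; lra.
have : nm (y - 1) * nm (w x) <= nm (y - 1).
  rewrite -[leRHS]mulr1 ler_wpM2l ?nm_ge0 //; lra.
rewrite cReB Re1; lra.
Qed.

Lemma tip_value_ccont y : 0 < Re y -> (forall x, x \in ns -> 0 < Re (y - w x) /\ 0 < Re (1 - y * (w x)^*)) ->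
  ccont (tip_value w K) y.
Proof.
move=> y0 H; rewrite /tip_value /expo /=.
apply: ccontD; last exact: ccont_cst.
apply: ccontD; last exact: ccont_cst.
apply: ccontD.
  apply: ccontD; last exact: ccont_cst.
  apply: ccontD; last by apply: ccontN; apply: ccont_p2; exact: LogC_ccont.
  by apply: ccontD; [exact: ccont_cst|apply: ccont_p2; exact: LogC_ccont].
apply: (@ccont_sum _ ns (fun x y => p2 (LogC (y - w x)) (a * sg x) 0 + p2 (LogC (1 - y * (w x)^*)) (a * sgs x) 0)) => x xn.
have [h1 h2] := H _ xn; apply: ccontD; apply: ccont_p2.
  apply: (@ccont_comp _ (fun y => y - w x)); last exact: LogC_ccont.
  by apply: ccontD; [exact: ccont_id|exact: ccont_cst].
apply: (@ccont_comp _ (fun y => 1 - y * (w x)^*)); last exact: LogC_ccont.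
apply: ccontD; first exact: ccont_cst.
by apply: ccontN; apply: ccontM; [exact: ccont_id|exact: ccont_cst].
Qed.

Lemma tip_logs_of l zeta : Defs.dom W zeta -> expC l = derive1 w zeta ->
  0 < Re (w zeta) -> (forall x, x \in ns -> 0 < Re (w zeta - w x) /\ 0 < Re (1 - w zeta * (w x)^*)) ->
  logs_of X W zeta (tip_logs w K l (w zeta)).
Proof.
move=> Wz ll y0 H; have [K1 K2 K3] := KW.
apply: And5; [exact: (conj K1 K1)|exact: (conj ll ll)|exact: (conj (expC_LogC y0) (expC_LogC y0))| |exact: K3].
move=> x xn; have [h1 h2] := H _ xn; have [k1 k2] := K2 _ xn.
by apply: And4; [exact: k1|exact: k2|exact: expC_LogC|exact: expC_LogC].
Qed.

Lemma logs_of_int zeta L I : logs_of X W zeta L -> logs_of X W zeta (addl L (logs_int I)).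
Proof.
move=> [[q q'] [z z'] [wz wz'] H1 H2];
have E (l c : C) k : expC l = c -> expC (l + tp k) = c by move=> <-; rewrite expCD expC_2piik mulr1.
split; [by split; exact: E|by split; exact: E|by split; exact: E| |].
  by move=> x xn; have [h1 h2 h3 h4] := H1 _ xn; split; exact: E.
by move=> x y xn yn ne; have [h1 h2] := H2 _ _ xn yn ne; split; exact: E.
Qed.

Lemma logs_of_diff zeta L M : logs_of X W zeta L -> logs_of X W zeta M ->
  exists I, expo L = expo (addl M (logs_int I)).
Proof.
move=> [[q q'] [z z'] [wz wz'] H1 H2] [[mq mq'] [mz mz'] [mwz mwz'] M1 M2].
have [iq eq] := expC_inj (etrans q (esym mq)); have [iq' eq'] := expC_inj (etrans q' (esym mq')).
have [iz ez] := expC_inj (etrans z (esym mz)); have [iz' ez'] := expC_inj (etrans z' (esym mz')).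
have [iw ew] := expC_inj (etrans wz (esym mwz)); have [iw' ew'] := expC_inj (etrans wz' (esym mwz')).
have ch (f g : C -> C) : (forall x, x \in ns -> expC (f x) = expC (g x)) ->
    exists i : C -> int, forall x, x \in ns -> f x = g x + tp (i x).
  move=> E; have : forall x, exists k : int, x \in ns -> f x = g x + tp k.
    move=> x; have [xn|_] := boolP (x \in ns); last by exists 0.
    by have [k kE] := expC_inj (E _ xn); exists k.
  by case/boolp.choice => i Hi; exists i.
have ch2 (f g : C -> C -> C) : (forall x y, x \in ns -> y \in ns -> x != y -> expC (f x y) = expC (g x y)) ->
    exists i : C -> C -> int, forall x y, x \in ns -> y \in ns -> x != y -> f x y = g x y + tp (i x y).
  move=> E; have : forall p : C * C, exists k : int, p.1 \in ns -> p.2 \in ns -> p.1 != p.2 -> f p.1 p.2 = g p.1 p.2 + tp k.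
    move=> [x y] /=; have [/and3P[xn yn ne]|h] := boolP [&& x \in ns, y \in ns & x != y]; last first.
      by exists 0 => xn yn ne; move: h; rewrite xn yn ne.
    by have [k kE] := expC_inj (E _ _ xn yn ne); exists k.
  by case/boolp.choice => i Hi; exists (fun x y => i (x, y)) => x y; exact: (Hi (x, y)).
have [id hd] : exists i, forall x, x \in ns -> ld L x = ld M x + tp (i x).
  by apply: ch => x xn; have [h _ _ _] := H1 _ xn; have [m _ _ _] := M1 _ xn; exact: etrans h (esym m).
have [iw2 hw] : exists i, forall x, x \in ns -> lw L x = lw M x + tp (i x).
  by apply: ch => x xn; have [_ h _ _] := H1 _ xn; have [_ m _ _] := M1 _ xn; exact: etrans h (esym m).
have [isz hsz] : exists i, forall x, x \in ns -> lsz L x = lsz M x + tp (i x).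
  by apply: ch => x xn; have [_ _ h _] := H1 _ xn; have [_ _ m _] := M1 _ xn; exact: etrans h (esym m).
have [irz hrz] : exists i, forall x, x \in ns -> lrz L x = lrz M x + tp (i x).
  by apply: ch => x xn; have [_ _ _ h] := H1 _ xn; have [_ _ _ m] := M1 _ xn; exact: etrans h (esym m).
have [is2 hs] : exists i, forall x y, x \in ns -> y \in ns -> x != y -> ls L x y = ls M x y + tp (i x y).
  by apply: ch2 => x y xn yn ne; have [h _] := H2 _ _ xn yn ne; have [m _] := M2 _ _ xn yn ne; exact: etrans h (esym m).
have [ir hr] : exists i, forall x y, x \in ns -> y \in ns -> x != y -> lr L x y = lr M x y + tp (i x y).
  by apply: ch2 => x y xn yn ne; have [_ h] := H2 _ _ xn yn ne; have [_ m] := M2 _ _ xn yn ne; exact: etrans h (esym m).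
exists (Ints iq iq' iz iz' iw iw' id iw2 isz irz is2 ir).
apply: expo_ext; split; [by split|by split|by split| |].
  by move=> x xn; split; [exact: hd|exact: hw|exact: hsz|exact: hrz].
by move=> x y xn yn ne; split; [exact: hs|exact: hr].
Qed.

(** Read in the coordinate y = w(zeta), any admissible branch divided by exp([tip_value]) is
    continuous with values in the countable set of phases, hence constant; letting y tend to 1 gives
    v. *)
Lemma Ehat_sound v : Ehat kappa W X v -> exists2 g, phases g & v = expC (tip_value w K 1) * g.
Proof.
move=> [g [U [tU UD cg fg gv]]].
have [V /nbhsCP[r1 r10 Hr1] VU] := tU.
have [r0 r00 Hr0] := tip_radius.
pose r := Num.min r0 r1; have rr0 : 0 < r by rewrite lt_min r00.
have val y : nm y < 1 -> nm (y - 1) < r -> U (psi y) /\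
    exists2 p, phases p & g (psi y) = expC (tip_value w K y) * p.
  rewrite lt_min => y1 /andP[h0 h1]; have [Dz wz] := gd_psi gW y1.
  have Uz : U (psi y) by apply: VU; split => //; rewrite /preimage /= wz; exact: Hr1.
  split => //; have [y0 H] := Hr0 _ h0.
  have zn : psi y \notin nodes X.
    apply/negP; rewrite -mem_undup => /H[]; rewrite /w wz subrr => /=; by rewrite ltxx.
  have zr : psi y <> Defs.root W.
    by move=> E; move: y0; rewrite -wz E (gd_root gW) ltxx.
  have [L LW gE] := (quotient_valuesP kappa sg0 (W := W) (g (psi y)) zn Dz zr nW).1 (fg _ Uz).
  have [l ll] := expC_log (gd_der gW Dz).
  have TL := @tip_logs_of l (psi y) Dz ll; rewrite /w wz in TL.
  have {}TL := TL y0 H.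
  have [I EI] := logs_of_diff LW TL.
  exists (expC (expo (logs_int I))); first by exists I.
  by rewrite gE EI expo_add expo_tip_l -expCD /tip_value; congr expC; ring.
have Re10 : 0 < Re (1 : C) by [].
have [h1 H1] := Hr0 1 ltac:(by rewrite subrr nm0).
have cT y : nm (y - 1) < r -> ccont (tip_value w K) y.
  by rewrite lt_min => /andP[/Hr0[? ?] _]; exact: tip_value_ccont.
pose c y := g (psi y) * expC (- tip_value w K y).
have cph y : nm y < 1 -> nm (y - 1) < r -> phases (c y) /\ g (psi y) = expC (tip_value w K y) * c y.
  move=> y1 yr; have [_ [p hp E]] := val y y1 yr.
  have -> : c y = p by rewrite /c E mulrAC -expCD subrr expC0 mul1r.
  by [].
(* The region |y| < 1, |y - 1| < r is convex, so two of its points are joined by a segment to which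
   [countable_const] applies. *)
have ccst y1 y2 : nm y1 < 1 -> nm (y1 - 1) < r -> nm y2 < 1 -> nm (y2 - 1) < r -> c y1 = c y2.
  move=> a1 b1 a2 b2; pose pa (s : R) := y1 + cst_of s * (y2 - y1).
  have conv (o : C) rho s : nm (y1 - o) < rho -> nm (y2 - o) < rho -> 0 <= s <= 1 -> nm (pa s - o) < rho.
    move=> h h' /andP[s0 s1].
    have -> : pa s - o = cst_of (1 - s) * (y1 - o) + cst_of s * (y2 - o) by rewrite /pa cstB cst1; ring.
    apply: le_lt_trans (nmD _ _) _; rewrite !nmM !nm_cst (ger0_norm s0) ger0_norm ?subr_ge0 //.
    have [->|sn] := eqVneq s 0; first by rewrite mul0r subr0 mul1r addr0.
    have s0' : 0 < s by rewrite lt_def sn.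
    have : (1 - s) * nm (y1 - o) <= (1 - s) * rho by rewrite ler_wpM2l ?subr_ge0 // ltW.
    have : s * nm (y2 - o) < s * rho by rewrite ltr_pM2l.
    lra.
  have pin s : 0 <= s <= 1 -> nm (pa s) < 1 /\ nm (pa s - 1) < r.
    by move=> hs; split; [rewrite -[pa s]subr0; apply: conv => //; rewrite subr0|exact: conv].
  have p0 : pa 0 = y1 by rewrite /pa cst0 mul0r addr0.
  have p1 : pa 1 = y2 by rewrite /pa cst1 mul1r addrC subrK.
  rewrite -p0 -p1; apply: (@countable_const _ (fun s => c (pa s)) 0 1 phases ler01); last first.
  - by move=> s hs; have [q1 q2] := pin s hs; have [] := cph _ q1 q2.
  - exact: phases_countable.
  have pcont s e : 0 < e -> exists2 d : R, 0 < d & forall s', `|s' - s| < d -> nm (pa s' - pa s) < e.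
    move=> e0; have n0 : 0 < 1 + nm (y2 - y1) by rewrite ltr_pwDl ?nm_ge0.
    exists (e / (1 + nm (y2 - y1))); first by rewrite divr_gt0.
    move=> s'; rewrite ltr_pdivlMr // => h; apply: le_lt_trans h.
    have -> : pa s' - pa s = cst_of (s' - s) * (y2 - y1) by rewrite /pa cstB; ring.
    by rewrite nmM nm_cst ler_wpM2l // lerDr.
  have c1 : {within `[0, 1], continuous (fun s => g (psi (pa s)))}.
    apply: within_eps => s; rewrite /= in_itv /= => hs e e0.
    have [q1 q2] := pin s hs; have [Uz _] := val _ q1 q2.
    have [d1 d10 Hd1] := within_ccontP cg Uz e0.
    have [d2 d20 Hd2] := gd_psi_cont gW q1 d10.
    have [d3 d30 Hd3] := pcont s _ d20.
    exists d3 => // s'; rewrite /= in_itv /= => hs' ss.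
    have [q1' q2'] := pin s' hs'; have [Uz' _] := val _ q1' q2'.
    by apply: Hd1 => //; apply: Hd2 => //; exact: Hd3.
  have c2 : {within `[0, 1], continuous (fun s => expC (- tip_value w K (pa s)))}.
    apply: within_eps => s; rewrite /= in_itv /= => hs e e0.
    have [q1 q2] := pin s hs.
    have cc : ccont (fun y => expC (- tip_value w K y)) (pa s).
      by apply: ccont_comp; [apply: ccontN; exact: cT|exact: ccont_exp].
    have [d2 d20 Hd2] := cc e e0; have [d3 d30 Hd3] := pcont s _ d20.
    by exists d3 => // s' _ ss; apply: Hd2; exact: Hd3.
  by move=> s; apply: cvgM; [exact: c1|exact: c2].
(* The radial approach to 1, along which the limit of g and the continuity of [tip_value] at 1 are
   compared. *)
pose yy (d : R) : C := cst_of (1 - d).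
have yyP d : 0 < d -> d < 1 -> nm (yy d) < 1 /\ nm (yy d - 1) = d.
  move=> d0 d1; split; first by rewrite nm_cst gtr0_norm ?subr_gt0 //; lra.
  have -> : yy d - 1 = cst_of (- d) by rewrite /yy cstB cst1 cstN; ring.
  by rewrite nm_cst normrN gtr0_norm.
pose d0 := Num.min 1 r / 2; have d00 : 0 < d0 by rewrite divr_gt0 // lt_min ltr01.
have [d01 d0r] : d0 < 1 /\ d0 < r by exact: (min_half_lt ltr01 rr0).
have [y01 y02] := yyP _ d00 d01; have y0r : nm (yy d0 - 1) < r by rewrite y02.
have [ph0 _] := cph _ y01 y0r.
exists (c (yy d0)) => //.
apply/eqP; rewrite -subr_eq0 -nm_eq0 eq_le nm_ge0 andbT.
apply/ler_addgt0Pr => e e0; rewrite add0r.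
have e2 : 0 < e / 2 by rewrite divr_gt0.
have [V' /nbhsCP[r2 r20 Hr2] VU'] : tip W (g @^-1` [set y | nm (y - v) < e / 2]).
  by apply: gv; apply/nbhsCP; exists (e / 2).
have cc : ccont (fun y => expC (tip_value w K y) * c (yy d0)) 1.
  apply: ccontM; last exact: ccont_cst.
  apply: ccont_comp; last exact: ccont_exp.
  by apply: cT; rewrite subrr nm0.
have [r3 r30 Hr3] := cc _ e2.
have m1 : 0 < Num.min 1 r by rewrite lt_min ltr01.
have m2 : 0 < Num.min r2 r3 by rewrite lt_min r20.
have m12 : 0 < Num.min (Num.min 1 r) (Num.min r2 r3) by rewrite lt_min m1.
pose d := Num.min (Num.min 1 r) (Num.min r2 r3) / 2.
have dd0 : 0 < d by rewrite divr_gt0.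
have [] : d < Num.min 1 r /\ d < Num.min r2 r3 by exact: min_half_lt.
rewrite lt_min => /andP[dm1 dmr]; rewrite lt_min => /andP[dm2 dm3].
have [q1 q2] := yyP _ dd0 dm1.
have q2r : nm (yy d - 1) < r by rewrite q2.
have [_ gE] := cph _ q1 q2r; rewrite (ccst _ _ q1 q2r y01 y0r) in gE.
have [Dz wz] := gd_psi gW q1.
have : nm (g (psi (yy d)) - v) < e / 2.
  by apply: VU'; split => //; rewrite /preimage /= wz; apply: Hr2; rewrite q2.
have := Hr3 (yy d); rewrite q2 => /(_ dm3); rewrite -gE => A B.
apply: le_trans (nm_tri (g (psi (yy d))) _ _) _; rewrite [nm (v - _)]nmBC; lra.
Qed.

(** The branch is explicit: exp([tip_value]) at w(z) times the constant phase, defined for w(z)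
    within [tip_radius] of 1. *)
Lemma Ehat_complete g : phases g -> Ehat kappa W X (expC (tip_value w K 1) * g).
Proof.
move=> [I ->]; have [r0 r00 Hr0] := tip_radius.
pose G (y : C) := expC (tip_value w K y) * expC (expo (logs_int I)).
have cG y : nm (y - 1) < r0 -> ccont G y.
  move=> /Hr0[y0 H]; apply: ccontM; last exact: ccont_cst.
  by apply: ccont_comp; [exact: tip_value_ccont|exact: ccont_exp].
exists (fun z => G (w z)), [set z | Defs.dom W z /\ nm (w z - 1) < r0]; split.
- exists [set y | nm (y - 1) < r0]; first by apply/nbhsCP; exists r0.
  by move=> z [].
- by move=> z [].
- apply: within_ccont => z [Dz wz].
  by apply: ccont_comp; [exact: (gd_cont gW Dz)|exact: cG].
- move=> z [Dz wz]; have [y0 H] := Hr0 _ wz.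
  have zn : z \notin nodes X.
    by apply/negP; rewrite -mem_undup => /H[]; rewrite subrr ltxx.
  have zr : z <> Defs.root W by move=> E; move: y0; rewrite E /w (gd_root gW) ltxx.
  apply/(quotient_valuesP kappa sg0 (W := W) _ zn Dz zr nW).
  have [l ll] := expC_log (gd_der gW Dz).
  exists (addl (tip_logs w K l (w z)) (logs_int I)).
    by apply: logs_of_int; exact: tip_logs_of.
  by rewrite expo_add expo_tip_l /G -expCD /tip_value; congr expC; ring.
- move=> P /nbhsCP[e e0 He]; have [d d0 Hd] := cG 1 ltac:(by rewrite subrr nm0) e e0.
  exists [set y | nm (y - 1) < d]; first by apply/nbhsCP; exists d.
  by move=> z [Dz wz]; apply: He; exact: Hd.
Qed.

End Good.
End EhatSet.

(** * The evolved domains *)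

Section NodesOfValue.
Variable R : realType.
Local Notation C := (Cplx R).

(** The existence of one value already forces the nodes to be admissible and provides logarithms at
    them: it suffices to look at the numerator at a single point psi(1 - d) close to the tip. *)
Lemma Ehat_nodes (kappa : R) (W : marked_domain R) (X : rooted_vertex R) (psi : C -> C) (v : C) :
  good_domain W psi -> Ehat kappa W X v ->
  (forall x, x \in undup (nodes X) -> Defs.dom W x /\ x <> Defs.root W) /\
  exists K, node_logs_of X W K.
Proof.
move=> gW [g [U [[V /nbhsCP[r r0 Hr] VU] _ _ fg _]]].
have [d0 d1] := min_half_lt (ltr01 : 0 < 1 :> R) r0.
set d := Num.min 1 r / 2 in d0 d1; have dp : 0 < d by rewrite divr_gt0 // lt_min ltr01.
have y1 : nm (cst_of (1 - d) : C) < 1 by rewrite nm_cst gtr0_norm; lra.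
have y2 : nm (cst_of (1 - d) - 1 : C) < r.
  have -> : cst_of (1 - d) - 1 = cst_of (- d) :> C by rewrite cstB cst1 cstN; ring.
  by rewrite nm_cst normrN gtr0_norm.
have [Dz wz] := gd_psi gW y1.
have Uz : U (psi (cst_of (1 - d))).
  by apply: VU; split; [exact: Dz|rewrite /preimage /= wz; exact: Hr].
have [_ [us Hd [L [L1 L2 L3 L4 L5] _]] _] := fg _ Uz.
have sub x : x \in undup (nodes X) -> x \in nodes (star (one_leg kappa (psi (cst_of (1 - d)))) X).
  by rewrite /= !mem_undup mem_cat => ->; rewrite orbT.
split; first by move=> x /sub; exact: Hd.
exists (NodeLogs (log_dq L) (log_d L) (log_w L) (log_sub L) (log_refl L)).
apply: And3; first exact: L1.
  by move=> x /sub xn; split; [exact: L2|exact: L3].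
by move=> x y /sub xn /sub yn ne; split; [exact: L4|exact: L5].
Qed.

End NodesOfValue.

Section EvolvedDomain.
Variable R : realType.
Local Notation C := (Cplx R).
Implicit Types (z y : C) (t s e : R).

Lemma ppos_eq (f g : R -> C) t : continuous f -> continuous g -> 0 <= t ->
  (forall s, 0 < s < t -> f s = g s) -> ppos f t = ppos g t.
Proof.
move=> cf cg t0 E; apply/eqP; rewrite -subr_eq0 -nm_eq0 eq_le nm_ge0 andbT.
rewrite -[leRHS](mul0r t); apply: ppos_diff_le_cst; [exact: cf|exact: cg|exact: t0|].
by move=> s hs; rewrite E // subrr nm0.
Qed.

Variables (D : set C) (q : C) (w : C -> C).
Hypotheses (oD : open D) (Dq : D q) (wder : forall z, D z -> derivable w z 1)
  (winj : {in D &, injective w}) (wD : w @` D = @unit_disc R) (wq : w q = 0).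

Lemma domain_ball z : D z -> exists2 r : R, 0 < r & forall y, nm (y - z) < r -> D y.
Proof. by move=> Dz; apply/nbhsCP; exact: (open_nbhs_nbhs (conj oD Dz)). Qed.
Lemma unif_cdiff z : D z -> cdiff w z (derive1 w z).
Proof. by move=> Dz; apply: cdiff_derive1; exact: wder. Qed.
Lemma unif_inj z y : D z -> D y -> w z = w y -> z = y.
Proof. by move=> Dz Dy; apply: winj; rewrite inE. Qed.
Lemma unif_disc z : D z -> nm (w z) < 1.
Proof.
move=> Dz; have : @unit_disc R (w z) by rewrite -wD; exists z.
by rewrite /unit_disc /= -cst1 normC_lt.
Qed.
Lemma unif_surj y : nm y < 1 -> exists2 z, D z & w z = y.
Proof.
move=> y1; have : @unit_disc R y by rewrite /unit_disc /= -cst1 normC_lt.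
by rewrite -wD => -[z Dz <-]; exists z.
Qed.

Definition psi0 y : C := xget q [set z | D z /\ w z = y].
Lemma psi0P y : nm y < 1 -> D (psi0 y) /\ w (psi0 y) = y.
Proof.
move=> /unif_surj[z Dz wz]; rewrite /psi0.
exact: (@xgetPex _ q [set z | D z /\ w z = y] (ex_intro _ z (conj Dz wz))).
Qed.
Lemma psi0_cont y : nm y < 1 -> forall e, 0 < e -> exists2 d : R, 0 < d &
  forall y', nm y' < 1 -> nm (y' - y) < d -> nm (psi0 y' - psi0 y) < e.
Proof.
move=> y1 e e0; have [D1 w1] := psi0P y1.
have [d d0 Hd] := inj_inv_cont domain_ball unif_cdiff unif_inj D1 e0.
exists d => // y' y'1 yd; have [D2 w2] := psi0P y'1.
by apply: Hd => //; rewrite w1 w2.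
Qed.
Lemma psi0K z : D z -> psi0 (w z) = z.
Proof. by move=> Dz; have [D1 w1] := psi0P (unif_disc Dz); exact: unif_inj. Qed.

Variables (th : R -> R) (x : R -> C).
Hypothesis cth : continuous th.
Hypothesis xE : forall t, 0 <= t -> x t = xi th t.
Local Notation W0 := (MarkedDomain D q w).
Local Notation Wt t := (evolved x t W0).

Lemma evolved_alive t z : 0 <= t -> Defs.dom (Wt t) z ->
  D z /\ exists e, [/\ 0 < e, e < 1 & alive th e (w z) t].
Proof.
move=> t0 [Dz /(lifetime_alive cth xE t0)[e e0 A]]; split; first exact: Dz.
(* Capped at 1/2 so that e < 1. *)
exists (Num.min e (2^-1)).
have m0 : 0 < Num.min e 2^-1 by rewrite lt_min e0 invr_gt0 ltr0n.
split; first exact: m0.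
  by apply: (@le_lt_trans _ _ 2^-1); [rewrite ge_min lexx orbT|rewrite invf_lt1 ?ltr1n].
have me : Num.min e 2^-1 <= e by rewrite ge_min lexx.
by have [] := alive_mono cth xE m0 me t0 A.
Qed.

Lemma alive_evolved e t z : 0 < e -> 0 <= t -> D z -> alive th e (w z) t -> Defs.dom (Wt t) z.
Proof. by move=> e0 t0 Dz A; split; [exact: Dz|exact: (alive_lifetime cth xE e0 t0 A)]. Qed.

Lemma evolved_unif e t z : 0 < e -> 0 <= t -> alive th e (w z) t -> unif (Wt t) z = We th e (w z) t.
Proof. by move=> e0 t0 A; rewrite /= (flowE cth xE e0 t0 A) (xE t0). Qed.

(** Being alive is open in the starting point, so near z the map w_t is given by the regularised
    flow at one level e and the chain rule applies. *)
Lemma evolved_cdiff e t z : 0 < e -> 0 <= t -> D z -> alive th e (w z) t ->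
  cdiff (unif (Wt t)) z (expC (ppos (kA th e (w z) (w z)) t) * derive1 w z / xi th t).
Proof.
move=> e0 t0 Dz A; have [r r0 Hr] := alive_open cth e0 t0 A.
have [d d0 Hd] := cdiff_cont (unif_cdiff Dz) r0.
apply: (@cdiff_near _ (fun y => Ue th e (w y) t * (xi th t)^-1) _ z _ d d0).
  move=> y yd; have A' := Hr _ (Hd _ yd).
  by rewrite (evolved_unif e0 t0 A').
have := cdiffM (cdiff_comp (unif_cdiff Dz) (Ue_cdiff cth e0 t0 A)) (cdiff_cst (xi th t)^-1 z).
by rewrite mulr0 addr0.
Qed.

Lemma evolved_pre t y : 0 <= t -> nm y < 1 -> exists z, [/\ D z,
  Defs.dom (Wt t) z & unif (Wt t) z = y].
Proof.
move=> t0 y1; pose e := (1 - nm y) / 2.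
have e0 : 0 < e by rewrite divr_gt0 // subr_gt0.
have [K K0 H] := flow_surj cth (erefl e) y1 t0.
(* The target of the unrotated flow is y xi, since w_t = g_t / xi. *)
have n1 : nm (y * xi th t) <= nm y by rewrite nmM nm_xi mulr1.
have [u [_ [[nu _] [Au _] [Uu _] _]]] := H _ _ n1 n1.
have [z Dz wz] := unif_surj (le_lt_trans nu y1).
have A : alive th e (w z) t by rewrite wz.
exists z; split; [exact: Dz|exact: alive_evolved e0 t0 Dz A|].
by rewrite (evolved_unif e0 t0 A) wz /We Uu mulfK ?xi_neq0.
Qed.

Lemma evolved_inj t z z' : 0 <= t -> Defs.dom (Wt t) z -> Defs.dom (Wt t) z' ->
  unif (Wt t) z = unif (Wt t) z' -> z = z'.
Proof.
move=> t0 Dz Dz'.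
have [Dz1 [e [e0 _ A]]] := evolved_alive t0 Dz.
have [Dz1' [e' [e0' _ A']]] := evolved_alive t0 Dz'.
have m0 : 0 < Num.min e e' by rewrite lt_min e0.
have [B _] := alive_mono cth xE m0 (ltac:(by rewrite ge_min lexx) : Num.min e e' <= e) t0 A.
have [B' _] := alive_mono cth xE m0 (ltac:(by rewrite ge_min lexx orbT) : Num.min e e' <= e') t0 A'.
rewrite (evolved_unif m0 t0 B) (evolved_unif m0 t0 B') /We => E.
apply: unif_inj => //; apply: (flow_inj cth m0 t0 B B').
by apply: (mulIf _ E); rewrite invr_eq0 xi_neq0.
Qed.

Definition psi t y : C := xget q [set z | Defs.dom (Wt t) z /\ unif (Wt t) z = y].
Lemma psiP t y : 0 <= t -> nm y < 1 -> Defs.dom (Wt t) (psi t y) /\ unif (Wt t) (psi t y) = y.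
Proof.
move=> t0 /(evolved_pre t0)[z [_ Dz wz]].
exact: (@xgetPex _ q [set z | Defs.dom (Wt t) z /\ unif (Wt t) z = y] (ex_intro _ z (conj Dz wz))).
Qed.

(** The inverse of w_t is the Lipschitz inverse of the flow followed by the inverse of w, continuous
    by [inj_inv_cont]. The radius rho = (1 + |y|)/2 leaves room for a neighbourhood of y. *)
Lemma psi_cont t y : 0 <= t -> nm y < 1 -> forall e, 0 < e -> exists2 d : R, 0 < d &
  forall y', nm y' < 1 -> nm (y' - y) < d -> nm (psi t y' - psi t y) < e.
Proof.
move=> t0 y1 eps eps0; pose rho := (1 + nm y) / 2.
have rho0 : 0 <= rho by rewrite divr_ge0 // addr_ge0 // nm_ge0.
have rho1 : rho < 1 by rewrite /rho; lra.
have yrho : nm y < rho by rewrite /rho; lra.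
pose e := (1 - rho) / 2; have e0 : 0 < e by rewrite divr_gt0 // subr_gt0.
have [K K0 H] := flow_surj cth (erefl e) rho1 t0.
have [D1 w1] := psiP t0 y1; have Dp := D1.1.
have wp1 := unif_disc Dp.
have [d d0 Hd] := inj_inv_cont domain_ball unif_cdiff unif_inj Dp eps0.
exists (Num.min (d / K) (rho - nm y)); first by rewrite lt_min divr_gt0 //= subr_gt0.
move=> y' y'1; rewrite lt_min => /andP[yd yr].
have y'rho : nm y' < rho.
  by have := nmD (y' - y) y; rewrite subrK => h; apply: le_lt_trans h _; rewrite -ltrBrDr.
have n0 : nm (y * xi th t) <= rho by rewrite nmM nm_xi mulr1 ltW.
have n1 : nm (y' * xi th t) <= rho by rewrite nmM nm_xi mulr1 ltW.
have [u [u' [[nu nu'] [Au Au'] [Uu Uu'] uu]]] := H _ _ n0 n1.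
have [z Dz wz] := unif_surj (le_lt_trans nu rho1).
have [z' Dz' wz'] := unif_surj (le_lt_trans nu' rho1).
have A : alive th e (w z) t by rewrite wz.
have A' : alive th e (w z') t by rewrite wz'.
have [D2 w2] := psiP t0 y'1.
have E : z = psi t y.
  apply: (evolved_inj t0 (alive_evolved e0 t0 Dz A) D1).
  by rewrite w1 (evolved_unif e0 t0 A) wz /We Uu mulfK ?xi_neq0.
have E' : z' = psi t y'.
  apply: (evolved_inj t0 (alive_evolved e0 t0 Dz' A') D2).
  by rewrite w2 (evolved_unif e0 t0 A') wz' /We Uu' mulfK ?xi_neq0.
rewrite -E'; apply: Hd; first exact: Dz'.
rewrite -E wz wz' nmBC; apply: le_lt_trans uu _.
rewrite -mulrBl nmM nm_xi mulr1 nmBC.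
by move: yd; rewrite ltr_pdivlMr // mulrC.
Qed.

Lemma root_alive e t : 0 < e -> e < 1 -> 0 <= t -> alive th e (w q) t.
Proof. by move=> e0 e1 t0; rewrite wq; have [] := Ue_at0 cth xE e0 e1 t0. Qed.

Lemma evolved_good t : 0 <= t -> good_domain (Wt t) (psi t).
Proof.
move=> t0; apply: GoodDomain.
- move=> z /(evolved_alive t0)[Dz [e [e0 _ A]]].
  by rewrite (evolved_unif e0 t0 A) nm_We_lt1 // unif_disc.
- move=> z /(evolved_alive t0)[Dz [e [e0 _ A]]].
  rewrite (derive1_cdiff (evolved_cdiff e0 t0 Dz A)).
  have dw0 := inj_deriv_neq0 domain_ball unif_cdiff unif_inj Dz.
  apply: mulf_neq0; last by rewrite invr_eq0; exact: xi_neq0.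
  by apply: mulf_neq0; [exact: expC_neq0|exact: dw0].
- by move=> y y1; exact: psiP.
- by move=> y y1; exact: psi_cont.
- move=> z Dz; have [Dz0 [e [e0 _ A]]] := evolved_alive t0 Dz.
  have n1 : nm (unif (Wt t) z) < 1 by rewrite (evolved_unif e0 t0 A) nm_We_lt1 // unif_disc.
  by have [D1 w1] := psiP t0 n1; exact: (evolved_inj t0 D1 Dz w1).
- move=> z /(evolved_alive t0)[Dz [e [e0 _ A]]].
  exact: cdiff_cont (evolved_cdiff e0 t0 Dz A).
- have e0 : 0 < 2^-1 :> R by rewrite invr_gt0.
  have e1 : 2^-1 < 1 :> R by rewrite invf_lt1 ?ltr1n.
  rewrite (evolved_unif e0 t0 (root_alive e0 e1 t0)) wq /We.
  by have [-> _] := Ue_at0 cth xE e0 e1 t0; rewrite mul0r.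
Qed.

Lemma base_good : good_domain W0 psi0.
Proof.
apply: GoodDomain.
- exact: unif_disc.
- by move=> z Dz; exact: (inj_deriv_neq0 domain_ball unif_cdiff unif_inj Dz).
- exact: psi0P.
- exact: psi0_cont.
- exact: psi0K.
- by move=> z Dz; exact: cdiff_cont (unif_cdiff Dz).
- exact: wq.
Qed.

(** At the fixed point r = 1, so the derivative of the flow at 0 is e^t: the capacity
    parametrisation of radial Loewner chains. *)
Lemma kA00 e s : 0 < e -> e < 1 -> 0 <= s -> kA th e 0 0 s = 1.
Proof.
move=> e0 e1 s0; have [U0 A] := Ue_at0 cth xE e0 e1 s0.
have r1 : re th e 0 s = 1.
  by rewrite (reE e0 A) ?lexx ?andbT // /We U0 mul0r subr0 invr1.
by rewrite /kA r1; ring.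
Qed.

Lemma ppos_kA00 e t : 0 < e -> e < 1 -> 0 <= t -> ppos (kA th e 0 0) t = cst_of t.
Proof.
move=> e0 e1 t0; have c1 : continuous (fun _ : R => 1 : C) by move=> ?; exact: cvg_cst.
rewrite (@ppos_eq _ (fun _ => 1) t (@kA_continuous _ _ cth _ e0 0 0) c1 t0).
  have cc : continuous (fun s : R => cst_of s : C) by apply: continuousCcst => s; exact: cvg_id.
  rewrite [RHS](@ppos_uniq _ (fun _ => 1) (fun s => cst_of s) t c1 cc t0) ?cst0 ?add0r //.
  by move=> s _; rewrite -cst1; apply: dC_real; exact: is_derive_id.
by move=> s /andP[s0 _]; rewrite kA00 // ltW.
Qed.

Section NodeLogs.
Variable (X : rooted_vertex R) (K : node_logs R).
Local Notation ns := (undup (nodes X)).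
Hypothesis KW : node_logs_of X W0 K.
Hypothesis nW : forall z, z \in ns -> D z /\ z <> q.

(** Dividing by xi_t subtracts i theta_t from each logarithm, except for 1 - w conj(w'), which a
    rotation does not change. *)
Definition node_logs_at e t : node_logs R :=
  NodeLogs (nq K + cst_of t - iu * cst_of (th t))
   (fun z => nd K z + ppos (kA th e (w z) (w z)) t - iu * cst_of (th t))
   (fun z => nw K z + ppos (kA th e (w z) 0) t - iu * cst_of (th t))
   (fun z y => nsb K z y + ppos (kA th e (w z) (w y)) t - iu * cst_of (th t))
   (fun z y => nr K z y + ppos (kB th e (w z) (w y)) t).

Lemma node_logs_atP e t : 0 < e -> e < 1 -> 0 <= t -> (forall z, z \in ns -> alive th e (w z) t) ->
  node_logs_of X (Wt t) (node_logs_at e t).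
Proof.
move=> e0 e1 t0 A; have [K1 K2 K3] := KW; apply: And3; rewrite /node_logs_at /=.
- have Aq := root_alive e0 e1 t0.
  rewrite (derive1_cdiff (evolved_cdiff e0 t0 Dq Aq)) wq ppos_kA00 // expCB expCD K1 /=.
  by rewrite (mulrC (derive1 w q)).
- move=> z zn; have [k1 k2] := K2 _ zn; have [Dz _] := nW zn; have Az := A _ zn; split.
    by rewrite (derive1_cdiff (evolved_cdiff e0 t0 Dz Az)) expCB expCD k1 /= (mulrC (derive1 w z)).
  rewrite -[RHS]/(unif (Wt t) z) (evolved_unif e0 t0 Az) expCB expCD k2 /=.
  have [U0 A0] := Ue_at0 cth xE e0 e1 t0.
  by have := Ue_diff cth e0 t0 Az A0; rewrite U0 !subr0 /We => ->.
- move=> z y zn yn ne; have [k1 k2] := K3 _ _ zn yn ne; have Az := A _ zn; have Ay := A _ yn.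
  rewrite -[X in _ = X - _]/(unif (Wt t) z) -[X in _ = _ - X]/(unif (Wt t) y).
  rewrite -[X in _ /\ _ = 1 - X * _]/(unif (Wt t) z) -[X in _ /\ _ = 1 - _ * X^*]/(unif (Wt t) y).
  rewrite (evolved_unif e0 t0 Az) (evolved_unif e0 t0 Ay); split.
    by rewrite expCB expCD k1 /= -(Ue_diff cth e0 t0 Az Ay) /We mulrBl.
  by rewrite expCD k2 /= (Ue_refl cth e0 t0 Az Ay).
Qed.

End NodeLogs.
End EvolvedDomain.

(** * Taylor expansions with O-terms *)

Section JetArith.
Variable R : realType.
Implicit Types X h n : R.

(** The weights X + h, X^2 + h and X^3 + h n measure terms of first order, second order and errors;
    these inequalities are the rules for multiplying and comparing them. *)
Lemma jet_arith X h n : 0 <= X -> X <= 1 -> 0 <= h -> h <= 1 -> X <= n -> h <= n -> n <= 2 ->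
  [/\ X ^+ 3 + h * n <= 2 * (X ^+ 2 + h), X ^+ 2 + h <= X + h,
      X * (X ^+ 2 + h) <= X ^+ 3 + h * n, (X ^+ 2 + h) * (X + h) <= 3 * (X ^+ 3 + h * n) &
      (X + h) ^+ 3 <= 7 * (X ^+ 3 + h * n)].
Proof.
move=> X0 X1 h0 h1 Xn hn n2.
have X2 : X ^+ 2 <= X by rewrite expr2 ler_piMr.
have X20 : 0 <= X ^+ 2 by rewrite exprn_ge0.
have X3 : X ^+ 3 <= X ^+ 2 by rewrite exprSr ler_piMr.
have X30 : 0 <= X ^+ 3 by rewrite exprn_ge0.
have hn2 : h * n <= h * 2 by rewrite ler_wpM2l.
have Xh : h * X <= h * n by rewrite ler_wpM2l.
have hh : h * h <= h * n by rewrite ler_wpM2l.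
have X2h : h * X ^+ 2 <= h * X by rewrite ler_wpM2l.
have Xhh : h * (h * X) <= h * X by rewrite ler_piMl // mulr_ge0.
have hhh : h * (h * h) <= h * h by rewrite ler_piMl // mulr_ge0.
have E1 : X * (X ^+ 2 + h) = X ^+ 3 + h * X by ring.
have E2 : (X ^+ 2 + h) * (X + h) = X ^+ 3 + h * X ^+ 2 + h * X + h * h by ring.
have E3 : (X + h) ^+ 3 = X ^+ 3 + 3 * (h * X ^+ 2) + 3 * (h * (h * X)) + h * (h * h) by ring.
by rewrite E1 E2 E3; split; lra.
Qed.

End JetArith.

Section TaylorLog.
Variable R : realType.
Local Notation C := (Cplx R).

Lemma expC_taylor_bdd (M : R) : exists2 K : R, 0 <= K &
  forall y : C, nm y <= M -> nm (expC y - 1 - y - 2^-1 * y ^+ 2) <= K * nm y ^+ 3.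
Proof.
exists (4 + (expR M + 1 + M + M ^+ 2)).
  have := expR_gt0 M; have := sqr_ge0 M.
  case: (leP 0 M) => [M0|M0]; last first.
    have := expR_gt0 M; have : 0 <= (M + 1/2)^+2 by exact: sqr_ge0. nra.
  lra.
move=> y yM; have M0 : 0 <= M := le_trans (nm_ge0 y) yM.
have e0 : 0 <= expR M + 1 + M + M ^+ 2 by rewrite !addr_ge0 ?expR_ge0 ?sqr_ge0.
have [y1|y1] := leP (nm y) 1.
  have := expC_taylor3 y1; rewrite [_ ^+ 2 / 2]mulrC => hT; apply: le_trans hT _.
  by rewrite ler_wpM2r ?exprn_ge0 ?nm_ge0 // lerDl.
have h1 : nm (expC y - 1 - y - 2^-1 * y ^+ 2) <= expR M + 1 + M + M ^+ 2.
  apply: le_trans (nmB _ _) _; apply: lerD; last first.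
    rewrite nmM nmX; have -> : (2^-1 : C) = cst_of 2^-1 by rewrite cstV (cst_nat R 2).
    rewrite nm_cst ger0_norm ?invr_ge0 // -[leRHS]mul1r; apply: ler_pM; rewrite ?invr_ge0 ?exprn_ge0 ?nm_ge0 //.
      by rewrite invf_le1 ?ler1n.
    by rewrite lerXn2r ?nnegrE ?nm_ge0.
  apply: le_trans (nmB _ _) _; apply: lerD; last exact: yM.
  apply: le_trans (nmB _ _) _; apply: lerD; last by rewrite nm1.
  rewrite nm_expC ler_expR; apply: le_trans (ler_norm _) (le_trans (Re_le_nm y) yM).
apply: le_trans h1 _; rewrite -[leLHS]mulr1; apply: ler_pM => //; first by rewrite lerDr.
by rewrite exprn_ege1 // ltW.
Qed.

Lemma atan_le (u : R) : 0 <= u -> atan u <= u.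
Proof.
move=> u0.
have dd : forall y, 0 < y < u -> is_derive y 1 (fun y : R => atan y - y) ((1 + y ^+ 2)^-1 - 1).
  by move=> y _; apply: (is_deriveB' (is_derive1_atan y) (is_derive_id y 1)).
have cc : {within `[0, u], continuous (fun y : R => atan y - y)}.
  by apply: within_cont => y; apply: cvgB; [exact: continuous_atan|exact: cvg_id].
have := le_of_derive u0 dd cc; rewrite atan0 subrr subr_le0; apply.
move=> y _; rewrite subr_le0 invf_le1 ?lerDl ?sqr_ge0 //.
by rewrite ltr_pwDl // sqr_ge0.
Qed.

Lemma norm_atan_le (u : R) : `|atan u| <= `|u|.
Proof.
have main (v : R) : 0 <= v -> `|atan v| <= `|v|.
  move=> v0; rewrite (ger0_norm v0) ger0_norm ?atan_le //.
  by rewrite -[leLHS](atan0 R) le_atan.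
have [u0|u0] := leP 0 u; first exact: main.
by rewrite -normrN -atanN -(normrN u) main // oppr_ge0 ltW.
Qed.

Lemma nm_LogC_le (y : C) : nm y <= 1 / 2 -> nm (LogC (1 + y)) <= 4 * nm y.
Proof.
move=> y1; apply: le_trans (nm_le_ReIm _) _.
have n1 : 1 - nm y <= nm (1 + y) by have := nmDB 1 (- y); rewrite opprK nmN nm1.
have n2 : nm (1 + y) <= 1 + nm y by have := nmD 1 y; rewrite nm1.
have y0 := nm_ge0 y.
have R1 : `|Re (LogC (1 + y))| <= 2 * nm y.
  rewrite Re_LogC ler_norml; apply/andP; split; last first.
    have h : ln (1 + (nm (1 + y) - 1)) <= nm (1 + y) - 1 by apply: le_ln1Dx; lra.
    by move: h; rewrite addrCA subrr addr0; lra.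
  have p : 0 < nm (1 + y) by lra.
  have h : ln (1 + ((nm (1 + y))^-1 - 1)) <= (nm (1 + y))^-1 - 1.
    have p' : 0 < (nm (1 + y))^-1 by rewrite invr_gt0.
    by apply: le_ln1Dx; lra.
  move: h; rewrite addrCA subrr addr0 lnV ?posrE // => h.
  have : (nm (1 + y))^-1 <= 1 + 2 * nm y.
    rewrite -[leLHS]mul1r ler_pdivrMr //.
    apply: (@le_trans _ _ ((1 + 2 * nm y) * (1 - nm y))); first by nra.
    by rewrite ler_wpM2l //; lra.
  lra.
have I1 : `|Im (LogC (1 + y))| <= 2 * nm y.
  rewrite Im_LogC; apply: le_trans (norm_atan_le _) _.
  have r := Re_le_nm y; have i := Im_le_nm y.
  have r1 : 1 / 2 <= Re (1 + y) by move: r; rewrite cReD Re1 ler_norml => /andP[h _]; lra.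
  rewrite normrM normfV (ger0_norm (_ : 0 <= Re (1 + y))) ?(le_trans _ r1) //.
  rewrite ler_pdivrMr ?(lt_le_trans _ r1) // cImD Im1 add0r.
  apply: le_trans i _; rewrite -mulrA [leRHS]mulrCA ler_peMr //; lra.
lra.
Qed.

(** Obtained by inverting the expansion of exp: l = LogC(1 + y) satisfies y = l + l^2/2 + O(l^3) and
    |l| <= 4 |y|. Replacing l^2 by y^2 costs (y - l)(y + l)/2, again of third order. *)
Lemma LogC_taylor : exists2 K : R, 0 <= K &
  forall y : C, nm y <= 1 / 2 -> nm (LogC (1 + y) - y - (- 2^-1) * y ^+ 2) <= K * nm y ^+ 3.
Proof.
have [K K0 HK] := expC_taylor_bdd 2.
exists (64 * K + 5 * (8 + 32 * K)); first by rewrite !addr_ge0 ?mulr_ge0 ?addr_ge0 ?mulr_ge0.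
move=> y y1; set l := LogC (1 + y); have y0 := nm_ge0 y.
have ly : nm l <= 4 * nm y by exact: nm_LogC_le.
have l2 : nm l <= 2 by lra.
have El : expC l = 1 + y.
  apply: expC_LogC; have := Re_le_nm y; rewrite cReD Re1 ler_norml => /andP[h _]; lra.
have := HK l l2; rewrite El [1 + y]addrC addrK => T.
have T' : nm (y - l - 2^-1 * l ^+ 2) <= 64 * K * nm y ^+ 3.
  apply: le_trans T _; rewrite -[leRHS]mulrA [leRHS]mulrCA ler_wpM2l //.
  have -> : 64 * nm y ^+ 3 = (4 * nm y) ^+ 3 by ring.
  by rewrite lerXn2r ?nnegrE ?nm_ge0 ?mulr_ge0.
have half : (2^-1 : C) = cst_of 2^-1 by rewrite cstV (cst_nat R 2).
have l2y : nm (2^-1 * l ^+ 2) <= 8 * nm y ^+ 2.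
  rewrite half nmM nm_cst nmX ger0_norm ?invr_ge0 //.
  have : nm l ^+ 2 <= (4 * nm y) ^+ 2 by rewrite lerXn2r ?nnegrE ?nm_ge0 ?mulr_ge0.
  lra.
have yl : nm (y - l) <= (8 + 32 * K) * nm y ^+ 2.
  have -> : y - l = (y - l - 2^-1 * l ^+ 2) + 2^-1 * l ^+ 2 by ring.
  apply: le_trans (nmD _ _) _.
  have : 64 * K * nm y ^+ 3 <= 32 * K * nm y ^+ 2.
    have -> : 64 * K * nm y ^+ 3 = 32 * K * nm y ^+ 2 * (2 * nm y) by ring.
    by rewrite ler_piMr ?mulr_ge0 ?exprn_ge0 //; lra.
  lra.
have yl2 : nm (2^-1 * ((y - l) * (y + l))) <= 5 * (8 + 32 * K) * nm y ^+ 3.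
  rewrite half nmM nm_cst ger0_norm ?invr_ge0 // nmM.
  have h5 : nm (y + l) <= 5 * nm y by apply: le_trans (nmD _ _) _; lra.
  have := ler_pM (nm_ge0 _) (nm_ge0 _) yl h5.
  have -> : (8 + 32 * K) * nm y ^+ 2 * (5 * nm y) = 5 * (8 + 32 * K) * nm y ^+ 3 by ring.
  have := mulr_ge0 (nm_ge0 (y - l)) (nm_ge0 (y + l)); lra.
have -> : l - y - (- 2^-1) * y ^+ 2 = - (y - l - 2^-1 * l ^+ 2) + 2^-1 * ((y - l) * (y + l)).
  by field.
apply: le_trans (nmD _ _) _; by rewrite nmN [leRHS]mulrDl; apply: lerD.
Qed.

End TaylorLog.

(** * Uniform second-order expansions *)

Section Jets.
Variables (R : realType) (I : Type) (x h eta : I -> R).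
Local Notation C := (Cplx R).
Hypothesis xhB : forall i, [/\ `|x i| <= 1, 0 <= h i <= 1, `|x i| <= eta i, h i <= eta i & eta i <= 2].
Implicit Types (f g c : I -> C) (u v : I -> R).

(** Uniform over the whole index type, which will be the type of all time steps of all driving
    paths: the constants then depend neither on the path nor on the time. *)
Definition bigO u f := exists2 K : R, 0 <= K & forall i, nm (f i) <= K * u i.

Lemma bigO_le u v f : (exists2 K : R, 0 <= K & forall i, u i <= K * v i) -> bigO u f -> bigO v f.
Proof.
move=> [K K0 H] [K' K'0 H']; exists (K' * K); first by rewrite mulr_ge0.
by move=> i; apply: le_trans (H' i) _; rewrite -mulrA ler_wpM2l.
Qed.
Lemma bigOD u f g : bigO u f -> bigO u g -> bigO u (fun i => f i + g i).
Proof.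
move=> [K K0 H] [K' K'0 H']; exists (K + K'); first by rewrite addr_ge0.
by move=> i; apply: le_trans (nmD _ _) _; rewrite mulrDl lerD.
Qed.
Lemma bigOM u v f g : bigO u f -> bigO v g -> bigO (fun i => u i * v i) (fun i => f i * g i).
Proof.
move=> [K K0 H] [K' K'0 H']; exists (K * K'); first by rewrite mulr_ge0.
by move=> i; rewrite nmM mulrACA ler_pM ?nm_ge0.
Qed.
Lemma bigO_conj u f : bigO u f -> bigO u (fun i => (f i)^*).
Proof. by move=> [K K0 H]; exists K => // i; rewrite nm_conj. Qed.
Lemma bigO_ext u f g : (forall i, f i = g i) -> bigO u f -> bigO u g.
Proof. by move=> E [K K0 H]; exists K => // i; rewrite -E. Qed.
Lemma bigO_extu u v f : (forall i, u i = v i) -> bigO u f -> bigO v f.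
Proof. by move=> E [K K0 H]; exists K => // i; rewrite -E. Qed.

Definition bdd f := bigO (fun _ => 1) f.
Lemma bdd_cst (k : C) : bdd (fun _ => k).
Proof. by exists (nm k); [exact: nm_ge0|move=> _; rewrite mulr1]. Qed.
Lemma bddM f g : bdd f -> bdd g -> bdd (fun i => f i * g i).
Proof. by move=> F G; apply: (bigO_extu _ (bigOM F G)) => i; rewrite mulr1. Qed.
Lemma bddMO u c f : bdd c -> bigO u f -> bigO u (fun i => c i * f i).
Proof. by move=> F G; apply: (bigO_extu _ (bigOM F G)) => i; rewrite mul1r. Qed.
Lemma bddD f g : bdd f -> bdd g -> bdd (fun i => f i + g i).
Proof. exact: bigOD. Qed.
Lemma bddN f : bdd f -> bdd (fun i => - f i).
Proof. by move=> [K K0 H]; exists K => // i; rewrite nmN. Qed.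

Definition err i := `|x i| ^+ 3 + h i * eta i.
Local Notation xc i := (cst_of (x i) : C).
Local Notation hc i := (cst_of (h i) : C).

(** x^2 and h are of the same order only on average, so they keep separate coefficients. The error
    [err] allows |x|^3 and h times the oscillation. *)
Definition jet f c1 c2 c3 := [/\ bdd c1, bdd c2, bdd c3 &
  bigO err (fun i => f i - c1 i * xc i - c2 i * xc i ^+ 2 - c3 i * hc i)].

Let ar i : [/\ err i <= 2 * (`|x i| ^+ 2 + h i), `|x i| ^+ 2 + h i <= `|x i| + h i,
  `|x i| * (`|x i| ^+ 2 + h i) <= err i, (`|x i| ^+ 2 + h i) * (`|x i| + h i) <= 3 * err i &
      (`|x i| + h i) ^+ 3 <= 7 * err i].
Proof. by have [a /andP[b c] d e f] := xhB i; exact: jet_arith. Qed.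

Lemma bigO_x : bigO (fun i => `|x i|) (fun i => xc i).
Proof. by exists 1 => // i; rewrite mul1r nm_cst. Qed.

Lemma jet_rest f c1 c2 c3 : jet f c1 c2 c3 ->
  bigO (fun i => `|x i| ^+ 2 + h i) (fun i => f i - c1 i * xc i).
Proof.
move=> [b1 b2 b3 H].
have H' : bigO (fun i => `|x i| ^+ 2 + h i) (fun i => f i - c1 i * xc i - c2 i * xc i ^+ 2 - c3 i * hc i).
  by apply: bigO_le H; exists 2 => // i; have [] := ar i.
have P2 : bigO (fun i => `|x i| ^+ 2 + h i) (fun i => c2 i * xc i ^+ 2).
  apply: bddMO b2 _; exists 1 => // i; rewrite nmX nm_cst mul1r lerDl.
  by have [_ /andP[]] := xhB i.
have P3 : bigO (fun i => `|x i| ^+ 2 + h i) (fun i => c3 i * hc i).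
  apply: bddMO b3 _; exists 1 => // i; have [_ /andP[h0 _] _ _ _] := xhB i.
  by rewrite nm_cst mul1r ger0_norm // lerDr exprn_ge0.
by apply: (bigO_ext _ (bigOD H' (bigOD P2 P3))) => i; ring.
Qed.

Lemma jet_size f c1 c2 c3 : jet f c1 c2 c3 -> bigO (fun i => `|x i| + h i) f.
Proof.
move=> J; have [b1 _ _ _] := J.
have H' : bigO (fun i => `|x i| + h i) (fun i => f i - c1 i * xc i).
  by apply: bigO_le (jet_rest J); exists 1 => // i; have [] := ar i; rewrite mul1r.
have P1 : bigO (fun i => `|x i| + h i) (fun i => c1 i * xc i).
  apply: bddMO b1 _; exists 1 => // i; have [_ /andP[h0 _] _ _ _] := xhB i.
  by rewrite nm_cst mul1r lerDl.
by apply: (bigO_ext _ (bigOD H' P1)) => i; ring.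
Qed.

Lemma jet_bdd f c1 c2 c3 : jet f c1 c2 c3 -> bdd f.
Proof.
move=> /jet_size; apply: bigO_le; exists 2 => // i.
by have [a /andP[_ b] _ _ _] := xhB i; rewrite mulr1; lra.
Qed.

Lemma jet_ext f g c1 c2 c3 d1 d2 d3 : (forall i, f i = g i) -> (forall i, c1 i = d1 i) ->
  (forall i, c2 i = d2 i) -> (forall i, c3 i = d3 i) -> jet f c1 c2 c3 -> jet g d1 d2 d3.
Proof.
move=> /funext E /funext E1 /funext E2 /funext E3; by rewrite E E1 E2 E3.
Qed.

Lemma jetD f g c1 c2 c3 d1 d2 d3 : jet f c1 c2 c3 -> jet g d1 d2 d3 ->
  jet (fun i => f i + g i) (fun i => c1 i + d1 i) (fun i => c2 i + d2 i) (fun i => c3 i + d3 i).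
Proof.
move=> [a1 a2 a3 a] [b1 b2 b3 b]; split; [exact: bddD|exact: bddD|exact: bddD|].
by apply: (bigO_ext _ (bigOD a b)) => i; ring.
Qed.

Lemma jetZ k f c1 c2 c3 : bdd k -> jet f c1 c2 c3 ->
  jet (fun i => k i * f i) (fun i => k i * c1 i) (fun i => k i * c2 i) (fun i => k i * c3 i).
Proof.
move=> bk [a1 a2 a3 a]; split; [exact: bddM|exact: bddM|exact: bddM|].
by apply: (bigO_ext _ (bddMO bk a)) => i; ring.
Qed.

Lemma jet_conj f c1 c2 c3 : jet f c1 c2 c3 ->
  jet (fun i => (f i)^*) (fun i => (c1 i)^*) (fun i => (c2 i)^*) (fun i => (c3 i)^*).
Proof.
move=> [a1 a2 a3 a]; split; [exact: bigO_conj|exact: bigO_conj|exact: bigO_conj|].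
apply: (bigO_ext _ (bigO_conj a)) => i.
by rewrite !expr2 !conjCB !conjCM !conj_cst.
Qed.

Lemma bdd0 : bdd (fun _ => 0). Proof. exact: bdd_cst. Qed.

Lemma jet0 f : bigO err f -> jet f (fun _ => 0) (fun _ => 0) (fun _ => 0).
Proof.
move=> H; split; [exact: bdd0|exact: bdd0|exact: bdd0|].
by apply: (bigO_ext _ H) => i; rewrite !mul0r !subr0.
Qed.

Lemma jet_zero : jet (fun _ => 0) (fun _ => 0) (fun _ => 0) (fun _ => 0).
Proof.
apply: jet0; exists 0 => // i; by rewrite nm0 mul0r.
Qed.

Lemma jet_x : jet (fun i => xc i) (fun _ => 1) (fun _ => 0) (fun _ => 0).
Proof.
split; [exact: bdd_cst|exact: bdd0|exact: bdd0|].
by exists 0 => // i; rewrite !mul0r !subr0 mul1r subrr nm0.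
Qed.

(** Only the product of the first-order terms survives: |x| h and h^2 are at most h eta. *)
Lemma jetM f g c1 c2 c3 d1 d2 d3 : jet f c1 c2 c3 -> jet g d1 d2 d3 ->
  jet (fun i => f i * g i) (fun _ => 0) (fun i => c1 i * d1 i) (fun _ => 0).
Proof.
move=> J J'; have [a1 _ _ _] := J; have [b1 _ _ _] := J'.
split; [exact: bdd0|exact: bddM|exact: bdd0|].
have P1 : bigO err (fun i => c1 i * (xc i * (g i - d1 i * xc i))).
  apply: bddMO a1 _; apply: bigO_le (bigOM bigO_x (jet_rest J')).
  by exists 1 => // i; rewrite mul1r; have [] := ar i.
have P2 : bigO err (fun i => (f i - c1 i * xc i) * g i).
  apply: bigO_le (bigOM (jet_rest J) (jet_size J')).
  by exists 3 => // i; have [] := ar i.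
by apply: (bigO_ext _ (bigOD P1 P2)) => i; ring.
Qed.

Lemma jet_sum (T : eqType) (s : seq T) (f c1 c2 c3 : T -> I -> C) :
  (forall z, z \in s -> jet (f z) (c1 z) (c2 z) (c3 z)) ->
  jet (fun i => \sum_(z <- s) f z i) (fun i => \sum_(z <- s) c1 z i)
      (fun i => \sum_(z <- s) c2 z i) (fun i => \sum_(z <- s) c3 z i).
Proof.
elim: s => [|z s IH] H.
  by apply: (jet_ext _ _ _ _ jet_zero) => i; rewrite big_nil.
have J := jetD (H z (mem_head z s)) (IH (fun y ys => H y (mem_behead (s := z :: s) ys))).
by apply: (jet_ext _ _ _ _ J) => i; rewrite big_cons.
Qed.

Lemma jet_cube f c1 c2 c3 : jet f c1 c2 c3 -> bigO err (fun i => f i ^+ 3).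
Proof.
move=> /jet_size O; apply: bigO_le (bigO_ext _ (bigOM O (bigOM O O))) => [|i]; last by rewrite !exprS expr0 mulr1.
by exists 7 => // i; have [_ _ _ _ H] := ar i; apply: le_trans H; rewrite !exprS expr0 mulr1.
Qed.

(** This covers exp - 1 with k = 1/2 and log(1 + .) with k = -1/2; the shift of c2 by k c1^2 is the
    Ito correction. *)
Lemma jet_taylor (F : C -> C) (k : C) f c1 c2 c3 (P : C -> Prop) (K : R) : 0 <= K ->
  (forall y, P y -> nm (F y - y - k * y ^+ 2) <= K * nm y ^+ 3) -> (forall i, P (f i)) ->
  jet f c1 c2 c3 -> jet (fun i => F (f i)) c1 (fun i => c2 i + k * c1 i ^+ 2) c3.
Proof.
move=> K0 H Pf J.
have T : bigO err (fun i => F (f i) - f i - k * f i ^+ 2).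
  have [K' K'0 HK] := jet_cube J; exists (K * K'); first by rewrite mulr_ge0.
  by move=> i; apply: le_trans (H _ (Pf i)) _; rewrite -mulrA -nmX ler_wpM2l.
have J2 := jetZ (bdd_cst k) (jetM J J).
apply: (jet_ext _ _ _ _ (jetD (jet0 T) (jetD J J2))) => i /=; ring.
Qed.

Lemma jet_exp f c1 c2 c3 : jet f c1 c2 c3 ->
  jet (fun i => expC (f i) - 1) c1 (fun i => c2 i + 2^-1 * c1 i ^+ 2) c3.
Proof.
move=> J; have [M M0 HM] := jet_bdd J; have [K K0 HK] := expC_taylor_bdd (M * 1).
exact: (@jet_taylor (fun y => expC y - 1) 2^-1 f c1 c2 c3 (fun y => nm y <= M * 1) K).
Qed.

Lemma jet_log f c1 c2 c3 : (forall i, nm (f i) <= 1 / 2) -> jet f c1 c2 c3 ->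
  jet (fun i => LogC (1 + f i)) c1 (fun i => c2 i + (- 2^-1) * c1 i ^+ 2) c3.
Proof.
move=> H J; have [K K0 HK] := @LogC_taylor R.
exact: (@jet_taylor (fun y => LogC (1 + y)) (- 2^-1) f c1 c2 c3 (fun y => nm y <= 1/2) K).
Qed.

End Jets.

(** * The drift of the observable *)

Section SleConstants.
Variable R : realType.
Local Notation C := (Cplx R).
Variable kappa : R.
Hypothesis k0 : 0 < kappa.

(** This and b = a (kappa/4 - 1) are the only properties of a and b that enter the drift
    identity. *)
Lemma sle_a2 : sle_a kappa ^+ 2 * kappa = 2.
Proof. by rewrite /sle_a sqr_sqrtr ?divfK ?gt_eqF // divr_ge0 // ltW. Qed.
Lemma sle_bE : sle_b kappa = sle_a kappa * (kappa / 4 - 1).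
Proof.
rewrite /sle_b -/(sle_a kappa); have -> : Num.sqrt (kappa / 8) = sle_a kappa * (kappa / 4).
  have p : 0 <= sle_a kappa * (kappa / 4) by rewrite mulr_ge0 ?sqrtr_ge0 ?divr_ge0 // ltW.
  rewrite -[RHS](ger0_norm p) -sqrtr_sqr; congr Num.sqrt.
  have := sle_a2; rewrite !exprMn => E.
  have -> : sle_a kappa ^+ 2 * (kappa ^+ 2 * 4^-1 ^+ 2) = (sle_a kappa ^+ 2 * kappa) * kappa / 16 by field.
  by rewrite E; field.
ring.
Qed.
Lemma cst_sle_a2 : (cst_of (sle_a kappa) : C) ^+ 2 * cst_of kappa = 2.
Proof. by rewrite expr2 -!cstM -expr2 sle_a2 (cst_nat R 2). Qed.
Lemma cst_sle_b : cst_of (sle_b kappa) = cst_of (sle_a kappa) * (cst_of kappa / 4 - 1) :> C.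
Proof. by rewrite sle_bE cstM cstB cstM cstV (cst_nat R 4) cst1. Qed.

End SleConstants.

Section Drift.
Variable R : realType.
Local Notation C := (Cplx R).
Implicit Types (s : seq C) (f g sg sgs r rb : C -> C).

(** Twice the sum of a_j a_k over pairs is the square of the sum minus the sum of squares, with a
    bilinear analogue for the mixed terms. The drift becomes a polynomial in finitely many power
    sums. *)
Lemma sumpairs_drift s sg sgs r rb :
  sumpairs s (fun x y =>
     (sg x * sg y * (2 * r x * r y - 1) + sgs x * sgs y * (2 * rb x * rb y - 1))
   + (sg x * sgs y * (- 2 * (r x - 1) * (rb y - 1)) + sgs x * sg y * (- 2 * (rb x - 1) * (r y - 1)))) =
  ((\sum_(x <- s) sg x * r x) ^+ 2 - \sum_(x <- s) sg x ^+ 2 * r x ^+ 2)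
  - ((\sum_(x <- s) sg x) ^+ 2 - \sum_(x <- s) sg x ^+ 2) / 2
  + ((\sum_(x <- s) sgs x * rb x) ^+ 2 - \sum_(x <- s) sgs x ^+ 2 * rb x ^+ 2)
  - ((\sum_(x <- s) sgs x) ^+ 2 - \sum_(x <- s) sgs x ^+ 2) / 2
  - 2 * ((\sum_(x <- s) sg x * r x - \sum_(x <- s) sg x) * (\sum_(x <- s) sgs x * rb x - \sum_(x <- s) sgs x)
    - \sum_(x <- s) sg x * sgs x * ((r x - 1) * (rb x - 1))).
Proof.
elim: s => [|x s IH]; first by rewrite /sumpairs big_ord0 !big_nil; ring.
rewrite sumpairs_cons IH {IH} !big_cons.
have -> : \sum_(y <- s)
     ((sg x * sg y * (2 * r x * r y - 1) + sgs x * sgs y * (2 * rb x * rb y - 1))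
   + (sg x * sgs y * (- 2 * (r x - 1) * (rb y - 1)) + sgs x * sg y * (- 2 * (rb x - 1) * (r y - 1)))) =
  2 * sg x * r x * (\sum_(y <- s) sg y * r y) - sg x * (\sum_(y <- s) sg y)
  + 2 * sgs x * rb x * (\sum_(y <- s) sgs y * rb y) - sgs x * (\sum_(y <- s) sgs y)
  - 2 * sg x * (r x - 1) * (\sum_(y <- s) sgs y * rb y - \sum_(y <- s) sgs y)
  - 2 * sgs x * (rb x - 1) * (\sum_(y <- s) sg y * r y - \sum_(y <- s) sg y).
  by elim: s => [|y s IH]; [rewrite !big_nil; ring|rewrite !big_cons IH; ring].
by field.
Qed.

Lemma sumpairs_turn s sg sgs (k k' : C) :
  sumpairs s (fun x y => sg x * sg y * k + sgs x * sgs y * k') =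
  k * (((\sum_(x <- s) sg x) ^+ 2 - \sum_(x <- s) sg x ^+ 2) / 2)
  + k' * (((\sum_(x <- s) sgs x) ^+ 2 - \sum_(x <- s) sgs x ^+ 2) / 2).
Proof.
elim: s => [|x s IH]; first by rewrite /sumpairs big_ord0 !big_nil; ring.
rewrite sumpairs_cons IH {IH} !big_cons.
have -> : \sum_(y <- s) (sg x * sg y * k + sgs x * sgs y * k') =
  k * (sg x * (\sum_(y <- s) sg y)) + k' * (sgs x * (\sum_(y <- s) sgs y)).
  by elim: s => [|y s IH]; [rewrite !big_nil; ring|rewrite !big_cons IH; ring].
by field.
Qed.

(* Unprimed sums are over sigma, primed ones over sigma_*: S = sum sigma,
   P = sum sigma r, Q = sum sigma r^2, E = sum sigma^2, G = sum sigma^2 r^2,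
   H = sum sigma sigma_* |r - 1|^2. *)
Lemma drift_identity (a b kap tau taus S S' P P' Q Q' E E' G G' H : C) :
  a ^+ 2 * kap = 2 -> b = a * (kap / 4 - 1) -> tau + taus + (S + S') = 0 ->
  let c3 := ((- a / 2 + tau) ^+ 2 / 2 + (- a / 2 + taus) ^+ 2 / 2 - ((- a / 2) ^+ 2 / 2 + (- a / 2) ^+ 2 / 2))
    + (G - E / 2 - b * (2 * Q - S) + (G' - E' / 2 - b * (2 * Q' - S'))
       + (b + (- a / 2 + tau)) * (2 * P - S) + (b + (- a / 2 + taus)) * (2 * P' - S'))
    + (- a * (2 * Q - 3 * P + S) - a * (2 * Q' - 3 * P' + S'))
    + ((P ^+ 2 - G) - (S ^+ 2 - E) / 2 + (P' ^+ 2 - G') - (S' ^+ 2 - E') / 2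
       - 2 * ((P - S) * (P' - S') - H)) - 2 * H in
  let c2 := a / 2 * (Q - P) + a / 2 * (Q' - P') in
  let z := (- ((- a / 2 + tau) ^+ 2 / 2) + (- a / 2 + taus) ^+ 2 / 2)
    + (- (E / 2 - b * S) + (E' / 2 - b * S') - (b + (- a / 2 + tau)) * S + (b + (- a / 2 + taus)) * S')
    + a * ((P - S) - (P' - S'))
    - ((S ^+ 2 - E) / 2) + (S' ^+ 2 - E') / 2 in
  c3 + kap * (c2 - 2^-1 * z ^+ 2) = 0.
Proof.
move=> ak bE n c3 c2 z.
have tE : taus = - tau - (S + S') by rewrite -[LHS]subr0 -n; ring.
(* In the first-order coefficient b, E and E' cancel, and by neutrality the rest is a multiple of a,
   so that its square brings a^2 kappa. *)
have zE : z = a * ((S + tau) + (P - S) - (P' - S')).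
  by rewrite /z tE; field.
have {ak} ak' : 2 - a ^+ 2 * kap = 0 by rewrite ak subrr.
(* E, G and H cancel within c3, and Q, Q' cancel by the relation between a and b; what is left is a
   square times 2 - a^2 kappa. *)
have : c3 + kap * (c2 - 2^-1 * z ^+ 2) = (2 - a ^+ 2 * kap) * (2^-1 * (S + tau + (P - S) - (P' - S')) ^+ 2).
  by rewrite zE /c3 /c2 tE bE; field.
by rewrite ak' mul0r.
Qed.

End Drift.

(** * Expansion of the exponent and vanishing of its drift *)

Section ExpoJets.
Variable R : realType.
Local Notation C := (Cplx R).
Variables (kappa : R) (X : rooted_vertex R).
Local Notation a := (cst_of (sle_a kappa) : C).
Local Notation b := (cst_of (sle_b kappa) : C).
Local Notation tau := (rtau X).
Local Notation taus := (rtaus X).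
Local Notation sg := (chg X).
Local Notation sgs := (chgs X).
Local Notation ns := (undup (nodes X)).
Local Notation expo := (expo kappa X).

Definition subl (L M : logs R) : logs R :=
  Logs (lq L - lq M) (lq' L - lq' M) (lz L - lz M) (lz' L - lz' M) (lwz L - lwz M) (lwz' L - lwz' M)
    (fun x => ld L x - ld M x) (fun x => lw L x - lw M x)
    (fun x => lsz L x - lsz M x) (fun x => lrz L x - lrz M x)
    (fun x y => ls L x y - ls M x y) (fun x y => lr L x y - lr M x y).

Lemma expo_sub L M : expo L - expo M = expo (subl L M).
Proof.
have -> : expo L = expo (addl M (subl L M)).
  have E (u v : C) : u = v + (u - v) by ring.
  by apply: expo_ext; apply: And5; [split|split|split| |]; try move=> *; try split; exact: E.
by rewrite expo_add addrC addKr.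
Qed.

Section Jets.
Variables (I : Type) (x h eta : I -> R).
Hypothesis xhB : forall i, [/\ `|x i| <= 1, 0 <= h i <= 1, `|x i| <= eta i, h i <= eta i & eta i <= 2].
Local Notation jet := (jet x h eta).

Lemma jet_p2 (f c1 c2 c3 : I -> C) (s t : C) : jet f c1 c2 c3 ->
  jet (fun i => p2 (f i) s t) (fun i => p2 (c1 i) s t) (fun i => p2 (c2 i) s t) (fun i => p2 (c3 i) s t).
Proof.
move=> J; apply: jetD; apply: jetZ; try exact: bdd_cst; [exact: J|exact: jet_conj].
Qed.

Lemma jetB (f g c1 c2 c3 d1 d2 d3 : I -> C) : jet f c1 c2 c3 -> jet g d1 d2 d3 ->
  jet (fun i => f i - g i) (fun i => c1 i - d1 i) (fun i => c2 i - d2 i) (fun i => c3 i - d3 i).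
Proof.
move=> J J'; have := jetD J (jetZ (@bdd_cst R I (- 1)) J').
by apply: jet_ext => i; rewrite mulN1r.
Qed.

Lemma jet_sumpairs (s : seq C) (f c1 c2 c3 : C -> C -> I -> C) :
  (forall u v, u \in s -> v \in s -> jet (f u v) (c1 u v) (c2 u v) (c3 u v)) ->
  jet (fun i => sumpairs s (fun u v => f u v i)) (fun i => sumpairs s (fun u v => c1 u v i))
    (fun i => sumpairs s (fun u v => c2 u v i)) (fun i => sumpairs s (fun u v => c3 u v i)).
Proof.
elim: s => [|z s IH] H.
  by apply: (jet_ext _ _ _ _ (jet_zero x h eta)) => i; rewrite /sumpairs big_ord0.
have J1 := jet_sum (fun y ys => H z y (mem_head z s) (mem_behead (s := z :: s) ys)).
have J2 := IH (fun u v us vs => H u v (mem_behead (s := z :: s) us) (mem_behead (s := z :: s) vs)).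
by apply: (jet_ext _ _ _ _ (jetD J1 J2)) => i; rewrite sumpairs_cons.
Qed.

Lemma jet_expo (L L1 L2 L3 : I -> logs R) :
  let J (p : logs R -> C) := jet (fun i => p (L i)) (fun i => p (L1 i)) (fun i => p (L2 i)) (fun i => p (L3 i)) in
  [/\ J (@lq R) /\ J (@lq' R), J (@lz R) /\ J (@lz' R), J (@lwz R) /\ J (@lwz' R),
    (forall u, u \in ns -> [/\ J (fun M => ld M u), J (fun M => lw M u), J (fun M => lsz M u) & J (fun M => lrz M u)]) &
    forall u v, u \in ns -> v \in ns -> J (fun M => ls M u v) /\ J (fun M => lr M u v)] ->
  jet (fun i => expo (L i)) (fun i => expo (L1 i)) (fun i => expo (L2 i)) (fun i => expo (L3 i)).
Proof.
move=> J [[Jq Jq'] [Jz Jz'] [Jw Jw'] H1 H2]; rewrite /expo.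
apply: jetD.
  apply: jetD.
    apply: jetD.
      apply: jetB; last exact: jet_p2.
      apply: jetD; last exact: jet_p2.
      apply: jetB; last exact: jet_p2.
      apply: jetD; last exact: jet_p2.
      by apply: jetB; exact: jet_p2.
    apply: (jet_sum (f := fun u i => _)) => u un; have [j1 j2 _ _] := H1 _ un.
    by apply: jetD; exact: jet_p2.
  apply: (jet_sum (f := fun u i => _)) => u un; have [_ _ j1 j2] := H1 _ un.
  by apply: jetD; exact: jet_p2.
apply: (jet_sumpairs (f := fun u v i => _)) => u v un vn; have [j1 j2] := H2 _ _ un vn.
by apply: jetD; exact: jet_p2.
Qed.

End Jets.

(* first and second order coefficients in the increment of the driving
   angle, and coefficient of the time increment, of the logarithms *)
Definition turn_logs (r : C -> C) : logs R :=
  Logs (- iu) (- iu) 0 0 0 0 (fun _ => - iu) (fun _ => - iu) (fun z => iu * (r z - 1)) (fun z => (iu * (r z - 1))^*)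
    (fun _ _ => - iu) (fun _ _ => 0).
Definition turn2_logs (r : C -> C) : logs R :=
  Logs 0 0 0 0 0 0 (fun _ => 0) (fun _ => 0) (fun z => r z * (r z - 1) / 2) (fun z => (r z * (r z - 1) / 2)^*)
    (fun _ _ => 0) (fun _ _ => 0).
Definition drift_logs (r : C -> C) : logs R :=
  Logs 1 1 0 0 0 0 (fun z => 2 * r z * r z - 1) (fun z => 2 * r z - 1)
    (fun z => - (r z - 1) * (2 * r z - 1)) (fun z => (- (r z - 1) * (2 * r z - 1))^*)
    (fun z y => 2 * r z * r y - 1) (fun z y => - 2 * (r z - 1) * (r y - 1)^*).

(** The h-coefficient of exp([Lam]) plus kappa times its x^2-coefficient, half the square of the
    first-order term being the Ito correction. The explicit sum is the contribution of the powers of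
    1 - |w|^2. *)
Lemma expo_drift (r : C -> C) : 0 < kappa -> tau + taus + \sum_(z <- ns) (sg z + sgs z) = 0 ->
  expo (drift_logs r) + \sum_(z <- ns) sg z * sgs z * (- 2 * (r z - 1) * (r z - 1)^*)
  + cst_of kappa * (expo (turn2_logs r) + 2^-1 * expo (turn_logs r) ^+ 2) = 0.
Proof.
move=> k0 neu; pose rb z := (r z)^*.
have cn (k : nat) : (k%:R : C)^* = k%:R by exact: conjC_nat'.
have cn2 : (2^-1 : C)^* = 2^-1 by rewrite -(cst_nat R 2) -cstV conj_cst.
rewrite big_split in neu.
have := @drift_identity R a b (cst_of kappa) tau taus (\sum_(z <- ns) sg z) (\sum_(z <- ns) sgs z)
  (\sum_(z <- ns) sg z * r z) (\sum_(z <- ns) sgs z * rb z)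
  (\sum_(z <- ns) sg z * r z ^+ 2) (\sum_(z <- ns) sgs z * rb z ^+ 2)
  (\sum_(z <- ns) sg z ^+ 2) (\sum_(z <- ns) sgs z ^+ 2)
  (\sum_(z <- ns) sg z ^+ 2 * r z ^+ 2) (\sum_(z <- ns) sgs z ^+ 2 * rb z ^+ 2)
  (\sum_(z <- ns) sg z * sgs z * ((r z - 1) * (rb z - 1)))
  (cst_sle_a2 k0) (cst_sle_b k0) neu.
move=> /[let] c3 /[let] c2 /[let] z dH.
have E2 : expo (turn2_logs r) = c2.
  rewrite /expo /p2 /= conjC0.
  have -> : sumpairs ns (fun x y => sg x * sg y * 0 + sgs x * sgs y * 0 + (sg x * sgs y * 0 + sgs x * sg y * 0)) = 0.
    by rewrite /sumpairs big1 // => j _; rewrite big1 // => k _; rewrite !mulr0 !addr0.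
  rewrite [X in _ + X + _ + _]big1; last by move=> u _; rewrite !mulr0 !addr0.
  have -> : \sum_(x <- ns) (a * sg x * (r x * (r x - 1) / 2) + 0 * (r x * (r x - 1) / 2)^* +
      (a * sgs x * (r x * (r x - 1) / 2)^* + 0 * (r x * (r x - 1) / 2)^*^*)) = c2.
    rewrite /c2; elim: (ns) => [|u s IH]; first by rewrite !big_nil; ring.
    rewrite !big_cons IH /rb !conjCM conjCB conjC1' cn2; by field.
  by rewrite !mulr0 !addr0 !subr0 add0r.
have E1 : expo (turn_logs r) = iu * z.
  rewrite /expo /p2 /= conjC0 !conjCN conj_iu.
  have -> : sumpairs ns (fun x y => sg x * sg y * (- iu) + sgs x * sgs y * (- - iu)
      + (sg x * sgs y * 0 + sgs x * sg y * 0)) =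
     sumpairs ns (fun x y => sg x * sg y * (- iu) + sgs x * sgs y * iu).
    apply: eq_sumpairs; first exact: undup_uniq.
    by move=> u v _ _ _; rewrite !mulr0 !addr0 opprK.
  rewrite sumpairs_turn.
  have -> : \sum_(x <- ns) (cdim kappa (sg x) * (- iu) + cdim kappa (sgs x) * (- - iu) +
     ((b + (- a / 2 + tau)) * sg x * (- iu) + (b + (- a / 2 + taus)) * sgs x * (- - iu))) =
     iu * (- ((\sum_(z <- ns) sg z ^+ 2) / 2 - b * (\sum_(z <- ns) sg z))
       + ((\sum_(z <- ns) sgs z ^+ 2) / 2 - b * (\sum_(z <- ns) sgs z))
      - (b + (- a / 2 + tau)) * (\sum_(z <- ns) sg z) + (b + (- a / 2 + taus)) * (\sum_(z <- ns) sgs z)).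
    elim: (ns) => [|u s IH]; first by rewrite !big_nil; field.
    by rewrite !big_cons IH /cdim /dimension; field.
  have -> : \sum_(x <- ns) (a * sg x * (iu * (r x - 1)) + 0 * (iu * (r x - 1))^* +
      (a * sgs x * (iu * (r x - 1))^* + 0 * (iu * (r x - 1))^*^*)) =
    iu * (a * ((\sum_(z <- ns) sg z * r z - \sum_(z <- ns) sg z) - (\sum_(z <- ns) sgs z * rb z - \sum_(z <- ns) sgs z))).
    elim: (ns) => [|u s IH]; first by rewrite !big_nil; ring.
    by rewrite !big_cons IH /rb !conjCM conj_iu conjCB conjC1'; ring.
  by rewrite /z; field.
have e1 u v : (2 * r u * r v - 1)^* = 2 * rb u * rb v - 1 by rewrite conjCB !conjCM conjC1' cn.
have e2 u : (r u - 1)^* = rb u - 1 by rewrite conjCB conjC1'.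
have e3 u v : (- 2 * (r u - 1) * (r v - 1)^*)^* = - 2 * (rb u - 1) * (r v - 1).
  by rewrite !conjCM conjCN cn conjCK' e2.
have E3 : expo (drift_logs r) + \sum_(z <- ns) sg z * sgs z * (- 2 * (r z - 1) * (r z - 1)^*) = c3.
  rewrite /expo /p2 /= conjC0 conjC1'.
  have -> : sumpairs ns (fun x y => sg x * sg y * (2 * r x * r y - 1) + sgs x * sgs y * (2 * r x * r y - 1)^*
      + (sg x * sgs y * (- 2 * (r x - 1) * (r y - 1)^*) + sgs x * sg y * (- 2 * (r x - 1) * (r y - 1)^*)^*)) =
     sumpairs ns (fun x y =>
     (sg x * sg y * (2 * r x * r y - 1) + sgs x * sgs y * (2 * rb x * rb y - 1))
   + (sg x * sgs y * (- 2 * (r x - 1) * (rb y - 1)) + sgs x * sg y * (- 2 * (rb x - 1) * (r y - 1)))).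
    apply: eq_sumpairs; first exact: undup_uniq.
    by move=> u v _ _ _; rewrite e1 e3 e2.
  rewrite sumpairs_drift.
  have -> : \sum_(x <- ns) (cdim kappa (sg x) * (2 * r x * r x - 1) + cdim kappa (sgs x) * (2 * r x * r x - 1)^* +
     ((b + (- a / 2 + tau)) * sg x * (2 * r x - 1) + (b + (- a / 2 + taus)) * sgs x * (2 * r x - 1)^*)) =
     \sum_(z <- ns) sg z ^+ 2 * r z ^+ 2 - (\sum_(z <- ns) sg z ^+ 2) / 2
       - b * (2 * (\sum_(z <- ns) sg z * r z ^+ 2) - \sum_(z <- ns) sg z)
      + (\sum_(z <- ns) sgs z ^+ 2 * rb z ^+ 2 - (\sum_(z <- ns) sgs z ^+ 2) / 2
       - b * (2 * (\sum_(z <- ns) sgs z * rb z ^+ 2) - \sum_(z <- ns) sgs z))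
      + (b + (- a / 2 + tau)) * (2 * (\sum_(z <- ns) sg z * r z) - \sum_(z <- ns) sg z)
      + (b + (- a / 2 + taus)) * (2 * (\sum_(z <- ns) sgs z * rb z) - \sum_(z <- ns) sgs z).
    elim: (ns) => [|u s IH]; first by rewrite !big_nil; field.
    by rewrite !big_cons IH /rb !conjCB !conjCM conjC1' cn /cdim /dimension; field.
  have -> : \sum_(x <- ns) (a * sg x * (- (r x - 1) * (2 * r x - 1)) + 0 * (- (r x - 1) * (2 * r x - 1))^* +
      (a * sgs x * (- (r x - 1) * (2 * r x - 1))^* + 0 * (- (r x - 1) * (2 * r x - 1))^*^*)) =
    - a * (2 * (\sum_(z <- ns) sg z * r z ^+ 2) - 3 * (\sum_(z <- ns) sg z * r z) + \sum_(z <- ns) sg z)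
    - a * (2 * (\sum_(z <- ns) sgs z * rb z ^+ 2) - 3 * (\sum_(z <- ns) sgs z * rb z) + \sum_(z <- ns) sgs z).
    elim: (ns) => [|u s IH]; first by rewrite !big_nil; ring.
    by rewrite !big_cons IH /rb !conjCM conjCN !conjCB conjCM conjC1' cn; ring.
  have -> : \sum_(z <- ns) sg z * sgs z * (- 2 * (r z - 1) * (r z - 1)^*) =
    - 2 * \sum_(z <- ns) sg z * sgs z * ((r z - 1) * (rb z - 1)).
    elim: (ns) => [|u s IH]; first by rewrite !big_nil; ring.
    by rewrite !big_cons IH /rb conjCB conjC1'; ring.
  by rewrite /c3; ring.
rewrite E1 E2 E3; have -> : (iu * z) ^+ 2 = - z ^+ 2 by rewrite exprMn expr2 iu2 mulN1r.
by rewrite mulrN; exact: dH.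
Qed.

End ExpoJets.

(** * Increments of the logarithms *)

Section Increments.
Variable R : realType.
Local Notation C := (Cplx R).
Implicit Types (z : C) (t s h : R).

Lemma ppos_incr (f : R -> C) t h (k : C) (M : R) : continuous f -> 0 <= t -> 0 <= h ->
  (forall s, t < s < t + h -> nm (f s - k) <= M) ->
  nm (ppos f (t + h) - ppos f t - k * cst_of h) <= M * h.
Proof.
move=> cf t0 h0 H; pose F s := ppos f s - cst_of s * k.
have th : t <= t + h by rewrite lerDl.
have dF s : t < s < t + h -> dC F s (f s - k).
  move=> /andP[s0 _]; apply: dCB; last exact: dC_line.
  by apply: ppos_derive; [exact: cf|exact: le_lt_trans t0 s0].
have cF : {within `[t, t + h], continuous F}.
  apply: within_cont => s; apply: cvgB; first exact: ppos_continuous.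
  apply: cvgM; last exact: cvg_cst.
  by apply: (@continuousCcst _ _ (fun s : R => s)) => u; exact: cvg_id.
have := mvt_nm_cst th dF cF H.
have -> : F (t + h) - F t = ppos f (t + h) - ppos f t - k * cst_of h.
  by rewrite /F cstD; ring.
by rewrite [t + h - t]addrAC subrr add0r.
Qed.

(** The two sides differ by a multiple of 2 pi i, yet the three imaginary parts are below pi/2 in
    modulus, which leaves less than 3 pi/2. *)
Lemma LogC_mul (y z : C) : 0 < Re y -> 0 < Re z -> 0 < Re (y * z) -> LogC (y * z) = LogC y + LogC z.
Proof.
move=> y0 z0 yz0; have E : expC (LogC (y * z)) = expC (LogC y + LogC z).
  by rewrite expCD !expC_LogC.
have [k kE] := expC_inj E; rewrite kE; suff -> : k = 0 by rewrite mulr0 addr0.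
have p0 : 0 < pi :> R := pi_gt0 R.
have p2 : 0 < pi *+ 2 :> R by rewrite mulr2n addr_gt0.
have IE : Im (LogC (y * z)) = Im (LogC y) + Im (LogC z) + pi *+ 2 * k%:~R.
  by rewrite kE cImD cImD /twopii -cst_int -mulrA -cstM cImM Re_iu Im_iu Re_cst Im_cst; ring.
have at2 (v : R) : - (pi / 2) < atan v < pi / 2 by rewrite atan_gtNpi2 atan_ltpi2.
move: IE; rewrite !Im_LogC; move: (at2 (Im y / Re y)) (at2 (Im z / Re z)) (at2 (Im (y * z) / Re (y * z))).
move: (atan _) (atan _) (atan _) => u v m /andP[u1 u2] /andP[v1 v2] /andP[m1 m2] E'.
have k1 : -1 < k%:~R :> R.
  by rewrite -(ltr_pM2l p2) mulrN1; lra.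
have k2 : k%:~R < 1 :> R.
  by rewrite -(ltr_pM2l p2) mulr1; lra.
move: k1 k2; rewrite -[1]/(1%:~R) -[X in X < _]/((-1)%:~R) !ltr_int; case: k {E kE E'} => [[|k]|k] //.
Qed.

(** Because |1 - y|^2 = 1 - 2 Re y + |y|^2 < 2 Re(1 - y) in the disc. *)
Lemma Re_gap (y : C) (e : R) : 0 < e -> e < nm (1 - y) -> nm y < 1 -> e ^+ 2 / 2 < Re (1 - y).
Proof.
move=> e0 h1 h2; have y0 := nm_ge0 y.
have : e ^+ 2 < nm (1 - y) ^+ 2 by rewrite ltrXn2r ?nnegrE ?nm_ge0 // ltW.
have : nm y ^+ 2 < 1 by rewrite expr_lt1.
rewrite !nm2 !ReImE; nra.
Qed.

End Increments.

(** * One time step of the flow *)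

Section Steps.
Variable R : realType.
Local Notation C := (Cplx R).
Variables (ns : seq C) (w : C -> C) (e T : R).
Hypotheses (e0 : 0 < e) (e1 : e < 1) (T0 : 0 <= T) (wn : forall z, z \in ns -> nm (w z) < 1).

(** A bound for the velocity field: |r - 1| <= 1/e + 1, and the second term bounds |U| up to the
    time T + 1, which no step exceeds. *)
Definition speed : R := 2 * (e^-1 + 1) + expR (Lc e * (T + 1)).
Lemma speed_ge0 : 0 <= speed.
Proof. by rewrite addr_ge0 ?expR_ge0 // mulr_ge0 // addr_ge0 // invr_ge0 ltW. Qed.

(** The index type of the jets: a driving angle together with a time step. [s_speed] and [s_turn]
    keep the increment of W below e^2/4, so that log(1 - W) does not change branch. The nodes are
    alive at the start of the step; the regularised flow carries them through it. *)
Record step := Step {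
  s_th : R -> R; s_t : R; s_h : R; s_eta : R;
  s_cont : continuous s_th;
  s_time : 0 <= s_t <= T;
  s_len : 0 <= s_h <= 1;
  s_speed : speed * s_h <= e ^+ 2 / 8;
  s_turn : 4 * `|s_th (s_t + s_h) - s_th s_t| <= e ^+ 2 / 8;
  s_eta1 : `|s_th (s_t + s_h) - s_th s_t| <= s_eta;
  s_eta2 : s_h <= s_eta <= 2;
  s_osc : forall s, s_t <= s <= s_t + s_h -> nm (xi s_th s - xi s_th s_t) <= s_eta;
  s_alive : forall z, z \in ns -> alive s_th e (w z) s_t }.

Definition s_x (i : step) : R := s_th i (s_t i + s_h i) - s_th i (s_t i).

Lemma step_bounds i : [/\ `|s_x i| <= 1, 0 <= s_h i <= 1, `|s_x i| <= s_eta i, s_h i <= s_eta i & s_eta i <= 2].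
Proof.
have /andP[a b] := s_eta2 i; split; [|exact: s_len|exact: s_eta1|exact: a|exact: b].
have := s_turn i; rewrite -/(s_x i) => h.
have : e ^+ 2 <= 1 by rewrite exprn_ile1 // ltW.
lra.
Qed.

Local Notation jet := (jet s_x s_h s_eta).
Local Notation U i z := (Ue (s_th i) e (w z)).
Local Notation W i z := (We (s_th i) e (w z)).
Local Notation t1 i := (s_t i + s_h i).
Definition s_r (i : step) (z : C) : C := re (s_th i) e (w z) (s_t i).
Local Notation r := s_r.

Lemma einv_ge0 : 0 <= e^-1. Proof. by rewrite invr_ge0 ltW. Qed.
Definition rate : R := 3 / e ^+ 2 * (speed + 1).
Lemma rate_ge0 : 0 <= rate.
Proof.
have a := speed_ge0; apply: mulr_ge0; last by rewrite addr_ge0.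
by rewrite divr_ge0 // exprn_ge0 // ltW.
Qed.

Section Node.
Variables (i : step) (z : C).
Hypothesis zn : z \in ns.
Let cth := @s_cont i.
Let t := s_t i.
Let t0 : 0 <= t. Proof. by have /andP[] := s_time i. Qed.
Let tT : t <= T. Proof. by have /andP[] := s_time i. Qed.
Let h0 : 0 <= s_h i. Proof. by have /andP[] := s_len i. Qed.
Let h1 : s_h i <= 1. Proof. by have /andP[] := s_len i. Qed.
Let al : alive (s_th i) e (w z) t. Proof. exact: s_alive. Qed.

(** Lipschitz dependence on the starting point, compared with the fixed point 0. The nodes may cease
    to be alive within the step, so the disc bound cannot be used. *)
Lemma step_U_bound s : 0 <= s <= t1 i -> nm (U i z s) <= expR (Lc e * (T + 1)).
Proof.
move=> /andP[s0 st]; have [U0 _] := @Ue_at0 R _ cth (xi (s_th i)) (fun _ _ => erefl) e s e0 e1 s0.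
have := Ue_lip cth e0 (w z) 0 s0; rewrite U0 !subr0 => h; apply: le_trans h _.
rewrite -[leRHS]mul1r; apply: ler_pM; rewrite ?nm_ge0 ?expR_ge0 ?(ltW (wn zn)) //.
have sT : s <= T + 1 by apply: le_trans st _; apply: lerD; [exact: tT|exact: h1].
by rewrite ler_expR ler_wpM2l // ltW // Lc_gt0.
Qed.

Lemma step_fld_bound s : 0 <= s <= t1 i -> nm (fld (s_th i) e s (U i z s)) <= speed.
Proof.
move=> hs; apply: le_trans (nmB _ _) _; apply: lerD; last exact: step_U_bound.
rewrite !nmM nm2C nm_xi mulr1 ler_wpM2l //.
apply: le_trans (nmB _ _) _; rewrite nm1 lerD2r; exact: Rg_bound.
Qed.

Lemma step_U_incr s : t <= s <= t1 i -> nm (U i z s - U i z t) <= speed * (s - t).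
Proof.
move=> /andP[ts st].
apply: (@mvt_nm_cst _ _ (fun s => fld (s_th i) e s (U i z s)) t s speed ts).
- by move=> u /andP[u0 _]; apply: Ue_derive; [exact: cth|exact: e0|exact: le_lt_trans t0 u0].
- by apply: within_cont; exact: Ue_continuous.
- move=> u /andP[u0 us]; apply: step_fld_bound.
  by rewrite (le_trans t0 (ltW u0)) (le_trans (ltW us) st).
Qed.

Lemma step_W_lt1 : nm (W i z t) < 1.
Proof. by apply: nm_We_lt1; [exact: cth|exact: e0|exact: t0|exact: al|exact: wn]. Qed.

Lemma step_W_gap : e < nm (1 - W i z t).
Proof. by apply: al; rewrite t0 lexx. Qed.

Lemma step_r : r i z = (1 - W i z t)^-1.
Proof. by apply: (reE e0 al); rewrite t0 lexx. Qed.

Lemma step_Wr : W i z t * r i z = r i z - 1.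
Proof. by apply: (re_rel e0 al); rewrite t0 lexx. Qed.

Lemma step_W_incr s : t <= s <= t1 i ->
  nm (W i z s - W i z t) <= speed * (s - t) + nm (xi (s_th i) s - xi (s_th i) t).
Proof.
move=> hs; set p := xi _ s; set q := xi _ t.
have p0 : p != 0 := xi_neq0 _ _. have q0 : q != 0 := xi_neq0 _ _.
have -> : W i z s - W i z t = (U i z s - U i z t) / p + (U i z t / q) * ((q - p) / p).
  by rewrite /We -/p -/q; field; rewrite p0.
apply: le_trans (nmD _ _) _; apply: lerD.
  by rewrite nmM nmV nm_xi invr1 mulr1 step_U_incr.
rewrite nmM [nm ((q - p) / p)]nmM nmV nm_xi invr1 mulr1 [nm (q - p)]nmBC -[leRHS]mul1r; apply: ler_pM; rewrite ?nm_ge0 //.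
exact: ltW step_W_lt1.
Qed.

Lemma step_W_incr_eta s : t <= s <= t1 i -> nm (W i z s - W i z t) <= (speed + 1) * s_eta i.
Proof.
move=> hs; apply: le_trans (step_W_incr hs) _; rewrite [leRHS]mulrDl mul1r; apply: lerD; last exact: s_osc.
apply: ler_wpM2l; first exact: speed_ge0.
have /andP[h2 _] := s_eta2 i; apply: le_trans h2; rewrite lerBlDl.
by have /andP[] := hs.
Qed.

Lemma step_re_incr s : t <= s <= t1 i -> nm (re (s_th i) e (w z) s - r i z) <= rate * s_eta i.
Proof.
move=> hs; apply: le_trans (Rg_lip _ _ e0) _; rewrite /rate -[leRHS]mulrA ler_wpM2l //.
  by rewrite divr_ge0 // exprn_ge0 // ltW.
exact: step_W_incr_eta.
Qed.

End Node.

Lemma bdd_r z : z \in ns -> bdd (fun i : step => r i z).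
Proof.
move=> zn; exists e^-1; first by rewrite invr_ge0 ltW.
by move=> i; rewrite mulr1; exact: nm_re.
Qed.

Lemma bdd_W z : z \in ns -> bdd (fun i : step => W i z (s_t i)).
Proof. by move=> zn; exists 1 => // i; rewrite mulr1 ltW // step_W_lt1. Qed.

Lemma jet_turn : jet (fun i => - iu * cst_of (s_x i)) (fun _ => - iu) (fun _ => 0) (fun _ => 0).
Proof.
have := jetZ (@bdd_cst R step (- iu)) (jet_x s_x s_h s_eta).
by apply: jet_ext => i; rewrite ?mulr1 ?mulr0.
Qed.

(** A time integral whose integrand varies by O(eta) during the step has a purely linear
    expansion. *)
Lemma jet_of_rate (f c : step -> C) : bdd c ->
  (exists2 M : R, 0 <= M & forall i, nm (f i - c i * cst_of (s_h i)) <= M * s_eta i * s_h i) ->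
  jet f (fun _ => 0) (fun _ => 0) c.
Proof.
move=> bc [M M0 H]; split; [exact: bdd0|exact: bdd0|exact: bc|].
exists M; first exact: M0.
move=> i; have -> : f i - 0 * cst_of (s_x i) - 0 * cst_of (s_x i) ^+ 2 - c i * cst_of (s_h i) = f i - c i * cst_of (s_h i) by ring.
apply: le_trans (H i) _; rewrite -mulrA ler_wpM2l // /err mulrC lerDr.
exact: exprn_ge0.
Qed.

Lemma kA_step z y i : z \in ns -> y \in ns -> forall s, s_t i < s < t1 i ->
  nm (kA (s_th i) e (w z) (w y) s - (2 * r i z * r i y - 1)) <= 4 / e * rate * s_eta i.
Proof.
move=> zn yn s /andP[s0 s1]; have hs : s_t i <= s <= t1 i by rewrite !ltW.
have a := step_re_incr zn hs; have b := step_re_incr yn hs.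
rewrite /kA; set rz := re _ _ (w z) s in a *; set ry := re _ _ (w y) s in b *.
have -> : 2 * rz * ry - 1 - (2 * r i z * r i y - 1) = 2 * (rz * (ry - r i y) + r i y * (rz - r i z)) by ring.
rewrite nmM nm2C.
have n1 : nm (rz * (ry - r i y)) <= e^-1 * (rate * s_eta i).
  by rewrite nmM; apply: ler_pM; rewrite ?nm_ge0 ?nm_re.
have n2 : nm (r i y * (rz - r i z)) <= e^-1 * (rate * s_eta i).
  by rewrite nmM; apply: ler_pM; rewrite ?nm_ge0 ?nm_re.
have -> : 4 / e * rate * s_eta i = 2 * (e^-1 * (rate * s_eta i) + e^-1 * (rate * s_eta i)) by ring.
by rewrite ler_wpM2l //; apply: le_trans (nmD _ _) (lerD n1 n2).
Qed.

Lemma s_time0 (i : step) : 0 <= s_t i. Proof. by have /andP[] := s_time i. Qed.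
Lemma s_len0 (i : step) : 0 <= s_h i. Proof. by have /andP[] := s_len i. Qed.

Lemma jet_kA z y : z \in ns -> y \in ns ->
  jet (fun i => ppos (kA (s_th i) e (w z) (w y)) (t1 i) - ppos (kA (s_th i) e (w z) (w y)) (s_t i))
    (fun _ => 0) (fun _ => 0) (fun i => 2 * r i z * r i y - 1).
Proof.
move=> zn yn; apply: jet_of_rate.
  apply: bddD; last by apply: bdd_cst.
  by apply: bddM; [apply: bddM; [exact: bdd_cst|exact: bdd_r]|exact: bdd_r].
exists (4 / e * rate); first by apply: mulr_ge0; [rewrite mulr_ge0 ?einv_ge0|exact: rate_ge0].
move=> i; apply: ppos_incr; [exact: (@kA_continuous _ _ (@s_cont i) _ e0)|exact: s_time0|exact: s_len0|].
exact: kA_step.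
Qed.

Lemma re0 (i : step) s : 0 <= s -> re (s_th i) e 0 s = 1.
Proof.
move=> s0; have [U0 A] := @Ue_at0 R _ (@s_cont i) (xi (s_th i)) (fun _ _ => erefl) e s e0 e1 s0.
by rewrite (reE e0 A) ?lexx ?andbT // /We U0 mul0r subr0 invr1.
Qed.

Lemma jet_kA0 z : z \in ns ->
  jet (fun i => ppos (kA (s_th i) e (w z) 0) (t1 i) - ppos (kA (s_th i) e (w z) 0) (s_t i))
    (fun _ => 0) (fun _ => 0) (fun i => 2 * r i z - 1).
Proof.
move=> zn; apply: jet_of_rate.
  by apply: bddD; [apply: bddM; [exact: bdd_cst|exact: bdd_r]|exact: bdd_cst].
exists (2 * rate); first by apply: mulr_ge0; [|exact: rate_ge0].
move=> i; apply: ppos_incr; [exact: (@kA_continuous _ _ (@s_cont i) _ e0)|exact: s_time0|exact: s_len0|].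
move=> s /andP[s0 s1]; have hs : s_t i <= s <= t1 i by rewrite !ltW.
have s0' : 0 <= s by exact: le_trans (s_time0 i) (ltW s0).
rewrite /kA re0 // mulr1.
set rz := re _ _ (w z) s.
have -> : 2 * rz - 1 - (2 * r i z - 1) = 2 * (rz - r i z) by ring.
by rewrite nmM nm2C -[leRHS]mulrA ler_wpM2l // step_re_incr.
Qed.

Lemma jet_kB z y : z \in ns -> y \in ns ->
  jet (fun i => ppos (kB (s_th i) e (w z) (w y)) (t1 i) - ppos (kB (s_th i) e (w z) (w y)) (s_t i))
    (fun _ => 0) (fun _ => 0) (fun i => - 2 * (r i z - 1) * (r i y - 1)^*).
Proof.
move=> zn yn; apply: jet_of_rate.
  apply: bddM; first by apply: bddM; [exact: bdd_cst|apply: bddD; [exact: bdd_r|exact: bdd_cst]].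
  by apply: bigO_conj; apply: bddD; [exact: bdd_r|exact: bdd_cst].
exists (4 * (e^-1 + 1) * rate); first by apply: mulr_ge0; [rewrite mulr_ge0 // addr_ge0 // einv_ge0|exact: rate_ge0].
move=> i; apply: ppos_incr; [exact: (@kB_continuous _ _ (@s_cont i) _ e0)|exact: s_time0|exact: s_len0|].
move=> s /andP[s0 s1]; have hs : s_t i <= s <= t1 i by rewrite !ltW.
have a := step_re_incr zn hs; have b := step_re_incr yn hs.
rewrite /kB; set rz := re _ _ (w z) s in a *; set ry := re _ _ (w y) s in b *.
have -> : - 2 * (rz - 1) * (ry - 1)^* - (- 2 * (r i z - 1) * (r i y - 1)^*) =
  - (2 * ((rz - 1) * (ry - r i y)^* + (r i y - 1)^* * (rz - r i z))).
  by rewrite !conjCB; ring.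
rewrite nmN nmM nm2C.
have rb (c : C) : nm c <= e^-1 -> nm (c - 1) <= e^-1 + 1.
  by move=> h; apply: le_trans (nmB _ _) _; rewrite nm1 lerD2r.
have n1 : nm ((rz - 1) * (ry - r i y)^*) <= (e^-1 + 1) * (rate * s_eta i).
  by rewrite nmM nm_conj; apply: ler_pM; rewrite ?nm_ge0 //; apply: rb; exact: nm_re.
have n2 : nm ((r i y - 1)^* * (rz - r i z)) <= (e^-1 + 1) * (rate * s_eta i).
  by rewrite nmM nm_conj; apply: ler_pM; rewrite ?nm_ge0 //; apply: rb; exact: nm_re.
have -> : 4 * (e^-1 + 1) * rate * s_eta i = 2 * ((e^-1 + 1) * (rate * s_eta i) + (e^-1 + 1) * (rate * s_eta i)) by ring.
by rewrite ler_wpM2l //; apply: le_trans (nmD _ _) (lerD n1 n2).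
Qed.

Lemma step_fld_incr i z s : z \in ns -> s_t i <= s <= t1 i ->
  nm (fld (s_th i) e s (U i z s) - fld (s_th i) e (s_t i) (U i z (s_t i))) <=
  (2 * (rate + (e^-1 + 1)) + speed) * s_eta i.
Proof.
move=> zn hs; have hr := step_re_incr zn hs; have hU := step_U_incr zn hs.
have ho := s_osc hs; rewrite /fld -/(We _ _ _ _) -/(We (s_th i) e (w z) (s_t i)) -/(re _ _ _ _) -/(re (s_th i) e (w z) (s_t i)) -/(r i z).
set p := xi _ s in ho *; set q := xi _ (s_t i) in ho *; set rz := re _ _ _ s in hr *.
have -> : 2 * p * (rz - 1) - U i z s - (2 * q * (r i z - 1) - U i z (s_t i)) =
  2 * (p * (rz - r i z) + (p - q) * (r i z - 1)) - (U i z s - U i z (s_t i)) by ring.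
apply: le_trans (nmB _ _) _; rewrite [leRHS]mulrDl; apply: lerD; last first.
  apply: le_trans hU _; apply: ler_wpM2l; first exact: speed_ge0.
  have /andP[h2 _] := s_eta2 i; apply: le_trans h2; rewrite lerBlDl.
  by have /andP[] := hs.
rewrite nmM nm2C -[leRHS]mulrA ler_wpM2l //; apply: le_trans (nmD _ _) _.
rewrite [leRHS]mulrDl; apply: lerD; first by rewrite nmM nm_xi mul1r.
rewrite nmM mulrC; apply: ler_pM; rewrite ?nm_ge0 //.
apply: le_trans (nmB _ _) _; rewrite nm1 lerD2r; exact: nm_re.
Qed.

Lemma step_fldE i z : z \in ns ->
  fld (s_th i) e (s_t i) (U i z (s_t i)) / xi (s_th i) (s_t i) = 2 * (r i z - 1) - W i z (s_t i).
Proof.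
move=> zn; rewrite /fld -/(We _ _ _ _) -/(re _ _ _ _) -/(r i z) mulrBl -/(We _ _ _ _).
by rewrite mulrAC mulfK ?xi_neq0 // mulrAC.
Qed.

Lemma jet_U z : z \in ns ->
  jet (fun i => (U i z (t1 i) - U i z (s_t i)) / xi (s_th i) (s_t i))
    (fun _ => 0) (fun _ => 0) (fun i => 2 * (r i z - 1) - W i z (s_t i)).
Proof.
move=> zn; apply: jet_of_rate.
  apply: bddD; last by apply: bddN; exact: bdd_W.
  by apply: bddM; [exact: bdd_cst|apply: bddD; [exact: bdd_r|exact: bdd_cst]].
exists (2 * (rate + (e^-1 + 1)) + speed).
  by rewrite addr_ge0 ?speed_ge0 // mulr_ge0 // addr_ge0 ?rate_ge0 // addr_ge0 ?einv_ge0.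
move=> i; rewrite -step_fldE // -mulrAC -mulrBl nmM nmV nm_xi invr1 mulr1.
have ts : s_t i <= t1 i by rewrite lerDl s_len0.
pose F s := U i z s - cst_of s * fld (s_th i) e (s_t i) (U i z (s_t i)).
have dF s : s_t i < s < t1 i -> dC F s (fld (s_th i) e s (U i z s) - fld (s_th i) e (s_t i) (U i z (s_t i))).
  move=> /andP[s0 _]; apply: dCB; last exact: dC_line.
  by apply: Ue_derive; [exact: s_cont|exact: e0|exact: le_lt_trans (s_time0 i) s0].
have cF : {within `[s_t i, t1 i], continuous F}.
  apply: within_cont => s; apply: cvgB; first by apply: Ue_continuous; [exact: s_cont|exact: e0].
  apply: cvgM; last exact: cvg_cst.
  by apply: (@continuousCcst _ _ (fun s : R => s)) => u; exact: cvg_id.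
have kF s : s_t i < s < t1 i -> nm (fld (s_th i) e s (U i z s) - fld (s_th i) e (s_t i) (U i z (s_t i))) <=
    (2 * (rate + (e^-1 + 1)) + speed) * s_eta i.
  by move=> /andP[a b]; apply: step_fld_incr => //; rewrite !ltW.
have := mvt_nm_cst ts dF cF kF.
have -> : F (t1 i) - F (s_t i) = U i z (t1 i) - U i z (s_t i) - fld (s_th i) e (s_t i) (U i z (s_t i)) * cst_of (s_h i).
  by rewrite /F cstD; ring.
by rewrite [s_t i + _]addrC addrK.
Qed.

(** W(t + h) - W(t) = W(t) (E - 1) + d + d (E - 1), where E = exp(-i x) is the rotation by the
    driving increment and d the rescaled increment of U. *)
Lemma jet_W z : z \in ns ->
  jet (fun i => W i z (t1 i) - W i z (s_t i))
    (fun i => - iu * W i z (s_t i)) (fun i => - 2^-1 * W i z (s_t i)) (fun i => 2 * (r i z - 1) - W i z (s_t i)).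
Proof.
move=> zn; have JE := jet_exp step_bounds jet_turn.
have Jd := jet_U zn.
have J := jetD (jetD (jetZ (bdd_W zn) JE) Jd) (jetM step_bounds Jd JE).
apply: (jet_ext _ _ _ _ J) => i; last 3 first.
- by rewrite addr0 addr0 mulrC.
- by rewrite /= mul0r addr0 addr0 add0r expr2 mulrNN iu2 mulrN1 mulrC.
- by rewrite mulr0 add0r addr0.
set E := expC _; set d := (_ - _) / _.
have xiE : xi (s_th i) (t1 i) = xi (s_th i) (s_t i) * E^-1.
  rewrite /E mulNr expCN invrK -expCD /xi; congr expC.
  by rewrite -mulrDr -cstD /s_x subrKC.
have E0 : E != 0 := expC_neq0 _.
have q0 := xi_neq0 (s_th i) (s_t i).
rewrite /We xiE /d; field; by rewrite q0.
Qed.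

(** The relative increment of 1 - W over the step. *)
Definition s_g (z : C) (i : step) : C := - r i z * (W i z (t1 i) - W i z (s_t i)).

Lemma nm_xi_step i : nm (xi (s_th i) (t1 i) - xi (s_th i) (s_t i)) <= 4 * `|s_x i|.
Proof.
have -> : xi (s_th i) (t1 i) - xi (s_th i) (s_t i) = xi (s_th i) (s_t i) * (expC (iu * cst_of (s_x i)) - 1).
  rewrite mulrBr mulr1 -expCD; congr (_ - _); rewrite /xi; congr expC.
  by rewrite -mulrDr -cstD /s_x subrKC.
rewrite nmM nm_xi mul1r; have n1 : nm (iu * cst_of (s_x i) : C) = `|s_x i| by rewrite nmM nm_iu mul1r nm_cst.
by rewrite -n1; apply: expC_sub1; rewrite n1; have [] := step_bounds i.
Qed.

Lemma step_W_small i z : z \in ns -> nm (W i z (t1 i) - W i z (s_t i)) <= e ^+ 2 / 4.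
Proof.
move=> zn; have ts : s_t i <= t1 i <= t1 i by rewrite lerDl s_len0 lexx.
apply: le_trans (step_W_incr zn ts) _; rewrite [s_t i + _]addrC addrK.
have a := s_speed i; have b := s_turn i; rewrite -/(s_x i) in b; have c := nm_xi_step i.
rewrite [s_t i + _]addrC in c; lra.
Qed.

Lemma s_g_small i z : z \in ns -> nm (s_g z i) <= 1 / 2.
Proof.
move=> zn; rewrite /s_g mulNr nmN nmM.
have : nm (r i z) * nm (W i z (t1 i) - W i z (s_t i)) <= e^-1 * (e ^+ 2 / 4).
  by apply: ler_pM; rewrite ?nm_ge0 ?nm_re // step_W_small.
have -> : e^-1 * (e ^+ 2 / 4) = e / 4 by field; rewrite gt_eqF.
move=> h; apply: le_trans h _; rewrite ler_pdivrMr //; apply: le_trans (ltW e1) _; lra.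
Qed.

(** By [Re_gap] the real part of 1 - W exceeds e^2/2 at the start, and the increment is at most
    e^2/4, so both ends and their ratio lie in the right half-plane and [LogC_mul] applies. *)
Lemma LogC_step i z : z \in ns -> LogC (1 - W i z (t1 i)) - LogC (1 - W i z (s_t i)) = LogC (1 + s_g z i).
Proof.
move=> zn; have gap := Re_gap e0 (step_W_gap i zn) (step_W_lt1 i zn).
have small := step_W_small i zn.
have E : 1 - W i z (t1 i) = (1 - W i z (s_t i)) * (1 + s_g z i).
  have n0 : 1 - W i z (s_t i) != 0 by rewrite -nm_gt0 (lt_trans e0) // step_W_gap.
  by rewrite /s_g step_r //; field.
have e20 : 0 < e ^+ 2 by rewrite exprn_gt0.
have p1 : 0 < Re (1 - W i z (s_t i)) by apply: lt_trans gap; rewrite divr_gt0.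
have p2 : 0 < Re (1 + s_g z i).
  have := s_g_small i zn; have := Re_le_nm (s_g z i); rewrite cReD Re1 ler_norml => /andP[hh _]; lra.
have p3 : 0 < Re ((1 - W i z (s_t i)) * (1 + s_g z i)).
  rewrite -E; have := Re_le_nm (W i z (t1 i) - W i z (s_t i)).
  move: gap; rewrite !cReB Re1 => gap; rewrite ler_norml => /andP[_ hh]; lra.
by rewrite E LogC_mul // addrAC subrr add0r.
Qed.

(** Ito's formula for log(1 - W) before averaging; W r = r - 1 removes W from the coefficients. *)
Lemma jet_logW z : z \in ns ->
  jet (fun i => LogC (1 - W i z (t1 i)) - LogC (1 - W i z (s_t i)))
    (fun i => iu * (r i z - 1)) (fun i => r i z * (r i z - 1) / 2) (fun i => - (r i z - 1) * (2 * r i z - 1)).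
Proof.
move=> zn; have Jg := jetZ (bddN (bdd_r zn)) (jet_W zn).
have J := jet_log step_bounds (fun i => s_g_small i zn) Jg.
apply: (jet_ext _ _ _ _ J) => i; rewrite /=.
- by rewrite -LogC_step.
- by rewrite -(step_Wr i zn); ring.
- have -> : - r i z * (- iu * W i z (s_t i)) = iu * (r i z - 1) by rewrite -(step_Wr i zn); ring.
  have -> : - r i z * (- 2^-1 * W i z (s_t i)) = 2^-1 * (r i z - 1) by rewrite -(step_Wr i zn); ring.
  by rewrite exprMn expr2 iu2; field.
- have -> : - r i z * (2 * (r i z - 1) - W i z (s_t i)) = - r i z * 2 * (r i z - 1) + W i z (s_t i) * r i z by ring.
  by rewrite step_Wr //; ring.
Qed.

End Steps.

(** * A continuous logarithm of the observable *)

Section LogObservable.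
Variable R : realType.
Local Notation C := (Cplx R).
Variables (kappa : R) (X : rooted_vertex R) (w : C -> C) (K : node_logs R).
Local Notation ns := (undup (nodes X)).
Hypothesis wn : forall z, z \in ns -> nm (w z) < 1.

Lemma expo_tip_ext (u u' : C -> C) (K1 K2 : node_logs R) : nq K1 = nq K2 ->
  (forall z, z \in ns -> [/\ u z = u' z, nd K1 z = nd K2 z & nw K1 z = nw K2 z]) ->
  (forall z y, z \in ns -> y \in ns -> z != y -> nsb K1 z y = nsb K2 z y /\ nr K1 z y = nr K2 z y) ->
  expo kappa X (tip_logs u K1 0 1) = expo kappa X (tip_logs u' K2 0 1).
Proof.
move=> Eq E1 E2; apply: expo_ext; apply: And5; [exact: (conj Eq Eq)|exact: (conj erefl erefl)|exact: (conj erefl erefl)| |exact: E2].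
by move=> z zn; have [h1 h2 h3] := E1 _ zn; rewrite /= h1 h2 h3.
Qed.

Lemma nq_at th e t : nq (node_logs_at w th K e t) = nq K + cst_of t - iu * cst_of (th t).
Proof. by []. Qed.

Lemma half_conj (u : C) : 2^-1 * (u + u^*) = cst_of (Re u).
Proof.
have -> : u + u^* = 2 * cst_of (Re u) by apply: eqcx; rewrite -(cst_nat R 2) !ReImE; ring.
by rewrite mulrA mulVf ?mul1r.
Qed.

Definition logs_at e th t : logs R :=
  tip_logs (fun z => We th e (w z) t) (node_logs_at w th K e t) 0 1.

(* a logarithm of the observable, for the regularised flow *)
Definition Lam e th t : C :=
  expo kappa X (logs_at e th t) + rexpo X w
  + \sum_(z <- ns) chg X z * chgs X z * cst_of (Re (ppos (kB th e (w z) (w z)) t)).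

Section Expansion.
Variables (e T : R).
Hypotheses (k0 : 0 < kappa) (e0 : 0 < e) (e1 : e < 1) (T0 : 0 <= T).
Hypothesis neu : rtau X + rtaus X + \sum_(z <- ns) (chg X z + chgs X z) = 0.

Local Notation step := (step ns w e T).
Local Notation jet := (jet (@s_x _ ns w e T) (@s_h _ ns w e T) (@s_eta _ ns w e T)).
Local Notation t1 i := (s_t i + s_h i).
Local Notation sB := (step_bounds e0 e1).

Definition Zc th t : C := expo kappa X (turn_logs (fun z => re th e (w z) t)).
(** The x^2-coefficient after exponentiation. By [expo_drift] the h-coefficient is -kappa times
    it. *)
Definition Gc th t : C := expo kappa X (turn2_logs (fun z => re th e (w z) t)) + 2^-1 * Zc th t ^+ 2.

Lemma jet_Lam : jet (fun i => Lam e (s_th i) (t1 i) - Lam e (s_th i) (s_t i))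
  (fun i => expo kappa X (turn_logs (s_r i))) (fun i => expo kappa X (turn2_logs (s_r i)))
  (fun i => expo kappa X (drift_logs (s_r i)) +
     \sum_(z <- ns) chg X z * chgs X z * (- 2 * (s_r i z - 1) * (s_r i z - 1)^*)).
Proof.
have JT := jet_turn ns w e T.
have J0 := jet_zero (@s_x _ ns w e T) (@s_h _ ns w e T) (@s_eta _ ns w e T).
have Jh : jet (fun i => cst_of (s_h i)) (fun _ => 0) (fun _ => 0) (fun _ => 1).
  split; [exact: bdd0|exact: bdd0|exact: bdd_cst|].
  by exists 0 => // i; rewrite !mul0r !subr0 mul1r subrr nm0.
have Jrot (f c : step -> C) : jet f (fun _ => 0) (fun _ => 0) c ->
    jet (fun i => f i + - iu * cst_of (s_x i)) (fun _ => - iu) (fun _ => 0) c.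
  by move=> J; apply: (jet_ext _ _ _ _ (jetD J JT)) => i; rewrite ?add0r ?addr0.
have Jexpo : jet (fun i => expo kappa X (subl (logs_at e (s_th i) (t1 i)) (logs_at e (s_th i) (s_t i))))
    (fun i => expo kappa X (turn_logs (s_r i))) (fun i => expo kappa X (turn2_logs (s_r i)))
    (fun i => expo kappa X (drift_logs (s_r i))).
  have Jq : jet (fun i => nq K + cst_of (t1 i) - iu * cst_of (s_th i (t1 i)) -
      (nq K + cst_of (s_t i) - iu * cst_of (s_th i (s_t i)))) (fun _ => - iu) (fun _ => 0) (fun _ => 1).
    by apply: (jet_ext _ _ _ _ (Jrot _ _ Jh)) => i //; rewrite /s_x cstB cstD; ring.
  have Jc0 (c : C) : jet (fun _ => c - c) (fun _ => 0) (fun _ => 0) (fun _ => 0).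
    by apply: (jet_ext _ _ _ _ J0) => i //; rewrite subrr.
  apply: jet_expo; apply: And5.
  - by split; exact: Jq.
  - by split; exact: Jc0.
  - by split; exact: Jc0.
  - move=> z zn; apply: And4.
    + apply: (jet_ext _ _ _ _ (Jrot _ _ (jet_kA T e0 e1 wn zn zn))) => i //=.
      by rewrite /s_x cstB; ring.
    + apply: (jet_ext _ _ _ _ (Jrot _ _ (jet_kA0 T e0 e1 wn zn))) => i //=.
      by rewrite /s_x cstB; ring.
    + exact: (jet_logW T e0 e1 wn zn).
    + apply: (jet_ext _ _ _ _ (jet_conj (jet_logW T e0 e1 wn zn))) => i //=.
      by rewrite conjCB -!LogC_conj !conjCB conjC1' !mul1r.
  - move=> z y zn yn; split.
      apply: (jet_ext _ _ _ _ (Jrot _ _ (jet_kA T e0 e1 wn zn yn))) => i //=.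
      by rewrite /s_x cstB; ring.
    apply: (jet_ext _ _ _ _ (jet_kB T e0 e1 wn zn yn)) => i //=; ring.
have Jsum : jet (fun i => \sum_(z <- ns) chg X z * chgs X z *
      cst_of (Re (ppos (kB (s_th i) e (w z) (w z)) (t1 i) - ppos (kB (s_th i) e (w z) (w z)) (s_t i))))
    (fun _ => 0) (fun _ => 0)
    (fun i => \sum_(z <- ns) chg X z * chgs X z * (- 2 * (s_r i z - 1) * (s_r i z - 1)^*)).
  have S := @jet_sum R step (@s_x _ ns w e T) (@s_h _ ns w e T) (@s_eta _ ns w e T) C ns
    (fun z i => chg X z * chgs X z *
      cst_of (Re (ppos (kB (s_th i) e (w z) (w z)) (t1 i) - ppos (kB (s_th i) e (w z) (w z)) (s_t i))))
    (fun _ _ => 0) (fun _ _ => 0) (fun z i => chg X z * chgs X z * (- 2 * (s_r i z - 1) * (s_r i z - 1)^*)).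
  have {}S := S _; apply: (jet_ext _ _ _ _ (S _)) => [i|i|i|i|z zn]; [by []|by rewrite big1|by rewrite big1|by []|].
  have JB := jet_kB T e0 e1 wn zn zn.
  have J2 := jetZ (@bdd_cst R step (chg X z * chgs X z * 2^-1)) (jetD JB (jet_conj JB)).
  apply: (jet_ext _ _ _ _ J2) => i.
  - rewrite -mulrA; congr (_ * _); set u := (_ - _).
    exact: half_conj.
  - by rewrite conjC0 addr0 mulr0.
  - by rewrite conjC0 addr0 mulr0.
  - rewrite !conjCM conjCN conjC_nat' conjCK'; by field.
have J := jetD Jexpo Jsum.
apply: (jet_ext _ _ _ _ J) => i; [|by rewrite addr0|by rewrite addr0|by []].
rewrite -expo_sub /Lam.
have -> : \sum_(z <- ns) chg X z * chgs X z *
   cst_of (Re (ppos (kB (s_th i) e (w z) (w z)) (t1 i) - ppos (kB (s_th i) e (w z) (w z)) (s_t i))) =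
  \sum_(z <- ns) chg X z * chgs X z * cst_of (Re (ppos (kB (s_th i) e (w z) (w z)) (t1 i))) -
  \sum_(z <- ns) chg X z * chgs X z * cst_of (Re (ppos (kB (s_th i) e (w z) (w z)) (s_t i))).
  rewrite -sumrB; apply: eq_bigr => z _; by rewrite cReB cstB mulrBr.
by move: (expo _ _ _) (expo _ _ _) (rexpo _ _) => p q s; ring.
Qed.

Lemma Lam_expansion : exists2 M : R, 0 <= M & forall i : step,
  [/\ nm (Zc (s_th i) (s_t i)) <= M, nm (Gc (s_th i) (s_t i)) <= M &
   nm (expC (Lam e (s_th i) (t1 i) - Lam e (s_th i) (s_t i)) - 1
     - Zc (s_th i) (s_t i) * cst_of (s_x i)
     - Gc (s_th i) (s_t i) * cst_of (s_x i ^+ 2 - kappa * s_h i)) <= M * (`|s_x i| ^+ 3 + s_h i * s_eta i)].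
Proof.
have [[M1 M10 H1] [M2 M20 H2] _ [M3 M30 H3]] := jet_exp sB jet_Lam.
exists (M1 + M2 + M3); first by rewrite !addr_ge0.
move=> i; split.
- by apply: le_trans (H1 i) _; rewrite mulr1 -addrA lerDl addr_ge0.
- by apply: le_trans (H2 i) _; rewrite mulr1 addrAC lerDr addr_ge0.
have D := @expo_drift R kappa X (s_r i) k0 neu.
set p := (X in nm X).
have -> : p = expC (Lam e (s_th i) (t1 i) - Lam e (s_th i) (s_t i)) - 1
   - expo kappa X (turn_logs (s_r i)) * cst_of (s_x i)
   - (expo kappa X (turn2_logs (s_r i)) + 2^-1 * expo kappa X (turn_logs (s_r i)) ^+ 2) * cst_of (s_x i) ^+ 2
   - (expo kappa X (drift_logs (s_r i)) +
     \sum_(z <- ns) chg X z * chgs X z * (- 2 * (s_r i z - 1) * (s_r i z - 1)^*)) * cst_of (s_h i).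
  have -> : expo kappa X (drift_logs (s_r i)) +
     \sum_(z <- ns) chg X z * chgs X z * (- 2 * (s_r i z - 1) * (s_r i z - 1)^*) =
     - (cst_of kappa * (expo kappa X (turn2_logs (s_r i)) + 2^-1 * expo kappa X (turn_logs (s_r i)) ^+ 2)).
    by apply/eqP; rewrite -addr_eq0 D.
  have xx : cst_of (s_x i ^+ 2 - kappa * s_h i) = cst_of (s_x i) ^+ 2 - cst_of kappa * cst_of (s_h i) :> C.
    by rewrite cstB !expr2 !cstM.
  have ZE : Zc (s_th i) (s_t i) = expo kappa X (turn_logs (s_r i)) by [].
  have GE : Gc (s_th i) (s_t i) = expo kappa X (turn2_logs (s_r i)) + 2^-1 * expo kappa X (turn_logs (s_r i)) ^+ 2 by [].
  rewrite /p GE ZE xx {ZE GE xx D p}.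
  by move: (expC _) (expo _ _ _) (expo _ _ _) => E F G; ring.
apply: le_trans (H3 i) _; apply: ler_wpM2r; last by rewrite lerDr addr_ge0.
rewrite addr_ge0 ?exprn_ge0 // mulr_ge0 //; first by have [_ /andP[]] := sB i.
by have [_ /andP[a _] _ b _] := sB i; exact: le_trans a b.
Qed.

End Expansion.

Section Path.
Variables (th : R -> R) (x : R -> C).
Hypothesis cth : continuous th.
Hypothesis xE : forall t, 0 <= t -> x t = xi th t.

Lemma Lam_tip (D : set C) (q : C) e t : 0 < e -> 0 <= t ->
  (forall z, z \in ns -> alive th e (w z) t) ->
  tip_value kappa X (unif (evolved x t (MarkedDomain D q w))) (node_logs_at w th K e t) 1 = Lam e th t.
Proof.
move=> e0 t0 A; set u := unif _.
have uE z : z \in ns -> u z = We th e (w z) t.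
  by move=> zn; exact: (evolved_unif D q cth xE e0 t0 (A _ zn)).
have E1 : expo kappa X (tip_logs u (node_logs_at w th K e t) 0 1) = expo kappa X (logs_at e th t).
  by apply: expo_tip_ext => // z zn; rewrite (uE _ zn).
have E2 : rexpo X u = rexpo X w + \sum_(z <- ns) chg X z * chgs X z * cst_of (Re (ppos (kB th e (w z) (w z)) t)).
  rewrite /rexpo -big_split; apply: eq_big_seq => z zn /=.
  rewrite (uE _ zn) (nm_Ue_eq cth e0 t0 (A _ zn)) lnM ?posrE ?expR_gt0 //; last first.
    by rewrite subr_gt0 expr_lt1 ?nm_ge0 // wn.
  by rewrite expRK cstD mulrDr.
by rewrite /tip_value /Lam E1 E2 addrA.
Qed.

(** All ingredients are integrals over [0, t] of quantities on which the two levels agree. This lets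
    the branches built at different levels be pasted. *)
Lemma Lam_mono e e' t : 0 < e' -> e' <= e -> 0 <= t ->
  (forall z, z \in ns -> alive th e (w z) t) -> e < 1 -> Lam e' th t = Lam e th t.
Proof.
move=> e'0 ee t0 A e1; have e0 := lt_le_trans e'0 ee.
have M z : z \in ns -> forall s, 0 <= s <= t -> We th e' (w z) s = We th e (w z) s.
  move=> zn s hs; have [_ H] := alive_mono cth xE e'0 ee t0 (A _ zn).
  by rewrite /We H.
have M' z : z \in ns -> alive th e' (w z) t.
  by move=> zn; have [H _] := alive_mono cth xE e'0 ee t0 (A _ zn).
have r z : z \in ns -> forall s, 0 <= s <= t -> re th e' (w z) s = re th e (w z) s.
  by move=> zn s hs; rewrite (reE e'0 (M' _ zn) hs) (reE e0 (A _ zn) hs) M.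
have r0 s : 0 <= s <= t -> re th e' 0 s = re th e 0 s.
  move=> hs; have [U1 B1] := Ue_at0 cth xE e'0 (le_lt_trans ee e1) t0.
  have [U2 B2] := Ue_at0 cth xE e0 e1 t0.
  have /andP[s0 _] := hs.
  have [V1 _] := Ue_at0 cth xE e'0 (le_lt_trans ee e1) s0; have [V2 _] := Ue_at0 cth xE e0 e1 s0.
  by rewrite (reE e'0 B1 hs) (reE e0 B2 hs) /We V1 V2.
have kAE (a b : C) : (forall s, 0 <= s <= t -> re th e' a s = re th e a s) ->
    (forall s, 0 <= s <= t -> re th e' b s = re th e b s) ->
    ppos (kA th e' a b) t = ppos (kA th e a b) t /\ ppos (kB th e' a b) t = ppos (kB th e a b) t.
  move=> ha hb; split.
    apply: ppos_eq; [exact: (@kA_continuous _ _ cth _ e'0)|exact: (@kA_continuous _ _ cth _ e0)|exact: t0|].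
    by move=> s /andP[s0 s1]; have hs : 0 <= s <= t; [rewrite (ltW s0) (ltW s1)|rewrite /kA (ha _ hs) (hb _ hs)].
  apply: ppos_eq; [exact: (@kB_continuous _ _ cth _ e'0)|exact: (@kB_continuous _ _ cth _ e0)|exact: t0|].
  by move=> s /andP[s0 s1]; have hs : 0 <= s <= t; [rewrite (ltW s0) (ltW s1)|rewrite /kB (ha _ hs) (hb _ hs)].
have E1 : expo kappa X (logs_at e' th t) = expo kappa X (logs_at e th t).
  apply: expo_tip_ext; first exact: etrans (nq_at _ _ _) (esym (nq_at _ _ _)).
    move=> z zn; have [a _] := kAE _ _ (r _ zn) (r _ zn); have [b _] := kAE _ _ (r _ zn) r0.
    have tt : 0 <= t <= t by rewrite t0 lexx.
    apply: And3; first exact: (M _ zn _ tt).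
      exact: (congr1 (fun u => nd K z + u - iu * cst_of (th t)) a).
    exact: (congr1 (fun u => nw K z + u - iu * cst_of (th t)) b).
  move=> z y zn yn _; have [a b] := kAE _ _ (r _ zn) (r _ yn).
  split.
    exact: (congr1 (fun u => nsb K z y + u - iu * cst_of (th t)) a).
  exact: (congr1 (fun u => nr K z y + u) b).
have E2 : \sum_(z <- ns) chg X z * chgs X z * cst_of (Re (ppos (kB th e' (w z) (w z)) t)) =
    \sum_(z <- ns) chg X z * chgs X z * cst_of (Re (ppos (kB th e (w z) (w z)) t)).
  apply: eq_big_seq => z zn; have [_ b] := kAE _ _ (r _ zn) (r _ zn).
  exact: (congr1 (fun u => chg X z * chgs X z * cst_of (Re u)) b).
exact: (congr2 (fun u v => u + rexpo X w + v) E1 E2).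
Qed.

Definition cts (f : R -> C) t := f s @[s --> t] --> f t.
Lemma ctsD f g t : cts f t -> cts g t -> cts (fun s => f s + g s) t.
Proof. exact: cvgD. Qed.
Lemma ctsN f t : cts f t -> cts (fun s => - f s) t.
Proof. exact: cvgN. Qed.
Lemma ctsM f g t : cts f t -> cts g t -> cts (fun s => f s * g s) t.
Proof. exact: cvgM. Qed.
Lemma cts_cst (c : C) t : cts (fun _ => c) t.
Proof. exact: cvg_cst. Qed.
Lemma cts_of (f : R -> C) t : continuous f -> cts f t.
Proof. by move=> cf; exact: cf. Qed.
Lemma cts_conj f t : cts f t -> cts (fun s => (f s)^*) t.
Proof. by move=> cf; apply: (cvg_comp _ (fun z : C => z^*) cf); exact: continuous_conj. Qed.
Lemma cts_p2 f (k m : C) t : cts f t -> cts (fun s => p2 (f s) k m) t.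
Proof.
by move=> cf; apply: ctsD; apply: ctsM; [exact: cts_cst|exact: cf|exact: cts_cst|exact: cts_conj].
Qed.
Lemma cts_sum (s : seq C) (f : C -> R -> C) t : (forall z, z \in s -> cts (f z) t) ->
  cts (fun u => \sum_(z <- s) f z u) t.
Proof.
elim: s => [|z s IH] H.
  by rewrite (_ : (fun u => _) = (fun _ => 0)); [exact: cts_cst|apply/funext => u; rewrite big_nil].
rewrite (_ : (fun u => _) = (fun u => f z u + \sum_(z <- s) f z u)); last by apply/funext => u; rewrite big_cons.
by apply: ctsD; [exact: H (mem_head z s)|apply: IH => y ys; exact: H (mem_behead (s := z :: s) ys)].
Qed.
Lemma cts_sumpairs (s : seq C) (f : C -> C -> R -> C) t :
  (forall z y, z \in s -> y \in s -> cts (f z y) t) -> cts (fun u => sumpairs s (fun z y => f z y u)) t.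
Proof.
elim: s => [|z s IH] H.
  by rewrite (_ : (fun u => _) = (fun _ => 0)); [exact: cts_cst|apply/funext => u; rewrite /sumpairs big_ord0].
rewrite (_ : (fun u => _) = (fun u => \sum_(y <- s) f z y u + sumpairs s (fun z y => f z y u))); last first.
  by apply/funext => u; rewrite sumpairs_cons.
have sub y : y \in s -> y \in z :: s by move=> ys; exact: (mem_behead (s := z :: s) ys).
apply: ctsD; first by apply: cts_sum => y ys; apply: H; [exact: mem_head|exact: sub].
by apply: IH => u v us vs; apply: H; exact: sub.
Qed.

Lemma cts_tip (u : R -> C -> C) (K1 : R -> node_logs R) t :
  cts (fun s => nq (K1 s)) t ->
  (forall z, z \in ns -> [/\ cts (fun s => nd (K1 s) z) t, cts (fun s => nw (K1 s) z) t,
     cts (fun s => u s z) t & 0 < Re (1 - u t z)]) ->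
  (forall z y, z \in ns -> y \in ns -> cts (fun s => nsb (K1 s) z y) t /\ cts (fun s => nr (K1 s) z y) t) ->
  cts (fun s => expo kappa X (tip_logs (u s) (K1 s) 0 1)) t.
Proof.
move=> Cq C1 C2; rewrite /expo /tip_logs /=.
apply: ctsD.
  apply: ctsD.
    apply: ctsD; last first.
      apply: (cts_sum (f := fun z s => _)) => z zn; have [h1 h2 _ _] := C1 _ zn.
      by apply: ctsD; exact: cts_p2.
    apply: ctsD; last exact: cts_cst.
    apply: ctsD; last exact: cts_cst.
    apply: ctsD; last exact: cts_cst.
    apply: ctsD; last exact: cts_cst.
    by apply: ctsD; [exact: cts_p2|apply: ctsN; exact: cts_p2].
  apply: (cts_sum (f := fun z s => _)) => z zn; have [_ _ h1 h2] := C1 _ zn.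
  have cL : cts (fun s => LogC (1 - u s z)) t.
    have cf : cts (fun s => 1 - u s z) t by apply: ctsD; [exact: cts_cst|exact: ctsN].
    apply: (cvg_comp _ (@LogC R) cf).
    by apply/ccontP; exact: LogC_ccont.
  apply: ctsD; apply: cts_p2; first exact: cL.
  rewrite (_ : (fun s => _) = (fun s => (LogC (1 - u s z))^*)); first exact: cts_conj.
  by apply/funext => s; rewrite -LogC_conj conjCB conjC1' mul1r.
apply: (cts_sumpairs (f := fun z y s => _)) => z y zn yn; have [h1 h2] := C2 _ _ zn yn.
by apply: ctsD; exact: cts_p2.
Qed.

Lemma Lam_cont e t : 0 < e -> (forall z, z \in ns -> 0 < Re (1 - We th e (w z) t)) -> cts (Lam e th) t.
Proof.
move=> e0 H; have cid : continuous (fun s : R => cst_of s : C).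
  by apply: (@continuousCcst _ _ (fun s : R => s)) => s; exact: cvg_id.
have cturn : cts (fun s => - (iu * cst_of (th s))) t.
  apply: ctsN; apply: ctsM; first exact: cts_cst.
  by apply: cts_of; exact: (@continuousCcst _ _ th).
have cA a b : cts (ppos (kA th e a b)) t.
  by apply: cts_of; apply: ppos_continuous; exact: (@kA_continuous _ _ cth _ e0).
have cB a b : cts (ppos (kB th e a b)) t.
  by apply: cts_of; apply: ppos_continuous; exact: (@kB_continuous _ _ cth _ e0).
have c1 : cts (fun s => expo kappa X (logs_at e th s)) t.
  apply: (@cts_tip (fun s z => We th e (w z) s) (node_logs_at w th K e)).
  + by apply: ctsD; [apply: ctsD; [exact: cts_cst|exact: cts_of]|exact: cturn].
  + move=> z zn; apply: And4; last exact: H.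
    * by apply: ctsD; [apply: ctsD; [exact: cts_cst|exact: cA]|exact: cturn].
    * by apply: ctsD; [apply: ctsD; [exact: cts_cst|exact: cA]|exact: cturn].
    * by apply: cts_of; exact: We_continuous.
  + move=> z y zn yn; split.
      by apply: ctsD; [apply: ctsD; [exact: cts_cst|exact: cA]|exact: cturn].
    by apply: ctsD; [exact: cts_cst|exact: cB].
have c2 : cts (fun s => \sum_(z <- ns) chg X z * chgs X z * cst_of (Re (ppos (kB th e (w z) (w z)) s))) t.
  apply: (cts_sum (f := fun z s => _)) => z zn; apply: ctsM; first exact: cts_cst.
  have E s : cst_of (Re (ppos (kB th e (w z) (w z)) s)) = 2^-1 * (ppos (kB th e (w z) (w z)) s + (ppos (kB th e (w z) (w z)) s)^*).
    by rewrite half_conj.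
  have -> : (fun s => cst_of (Re (ppos (kB th e (w z) (w z)) s)) : C) =
     (fun s => 2^-1 * (ppos (kB th e (w z) (w z)) s + (ppos (kB th e (w z) (w z)) s)^*)).
    by apply/funext => s; exact: E.
  apply: ctsM; first exact: cts_cst.
  by apply: ctsD; [exact: cB|apply: cts_conj; exact: cB].
exact: (ctsD (ctsD c1 (@cts_cst (rexpo X w) t)) c2).
Qed.

End Path.
End LogObservable.

(** * Expectations and Gaussian increments *)

Section BoundedExpectation.
Context {d : measure_display} {Omega : measurableType d} {R : realType} (P : probability Omega R).
Implicit Types (f g : Omega -> R).

Definition bmeas f := measurable_fun setT f /\ exists M : R, forall w, `|f w| <= M.

Lemma bounded_int (d' : measure_display) (T : measurableType d') (mu : probability T R) (f : T -> R) (M : R) :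
  measurable_fun setT f -> (forall w, `|f w| <= M) -> mu.-integrable setT (EFin \o f).
Proof.
move=> mf HM; apply: measurable_bounded_integrable.
- exact: measurableT.
- by apply: (@le_lt_trans _ _ 1%E); [exact: probability_le1|exact: ltry].
- exact: mf.
- exists M; split; first exact: num_real.
  by move=> N MN x _; exact: le_trans (HM x) (ltW MN).
Qed.

Lemma bmeas_int f : bmeas f -> P.-integrable setT (EFin \o f).
Proof. by move=> [mf [M HM]]; exact: bounded_int mf HM. Qed.

Lemma bmeasD f g : bmeas f -> bmeas g -> bmeas (fun w => f w + g w).
Proof.
move=> [mf [M HM]] [mg [M' HM']]; split; first exact: measurable_funD.
by exists (M + M') => w; apply: le_trans (ler_normD _ _) (lerD _ _).
Qed.
Lemma bmeasM f g : bmeas f -> bmeas g -> bmeas (fun w => f w * g w).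
Proof.
move=> [mf [M HM]] [mg [M' HM']]; split; first exact: measurable_funM.
by exists (M * M') => w; rewrite normrM; apply: ler_pM.
Qed.
Lemma bmeas_cst (k : R) : bmeas (fun _ => k).
Proof. by split; [exact: measurable_cst|exists `|k|]. Qed.
Lemma bmeas_sum (I : Type) (s : seq I) (F : I -> Omega -> R) :
  (forall i, bmeas (F i)) -> bmeas (fun w => \sum_(i <- s) F i w).
Proof.
move=> H; elim: s => [|i s IH].
  by rewrite (_ : (fun w => _) = (fun _ => 0)); [exact: bmeas_cst|apply/funext => w; rewrite big_nil].
rewrite (_ : (fun w => _) = (fun w => F i w + \sum_(i <- s) F i w)); last by apply/funext => w; rewrite big_cons.
exact: bmeasD.
Qed.
Lemma bmeas_indic (A : set Omega) : measurable A -> bmeas (\1_A).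
Proof.
move=> mA; split; first exact: measurable_indic.
by exists 1 => w; rewrite indicE; case: (_ \in _); rewrite ?normr1 ?normr0.
Qed.

Local Notation E f := (\int[P]_w f w).

Lemma E_D f g : bmeas f -> bmeas g -> E (fun w => f w + g w) = E f + E g.
Proof. by move=> /bmeas_int a /bmeas_int b; apply: RintegralD => //; exact: measurableT. Qed.
Lemma E_B f g : bmeas f -> bmeas g -> E (fun w => f w - g w) = E f - E g.
Proof. by move=> /bmeas_int a /bmeas_int b; apply: RintegralB => //; exact: measurableT. Qed.
Lemma E_Z (k : R) f : bmeas f -> E (fun w => k * f w) = k * E f.
Proof. by move=> /bmeas_int a; apply: RintegralZl => //; exact: measurableT. Qed.
Lemma E_cst (k : R) : E (fun _ => k) = k.
Proof.
rewrite (Rintegral_cst _ measurableT); suff -> : fine (P setT) = 1 by rewrite mulr1.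
exact: (congr1 fine (probability_setT P)).
Qed.
Lemma E_le f g : bmeas f -> bmeas g -> (forall w, f w <= g w) -> E f <= E g.
Proof. by move=> /bmeas_int a /bmeas_int b H; apply: le_Rintegral => //; exact: measurableT. Qed.
Lemma E_sum (I : Type) (s : seq I) (F : I -> Omega -> R) : (forall i, bmeas (F i)) ->
  E (fun w => \sum_(i <- s) F i w) = \sum_(i <- s) E (F i).
Proof.
move=> H; elim: s => [|i s IH].
  rewrite big_nil -[RHS](E_cst 0); congr Rintegral; by apply/funext => w; rewrite big_nil.
rewrite big_cons -IH -E_D //; last exact: bmeas_sum.
by congr Rintegral; apply/funext => w; rewrite big_cons.
Qed.
Lemma E_abs f (M : R) : bmeas f -> (forall w, `|f w| <= M) -> `|E f| <= M.
Proof.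
move=> bf H; rewrite ler_norml; apply/andP; split.
  rewrite -(E_cst (- M)); apply: E_le => //; first exact: bmeas_cst.
  by move=> w; have := H w; rewrite ler_norml => /andP[].
rewrite -[leRHS](E_cst M); apply: E_le => //; first exact: bmeas_cst.
by move=> w; have := H w; rewrite ler_norml => /andP[].
Qed.

Lemma E_abs_le f g : bmeas f -> bmeas g -> (forall w, `|f w| <= g w) -> `|E f| <= E g.
Proof.
move=> bf bg H; rewrite ler_norml -[- E g]mulN1r -E_Z //; apply/andP; split.
  apply: E_le => //; first by apply: bmeasM => //; exact: bmeas_cst.
  by move=> w; have := H w; rewrite ler_norml mulN1r => /andP[].
by apply: E_le => // w; have := H w; rewrite ler_norml => /andP[].
Qed.

Lemma E_dct (F : nat -> Omega -> R) f (M : R) : (forall n, measurable_fun setT (F n)) -> measurable_fun setT f ->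
  (forall n w, `|F n w| <= M) -> (forall w, F n w @[n --> \oo] --> f w) -> E (F n) @[n --> \oo] --> E f.
Proof.
move=> mF mf HM Hc.
have h1 n : measurable_fun setT (EFin \o F n) by apply/measurable_EFinP.
have h2 : measurable_fun setT (EFin \o f) by apply/measurable_EFinP.
have h3 : {ae P, forall w, setT w -> (EFin \o F n) w @[n --> \oo] --> (EFin \o f) w}.
  by apply: aeW => w _; apply: cvg_EFin; [exact: nearW|exact: Hc].
have h4 : P.-integrable setT (EFin \o (fun _ => M)) by apply: bmeas_int; exact: bmeas_cst.
have h5 : {ae P, forall w n, setT w -> (`|(EFin \o F n) w| <= (EFin \o (fun _ => M)) w)%E}.
  by apply: aeW => w n _; rewrite /= lee_fin.
have [ig _ Hd] := dominated_convergence measurableT h1 h2 h3 h4 h5.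
rewrite /Rintegral; apply: fine_cvg; rewrite fineK; first exact: Hd.
exact: integrable_fin_num.
Qed.

End BoundedExpectation.

(** * Laws and independence under the integral *)

Section Independence.
Context {d : measure_display} {Omega : measurableType d} {R : realType} (P : probability Omega R).

Lemma E_law (d' : measure_display) (T : measurableType d') (X : Omega -> T) (nu : probability T R) (g : T -> R) (M : R) :
  measurable_fun setT X -> measurable_fun setT g -> (forall x, `|g x| <= M) ->
  (forall A : set T, measurable A -> P (X @^-1` A) = nu A) ->
  \int[P]_w g (X w) = \int[nu]_x g x.
Proof.
move=> mX mg HM HA; rewrite /Rintegral; congr fine.
have bg : P.-integrable (X @^-1` setT) ((EFin \o g) \o X).
  have I : P.-integrable setT (EFin \o (g \o X)).
    by apply: (@bounded_int _ _ _ P _ M (measurableT_comp mg mX)) => w; exact: HM.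
  exact: I.
have mEg : measurable_fun setT (EFin \o g) by apply/measurable_EFinP.
have := integral_pushforward mX mEg bg measurableT.
rewrite preimage_setT => <-; apply: eq_measure_integral => A mA _.
exact: HA.
Qed.

(** Independence on rectangles identifies the joint law with the product of the two laws, and
    Fubini's theorem factorises the integral. *)
Lemma E_indep (Y X : Omega -> R) (g : R -> R) (M M' : R) :
  measurable_fun setT Y -> (forall w, `|Y w| <= M') ->
  measurable_fun setT X -> measurable_fun setT g -> (forall x, `|g x| <= M) ->
  (forall A B : set R, measurable A -> measurable B ->
     P (Y @^-1` A `&` X @^-1` B) = (P (Y @^-1` A) * P (X @^-1` B))%E) ->
  \int[P]_w (Y w * g (X w)) = (\int[P]_w Y w) * (\int[P]_w g (X w)).
Proof.
move=> mY HY mX mg HM HI.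
(* Y is bounded but the identity of the line is not; clamping leaves Y unchanged and makes the
   integrand bounded on the plane. *)
pose h (y : R) := Num.max (- M') (Num.min M' y).
have M'0 : 0 <= M' by exact: le_trans (normr_ge0 _) (HY point).
have hY w : h (Y w) = Y w.
  have := HY w; rewrite ler_norml /h => /andP[a b].
  by rewrite (min_r b) (max_r a).
have hB y : `|h y| <= M'.
  rewrite /h ler_norml le_max lexx /= ge_max ge_min lexx /= andbT; lra.
have mh : measurable_fun setT h.
  by apply: measurable_maxr; [exact: measurable_cst|apply: measurable_minr; [exact: measurable_cst|exact: measurable_id]].
pose X' : {mfun Omega >-> R} := mfun_Sub (mem_set mX).
pose Y' : {mfun Omega >-> R} := mfun_Sub (mem_set mY).
have mYX : measurable_fun setT (fun w => (Y w, X w)) by exact: measurable_fun_pair.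
pose Z : {mfun Omega >-> (R * R)%type} := mfun_Sub (mem_set mYX).
pose f (p : R * R) := h p.1 * g p.2.
have mf : measurable_fun setT f.
  apply: measurable_funM.
    by apply: (measurableT_comp mh); exact: measurable_fst.
  by apply: (measurableT_comp mg); exact: measurable_snd.
have fB p : `|f p| <= M' * M by rewrite normrM; apply: ler_pM.
pose PY : probability R R := distribution P Y'; pose PX : probability R R := distribution P X'.
pose PZ : probability (R * R)%type R := distribution P Z.
have eqm (A : set (R * R)) : measurable A -> (PY \x PX)%E A = PZ A.
  by apply: (@product_measure_unique _ _ _ _ R PY PX PZ) => B B' mB mB'; rewrite -HI.
have mEf : measurable_fun setT (EFin \o f) by apply/measurable_EFinP.
have I1 : P.-integrable ((fun w => (Y w, X w)) @^-1` setT) ((EFin \o f) \o (fun w => (Y w, X w))).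
  have I : P.-integrable setT (EFin \o (f \o (fun w => (Y w, X w)))).
    by apply: (@bounded_int _ _ _ P _ (M' * M) (measurableT_comp mf mYX)) => w; exact: fB.
  exact: I.
have EE : (\int[P]_w (Y w * g (X w))%:E = \int[PY]_y \int[PX]_x (f (y, x))%:E)%E.
  have E1 := integral_pushforward mYX mEf I1 measurableT.
  rewrite preimage_setT in E1.
  have -> : (\int[P]_w (Y w * g (X w))%:E = \int[P]_x ((EFin \o f) \o (fun w => (Y w, X w))) x)%E.
    by apply: eq_integral => w _; rewrite /= /f /= hY.
  rewrite -E1 (@eq_measure_integral _ _ R setT (PY \x PX)%E PZ); last first.
    by move=> A mA _; exact: esym (eqm A mA).
  rewrite -(@integral12_prod_meas1 _ _ _ _ R PY PX (EFin \o f)) //.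
  have /integrableP[_ I2] := @bounded_int _ _ _ PZ f (M' * M) mf fB.
  apply/integrableP; split; first exact: mEf.
  by rewrite (@eq_measure_integral _ _ R setT PZ) // => A mA _; exact: eqm.
pose G := \int[PX]_x g x.
have IG y : (\int[PX]_x (f (y, x))%:E)%E = (h y * G)%:E.
  have ig : PX.-integrable setT (EFin \o g) by exact: (@bounded_int _ _ _ PX g M).
  have ihg : PX.-integrable setT (EFin \o (fun x => h y * g x)).
    apply: (@bounded_int _ _ _ PX _ (M' * M)); last by move=> x; exact: (fB (y, x)).
    by apply: measurable_funM => //; exact: measurable_cst.
  rewrite /G -(RintegralZl _ measurableT ig) /Rintegral fineK //.
  exact: integrable_fin_num.
rewrite [LHS]/Rintegral EE (eq_integral _ _ (fun y _ => IG y)).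
have ih : PY.-integrable setT (EFin \o h) by exact: (@bounded_int _ _ _ PY h M').
rewrite -[LHS]/(\int[PY]_y (h y * G)) (RintegralZr _ measurableT ih); congr (_ * _).
  rewrite -(@E_law _ _ Y PY h M' mY mh hB) //.
  by apply: eq_Rintegral => w _; rewrite hY.
by rewrite /G -(@E_law _ _ X PX g M mX mg HM).
Qed.

End Independence.

(** * Moments of truncated normal laws *)

Section NormalTruncated.
Variable R : realType.
Local Notation mu := (@lebesgue_measure R).
Implicit Types (m s x : R).

Lemma is_derive_val (f : R -> R) (t df df' : R) : is_derive t 1 f df -> df = df' -> is_derive t 1 f df'.
Proof. by move=> h <-. Qed.

(** The Radon-Nikodym derivative of the normal law is identified almost everywhere with the
    density. *)
Lemma integral_normal_prob m s (g : R -> R) (M : R) : measurable_fun setT g -> (forall x, `|g x| <= M) ->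
  (\int[normal_prob m s]_x (g x)%:E = \int[mu]_x (g x * normal_pdf m s x)%:E)%E.
Proof.
move=> mg gB.
have ig : (normal_prob m s : probability (measurableTypeR R) R).-integrable setT (EFin \o g).
  exact: (@bounded_int _ _ _ (normal_prob m s) g M).
have mEg : measurable_fun setT (EFin \o g) by apply/measurable_EFinP.
have dom := @normal_prob_dominates R m s.
have := @Radon_Nikodym_change_of_variables _ _ R (normal_prob m s) mu dom (EFin \o g) setT measurableT ig.
move=> <-; rewrite [RHS](_ : _ = \int[mu]_x ((EFin \o g) x * (normal_pdf m s x)%:E))%E //.
apply: ae_eq_integral; first exact: measurableT.
- by apply: emeasurable_funM => //; apply: (measurable_int mu).
- by apply: emeasurable_funM => //; apply/measurable_EFinP; exact: measurable_normal_pdf.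
apply: ae_eqe_mul2l => /=.
rewrite Radon_NikodymE //=.
case: cid => /= h [h1 h2 h3].
apply: integral_ae_eq => //=.
- by apply/measurable_EFinP; exact: measurable_normal_pdf.
- by move=> E _ mE; rewrite -h3.
Qed.

Section Truncated.
Variables (delta eta : R).
Hypotheses (d0 : 0 < delta) (e0 : 0 < eta).
Local Notation sd := (Num.sqrt delta).
Local Notation nu := (normal_prob 0 sd : probability (measurableTypeR R) R).
Local Notation phi := (normal_pdf 0 sd).
Local Notation I := (`[- eta, eta]%classic : set R).

Let sd0 : sd != 0. Proof. by rewrite gt_eqF // sqrtr_gt0. Qed.

Lemma normal_phiE x : phi x = normal_peak sd * expR (- x ^+ 2 / (delta *+ 2)).
Proof.
rewrite normal_pdfE //; change (normal_peak sd * normal_fun 0 sd x = normal_peak sd * expR (- x ^+ 2 / (delta *+ 2))).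
by rewrite /normal_fun subr0 sqr_sqrtr // ltW.
Qed.

Lemma normal_phi_derive x : is_derive x 1 phi (- x / delta * phi x).
Proof.
have E : phi = (fun x => normal_peak sd * expR (- (x * x) / (delta *+ 2))).
  by apply/funext => y; rewrite normal_phiE expr2.
have h1 : is_derive x 1 (fun y : R => - (y * y) / (delta *+ 2)) (- x / delta).
  have hc : is_derive x 1 (fun _ : R => - (delta *+ 2)^-1) 0 := is_derive_cst _ _ _.
  have h := is_deriveM' (is_deriveM' (is_derive_id x (1 : R)) (is_derive_id x (1 : R))) hc.
  have E2 (y : R) : y * y * (- (delta *+ 2)^-1) = - (y * y) / (delta *+ 2) by rewrite mulrN mulNr.
  apply: (is_derive_val (is_derive_ext E2 h)).
  rewrite mulr0 addr0 mulr2n; field.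
  by rewrite !gt_eqF // addr_gt0.
rewrite E; have h2 := @is_derive_comp' _ expR (fun y : R => - (y * y) / (delta *+ 2)) x _ _ (is_derive_expR (- (x * x) / (delta *+ 2))) h1.
have hc : is_derive x 1 (fun _ : R => normal_peak sd) 0 := is_derive_cst _ _ _.
have h3 := is_deriveM' hc h2.
apply: (is_derive_val h3).
by rewrite mul0r add0r; ring.
Qed.

Lemma phi_continuous : continuous phi. Proof. exact: continuous_normal_pdf. Qed.

Lemma phi_even x : phi (- x) = phi x.
Proof. by rewrite !normal_phiE sqrrN. Qed.

Lemma integral_truncated (p F : R -> R) : continuous p -> (forall x, is_derive x 1 F (p x * phi x)) ->
  \int[nu]_x (p x * \1_I x) = F eta - F (- eta).
Proof.
move=> cp dF; have ee : - eta < eta by rewrite gtrN.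
have cpp : continuous (fun x => p x * phi x) by move=> x; apply: cvgM; [exact: cp|exact: phi_continuous].
have [M HM] : exists M : R, forall x, `|p x * \1_I x| <= M.
  have [c cI Hc] := EVT_max (ltW ee) (continuous_subspaceT (fun x => cvg_norm (cp x) : (`|p y| @[y --> x] --> `|p x|))).
  exists `|p c| => x; rewrite indicE; case: (boolP (x \in I)) => xI.
    by rewrite mulr1; apply: Hc; move: xI; rewrite inE.
  by rewrite mulr0 normr0.
have mg : measurable_fun setT (fun x => p x * \1_I x).
  apply: measurable_funM; first exact: continuous_measurable_fun.
  by apply: measurable_indic; exact: measurable_itv.
rewrite /Rintegral (integral_normal_prob 0 sd mg HM).
have -> : (\int[mu]_x (p x * \1_I x * phi x)%:E = \int[mu]_(x in I) (p x * phi x)%:E)%E.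
  rewrite [RHS]integral_mkcond; apply: eq_integral => x _.
  rewrite patchE indicE; case: ifP => _; first by rewrite mulr1.
  by rewrite mulr0 mul0r.
have cF x : F y @[y --> x] --> F x by apply: is_derive_cvg; exact: dF.
rewrite (@continuous_FTC2 R (fun x => p x * phi x) F _ _ ee) //.
- exact: continuous_subspaceT.
- split; first by move=> x _; have [] := dF x.
    by apply: cvg_at_right_filter; exact: cF.
  by apply: cvg_at_left_filter; exact: cF.
- by move=> x _; rewrite derive1E; apply: derive_val.
Qed.

Lemma normal_trunc1 : \int[nu]_x (x * \1_I x) = 0.
Proof.
have cp : continuous (fun x : R => x) by move=> x; exact: cvg_id.
have dF (x : R) : is_derive x 1 (fun x => - delta * phi x) (x * phi x).
  have hc : is_derive x 1 (fun _ : R => - delta) 0 := is_derive_cst _ _ _.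
  have h := is_deriveM' hc (normal_phi_derive x).
  apply: (is_derive_val h).
  by rewrite mul0r add0r; field; rewrite gt_eqF.
by rewrite (integral_truncated cp dF) phi_even subrr.
Qed.

(** From phi' = -(x/delta) phi, the antiderivative of (x^2 - delta) phi is -delta x phi. *)
Lemma normal_trunc2 : \int[nu]_x ((x ^+ 2 - delta) * \1_I x) = - (2 * delta * eta * phi eta).
Proof.
have cp : continuous (fun x : R => x ^+ 2 - delta).
  move=> x; apply: cvgB; last exact: cvg_cst.
  by apply: (@exprn_continuous _ 2).
have dF (x : R) : is_derive x 1 (fun x => (- delta * x) * phi x) ((x ^+ 2 - delta) * phi x).
  have hc : is_derive x 1 (fun _ : R => - delta) 0 := is_derive_cst _ _ _.
  have h := is_deriveM' (is_deriveM' hc (is_derive_id x (1 : R))) (normal_phi_derive x).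
  apply: (is_derive_val h).
  by field; rewrite gt_eqF.
by rewrite (integral_truncated cp dF) phi_even; ring.
Qed.

Lemma normal_phi_ge0 x : 0 <= phi x. Proof. exact: normal_pdf_ge0. Qed.

(** The peak is at most 1/sd and exp(-u) <= 1/u for u = eta^2/(2 delta). The second-moment defect of
    one step is thus O(delta^{3/2}), and its sum over a grid of mesh delta tends to 0. *)
Lemma normal_phi_small : 2 * eta * phi eta <= 4 / eta * sd.
Proof.
rewrite normal_phiE.
have pk : normal_peak sd <= sd^-1.
  rewrite /normal_peak (sqr_sqrtr (ltW d0)).
  have q0 : 0 < delta * pi *+ 2 by rewrite mulrn_wgt0 // mulr_gt0 // pi_gt0.
  rewrite lef_pV2 ?posrE ?sqrtr_gt0 //.
  rewrite ler_wsqrtr // -mulrnAr -[leLHS]mulr1; apply: ler_wpM2l; first exact: ltW.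
  have := pi_ge2 R; rewrite mulr2n; lra.
have ex : expR (- eta ^+ 2 / (delta *+ 2)) <= delta *+ 2 / eta ^+ 2.
  have u0 : 0 < eta ^+ 2 / (delta *+ 2) by rewrite divr_gt0 ?exprn_gt0 // mulrn_wgt0.
  rewrite mulNr expRN -[leRHS]invrK lef_pV2 ?posrE ?expR_gt0 ?invr_gt0 ?divr_gt0 ?mulrn_wgt0 ?exprn_gt0 //.
  rewrite invf_div; apply: le_trans (expR_ge1Dx _); by rewrite lerDr.
have h : normal_peak sd * expR (- eta ^+ 2 / (delta *+ 2)) <= sd^-1 * (delta *+ 2 / eta ^+ 2).
  by apply: ler_pM => //; exact: normal_peak_ge0.
have e2 : 0 <= 2 * eta by rewrite mulr_ge0 // ltW.
have {}h := ler_wpM2l e2 h.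
apply: le_trans h _.
have sdE : delta = sd * sd by rewrite -expr2 sqr_sqrtr // ltW.
have dE : delta *+ 2 = 2 * (sd * sd) by rewrite -sdE mulr2n; ring.
rewrite [delta *+ 2]dE le_eqVlt; apply/orP; left; apply/eqP.
by field; rewrite sd0 gt_eqF.
Qed.

End Truncated.
End NormalTruncated.

(** * Adapted processes and stopped martingales *)

(** Weights that never return after vanishing make the sum telescope up to the first failure K. *)
Lemma telescope_until (R : realType) (b : nat -> bool) (f : nat -> R) (n : nat) :
  (forall k, b k.+1 -> b k) ->
  exists K, [/\ (K <= n)%N, forall k, (k < n)%N -> b k = (k < K)%N &
    \sum_(k < n) (b k)%:R * (f k.+1 - f k) = f K - f 0%N].
Proof.
move=> bd; elim: n => [|n [K [Kn bK sE]]].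
  by exists 0%N; split => //; rewrite big_ord0 subrr.
case bn: (b n).
  have ball k : (k <= n)%N -> b k.
    move=> kn; have bm i j : b (i + j)%N -> b i.
      by elim: j => [|j IH]; [rewrite addn0|rewrite addnS => /bd].
    by apply: (bm k (n - k)%N); rewrite subnKC.
  have KE : K = n.
    have [Kn'|//] := ltnP K n; last by move=> h; apply/eqP; rewrite eqn_leq Kn h.
    by move: (bK K Kn'); rewrite ltnn ball // ltnW.
  exists n.+1; split => //; first by move=> k kn; rewrite kn ball.
  by rewrite big_ord_recr /= sE bn mul1r KE; ring.
exists K; split; first exact: leqW.
  move=> k; rewrite ltnS leq_eqVlt => /orP[/eqP->|/bK//].
  by rewrite bn ltnNge Kn.
by rewrite big_ord_recr /= sE bn mul0r addr0.
Qed.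

(** Only x is confined to [0, T]: the end t + h of a step may pass T. *)
Lemma unif_cont (R : realType) (f : R -> R) (T : R) : continuous f -> forall e : R, 0 < e ->
  exists2 d : R, 0 < d & forall x y : R, 0 <= x <= T -> `|y - x| <= d -> `|f y - f x| <= e.
Proof.
move=> cf e e0.
have /compact_near_coveringP cpt := @segment_compact R 0 T.
have H := cpt R ((0 : R)^'+) (fun (d x : R) => forall y, `|y - x| <= d -> `|f y - f x| <= e) _.
have {}H : \forall d \near (0 : R)^'+, `[0, T]%classic `<=` (fun x => forall y, `|y - x| <= d -> `|f y - f x| <= e).
  apply: H => x _.
  have e2 : 0 < e / 2 by rewrite divr_gt0.
  have /cvgrPdist_lt/(_ _ e2)/nbhs_ballP[d0 /= d00 Hd] := cf x.
  have d2 : 0 < d0 / 2 by rewrite divr_gt0.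
  exists ([set x' | `|x - x'| < d0 / 2], [set d | 0 < d < d0 / 2]) => /=.
    split; first by apply/nbhs_ballP; exists (d0 / 2).
    by near=> d; apply/andP; split; near: d; [exact: nbhs_right_gt|exact: nbhs_right_lt].
  move=> [x' d] /= [xx' /andP[dp dd]] y yx.
  have h1 : `|f x - f y| < e / 2.
    apply: Hd; rewrite /ball /=; have -> : x - y = (x - x') + - (y - x') by ring.
    apply: le_lt_trans (ler_normD _ _) _; rewrite normrN; lra.
  have h2 : `|f x - f x'| < e / 2.
    by apply: Hd; rewrite /ball /=; lra.
  have -> : f y - f x' = - (f x - f y) + (f x - f x') by ring.
  apply: le_trans (ler_normD _ _) _; rewrite normrN; lra.
have [d [d0 Hd]] : exists d, 0 < d /\ `[0, T]%classic `<=` (fun x => forall y, `|y - x| <= d -> `|f y - f x| <= e).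
  near (0 : R)^'+ => d; exists d; split; near: d; [exact: nbhs_right_gt|exact: H].
exists d => // x y xT; apply: Hd; exact: xT.
Unshelve. all: end_near.
Qed.

Section Adaptedness.
Context {R : realType} {d : measure_display} {Omega : measurableType d}.
Variables (F : R -> set (set Omega)).
Hypothesis FF : filtration F.
Implicit Types (f g : Omega -> R) (s t : R).

Definition fmeas t f := forall A : set R, measurable A -> F t (f @^-1` A).

(** Seeing [F t] as the sigma-algebra of a measurable type gives access to the general closure
    properties of measurable functions. *)
Lemma FsetP t (A : set Omega) : 0 <= t -> F t A <-> @measurable _ (g_sigma_algebraType (F t)) A.
Proof.
move=> t0; have [h _ _] := FF; have e : <<s F t >> = F t by exact: sigma_algebra_id (h t t0).
by split => H; [rewrite /measurable /= e|move: H; rewrite /measurable /= e].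
Qed.
Lemma fmeasP t f : 0 <= t -> fmeas t f <-> measurable_fun [set: g_sigma_algebraType (F t)] f.
Proof.
move=> t0; split => H.
  by move=> _ A mA; rewrite setTI; apply/(FsetP _ t0); exact: H.
by move=> A mA; apply/(FsetP _ t0); rewrite -[X in measurable X]setTI; apply: H.
Qed.
Lemma F_mono s t A : 0 <= s -> s <= t -> F s A -> F t A.
Proof. by have [_ _ h] := FF; move=> s0 st; exact: h. Qed.
Lemma F_measurable t A : 0 <= t -> F t A -> measurable A.
Proof. by have [_ h _] := FF; move=> t0; exact: h. Qed.
Lemma FI t A A' : 0 <= t -> F t A -> F t A' -> F t (A `&` A').
Proof. by move=> t0 /(FsetP _ t0) a /(FsetP _ t0) b; apply/(FsetP _ t0); exact: measurableI. Qed.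
Lemma FC t A : 0 <= t -> F t A -> F t (~` A).
Proof. by move=> t0 /(FsetP _ t0) a; apply/(FsetP _ t0); exact: measurableC. Qed.
Lemma FT t : 0 <= t -> F t setT.
Proof. by move=> t0; apply/(FsetP _ t0); exact: measurableT. Qed.
Lemma fmeas_mono s t f : 0 <= s -> s <= t -> fmeas s f -> fmeas t f.
Proof. by move=> s0 st H A mA; apply: F_mono st _ => //; exact: H. Qed.
Lemma fmeas_measurable t f : 0 <= t -> fmeas t f -> measurable_fun setT f.
Proof. by move=> t0 H _ A mA; rewrite setTI; apply: (F_measurable t0); exact: H. Qed.
Lemma fmeasD t f g : 0 <= t -> fmeas t f -> fmeas t g -> fmeas t (fun w => f w + g w).
Proof. by move=> t0 /(fmeasP _ t0) a /(fmeasP _ t0) b; apply/(fmeasP _ t0); exact: measurable_funD. Qed.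
Lemma fmeasM t f g : 0 <= t -> fmeas t f -> fmeas t g -> fmeas t (fun w => f w * g w).
Proof. by move=> t0 /(fmeasP _ t0) a /(fmeasP _ t0) b; apply/(fmeasP _ t0); exact: measurable_funM. Qed.
Lemma fmeasN t f : 0 <= t -> fmeas t f -> fmeas t (fun w => - f w).
Proof. by move=> t0 /(fmeasP _ t0) a; apply/(fmeasP _ t0); exact: measurable_funN. Qed.
Lemma fmeasB t f g : 0 <= t -> fmeas t f -> fmeas t g -> fmeas t (fun w => f w - g w).
Proof. by move=> t0 a b; apply: fmeasD => //; exact: fmeasN. Qed.
Lemma fmeas_cst t (k : R) : 0 <= t -> fmeas t (fun _ => k).
Proof. by move=> t0; apply/(fmeasP _ t0); exact: measurable_cst. Qed.
Lemma fmeas_comp t f (g : R -> R) : measurable_fun setT g -> fmeas t f -> fmeas t (fun w => g (f w)).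
Proof. by move=> mg H A mA; apply: (H (g @^-1` A)); rewrite -[X in measurable X]setTI; exact: mg. Qed.
Lemma fmeas_indic t (A : set Omega) : 0 <= t -> F t A -> fmeas t (\1_A).
Proof. by move=> t0 /(FsetP _ t0) a; apply/(fmeasP _ t0); exact: measurable_indic. Qed.
Lemma fmeas_sum t (I : Type) (r : seq I) (f : I -> Omega -> R) : 0 <= t ->
  (forall i, fmeas t (f i)) -> fmeas t (fun w => \sum_(i <- r) f i w).
Proof. by move=> t0 H; apply/(fmeasP _ t0); apply: measurable_sum => i; apply/(fmeasP _ t0). Qed.
Lemma fmeas_cvg t (f : nat -> Omega -> R) g : 0 <= t -> (forall m, fmeas t (f m)) ->
  (forall w, f m w @[m --> \oo] --> g w) -> fmeas t g.
Proof.
move=> t0 H c; apply/(fmeasP _ t0).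
apply: (@measurable_fun_cvg _ (g_sigma_algebraType (F t)) R setT f g).
  by move=> m; apply/(fmeasP _ t0).
by move=> w _; exact: c.
Qed.

End Adaptedness.

Lemma mulr4_ge0 (R : realType) (x y z : R) : 0 <= x -> 0 <= y -> 0 <= z -> 0 <= 2 * x * y * z.
Proof. by move=> x0 y0 z0; rewrite !mulr_ge0 ?ler0n. Qed.

Lemma sum_affine (R : realType) (a b : R) (X : nat -> R) n :
  \sum_(k < n) (a + (b + X k)) = n%:R * a + (n%:R * b + \sum_(k < n) X k).
Proof. by rewrite !big_split /= !sumr_const !card_ord -[a *+ n]mulr_natl -[b *+ n]mulr_natl. Qed.

(** * From a second-order expansion to a stopped martingale *)

Section StoppedMartingale.
Context {R : realType} {d : measure_display} {Omega : measurableType d}.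
Variables (P : probability Omega R) (F : R -> set (set Omega)) (B : R -> Omega -> R).
Hypotheses (FF : filtration F) (BM : brownian_motion P F B).
Hypothesis Bc : forall w, continuous (fun t : R => B (Num.max t 0) w).
Variables (T : Omega -> R) (N c1 c2 : R -> Omega -> R) (M C h0 eta0 : R).
Hypothesis ST : stopping_time F T.
Hypotheses (aN : forall t : R, 0 <= t -> fmeas F t (N t)) (a1 : forall t : R, 0 <= t -> fmeas F t (c1 t))
  (a2 : forall t : R, 0 <= t -> fmeas F t (c2 t)).
Hypotheses (h00 : 0 < h0) (eta00 : 0 < eta0) (M0 : 0 <= M) (C0 : 0 <= C).
Hypothesis bN : forall (w : Omega) (t : R), 0 <= t <= T w -> `|N t w| <= M.
Hypothesis b1 : forall (w : Omega) (t : R), 0 <= t < T w -> `|c1 t w| <= M.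
Hypothesis b2 : forall (w : Omega) (t : R), 0 <= t < T w -> `|c2 t w| <= M.
Definition dB t h w := B (t + h) w - B t w.
(** Two bounds on it are assumed. The one uniform in w provides the dominating constants; the finer
    one has a threshold depending on w and provides pointwise limits. *)
Definition ito_rem t h w := N (t + h) w - N t w - c1 t w * dB t h w - c2 t w * (dB t h w ^+ 2 - h).
Hypothesis rem_le : forall (w : Omega) (t h : R), 0 <= t < T w -> 0 < h <= h0 -> `|dB t h w| <= eta0 ->
  `|ito_rem t h w| <= C * (`|dB t h w| ^+ 3 + h).
Hypothesis rem_small : forall (w : Omega) (e : R), 0 < e -> exists2 h1 : R, 0 < h1 &
  forall t h : R, 0 <= t < T w -> 0 < h <= h1 -> `|dB t h w| <= eta0 ->
  `|ito_rem t h w| <= C * `|dB t h w| ^+ 3 + h * e.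
Hypothesis cN : forall (w : Omega) (t : R), 0 <= t <= T w -> forall e : R, 0 < e -> exists2 h1 : R, 0 < h1 &
  forall u : R, t <= u <= t + h1 -> `|N u w - N t w| <= e.

Let aB (t : R) : 0 <= t -> fmeas F t (B t).
Proof. by have [_ _ h _ _] := BM; move=> t0 A; exact: h. Qed.

Section Grid.
Variables (s t : R) (E : set Omega) (eta : R) (m0 : nat).
Hypotheses (s0 : 0 <= s) (st : s < t) (FE : F s E) (e0 : 0 < eta) (ee : eta <= eta0).
Hypothesis m0h : (t - s) / m0.+1%:R <= h0.

(** The offset m0 makes even the coarsest grid finer than h0. *)
Definition num m := (m + m0).+1.
Definition step_len m : R := (t - s) / (num m)%:R.
Definition gtime m k : R := s + k%:R * step_len m.
Definition incr m k w := dB (gtime m k) (step_len m) w.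

Lemma step_len_gt0 m : 0 < step_len m.
Proof. by rewrite divr_gt0 // ?subr_gt0. Qed.
Lemma step_len_le m : step_len m <= h0.
Proof.
apply: le_trans m0h; rewrite ler_wpM2l ?subr_ge0 ?(ltW st) //.
by rewrite lef_pV2 ?posrE ?ltr0Sn // ler_nat /num ltnS leq_addl.
Qed.
Lemma step_len_small (h : R) : 0 < h -> exists m1, forall m, (m1 <= m)%N -> step_len m <= h.
Proof.
move=> hp; exists (Num.bound ((t - s) / h)) => m mm.
rewrite ler_pdivrMr ?ltr0n // mulrC -ler_pdivrMr //.
have h1 : (t - s) / h < (Num.bound ((t - s) / h))%:R.
  by apply: archi_boundP; rewrite divr_ge0 ?subr_ge0 ?ltW.
apply: le_trans (ltW h1) _; rewrite ler_nat /num.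
by apply: leq_trans mm _; rewrite -addnS leq_addr.
Qed.
Lemma gtimeS m k : gtime m k.+1 = gtime m k + step_len m.
Proof. by rewrite /gtime -natr1; ring. Qed.
Lemma gtime0 m : gtime m 0 = s. Proof. by rewrite /gtime mul0r addr0. Qed.
Lemma gtime_le m i j : (i <= j)%N -> gtime m i <= gtime m j.
Proof. by move=> ij; rewrite lerD2l ler_wpM2r ?ler_nat // ltW // step_len_gt0. Qed.
Lemma gtime_ge m k : s <= gtime m k.
Proof. by rewrite -(gtime0 m) gtime_le. Qed.
Lemma gtime_ge0 m k : 0 <= gtime m k.
Proof. exact: le_trans s0 (gtime_ge m k). Qed.
Lemma gtime_end m : gtime m (num m) = t.
Proof. by rewrite /gtime /step_len mulrC mulfVK ?pnatr_eq0 //; ring. Qed.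
Lemma gtime_le_end m k : (k <= num m)%N -> gtime m k <= t.
Proof. by move=> h; rewrite -(gtime_end m) gtime_le. Qed.

(** Known at the start of step k: it involves the increments before k only, and the strict
    inequality makes it the complement of a stopping event. *)
Definition live m k : set Omega :=
  [set w | [/\ E w, gtime m k < T w & forall j, (j < k)%N -> `|incr m j w| <= eta]].
Local Notation I := (`[- eta, eta]%classic : set R).
Definition small m k : set Omega := [set w | `|incr m k w| <= eta].

Lemma incr_fmeas m k u : gtime m k.+1 <= u -> fmeas F u (incr m k).
Proof.
move=> h; have k0 := gtime_ge0 m k; have k1 := gtime_ge0 m k.+1.
have u0 : 0 <= u by exact: le_trans k1 h.
rewrite /incr /dB -gtimeS; apply: (fmeasB FF u0).
  by apply: (fmeas_mono FF k1 h); exact: aB.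
apply: (fmeas_mono FF k0 _ (aB k0)).
by apply: le_trans h; exact: gtime_le.
Qed.

Lemma small_F m k u : gtime m k.+1 <= u -> F u (small m k).
Proof.
move=> h; have -> : small m k = incr m k @^-1` I.
  by apply/seteqP; split => w; rewrite /small /= in_itv /= ler_norml.
by apply: (incr_fmeas h); exact: measurable_itv.
Qed.

Lemma live_F m k : F (gtime m k) (live m k).
Proof.
have g0 j := gtime_ge0 m j; have [_ hT] := ST.
have FTk j : F (gtime m j) [set w | gtime m j < T w].
  have -> : [set w | gtime m j < T w] = ~` [set w | T w <= gtime m j].
    by apply/seteqP; split => w /=; rewrite ltNge => /negP.
  by apply: (FC FF (g0 j)); exact: hT.
elim: k => [|k IH].
  have -> : live m 0 = E `&` [set w | gtime m 0 < T w].
    by apply/seteqP; split => w /= [] // a b.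
  by apply: (FI FF (g0 0%N)); [rewrite gtime0|exact: FTk].
have -> : live m k.+1 = live m k `&` ([set w | gtime m k.+1 < T w] `&` small m k).
  apply/seteqP; split => w /=.
    move=> [a b c]; split; last by split => //; exact: c.
    split => //; first by apply: le_lt_trans b; exact: gtime_le.
    by move=> j jk; apply: c; exact: ltnW.
  move=> [[a b c] [e f]]; split => // j; rewrite ltnS leq_eqVlt => /orP[/eqP->//|]; exact: c.
apply: (FI FF (g0 k.+1)); first by apply: (F_mono FF (g0 k) _ IH); exact: gtime_le.
by apply: (FI FF (g0 k.+1)); [exact: FTk|exact: small_F].
Qed.

(* The weight of a step is past-measurable apart from the truncation of its own
   increment, and it vanishes after the first step that is too large. *)
Definition wt m k w : R := \1_(live m k) w * \1_(small m k) w.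
Definition gsum m w := \sum_(k < num m) wt m k w * (N (gtime m k.+1) w - N (gtime m k) w).
(** Its mean is the defect of the martingale identity between s and t on E. *)
Definition glim w := \1_E w * (N (Num.min t (T w)) w - N (Num.min s (T w)) w).

Lemma wtE m k w : wt m k w = (`[< live m k w /\ small m k w >])%:R.
Proof.
rewrite /wt !indicE -natrM mulnb; congr (_%:R); congr nat_of_bool.
by rewrite asbool_and; congr andb; apply/idP/asboolP; rewrite inE.
Qed.

Lemma gsumP m w : exists K, [/\ (K <= num m)%N,
  forall k, (k < num m)%N -> (live m k w /\ small m k w) <-> (k < K)%N &
  gsum m w = N (gtime m K) w - N s w].
Proof.
pose b k := `[< live m k w /\ small m k w >].
have bd k : b k.+1 -> b k.
  move=> /asboolP[[x1 x2 x3] _]; apply/asboolP; split; last by apply: x3.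
  split => //; first by apply: le_lt_trans x2; exact: gtime_le.
  by move=> j jk; apply: x3; exact: ltnW.
have [K [Kn bK sE]] := telescope_until (fun k => N (gtime m k) w) (num m) bd.
exists K; split => //.
  by move=> k kn; rewrite -(bK k kn); split => /asboolP.
rewrite -[in N s w](gtime0 m) -sE; apply: eq_bigr => k _; by rewrite wtE.
Qed.

Lemma live_time m k w : live m k w -> 0 <= gtime m k < T w.
Proof. by move=> [_ h _]; rewrite gtime_ge0 h. Qed.

(** On a fine grid no increment of the given path exceeds eta, by uniform continuity, so truncation
    is not felt. The telescoped sum then ends at the first grid time past min(t, T), at most one
    step later, and right-continuity of N concludes. *)
Lemma gsum_cvg w : gsum m w @[m --> \oo] --> glim w.
Proof.
apply/cvgrPdist_le => e ep.
have [Ew|Ew] := pselect (E w); last first.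
  apply: nearW => m; rewrite /glim indicE (memNset Ew) mul0r.
  have [K [Kn bK ->]] := gsumP m w.
  have -> : K = 0%N.
    apply/eqP; rewrite -leqn0 leqNgt; apply/negP => K0.
    have : (0 < num m)%N by [].
    by move=> /bK/iffRL/(_ K0)[[]].
  by rewrite gtime0 subrr subrr normr0 ltW.
have [Ts|Ts] := leP (T w) s.
  apply: nearW => m; rewrite /glim !min_r ?(le_trans Ts (ltW st)) // subrr mulr0.
  have [K [Kn bK ->]] := gsumP m w.
  have -> : K = 0%N.
    apply/eqP; rewrite -leqn0 leqNgt; apply/negP => K0.
    have : (0 < num m)%N by [].
    move=> /bK/iffRL/(_ K0)[[_]]; rewrite gtime0 => h; by have := lt_le_trans h Ts; rewrite ltxx.
  by rewrite gtime0 subrr subrr normr0 ltW.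
set u := Num.min t (T w).
have u0 : 0 <= u <= T w.
  by rewrite /u ge_min lexx orbT andbT le_min (le_trans s0 (ltW st)) (le_trans s0 (ltW Ts)).
have [h1 h1p H1] := cN u0 ep.
have [h2 h2p H2] := @unif_cont R (fun t : R => B (Num.max t 0) w) t (@Bc w) eta e0.
have h12 : 0 < Num.min h1 h2 by rewrite lt_min h1p.
have [m1 Hm] := step_len_small h12.
exists m1 => // m /= /Hm; rewrite le_min => /andP[d1 d2].
have [K [Kn bK ->]] := gsumP m w.
have sm k : (k < num m)%N -> small m k w.
  move=> kn; rewrite /small /= /incr /dB.
  have g0 := gtime_ge0 m k; have g1 : gtime m k <= t by apply: gtime_le_end; exact: ltnW.
  have sl := step_len_gt0 m.
  have := H2 (gtime m k) (gtime m k + step_len m).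
  rewrite g0 g1 => /(_ isT); rewrite !max_l //; last by rewrite addr_ge0 // ltW.
  apply; rewrite addrAC subrr add0r ger0_norm // ltW //.
rewrite /glim indicE (mem_set Ew) mul1r -/u (min_l (ltW Ts)).
have -> : N u w - N s w - (N (gtime m K) w - N s w) = - (N (gtime m K) w - N u w) by ring.
rewrite normrN; apply: H1; apply/andP; split.
  have [KE|KE] := leqP (num m) K.
    have -> : K = num m by apply/eqP; rewrite eqn_leq Kn.
    by rewrite gtime_end /u ge_min lexx.
  rewrite /u ge_min; apply/orP; right.
  rewrite leNgt; apply/negP => h.
  have : live m K w /\ small m K w.
    split; last exact: sm.
    by split => // j jK; apply: sm; exact: ltn_trans KE.
  by move=> /(bK K KE); rewrite ltnn.
case: K Kn bK => [|K] Kn bK.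
  rewrite gtime0; apply: (@le_trans _ _ u); last by rewrite lerDl ltW.
  by rewrite /u le_min (ltW st) (ltW Ts).
have [[_ kT _] _] := (bK K Kn).2 (ltnSn K).
have g1 : gtime m K <= t by apply: gtime_le_end; exact: ltnW.
rewrite gtimeS; apply: lerD => //.
by rewrite /u le_min g1 ltW.
Qed.

(** N is bounded by M only up to T, while the last grid step may pass T. This bounds the increment
    over one step through the expansion, whose coefficients are taken before T. *)
Definition jump := M * eta + M * (eta ^+ 2 + h0) + C * (eta ^+ 3 + h0).

Lemma rem_bound m k w : live m k w -> small m k w ->
  `|ito_rem (gtime m k) (step_len m) w| <= C * (`|incr m k w| ^+ 3 + step_len m).
Proof.
move=> L S; apply: rem_le; first exact: live_time L.
  by rewrite step_len_gt0 step_len_le.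
exact: le_trans S ee.
Qed.

Lemma jump_bound m k w : live m k w -> small m k w ->
  `|N (gtime m k.+1) w - N (gtime m k) w| <= jump.
Proof.
move=> L S; have r := rem_bound L S; have kT := live_time L.
have x1 := b1 kT; have x2 := b2 kT; rewrite /small /= in S.
set x := incr m k w in S r.
have sl := step_len_gt0 m; have sh := step_len_le m.
have -> : N (gtime m k.+1) w - N (gtime m k) w =
  c1 (gtime m k) w * x + c2 (gtime m k) w * (x ^+ 2 - step_len m) + ito_rem (gtime m k) (step_len m) w.
  by rewrite /ito_rem -gtimeS -/(incr m k w) -/x; ring.
have xx := normr_ge0 x.
have y1 : `|c1 (gtime m k) w * x| <= M * eta by rewrite normrM; apply: ler_pM.
have y2 : `|c2 (gtime m k) w * (x ^+ 2 - step_len m)| <= M * (eta ^+ 2 + h0).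
  rewrite normrM; apply: ler_pM => //; apply: le_trans (ler_normB _ _) _.
  by rewrite normrX (gtr0_norm sl); apply: lerD => //; rewrite ler_pXn2r // ?nnegrE // ltW.
have y3 : C * (`|x| ^+ 3 + step_len m) <= C * (eta ^+ 3 + h0).
  by apply: ler_wpM2l => //; apply: lerD => //; rewrite ler_pXn2r // ?nnegrE // ltW.
apply: le_trans (ler_normD _ _) _; apply: lerD; last exact: le_trans r y3.
by apply: le_trans (ler_normD _ _) _; apply: lerD.
Qed.

Lemma jump_ge0 : 0 <= jump.
Proof. by rewrite /jump !addr_ge0 ?mulr_ge0 ?addr_ge0 ?exprn_ge0 ?(ltW h00) ?(ltW e0). Qed.

Lemma wt_ge0 m k w : 0 <= wt m k w. Proof. by rewrite wtE ler0n. Qed.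
Lemma wt_bound m k w (x y : R) : 0 <= y -> (live m k w -> small m k w -> `|x| <= y) -> `|wt m k w * x| <= y.
Proof.
move=> y0 H; rewrite wtE; case: asboolP => [[a b]|_]; first by rewrite mul1r H.
by rewrite mul0r normr0.
Qed.

Lemma gsum_bound m w : `|gsum m w| <= 2 * M + jump.
Proof.
have jp := jump_ge0.
have [[|K] [Kn bK ->]] := gsumP m w.
  by rewrite gtime0 subrr normr0 addr_ge0 // mulr_ge0.
have [L S] := (bK K Kn).2 (ltnSn K).
have j := jump_bound L S; have kT := live_time L.
have n1 : `|N (gtime m K) w| <= M.
  by apply: bN; move: kT => /andP[-> /ltW ->].
have n2 : `|N s w| <= M.
  apply: bN; rewrite s0 /=; move: kT => /andP[_ h]; apply: le_trans (ltW h); exact: gtime_ge.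
have -> : N (gtime m K.+1) w - N s w = (N (gtime m K.+1) w - N (gtime m K) w) + (N (gtime m K) w - N s w) by ring.
apply: le_trans (ler_normD _ _) _; have := ler_normB (N (gtime m K) w) (N s w); lra.
Qed.

Lemma wt_fmeas m k u : gtime m k.+1 <= u -> fmeas F u (wt m k).
Proof.
move=> h; have k0 := gtime_ge0 m k; have k1 := gtime_ge0 m k.+1.
have u0 : 0 <= u by exact: le_trans k1 h.
apply: (fmeasM FF u0); apply: (fmeas_indic FF u0); last exact: small_F.
apply: (F_mono FF k0 _ (live_F m k)); apply: le_trans h; exact: gtime_le.
Qed.

Lemma gsum_fmeas m : fmeas F t (gsum m).
Proof.
have t0 : 0 <= t by exact: le_trans (ltW st).
have E1 k : (k < num m)%N -> fmeas F t (fun w => wt m k w * (N (gtime m k.+1) w - N (gtime m k) w)).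
  move=> kn; have k1 := gtime_le_end kn; have k0 := gtime_le_end (ltnW kn).
  apply: (fmeasM FF t0); first exact: wt_fmeas.
  by apply: (fmeasB FF t0); [apply: (fmeas_mono FF _ k1)|apply: (fmeas_mono FF _ k0)];
    rewrite ?gtime_ge0 //; apply: aN; exact: gtime_ge0.
by apply: (@fmeas_sum _ _ _ F FF t _ _ (fun (k : 'I_(num m)) w => wt m k w * (N (gtime m k.+1) w - N (gtime m k) w)) t0) => k; apply: E1.
Qed.

Lemma glim_fmeas : fmeas F t glim.
Proof. by apply: (fmeas_cvg FF (le_trans s0 (ltW st)) gsum_fmeas gsum_cvg). Qed.

Let incr_meas m k : measurable_fun setT (incr m k).
Proof. by apply: (fmeas_measurable FF (gtime_ge0 m k.+1)); exact: incr_fmeas. Qed.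

Let live_meas m k : measurable (live m k).
Proof. exact: (F_measurable FF (gtime_ge0 m k) (live_F m k)). Qed.
Let small_meas m k : measurable (small m k).
Proof. by apply: (F_measurable FF (gtime_ge0 m k.+1)); exact: small_F. Qed.

Local Notation sd m := (Num.sqrt (step_len m)).
Local Notation nu m := (normal_prob 0 (sd m) : probability (measurableTypeR R) R).
Local Notation Ex f := (\int[P]_w f w).

Lemma incr_law m k (A : set R) : measurable A -> P (incr m k @^-1` A) = nu m A.
Proof.
have [_ _ _ h _] := BM => mA.
have lt : gtime m k < gtime m k.+1 by rewrite gtimeS ltrDl step_len_gt0.
have := h _ _ (gtime_ge0 m k) lt A mA.
have -> : gtime m k.+1 - gtime m k = step_len m by rewrite gtimeS addrAC subrr add0r.
by rewrite gtimeS.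
Qed.

Lemma E_incr m k (g : R -> R) (K : R) : measurable_fun setT g -> (forall x, `|g x| <= K) ->
  Ex (fun w => g (incr m k w)) = \int[nu m]_x g x.
Proof.
move=> mg gK; apply: (@E_law _ _ _ P _ (measurableTypeR R) (incr m k) (nu m) g K).
- exact: incr_meas.
- exact: mg.
- exact: gK.
- exact: incr_law.
Qed.

Lemma E_live_incr m k (f : Omega -> R) (g : R -> R) (K K' : R) :
  fmeas F (gtime m k) f -> (forall w, live m k w -> `|f w| <= K') -> 0 <= K' ->
  measurable_fun setT g -> (forall x, `|g x| <= K) ->
  Ex (fun w => \1_(live m k) w * f w * g (incr m k w)) =
  Ex (fun w => \1_(live m k) w * f w) * \int[nu m]_x g x.
Proof.
move=> mf fK K0 mg gK; have g0 := gtime_ge0 m k.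
have mY : fmeas F (gtime m k) (fun w => \1_(live m k) w * f w).
  by apply: (fmeasM FF g0) => //; apply: (fmeas_indic FF g0); exact: live_F.
rewrite -(E_incr m k mg gK).
apply: (@E_indep _ _ _ P (fun w => \1_(live m k) w * f w) (incr m k) g K K').
- exact: (fmeas_measurable FF g0 mY).
- move=> w; rewrite indicE; have [L|L] := pselect (live m k w).
    by rewrite (mem_set L) mul1r fK.
  by rewrite (memNset L) mul0r normr0.
- exact: incr_meas.
- exact: mg.
- exact: gK.
- move=> A B' mA mB; have [_ _ _ _ h] := BM.
  have lt : gtime m k < gtime m k.+1 by rewrite gtimeS ltrDl step_len_gt0.
  have := h _ _ g0 lt B' _ mB (mY A mA).
  by rewrite gtimeS.
Qed.

Let p1 (x : R) := x * \1_I x.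
Let p2 (h x : R) := (x ^+ 2 - h) * \1_I x.
Let p3 (x : R) := x ^+ 2 * \1_I x.

Let p1_meas : measurable_fun setT p1.
Proof. by apply: measurable_funM; [exact: measurable_id|apply: measurable_indic; exact: measurable_itv]. Qed.
Let p3_meas : measurable_fun setT p3.
Proof.
apply: measurable_funM; last by apply: measurable_indic; exact: measurable_itv.
by apply: measurable_funX; exact: measurable_id.
Qed.
Let p2_meas h : measurable_fun setT (p2 h).
Proof.
apply: measurable_funM; last by apply: measurable_indic; exact: measurable_itv.
apply: measurable_funB; last exact: measurable_cst.
by apply: measurable_funX; exact: measurable_id.
Qed.
Let ind_le (x y z : R) : 0 <= z -> (`|x| <= eta -> `|y| <= z) -> `|y * \1_I x| <= z.
Proof.
move=> z0 H; rewrite indicE; have [xI|xI] := pselect (I x).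
  by rewrite (mem_set xI) mulr1; apply: H; move: xI; rewrite /= in_itv /= ler_norml.
by rewrite (memNset xI) mulr0 normr0.
Qed.
Let p1_le x : `|p1 x| <= eta. Proof. by apply: ind_le => //; exact: ltW. Qed.
Let p3_le x : `|p3 x| <= eta ^+ 2.
Proof.
by apply: ind_le; [exact: sqr_ge0|move=> h; rewrite normrX ler_pXn2r // ?nnegrE // ltW].
Qed.
Let p2_le h x : 0 < h -> `|p2 h x| <= eta ^+ 2 + h.
Proof.
move=> hp; apply: ind_le; first by rewrite addr_ge0 ?sqr_ge0 // ltW.
move=> xe; apply: le_trans (ler_normB _ _) _; rewrite (gtr0_norm hp) lerD // normrX.
by rewrite ler_pXn2r // ?nnegrE // ltW.
Qed.

(** Truncation only lowers the second moment: the value in [normal_trunc2] is at most 0. *)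
Lemma E_square m k : Ex (fun w => p3 (incr m k w)) <= step_len m.
Proof.
have sl := step_len_gt0 m.
have b3 : bmeas (fun w => p3 (incr m k w)).
  by split; [exact: (measurableT_comp p3_meas (incr_meas m k))|exists (eta ^+ 2) => w; exact: p3_le].
have b2' : bmeas (fun w => p2 (step_len m) (incr m k w)).
  split; first exact: (measurableT_comp (p2_meas _) (incr_meas m k)).
  by exists (eta ^+ 2 + step_len m) => w; exact: p2_le.
have b0 : bmeas (fun _ : Omega => step_len m) by exact: bmeas_cst.
apply: (@le_trans _ _ (Ex (fun w => p2 (step_len m) (incr m k w) + step_len m))).
  apply: (E_le P b3); first exact: bmeasD.
  move=> w; rewrite /p3 /p2 indicE; case: (_ \in _); rewrite ?mulr1 ?mulr0; lra.
rewrite (E_D P b2' b0) E_cst.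
have -> : Ex (fun w => p2 (step_len m) (incr m k w)) = \int[nu m]_x p2 (step_len m) x.
  by apply: (E_incr m k (p2_meas _)) => x; exact: p2_le.
rewrite /p2 (normal_trunc2 sl e0).
have := normal_phi_ge0 (step_len m) eta; move: (normal_pdf _ _ _) => y y0.
have : 0 <= 2 * step_len m * eta * y by exact: (mulr4_ge0 (ltW sl) (ltW e0) y0).
lra.
Qed.

Lemma wt_incr m k w : wt m k w = \1_(live m k) w * \1_I (incr m k w).
Proof.
rewrite /wt; congr (_ * _); rewrite !indicE; congr (nat_of_bool _)%:R.
apply/idP/idP; rewrite !inE /small /= in_itv /= ler_norml; by [].
Qed.

Lemma live_c_bmeas m k (c : R -> Omega -> R) : (forall u : R, 0 <= u -> fmeas F u (c u)) ->
  (forall (w : Omega) (u : R), 0 <= u < T w -> `|c u w| <= M) ->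
  bmeas (fun w => \1_(live m k) w * c (gtime m k) w).
Proof.
move=> mc bc; split.
  apply: measurable_funM; first exact: measurable_indic.
  exact: (fmeas_measurable FF (gtime_ge0 m k) (mc _ (gtime_ge0 m k))).
exists M => w; rewrite indicE; have [L|L] := pselect (live m k w).
  by rewrite (mem_set L) mul1r; apply: bc; exact: live_time L.
by rewrite (memNset L) mul0r normr0.
Qed.

Lemma E_first m k : Ex (fun w => wt m k w * (c1 (gtime m k) w * incr m k w)) = 0.
Proof.
have sl := step_len_gt0 m.
have -> : (fun w => wt m k w * (c1 (gtime m k) w * incr m k w)) =
  (fun w => \1_(live m k) w * c1 (gtime m k) w * p1 (incr m k w)).
  by apply/funext => w; rewrite wt_incr /p1; ring.
rewrite (@E_live_incr m k (c1 (gtime m k)) p1 eta M) //.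
- by rewrite /p1 (normal_trunc1 sl e0) mulr0.
- exact: a1 (gtime_ge0 m k).
- by move=> w L; apply: b1; exact: live_time L.
Qed.

(** Unlike the first-order term, which vanishes by symmetry, this one keeps the small defect caused
    by the truncation. *)
Lemma E_second m k : `|Ex (fun w => wt m k w * (c2 (gtime m k) w * (incr m k w ^+ 2 - step_len m)))| <=
  M * (step_len m * (4 / eta * sd m)).
Proof.
have sl := step_len_gt0 m.
have -> : (fun w => wt m k w * (c2 (gtime m k) w * (incr m k w ^+ 2 - step_len m))) =
  (fun w => \1_(live m k) w * c2 (gtime m k) w * p2 (step_len m) (incr m k w)).
  by apply/funext => w; rewrite wt_incr /p2; ring.
rewrite (@E_live_incr m k (c2 (gtime m k)) (p2 (step_len m)) (eta ^+ 2 + step_len m) M) //.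
- rewrite normrM; apply: ler_pM => //.
    apply: (E_abs P (live_c_bmeas m k a2 b2)) => w; rewrite indicE; have [L|L] := pselect (live m k w).
      by rewrite (mem_set L) mul1r; apply: b2; exact: live_time L.
    by rewrite (memNset L) mul0r normr0.
  rewrite /p2 (normal_trunc2 sl e0) normrN.
  have := normal_phi_small sl e0; have := normal_phi_ge0 (step_len m) eta.
  move: (normal_pdf _ _ _) => y y0 h; rewrite ger0_norm; last by exact: (mulr4_ge0 (ltW sl) (ltW e0) y0).
  have -> : 2 * step_len m * eta * y = step_len m * (2 * eta * y) by ring.
  by apply: ler_wpM2l => //; exact: ltW.
- exact: a2 (gtime_ge0 m k).
- by move=> w L; apply: b2; exact: live_time L.
- by move=> x; exact: p2_le.
Qed.

(** The part of the remainder beyond C |x|^3. On live small steps it is at most C times the step,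
    and along each path o(step) with a random threshold, so it is passed to the limit by dominated
    convergence. *)
Let excess m k w := Num.max (`|ito_rem (gtime m k) (step_len m) w| - C * `|incr m k w| ^+ 3) 0.
Definition gexcess m w := \sum_(k < num m) wt m k w * excess m k w.

Let rem_meas m k : measurable_fun setT (ito_rem (gtime m k) (step_len m)).
Proof.
have g0 := gtime_ge0 m k; have g1 := gtime_ge0 m k.+1.
have m1 := fmeas_measurable FF g0 (a1 g0); have m2 := fmeas_measurable FF g0 (a2 g0).
have n0 := fmeas_measurable FF g0 (aN g0); have n1 := fmeas_measurable FF g1 (aN g1).
rewrite gtimeS in n1; have mi := incr_meas m k.
rewrite /ito_rem; apply: measurable_funB; last first.
  apply: measurable_funM => //; apply: measurable_funB; last exact: measurable_cst.
  exact: measurable_funX.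
apply: measurable_funB; first exact: measurable_funB.
exact: measurable_funM.
Qed.
Let wt_meas m k : measurable_fun setT (wt m k).
Proof. by apply: measurable_funM; exact: measurable_indic. Qed.
Let excess_meas m k : measurable_fun setT (excess m k).
Proof.
apply: measurable_maxr; last exact: measurable_cst.
apply: measurable_funB; first by apply: measurableT_comp; [exact: normr_measurable|exact: rem_meas].
apply: measurable_funM; first exact: measurable_cst.
by apply: measurable_funX; apply: measurableT_comp; [exact: normr_measurable|exact: incr_meas].
Qed.
Let excess_ge0 m k w : 0 <= excess m k w. Proof. by rewrite /excess le_max lexx orbT. Qed.
Let excess_le m k w : live m k w -> small m k w -> excess m k w <= C * step_len m.
Proof.
move=> L S; have := rem_bound L S; rewrite mulrDr => h.
rewrite /excess ge_max; apply/andP; split; first lra.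
by rewrite mulr_ge0 // ltW // step_len_gt0.
Qed.
Let wt_excess_le m k w : `|wt m k w * excess m k w| <= C * step_len m.
Proof.
apply: wt_bound; first by rewrite mulr_ge0 // ltW // step_len_gt0.
by move=> L S; rewrite ger0_norm; [exact: excess_le|exact: excess_ge0].
Qed.
Lemma num_step m : (num m)%:R * step_len m = t - s.
Proof. by rewrite /step_len mulrC mulfVK // pnatr_eq0. Qed.

Lemma gexcess_le m w : `|gexcess m w| <= C * (t - s).
Proof.
rewrite /gexcess; apply: le_trans (ler_norm_sum _ _ _) _.
apply: (@le_trans _ _ (\sum_(k < num m) C * step_len m)); first by apply: ler_sum => k _; exact: wt_excess_le.
by rewrite sumr_const card_ord -mulr_natl -(num_step m) le_eqVlt; apply/orP; left; apply/eqP; ring.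
Qed.

Lemma gexcess_cvg w : gexcess m w @[m --> \oo] --> 0.
Proof.
apply/cvgrPdist_le => e ep; have ts : 0 < t - s by rewrite subr_gt0.
have ep' : 0 < e / (t - s) by rewrite divr_gt0.
have [h1 h1p H] := rem_small w ep'.
have [m1 Hm] := step_len_small h1p; exists m1 => // m /= /Hm hm.
rewrite sub0r normrN /gexcess; apply: le_trans (ler_norm_sum _ _ _) _.
apply: (@le_trans _ _ (\sum_(k < num m) step_len m * (e / (t - s)))); last first.
  rewrite sumr_const card_ord -mulr_natl mulrA (num_step m) le_eqVlt; apply/orP; left; apply/eqP.
  by field; rewrite gt_eqF.
apply: ler_sum => k _; have sl := step_len_gt0 m.
apply: wt_bound; first by rewrite mulr_ge0 // ltW.
move=> L S; rewrite ger0_norm //.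
have x1 : 0 < step_len m <= h1 by rewrite sl hm.
have := H _ _ (live_time L) x1 (le_trans S ee).
rewrite -/(incr m k w) /excess => x2; rewrite ge_max; apply/andP; split; first lra.
by rewrite mulr_ge0 // ltW.
Qed.

Lemma gexcess_meas m : measurable_fun setT (gexcess m).
Proof. by apply: measurable_sum => k; apply: measurable_funM. Qed.

(** On the truncation set |x|^3 <= eta x^2, whose mean is at most eta times the step. *)
Lemma E_rem m k : `|Ex (fun w => wt m k w * ito_rem (gtime m k) (step_len m) w)| <=
  C * eta * step_len m + Ex (fun w => wt m k w * excess m k w).
Proof.
have sl := step_len_gt0 m.
have b3 : bmeas (fun w => C * eta * p3 (incr m k w)).
  apply: bmeasM; first exact: bmeas_cst.
  by split; [exact: (measurableT_comp p3_meas (incr_meas m k))|exists (eta ^+ 2) => w; exact: p3_le].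
have b3' : bmeas (fun w => p3 (incr m k w)).
  by split; [exact: (measurableT_comp p3_meas (incr_meas m k))|exists (eta ^+ 2) => w; exact: p3_le].
have be : bmeas (fun w => wt m k w * excess m k w).
  split; first by apply: measurable_funM.
  by exists (C * step_len m) => w; exact: wt_excess_le.
have br : bmeas (fun w => wt m k w * ito_rem (gtime m k) (step_len m) w).
  split; first by apply: measurable_funM.
  exists (C * (eta ^+ 3 + step_len m)) => w; apply: wt_bound.
    by apply: mulr_ge0 => //; apply: addr_ge0; [apply: exprn_ge0|]; exact: ltW.
  move=> L S; apply: le_trans (rem_bound L S) _; apply: ler_wpM2l => //; apply: lerD => //.
  by rewrite ler_pXn2r // ?nnegrE // ltW.
apply: (@le_trans _ _ (Ex (fun w => C * eta * p3 (incr m k w) + wt m k w * excess m k w))).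
  apply: (E_abs_le P br); first exact: bmeasD.
  move=> w; rewrite normrM (ger0_norm (wt_ge0 m k w)).
  rewrite wtE; case: asboolP => [[L S]|_]; last first.
    rewrite !mul0r addr0; apply: mulr_ge0; first by rewrite mulr_ge0 // ltW.
    by apply: mulr_ge0; [exact: sqr_ge0|rewrite indicE; case: (_ \in _)].
  rewrite !mul1r /p3 indicE mem_set; last by rewrite /= in_itv /= -ler_norml.
  rewrite mulr1 /excess; set x := incr m k w in S *; set r := ito_rem _ _ _.
  have xx : C * `|x| ^+ 3 <= C * eta * x ^+ 2.
    rewrite -mulrA; apply: ler_wpM2l => //; rewrite exprS -normrX (ger0_norm (sqr_ge0 x)).
    by apply: ler_wpM2r; [exact: sqr_ge0|].
  have := le_max (`|r| - C * `|x| ^+ 3) 0 (`|r| - C * `|x| ^+ 3).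
  rewrite lexx /= => h; have {}h : `|r| - C * `|x| ^+ 3 <= Num.max (`|r| - C * `|x| ^+ 3) 0 by rewrite le_max lexx.
  lra.
rewrite (E_D P b3 be) (E_Z P _ b3') lerD2r; apply: ler_wpM2l; first by rewrite mulr_ge0 // ltW.
exact: E_square.
Qed.

Lemma E_gsum m : `|Ex (gsum m)| <= (t - s) * (M * (4 / eta * sd m)) + (C * eta * (t - s) + Ex (gexcess m)).
Proof.
have sl := step_len_gt0 m.
pose f1 k w := wt m k w * (c1 (gtime m k) w * incr m k w).
pose f2 k w := wt m k w * (c2 (gtime m k) w * (incr m k w ^+ 2 - step_len m)).
pose f3 k w := wt m k w * ito_rem (gtime m k) (step_len m) w.
have g0 k := gtime_ge0 m k.
have bf1 k : bmeas (f1 k).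
  split; first by apply: measurable_funM => //; apply: measurable_funM => //; exact: (fmeas_measurable FF (g0 k) (a1 (g0 k))).
  exists (M * eta) => w; apply: wt_bound; first by rewrite mulr_ge0 // ltW.
  by move=> L S; rewrite normrM; apply: ler_pM => //; apply: b1; exact: live_time L.
have bf2 k : bmeas (f2 k).
  split.
    apply: measurable_funM => //; apply: measurable_funM; first exact: (fmeas_measurable FF (g0 k) (a2 (g0 k))).
    by apply: measurable_funB; [exact: measurable_funX|exact: measurable_cst].
  exists (M * (eta ^+ 2 + step_len m)) => w; apply: wt_bound; first by rewrite mulr_ge0 ?addr_ge0 ?sqr_ge0 // ltW.
  move=> L S; rewrite normrM; apply: ler_pM => //; first by apply: b2; exact: live_time L.
  apply: le_trans (ler_normB _ _) _; rewrite normrX (gtr0_norm sl); apply: lerD => //.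
  by rewrite ler_pXn2r // ?nnegrE // ltW.
have bf3 k : bmeas (f3 k).
  split; first by apply: measurable_funM.
  exists (C * (eta ^+ 3 + step_len m)) => w; apply: wt_bound.
    by apply: mulr_ge0 => //; apply: addr_ge0; [apply: exprn_ge0|]; exact: ltW.
  move=> L S; apply: le_trans (rem_bound L S) _; apply: ler_wpM2l => //; apply: lerD => //.
  by rewrite ler_pXn2r // ?nnegrE // ltW.
have be k : bmeas (fun w => wt m k w * excess m k w).
  split; first by apply: measurable_funM.
  by exists (C * step_len m) => w; exact: wt_excess_le.
have bf k : bmeas (fun w => f1 k w + f2 k w + f3 k w) by apply: bmeasD => //; exact: bmeasD.
have -> : gsum m = (fun w => \sum_(k < num m) (f1 k w + f2 k w + f3 k w)).
  apply/funext => w; apply: eq_bigr => k _; rewrite /f1 /f2 /f3 /ito_rem -gtimeS -/(incr m k w); ring.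
rewrite (@E_sum _ _ _ P 'I_(num m) _ (fun k w => f1 k w + f2 k w + f3 k w)) //.
have -> : Ex (gexcess m) = \sum_(k < num m) Ex (fun w => wt m k w * excess m k w).
  by rewrite /gexcess (@E_sum _ _ _ P 'I_(num m) _ (fun k w => wt m k w * excess m k w)).
apply: le_trans (ler_norm_sum _ _ _) _.
have H k : `|Ex (fun w => f1 k w + f2 k w + f3 k w)| <=
    M * (step_len m * (4 / eta * sd m)) + (C * eta * step_len m + Ex (fun w => wt m k w * excess m k w)).
  rewrite (E_D P (bmeasD (bf1 k) (bf2 k)) (bf3 k)) (E_D P (bf1 k) (bf2 k)) (E_first m k) add0r.
  by apply: le_trans (ler_normD _ _) _; apply: lerD; [exact: E_second|exact: E_rem].
apply: (@le_trans _ _ _ _ _ (ler_sum _ (fun (k : 'I_(num m)) _ => H k))).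
rewrite (sum_affine _ _ (fun k => Ex (fun w => wt m k w * excess m k w))) -(num_step m).
by rewrite le_eqVlt; apply/orP; left; apply/eqP; ring.
Qed.

Lemma E_glim : `|Ex glim| <= C * eta * (t - s).
Proof.
have t0 : 0 <= t by exact: le_trans (ltW st).
have mg m := fmeas_measurable FF t0 (gsum_fmeas m).
have c1' := E_dct (P := P) mg (fmeas_measurable FF t0 glim_fmeas) gsum_bound gsum_cvg.
have m0' : measurable_fun setT (fun _ : Omega => 0 : R) by exact: measurable_cst.
have c2' := E_dct (P := P) gexcess_meas m0' gexcess_le gexcess_cvg.
rewrite E_cst in c2'.
have c3 : sd m @[m --> \oo] --> (0 : R).
  apply/cvgrPdist_le => e ep.
  have [m1 Hm] := step_len_small (exprn_gt0 2 ep); exists m1 => // m /= /Hm h.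
  rewrite sub0r normrN ger0_norm ?sqrtr_ge0 // -[leRHS](gtr0_norm ep) -sqrtr_sqr; exact: ler_wsqrtr.
have c4 : (t - s) * (M * (4 / eta * sd m)) + (C * eta * (t - s) + Ex (gexcess m)) @[m --> \oo] -->
   (t - s) * (M * (4 / eta * 0)) + (C * eta * (t - s) + 0).
  apply: cvgD; last by apply: cvgD; [exact: cvg_cst|exact: c2'].
  by do 3! (apply: cvgM; first exact: cvg_cst).
rewrite !mulr0 add0r addr0 in c4.
apply: (ler_cvg_to (cvg_norm c1') c4); apply: nearW => m; exact: E_gsum.
Qed.

End Grid.

(** [glim] depends neither on the grid nor on the truncation level, so eta may tend to 0 in
    [E_glim]. *)
Lemma glim_E0 s t E : 0 <= s -> s < t -> F s E -> \int[P]_w glim s t E w = 0.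
Proof.
move=> s0 st FE; have ts : 0 < t - s by rewrite subr_gt0.
have [m0 Hm0] : exists m0, (t - s) / m0.+1%:R <= h0.
  exists (Num.bound ((t - s) / h0)); rewrite ler_pdivrMr ?ltr0n // mulrC -ler_pdivrMr //.
  have h1 : (t - s) / h0 < (Num.bound ((t - s) / h0))%:R.
    by apply: archi_boundP; rewrite divr_ge0 ?ltW.
  by apply: le_trans (ltW h1) _; rewrite ler_nat.
have H eta : 0 < eta -> eta <= eta0 -> `|\int[P]_w glim s t E w| <= C * eta * (t - s).
  by move=> e0 ee; exact: (E_glim s0 st FE e0 ee Hm0).
apply/eqP; rewrite -normr_eq0 eq_le normr_ge0 andbT; apply/ler_addgt0Pr => e ep; rewrite add0r.
have q0 : 0 < (C + 1) * (t - s) by rewrite mulr_gt0 // ltr_wpDl.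
have n0 : 0 < Num.min eta0 (e / ((C + 1) * (t - s))) by rewrite lt_min eta00 divr_gt0.
have n1 : Num.min eta0 (e / ((C + 1) * (t - s))) <= eta0 by rewrite ge_min lexx.
have n2 : Num.min eta0 (e / ((C + 1) * (t - s))) <= e / ((C + 1) * (t - s)) by rewrite ge_min lexx orbT.
move: n2; rewrite ler_pdivlMr //; set y := Num.min _ _ in n0 n1 *; move=> n2.
apply: le_trans (H _ n0 n1) _; apply: le_trans n2.
have -> : C * y * (t - s) = C * (y * (t - s)) by ring.
have -> : y * ((C + 1) * (t - s)) = C * (y * (t - s)) + y * (t - s) by ring.
by rewrite lerDl mulr_ge0 // ltW.
Qed.

(** With s = 0 and E everything, the stopped process is a limit of the adapted grid sums plus its
    initial value. *)
Lemma stopped_fmeas t : 0 <= t -> fmeas F t (fun w => N (Num.min t (T w)) w).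
Proof.
move=> t0; have [T0 _] := ST.
have n0 w : Num.min 0 (T w) = 0 by rewrite min_l.
move: t0; rewrite le_eqVlt => /orP[/eqP <-|t0].
  by under eq_fun do rewrite n0; exact: aN.
have F0 : F 0 setT by exact: (FT FF).
have [m0 Hm0] : exists m0, (t - 0) / m0.+1%:R <= h0.
  exists (Num.bound (t / h0)); rewrite subr0 ler_pdivrMr ?ltr0n // mulrC -ler_pdivrMr //.
  have h1 : t / h0 < (Num.bound (t / h0))%:R by apply: archi_boundP; rewrite divr_ge0 ?ltW.
  by apply: le_trans (ltW h1) _; rewrite ler_nat.
have G := glim_fmeas m0 (lexx 0) t0 F0 eta00.
have -> : (fun w => N (Num.min t (T w)) w) = (fun w => glim 0 t setT w + N 0 w).
  by apply/funext => w; rewrite /glim n0 indicE in_setT mul1r subrK.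
apply: (fmeasD FF (ltW t0) G); apply: (fmeas_mono FF (lexx 0) (ltW t0)); exact: aN.
Qed.

Theorem stopped_martingale : martingale P F (fun t w => N (Num.min t (T w)) w).
Proof.
have [T0 _] := ST.
have nb t w : 0 <= t -> `|N (Num.min t (T w)) w| <= M.
  by move=> t0; apply: bN; rewrite le_min t0 T0 /= ge_min lexx orbT.
have nm t : 0 <= t -> measurable_fun setT (fun w => N (Num.min t (T w)) w).
  by move=> t0; exact: (fmeas_measurable FF t0 (stopped_fmeas t0)).
split.
- by move=> t t0 A mA; exact: stopped_fmeas.
- move=> t t0; apply: (@bounded_int _ _ _ P _ M (nm t t0)) => w; exact: nb.
move=> s t s0; rewrite le_eqVlt => /orP[/eqP <- //|st] E FE.
have t0 : 0 <= t by exact: le_trans (ltW st).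
have mE : measurable E by exact: (F_measurable FF s0).
have EE u : 0 <= u -> (\int[P]_(w in E) (N (Num.min u (T w)) w)%:E = (\int[P]_w (\1_E w * N (Num.min u (T w)) w))%:E)%E.
  move=> u0; have I := @bounded_int _ _ _ P _ M (nm u u0) (fun w => nb u w u0).
  have IE := integrableS measurableT mE (@subsetT _ E) I.
  have <- : \int[P]_(w in E) N (Num.min u (T w)) w = \int[P]_w (\1_E w * N (Num.min u (T w)) w).
    rewrite Rintegral_mkcond; congr Rintegral; apply/funext => w; rewrite patchE indicE.
    by case: ifP => _; rewrite ?mul1r ?mul0r.
  by rewrite /Rintegral fineK //; exact: integrable_fin_num.
rewrite (EE t t0) (EE s s0); congr (_%:E).
have bm u : 0 <= u -> bmeas (fun w => \1_E w * N (Num.min u (T w)) w).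
  move=> u0; apply: bmeasM; first exact: bmeas_indic.
  by split; [exact: nm|exists M => w; exact: nb].
apply/eqP; rewrite -subr_eq0 -(E_B P (bm t t0) (bm s s0)); apply/eqP.
rewrite -[RHS](glim_E0 s0 st FE); congr Rintegral; apply/funext => w.
by rewrite /glim mulrBr.
Qed.

End StoppedMartingale.

(** * Adaptedness of the flow *)

(* y^-1 = y exp(- ln y^2), also at y = 0 *)
Lemma measurable_invr (R : realType) : measurable_fun setT (fun y : R => y^-1).
Proof.
have -> : (fun y : R => y^-1) = (fun y => y * expR (- ln (y ^+ 2))).
  apply/funext => y; have [->|y0] := eqVneq y 0; first by rewrite invr0 mul0r.
  have y2 : 0 < y ^+ 2 by rewrite exprn_even_gt0.
  by rewrite expRN lnK ?posrE // expr2; field.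
apply: measurable_funM; first exact: measurable_id.
apply: (measurableT_comp (@measurable_expR R)).
apply: measurable_funN; apply: (measurableT_comp (@measurable_ln R)).
by apply: measurable_funX; exact: measurable_id.
Qed.

Section ComplexAdapted.
Context {R : realType} {d : measure_display} {Omega : measurableType d}.
Variables (F : R -> set (set Omega)).
Hypothesis FF : filtration F.
Local Notation C := (Cplx R).
Variable t : R.
Hypothesis t0 : 0 <= t.
Implicit Types (f g : Omega -> C) (p : Omega -> R).

Definition cfm f := fmeas F t (fun w => Re (f w)) /\ fmeas F t (fun w => Im (f w)).

Lemma cfm_cst (c : C) : cfm (fun _ => c).
Proof. by split; apply: (fmeas_cst FF). Qed.
Lemma cfmD f g : cfm f -> cfm g -> cfm (fun w => f w + g w).
Proof.
move=> [a b] [a' b']; split.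
  by rewrite (_ : (fun w => _) = (fun w => Re (f w) + Re (g w))); [apply: (fmeasD FF)|apply/funext => w; rewrite cReD].
by rewrite (_ : (fun w => _) = (fun w => Im (f w) + Im (g w))); [apply: (fmeasD FF)|apply/funext => w; rewrite cImD].
Qed.
Lemma cfmN f : cfm f -> cfm (fun w => - f w).
Proof.
move=> [a b]; split.
  by rewrite (_ : (fun w => _) = (fun w => - Re (f w))); [apply: (fmeasN FF)|apply/funext => w; rewrite cReN].
by rewrite (_ : (fun w => _) = (fun w => - Im (f w))); [apply: (fmeasN FF)|apply/funext => w; rewrite cImN].
Qed.
Lemma cfmB f g : cfm f -> cfm g -> cfm (fun w => f w - g w).
Proof. by move=> a b; apply: cfmD => //; exact: cfmN. Qed.
Lemma cfmM f g : cfm f -> cfm g -> cfm (fun w => f w * g w).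
Proof.
move=> [a b] [a' b']; split.
  rewrite (_ : (fun w => _) = (fun w => Re (f w) * Re (g w) - Im (f w) * Im (g w))).
    by apply: (fmeasB FF) => //; apply: (fmeasM FF).
  by apply/funext => w; rewrite cReM.
rewrite (_ : (fun w => _) = (fun w => Re (f w) * Im (g w) + Im (f w) * Re (g w))).
  by apply: (fmeasD FF) => //; apply: (fmeasM FF).
by apply/funext => w; rewrite cImM.
Qed.
Lemma cfm_conj f : cfm f -> cfm (fun w => (f w)^*).
Proof.
move=> [a b]; split.
  by rewrite (_ : (fun w => _) = (fun w => Re (f w))) //; apply/funext => w; rewrite cRe_conj.
by rewrite (_ : (fun w => _) = (fun w => - Im (f w))); [apply: (fmeasN FF)|apply/funext => w; rewrite cIm_conj].
Qed.
Lemma cfm_of p : fmeas F t p -> cfm (fun w => cst_of (p w)).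
Proof. by move=> a; split => //; apply: (fmeas_cst FF). Qed.
Lemma cfm_exp f : cfm f -> cfm (fun w => expC (f w)).
Proof.
move=> [a b]; split; rewrite /expC /=; apply: (fmeasM FF) => //.
- by apply: (fmeas_comp (@measurable_expR R)).
- by apply: (@fmeas_comp _ _ _ _ _ _ cos) => //; apply: continuous_measurable_fun; exact: continuous_cos.
- by apply: (fmeas_comp (@measurable_expR R)).
- by apply: (@fmeas_comp _ _ _ _ _ _ sin) => //; apply: continuous_measurable_fun; exact: continuous_sin.
Qed.
Lemma fmeas_nm f : cfm f -> fmeas F t (fun w => nm (f w)).
Proof.
move=> [a b].
have -> : (fun w => nm (f w)) = (fun w => Num.sqrt (Re (f w) * Re (f w) + Im (f w) * Im (f w))).
  by apply/funext => w; rewrite /nm; case: (f w) => x y; rewrite /= !expr2.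
apply: (@fmeas_comp _ _ _ _ _ _ (@Num.sqrt R)); first by apply: continuous_measurable_fun; exact: sqrt_continuous.
by apply: (fmeasD FF) => //; apply: (fmeasM FF).
Qed.
Lemma cfm_Log f : cfm f -> cfm (fun w => LogC (f w)).
Proof.
move=> cf; have [a b] := cf; split.
  rewrite (_ : (fun w => _) = (fun w => ln (nm (f w)))) //.
  by apply: (fmeas_comp (@measurable_ln R)); exact: fmeas_nm.
rewrite (_ : (fun w => _) = (fun w => atan (Im (f w) * (Re (f w))^-1))) //.
apply: (@fmeas_comp _ _ _ _ _ _ (@atan R)); first by apply: continuous_measurable_fun; exact: continuous_atan.
by apply: (fmeasM FF) => //; exact: (fmeas_comp (@measurable_invr R)).
Qed.
Lemma cfm_Rg e f : cfm f -> cfm (fun w => Rg e (f w)).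
Proof.
move=> cf; have c1 : cfm (fun w => 1 - f w) by apply: cfmB => //; exact: cfm_cst.
rewrite (_ : (fun w => _) = (fun w => (1 - f w)^* * cst_of ((Num.max (nm (1 - f w) ^+ 2) (e ^+ 2))^-1))).
  apply: cfmM; [exact: cfm_conj|apply: cfm_of].
  apply: (@fmeas_comp _ _ _ _ _ _ (fun y : R => (Num.max (y ^+ 2) (e ^+ 2))^-1)); last exact: fmeas_nm.
  apply: (measurableT_comp (@measurable_invr R)); apply: measurable_maxr; last exact: measurable_cst.
  by apply: measurable_funX; exact: measurable_id.
by apply/funext => w; rewrite /Rg cstV.
Qed.
Lemma cfm_sum (I : eqType) (r : seq I) (f : I -> Omega -> C) : (forall i, i \in r -> cfm (f i)) ->
  cfm (fun w => \sum_(i <- r) f i w).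
Proof.
elim: r => [|z s IH] H.
  by rewrite (_ : (fun u => _) = (fun _ => 0)); [exact: cfm_cst|apply/funext => u; rewrite big_nil].
rewrite (_ : (fun u => _) = (fun u => f z u + \sum_(z <- s) f z u)); last by apply/funext => u; rewrite big_cons.
by apply: cfmD; [exact: H (mem_head z s)|apply: IH => y ys; exact: H (mem_behead (s := z :: s) ys)].
Qed.
Lemma cfm_sumpairs (s : seq C) (f : C -> C -> Omega -> C) :
  (forall z y, z \in s -> y \in s -> cfm (f z y)) -> cfm (fun u => sumpairs s (fun z y => f z y u)).
Proof.
elim: s => [|z s IH] H.
  by rewrite (_ : (fun u => _) = (fun _ => 0)); [exact: cfm_cst|apply/funext => u; rewrite /sumpairs big_ord0].
rewrite (_ : (fun u => _) = (fun u => \sum_(y <- s) f z y u + sumpairs s (fun z y => f z y u))); last first.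
  by apply/funext => u; rewrite sumpairs_cons.
have sub y : y \in s -> y \in z :: s by move=> ys; exact: (mem_behead (s := z :: s) ys).
apply: cfmD; first by apply: cfm_sum => y ys; apply: H; [exact: mem_head|exact: sub].
by apply: IH => u v us vs; apply: H; exact: sub.
Qed.
Lemma cfm_p2 f (k m : C) : cfm f -> cfm (fun w => p2 (f w) k m).
Proof. by move=> cf; apply: cfmD; apply: cfmM; [exact: cfm_cst|exact: cf|exact: cfm_cst|exact: cfm_conj]. Qed.

Lemma cfm_cvg (f : nat -> Omega -> C) g : (forall m, cfm (f m)) ->
  (forall w (e : R), 0 < e -> exists m0, forall m, (m0 <= m)%N -> nm (f m w - g w) <= e) -> cfm g.
Proof.
move=> H c; split.
  apply: (fmeas_cvg FF t0 (fun m => (H m).1)) => w; apply/cvgrPdist_le => e e0.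
  have [m0 Hm] := c w e e0; exists m0 => // m /= /Hm; apply: le_trans.
  rewrite nmBC -cReB; exact: Re_le_nm.
apply: (fmeas_cvg FF t0 (fun m => (H m).2)) => w; apply/cvgrPdist_le => e e0.
have [m0 Hm] := c w e e0; exists m0 => // m /= /Hm; apply: le_trans.
rewrite nmBC -cImB; exact: Im_le_nm.
Qed.

Lemma cfm_expo kappa (X : rooted_vertex R) (L : Omega -> logs R) : let ns := undup (nodes X) in
  [/\ cfm (fun w => lq (L w)) /\ cfm (fun w => lq' (L w)), cfm (fun w => lz (L w)) /\ cfm (fun w => lz' (L w)),
    cfm (fun w => lwz (L w)) /\ cfm (fun w => lwz' (L w)),
    (forall z, z \in ns -> [/\ cfm (fun w => ld (L w) z), cfm (fun w => lw (L w) z),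
      cfm (fun w => lsz (L w) z) & cfm (fun w => lrz (L w) z)]) &
    forall z y, z \in ns -> y \in ns -> cfm (fun w => ls (L w) z y) /\ cfm (fun w => lr (L w) z y)] ->
  cfm (fun w => expo kappa X (L w)).
Proof.
move=> ns [[h1 h2] [h3 h4] [h5 h6] h7 h8]; rewrite /expo.
apply: cfmD.
  apply: cfmD.
    apply: cfmD; last first.
      apply: (cfm_sum (f := fun z w => _)) => z zn; have [k1 k2 _ _] := h7 _ zn.
      by apply: cfmD; exact: cfm_p2.
    apply: cfmB; last exact: cfm_p2.
    apply: cfmD; last exact: cfm_p2.
    apply: cfmB; last exact: cfm_p2.
    apply: cfmD; last exact: cfm_p2.
    by apply: cfmB; exact: cfm_p2.
  apply: (cfm_sum (f := fun z w => _)) => z zn; have [_ _ k1 k2] := h7 _ zn.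
  by apply: cfmD; exact: cfm_p2.
apply: (cfm_sumpairs (f := fun z y w => _)) => z y zn yn; have [k1 k2] := h8 _ _ zn yn.
by apply: cfmD; exact: cfm_p2.
Qed.

End ComplexAdapted.

Lemma unif_cont_nm (R : realType) (f : R -> Cplx R) (T : R) : continuous f -> forall e : R, 0 < e ->
  exists2 d : R, 0 < d & forall x y : R, 0 <= x <= T -> `|y - x| <= d -> nm (f y - f x) <= e.
Proof.
move=> cf e e0.
have cR : continuous (fun x => Re (f x)) by move=> x; apply: (cvg_comp _ (@complex.Re R) (cf x)); exact: continuous_Re.
have cI : continuous (fun x => Im (f x)) by move=> x; apply: (cvg_comp _ (@complex.Im R) (cf x)); exact: continuous_Im.
have e2 : 0 < e / 2 by rewrite divr_gt0.
have [d1 d10 H1] := unif_cont T cR e2; have [d2 d20 H2] := unif_cont T cI e2.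
exists (Num.min d1 d2); first by rewrite lt_min d10.
move=> x y xT; rewrite le_min => /andP[/(H1 _ _ xT) a /(H2 _ _ xT) b].
apply: le_trans (nm_le_ReIm _) _; rewrite cReB cImB; lra.
Qed.

(** * Riemann sums *)

Section Riemann.
Variable R : realType.
Local Notation C := (Cplx R).
Implicit Types (f : R -> C) (t : R).

(** These exhibit the time integral of an adapted continuous process as a pointwise limit of adapted
    sums, without joint measurability in time and chance. *)
Definition riemann f t m : C :=
  \sum_(k < m.+1) f (k%:R * (t / m.+1%:R)) * cst_of (t / m.+1%:R).

Lemma riemann_cvg f t : continuous f -> 0 <= t -> forall e : R, 0 < e ->
  exists m0, forall m, (m0 <= m)%N -> nm (riemann f t m - ppos f t) <= e.
Proof.
move=> cf t0 e e0; have q0 : 0 < e / (t + 1) by rewrite divr_gt0 // ltr_wpDl.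
have [dl d0 H] := unif_cont_nm t cf q0.
exists (Num.bound (t / dl)) => m mm.
set h := t / m.+1%:R.
have h0 : 0 <= h by rewrite divr_ge0.
have hd : h <= dl.
  rewrite ler_pdivrMr ?ltr0n // mulrC -ler_pdivrMr //.
  have h1 : t / dl < (Num.bound (t / dl))%:R by apply: archi_boundP; rewrite divr_ge0 // ltW.
  by apply: le_trans (ltW h1) _; rewrite ler_nat; exact: leqW.
have tE : t = m.+1%:R * h by rewrite /h mulrC divfK // pnatr_eq0.
have part n : (n <= m.+1)%N ->
    nm (\sum_(k < n) f (k%:R * h) * cst_of h - ppos f (n%:R * h)) <= n%:R * (e / (t + 1) * h).
  elim: n => [|n IH] nm1; first by rewrite big_ord0 !mul0r ppos0 subrr nm0.
  have nh0 : 0 <= n%:R * h by rewrite mulr_ge0.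
  have nht : n%:R * h <= t by rewrite tE ler_wpM2r // ler_nat ltnW.
  rewrite big_ord_recr /=.
  have E : n.+1%:R * h = n%:R * h + h by rewrite -natr1 mulrDl mul1r.
  have I := @ppos_incr _ f (n%:R * h) h (f (n%:R * h)) (e / (t + 1)) cf nh0 h0.
  have {}I : nm (ppos f (n%:R * h + h) - ppos f (n%:R * h) - f (n%:R * h) * cst_of h) <= e / (t + 1) * h.
    apply: I => s /andP[s1 s2]; apply: H; first by rewrite nh0.
    rewrite ger0_norm ?subr_ge0 ?(ltW s1) //; lra.
  rewrite {1}E -natr1 mulrDl mul1r.
  set S := \sum_(k < n) _ in IH *; set a := ppos _ _; set b := ppos f (n%:R * h) in IH I; set c := f _ * _ in I *.
  have -> : S + c - a = (S - b) - (a - b - c) by ring.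
  apply: le_trans (nmD _ _) _; rewrite nmN; apply: lerD; [apply: IH; exact: ltnW|exact: I].
have := part m.+1 (leqnn _); rewrite -tE mulrCA -tE => P.
apply: le_trans P _; rewrite mulrAC ler_pdivrMr ?ltr_wpDl //.
apply: ler_wpM2l; [exact: ltW|lra].
Qed.

End Riemann.

Section FlowAdapted.
Context {R : realType} {d : measure_display} {Omega : measurableType d}.
Variables (F : R -> set (set Omega)).
Hypothesis FF : filtration F.
Local Notation C := (Cplx R).

Lemma cfm_mono s t (f : Omega -> C) : 0 <= s -> s <= t -> cfm F s f -> cfm F t f.
Proof. by move=> s0 st [a b]; split; [exact: (fmeas_mono FF s0 st a)|exact: (fmeas_mono FF s0 st b)]. Qed.

Lemma cfm_ppos t (f : Omega -> R -> C) : 0 <= t -> (forall w, continuous (f w)) ->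
  (forall s, 0 <= s <= t -> cfm F t (fun w => f w s)) -> cfm F t (fun w => ppos (f w) t).
Proof.
move=> t0 cf H.
apply: (@cfm_cvg _ _ _ F FF t t0 (fun m w => riemann (f w) t m)); last first.
  by move=> w e e0; exact: riemann_cvg.
move=> m; rewrite /riemann.
apply: (@cfm_sum _ _ _ F FF t t0 'I_m.+1 _ (fun (k : 'I_m.+1) w => f w (k%:R * (t / m.+1%:R)) * cst_of (t / m.+1%:R))) => k _.
apply: (cfmM FF t0); last exact: (cfm_cst FF t0).
apply: H; rewrite mulr_ge0 ?divr_ge0 //= mulrA ler_pdivrMr ?ltr0n // mulrC ler_wpM2l // ler_nat ltnW //.
Qed.

Variable th : Omega -> R -> R.
Hypothesis cth : forall w, continuous (th w).
Hypothesis ath : forall t, 0 <= t -> fmeas F t (fun w => th w t).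
Variable e : R.
Hypothesis e0 : 0 < e.

Lemma cfm_xi t : 0 <= t -> cfm F t (fun w => xi (th w) t : C).
Proof.
move=> t0; apply: (cfm_exp FF t0); apply: (cfmM FF t0); first exact: (cfm_cst FF t0).
by apply: (cfm_of FF t0); exact: ath.
Qed.
Lemma cfm_div_xi t (f : Omega -> C) : 0 <= t -> cfm F t f -> cfm F t (fun w => f w / xi (th w) t).
Proof.
move=> t0 cf; rewrite (_ : (fun w => _) = (fun w => f w * (xi (th w) t)^*)).
  by apply: (cfmM FF t0) => //; apply: (cfm_conj FF t0); exact: cfm_xi.
apply/funext => w; congr (_ * _); apply: (mulfI (xi_neq0 (th w) t)).
by rewrite xi_conj mulfV // xi_neq0.
Qed.

Lemma cfm_fld t (f : Omega -> C) : 0 <= t -> cfm F t f -> cfm F t (fun w => fld (th w) e t (f w)).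
Proof.
move=> t0 cf; rewrite /fld; apply: (cfmB FF t0) => //; apply: (cfmM FF t0).
  by apply: (cfmM FF t0); [exact: (cfm_cst FF t0)|exact: cfm_xi].
apply: (cfmB FF t0); last exact: (cfm_cst FF t0).
by apply: (cfm_Rg FF t0); exact: cfm_div_xi.
Qed.

(** Each Picard iterate at time s uses the path up to s only, and the iterates converge for every
    path. *)
Lemma cfm_Ue z t : 0 <= t -> cfm F t (fun w => Ue (th w) e z t).
Proof.
have L0 := Lc_gt0 e0; have VL w t1 x y := @fld_lip R (th w) e t1 x y e0.
have Vc w (v : R -> C) (cv : continuous v) := @fld_cont R (th w) (@cth w) e v e0 cv.
have P n : forall s, 0 <= s -> cfm F s (fun w => pic (fld (th w) e) z n s).
  elim: n => [|n IH] s s0 /=; first exact: (cfm_cst FF s0).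
  apply: (cfmD FF s0); first exact: (cfm_cst FF s0).
  apply: cfm_ppos => //.
    by move=> w; apply: (Vc w) => x; exact: (@pic_continuous _ _ (Vc w) z n x).
  move=> r /andP[r0 rs]; apply: (cfm_mono r0 rs); apply: cfm_fld => //; exact: IH.
move=> t0; apply: (@cfm_cvg _ _ _ F FF t t0 (fun m w => pic (fld (th w) e) z m t)); first by move=> m; exact: P.
move=> w eps eps0; have [K K0 HK] := @psol_unif _ _ _ L0 (VL w) (Vc w) z t t0.
have [m0 Hm0] : exists m0 : nat, K / eps <= m0%:R.
  by exists (Num.bound (K / eps)); apply: ltW; apply: archi_boundP; rewrite divr_ge0 // ltW.
exists m0 => m mm; apply: le_trans (HK m t (lexx t)) _.
rewrite ler_pdivrMr ?exprn_gt0 // mulrC -ler_pdivrMr //; apply: le_trans Hm0 _.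
apply: (@le_trans _ _ m%:R); first by rewrite ler_nat.
by rewrite -natrX ler_nat ltnW // ltn_expl.
Qed.

Lemma cfm_We z t : 0 <= t -> cfm F t (fun w => We (th w) e z t).
Proof. by move=> t0; apply: cfm_div_xi => //; exact: cfm_Ue. Qed.
Lemma cfm_re z t : 0 <= t -> cfm F t (fun w => re (th w) e z t).
Proof. by move=> t0; apply: (cfm_Rg FF t0); exact: cfm_We. Qed.

Lemma cfm_pkA z z' t : 0 <= t -> cfm F t (fun w => ppos (kA (th w) e z z') t).
Proof.
move=> t0; apply: (cfm_ppos t0); first by move=> w; exact: (@kA_continuous _ _ (@cth w) _ e0).
move=> s /andP[s0 st]; apply: (cfm_mono s0 st); have r z1 := cfm_re z1 s0.
apply: (cfmB FF s0); last exact: (cfm_cst FF s0).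
by apply: (cfmM FF s0) => //; apply: (cfmM FF s0) => //; exact: (cfm_cst FF s0).
Qed.
Lemma cfm_pkB z z' t : 0 <= t -> cfm F t (fun w => ppos (kB (th w) e z z') t).
Proof.
move=> t0; apply: (cfm_ppos t0); first by move=> w; exact: (@kB_continuous _ _ (@cth w) _ e0).
move=> s /andP[s0 st]; apply: (cfm_mono s0 st); have r z1 := cfm_re z1 s0.
have c (k : C) := cfm_cst FF s0 k.
have r1 z1 : cfm F s (fun w => re (th w) e z1 s - 1) by apply: (cfmB FF s0); [exact: r|exact: c].
apply: (cfmM FF s0); last by apply: (cfm_conj FF s0); exact: r1.
by apply: (cfmM FF s0); [exact: c|exact: r1].
Qed.

Variables (kappa : R) (X : rooted_vertex R) (u : C -> C) (K : node_logs R).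
Local Notation ns := (undup (nodes X)).

Lemma cfm_Lam t : 0 <= t -> cfm F t (fun w => Lam kappa X u K e (th w) t).
Proof.
move=> t0; have c (k : C) := cfm_cst FF t0 k.
have cturn : cfm F t (fun w => - (iu * cst_of (th w t))).
  by apply: (cfmN FF t0); apply: (cfmM FF t0); [exact: c|apply: (cfm_of FF t0); exact: ath].
have A z z' := cfm_pkA z z' t0; have B z z' := cfm_pkB z z' t0.
have W z := cfm_We z t0.
apply: (cfmD FF t0); last first.
  apply: (@cfm_sum _ _ _ F FF t t0 _ _ (fun z w => _)) => z zn; apply: (cfmM FF t0); first exact: c.
  by apply: (cfm_of FF t0); have [] := B (u z) (u z).
apply: (cfmD FF t0); last exact: c.
have rot (f : Omega -> C) (k : C) : cfm F t f -> cfm F t (fun w => k + f w - iu * cst_of (th w t)).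
  by move=> cf; apply: (cfmD FF t0) => //; apply: (cfmD FF t0).
apply: (@cfm_expo _ _ _ F FF t t0 kappa X (fun w => logs_at u K e (th w) t)); apply: And5.
- by split; exact: rot (c _).
- by split; exact: c.
- by split; exact: c.
- move=> z zn; apply: And4.
  + exact: rot (A _ _).
  + exact: rot (A _ _).
  + by apply: (cfm_Log FF t0); apply: (cfmB FF t0); [exact: c|exact: W].
  + apply: (cfm_Log FF t0); apply: (cfmB FF t0); first exact: c.
    by apply: (cfmM FF t0); [exact: c|apply: (cfm_conj FF t0); exact: W].
- move=> z y zn yn; split; first exact: rot (A _ _).
  by apply: (cfmD FF t0); [exact: c|exact: B].
Qed.

Lemma cfm_Zc t : 0 <= t -> cfm F t (fun w => Zc kappa X u e (th w) t).
Proof.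
move=> t0; have c (k : C) := cfm_cst FF t0 k.
apply: (@cfm_expo _ _ _ F FF t t0 kappa X (fun w => turn_logs (fun z => re (th w) e (u z) t))); apply: And5.
- by split; exact: c.
- by split; exact: c.
- by split; exact: c.
- move=> z zn.
  have h : cfm F t (fun w => iu * (re (th w) e (u z) t - 1)).
    by apply: (cfmM FF t0); [exact: c|apply: (cfmB FF t0); [exact: cfm_re|exact: c]].
  by apply: And4; [exact: c|exact: c|exact: h|apply: (cfm_conj FF t0); exact: h].
- by move=> z y _ _; split; exact: c.
Qed.

Lemma cfm_Gc t : 0 <= t -> cfm F t (fun w => Gc kappa X u e (th w) t).
Proof.
move=> t0; have c (k : C) := cfm_cst FF t0 k.
apply: (cfmD FF t0); last first.
  apply: (cfmM FF t0); first exact: c.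
  rewrite (_ : (fun w => _) = (fun w => Zc kappa X u e (th w) t * Zc kappa X u e (th w) t)).
    by apply: (cfmM FF t0); exact: cfm_Zc.
  by apply/funext => w; rewrite expr2.
apply: (@cfm_expo _ _ _ F FF t t0 kappa X (fun w => turn2_logs (fun z => re (th w) e (u z) t))); apply: And5.
- by split; exact: c.
- by split; exact: c.
- by split; exact: c.
- move=> z zn.
  have h : cfm F t (fun w => re (th w) e (u z) t * (re (th w) e (u z) t - 1) / 2).
    apply: (cfmM FF t0); last exact: c.
    by apply: (cfmM FF t0); [exact: cfm_re|apply: (cfmB FF t0); [exact: cfm_re|exact: c]].
  by apply: And4; [exact: c|exact: c|exact: h|apply: (cfm_conj FF t0); exact: h].
- by move=> z y _ _; split; exact: c.
Qed.

End FlowAdapted.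

(** * Exit times *)

Section BoundedExpo.
Variables (R : realType) (I : Type).
Local Notation C := (Cplx R).
Implicit Types (f g : I -> C).

Lemma bdd_conj f : bdd f -> bdd (fun i => (f i)^*).
Proof. exact: bigO_conj. Qed.
Lemma bddB f g : bdd f -> bdd g -> bdd (fun i => f i - g i).
Proof. by move=> a b; apply: bddD => //; exact: bddN. Qed.
Lemma bdd_p2 f (k m : C) : bdd f -> bdd (fun i => p2 (f i) k m).
Proof. by move=> cf; apply: bddD; apply: bddM; [exact: bdd_cst|exact: cf|exact: bdd_cst|exact: bdd_conj]. Qed.
Lemma bdd_sum (J : eqType) (r : seq J) (f : J -> I -> C) : (forall j, j \in r -> bdd (f j)) ->
  bdd (fun i => \sum_(j <- r) f j i).
Proof.
elim: r => [|z s IH] H.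
  by rewrite (_ : (fun u => _) = (fun _ => 0)); [exact: bdd_cst|apply/funext => u; rewrite big_nil].
rewrite (_ : (fun u => _) = (fun u => f z u + \sum_(z <- s) f z u)); last by apply/funext => u; rewrite big_cons.
by apply: bddD; [exact: H (mem_head z s)|apply: IH => y ys; exact: H (mem_behead (s := z :: s) ys)].
Qed.
Lemma bdd_sumpairs (s : seq C) (f : C -> C -> I -> C) :
  (forall z y, z \in s -> y \in s -> bdd (f z y)) -> bdd (fun u => sumpairs s (fun z y => f z y u)).
Proof.
elim: s => [|z s IH] H.
  by rewrite (_ : (fun u => _) = (fun _ => 0)); [exact: bdd_cst|apply/funext => u; rewrite /sumpairs big_ord0].
rewrite (_ : (fun u => _) = (fun u => \sum_(y <- s) f z y u + sumpairs s (fun z y => f z y u))); last first.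
  by apply/funext => u; rewrite sumpairs_cons.
have sub y : y \in s -> y \in z :: s by move=> ys; exact: (mem_behead (s := z :: s) ys).
apply: bddD; first by apply: bdd_sum => y ys; apply: H; [exact: mem_head|exact: sub].
by apply: IH => u v us vs; apply: H; exact: sub.
Qed.

Lemma bdd_expo kappa (X : rooted_vertex R) (L : I -> logs R) : let ns := undup (nodes X) in
  [/\ bdd (fun w => lq (L w)) /\ bdd (fun w => lq' (L w)), bdd (fun w => lz (L w)) /\ bdd (fun w => lz' (L w)),
    bdd (fun w => lwz (L w)) /\ bdd (fun w => lwz' (L w)),
    (forall z, z \in ns -> [/\ bdd (fun w => ld (L w) z), bdd (fun w => lw (L w) z),
      bdd (fun w => lsz (L w) z) & bdd (fun w => lrz (L w) z)]) &
    forall z y, z \in ns -> y \in ns -> bdd (fun w => ls (L w) z y) /\ bdd (fun w => lr (L w) z y)] ->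
  bdd (fun w => expo kappa X (L w)).
Proof.
move=> ns [[h1 h2] [h3 h4] [h5 h6] h7 h8]; rewrite /expo.
apply: bddD.
  apply: bddD.
    apply: bddD; last first.
      apply: (bdd_sum (f := fun z w => _)) => z zn; have [k1 k2 _ _] := h7 _ zn.
      by apply: bddD; exact: bdd_p2.
    apply: bddB; last exact: bdd_p2.
    apply: bddD; last exact: bdd_p2.
    apply: bddB; last exact: bdd_p2.
    apply: bddD; last exact: bdd_p2.
    by apply: bddB; exact: bdd_p2.
  apply: (bdd_sum (f := fun z w => _)) => z zn; have [_ _ k1 k2] := h7 _ zn.
  by apply: bddD; exact: bdd_p2.
apply: (bdd_sumpairs (f := fun z y w => _)) => z y zn yn; have [k1 k2] := h8 _ _ zn yn.
by apply: bddD; exact: bdd_p2.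
Qed.

End BoundedExpo.

Lemma nm_LogC_bound (R : realType) (y : Cplx R) (a : R) : 0 < a -> a <= nm y -> nm y <= 2 ->
  nm (LogC y) <= `|ln a| + ln 2 + pi.
Proof.
move=> a0 ay y2; apply: le_trans (nm_le_ReIm _) _; rewrite Re_LogC Im_LogC.
have y0 : 0 < nm y by exact: lt_le_trans ay.
have h1 : ln a <= ln (nm y) by rewrite ler_ln ?posrE.
have h2 : ln (nm y) <= ln 2 by rewrite ler_ln ?posrE.
have l2 : 0 <= ln (2 : R) by rewrite ln_ge0 // ler1n.
apply: lerD.
  rewrite ler_norml; apply/andP; split; first by have := ler_norm (- ln a); rewrite normrN; lra.
  by have := normr_ge0 (ln a); lra.
have := atan_gtNpi2 (Im y / Re y); have := atan_ltpi2 (Im y / Re y); have := pi_gt0 R => p0.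
by move=> b1 b2; rewrite ler_norml; apply/andP; split; lra.
Qed.

Lemma nm_2ab (R : realType) (u v : Cplx R) (k : R) : nm u <= k -> nm v <= k -> nm (2 * u * v - 1) <= 2 * k * k + 1.
Proof.
move=> uk vk; apply: le_trans (nmB _ _) _; rewrite nm1; apply: lerD => //.
rewrite !nmM nm2C; apply: ler_pM => //; rewrite ?mulr_ge0 ?nm_ge0 //.
by apply: ler_wpM2l.
Qed.
Lemma nm_2ab_conj (R : realType) (u v : Cplx R) (k : R) : nm u <= k -> nm v <= k -> nm (- 2 * u * v^*) <= 2 * k * k.
Proof.
move=> uk vk; rewrite !nmM nm_conj nmN nm2C; apply: ler_pM => //; rewrite ?mulr_ge0 ?nm_ge0 //.
by apply: ler_wpM2l.
Qed.

(** * A uniform bound for the logarithm up to an exit level *)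

Section LamBound.
Variable R : realType.
Local Notation C := (Cplx R).
Variables (kappa : R) (X : rooted_vertex R) (w : C -> C) (K : node_logs R) (e T : R).
Local Notation ns := (undup (nodes X)).
Hypotheses (wn : forall z, z \in ns -> nm (w z) < 1) (e0 : 0 < e) (e1 : e < 1).

Lemma Lam_bound : exists2 M : R, 0 <= M & forall (th : R -> R) (t : R), continuous th -> 0 <= t <= T ->
  `|th t| <= T -> (forall z, z \in ns -> alive th e (w z) t) -> nm (Lam kappa X w K e th t) <= M.
Proof.
(* All admissible pairs of a path and a time form one index type, so that [bdd] yields a constant
   independent of the path. *)
pose I := {p : (R -> R) * R | [/\ continuous p.1, 0 <= p.2 <= T, `|p.1 p.2| <= T &
  forall z, z \in ns -> alive p.1 e (w z) p.2]}.
pose th (i : I) := (sval i).1; pose t (i : I) := (sval i).2.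
have cth i : continuous (th i) by have [] := svalP i.
have tT i : 0 <= t i <= T by have [] := svalP i.
have thT i : `|th i (t i)| <= T by have [] := svalP i.
have al i z : z \in ns -> alive (th i) e (w z) (t i) by move=> zn; have [_ _ _ h] := svalP i; exact: h.
suff [M M0 HM] : bdd (fun i => Lam kappa X w K e (th i) (t i)).
  exists M => // th' t' c1 c2 c3 c4.
  have P : [/\ continuous (th', t').1, 0 <= (th', t').2 <= T, `|(th', t').1 (th', t').2| <= T &
    forall z, z \in ns -> alive (th', t').1 e (w z) (th', t').2] by exact: (And4 c1 c2 c3 c4).
  by have := HM (exist _ (th', t') P); rewrite mulr1.
have bi : bdd (fun i => cst_of (t i) : C).
  exists `|T| => // i; rewrite mulr1 nm_cst; have /andP[a b] := tT i.
  by rewrite ger0_norm //; apply: le_trans b (ler_norm _).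
have bth : bdd (fun i => iu * cst_of (th i (t i)) : C).
  apply: bddM; first exact: bdd_cst.
  by exists `|T| => // i; rewrite mulr1 nm_cst; apply: le_trans (thT i) (ler_norm _).
have ei : 0 <= e^-1 by rewrite invr_ge0 ltW.
have rb i z s : nm (re (th i) e z s) <= e^-1 by exact: nm_re.
have kAb i z z' s : nm (kA (th i) e z z' s) <= 2 * e^-1 * e^-1 + 1.
  exact: (nm_2ab (rb _ _ _) (rb _ _ _)).
have r1 i z s : nm (re (th i) e z s - 1) <= e^-1 + 1.
  by apply: le_trans (nmB _ _) _; rewrite nm1; apply: lerD.
have kBb i z z' s : nm (kB (th i) e z z' s) <= 2 * (e^-1 + 1) * (e^-1 + 1).
  exact: (nm_2ab_conj (r1 _ _ _) (r1 _ _ _)).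
have bA z z' : bdd (fun i => ppos (kA (th i) e z z') (t i)).
  have q0 : 0 <= 2 * e^-1 * e^-1 + 1 by rewrite addr_ge0 // mulr_ge0 // mulr_ge0.
  exists ((2 * e^-1 * e^-1 + 1) * `|T|); first exact: mulr_ge0.
  move=> i; rewrite mulr1; have /andP[a b] := tT i.
  apply: (@le_trans _ _ ((2 * e^-1 * e^-1 + 1) * t i)).
    by apply: ppos_le_cst => //; exact: (@kA_continuous _ _ (cth i) _ e0).
  by apply: ler_wpM2l => //; apply: le_trans b (ler_norm _).
have bB z z' : bdd (fun i => ppos (kB (th i) e z z') (t i)).
  have q0 : 0 <= 2 * (e^-1 + 1) * (e^-1 + 1) by rewrite !mulr_ge0 // addr_ge0.
  exists (2 * (e^-1 + 1) * (e^-1 + 1) * `|T|); first exact: mulr_ge0.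
  move=> i; rewrite mulr1; have /andP[a b] := tT i.
  apply: (@le_trans _ _ (2 * (e^-1 + 1) * (e^-1 + 1) * t i)).
    by apply: ppos_le_cst => //; exact: (@kB_continuous _ _ (cth i) _ e0).
  by apply: ler_wpM2l => //; apply: le_trans b (ler_norm _).
have bL z : z \in ns -> bdd (fun i => LogC (1 - We (th i) e (w z) (t i))).
  move=> zn; exists (`|ln e| + ln 2 + pi).
    by apply: addr_ge0; [apply: addr_ge0 => //; rewrite ln_ge0 // ler1n|apply: ltW; exact: pi_gt0].
  move=> i; rewrite mulr1; have /andP[a b] := tT i.
  apply: (nm_LogC_bound e0); first by apply: ltW; apply: (al i _ zn); rewrite a lexx.
  apply: le_trans (nmB _ _) _; rewrite nm1.
  have := nm_We_lt1 (cth i) e0 a (al i _ zn) (wn zn); lra.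
have bLr z : z \in ns -> bdd (fun i => LogC (1 - 1 * (We (th i) e (w z) (t i))^*)).
  move=> zn; apply: (bigO_ext _ (bigO_conj (bL z zn))) => i.
  by rewrite -LogC_conj conjCB conjC1' mul1r.
have rot (f : I -> C) (k : C) : bdd f -> bdd (fun i => k + f i - iu * cst_of (th i (t i))).
  by move=> bf; apply: bddB => //; apply: bddD => //; exact: bdd_cst.
apply: bddD; last first.
  apply: (@bdd_sum _ _ _ _ (fun z i => _)) => z zn; apply: bddM; first exact: bdd_cst.
  have [M M0 HM] := bB (w z) (w z); exists M => // i; apply: le_trans (HM i).
  rewrite nm_cst; exact: Re_le_nm.
apply: bddD; last exact: bdd_cst.
apply: (@bdd_expo _ _ kappa X (fun i => logs_at w K e (th i) (t i))); apply: And5.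
- by split; exact: rot.
- by split; exact: bdd_cst.
- by split; exact: bdd_cst.
- move=> z zn; apply: And4; [exact: rot|exact: rot|exact: bL|exact: bLr].
- move=> z y zn yn; split; first exact: rot.
  by apply: bddD; [exact: bdd_cst|exact: bB].
Qed.

End LamBound.

(** * First hitting times of continuous adapted processes *)

Section HittingTime.
Context {R : realType} {d : measure_display} {Omega : measurableType d}.
Variables (F : R -> set (set Omega)).
Hypothesis FF : filtration F.
Variable phi : Omega -> R -> R.
Variable n0 : R.
Hypotheses (cphi : forall w, continuous (phi w)) (aphi : forall t : R, 0 <= t -> fmeas F t (fun w => phi w t)).
Hypotheses (n00 : 0 <= n0) (phin : forall w, phi w n0 <= 0).

Lemma phi_ed w t (e : R) : 0 < e -> exists2 dl : R, 0 < dl & forall s, `|t - s| < dl -> `|phi w t - phi w s| < e.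
Proof.
by move=> e0; have /cvgrPdist_lt/(_ _ e0)/nbhs_ballP[dl /= d0 H] := @cphi w t; exists dl => // s; exact: H.
Qed.

Definition hit_set w : set R := [set t | 0 <= t /\ phi w t <= 0].
Definition hit w : R := inf (hit_set w).

Lemma hit_set_has_inf w : has_inf (hit_set w).
Proof. by split; [exists n0|exists 0 => t []]. Qed.
Lemma hit_ge0 w : 0 <= hit w.
Proof. by apply: lb_le_inf; [exists n0|move=> t []]. Qed.
Lemma hit_le w t : 0 <= t -> phi w t <= 0 -> hit w <= t.
Proof. by move=> t0 h; apply: ge_inf => //; have [] := hit_set_has_inf w. Qed.
Lemma before_hit w t : 0 <= t < hit w -> 0 < phi w t.
Proof.
by move=> /andP[t0 h]; rewrite ltNge; apply/negP => p; have := le_lt_trans (hit_le t0 p) h; rewrite ltxx.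
Qed.
Lemma at_hit w : phi w (hit w) <= 0.
Proof.
rewrite leNgt; apply/negP => p.
have [dl d0 H] := phi_ed w (hit w) p.
have [y [y0 py] yl] := inf_adherent d0 (hit_set_has_inf w).
have yh : hit w <= y by exact: hit_le.
have : `|phi w (hit w) - phi w y| < phi w (hit w).
  apply: H; rewrite distrC ger0_norm ?subr_ge0 //; rewrite -/(hit w) in yl; lra.
by rewrite ltr_norml => /andP[_]; lra.
Qed.
Lemma hit_gt w t : 0 <= t -> (forall s, 0 <= s <= t -> 0 < phi w s) -> t < hit w.
Proof.
move=> t0 H; rewrite ltNge; apply/negP => h.
have : 0 < phi w (hit w) by apply: H; rewrite hit_ge0.
by rewrite ltNge at_hit.
Qed.
Lemma until_hit w t : 0 < hit w -> 0 <= t <= hit w -> 0 <= phi w t.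
Proof.
move=> h0 /andP[t0]; rewrite le_eqVlt => /orP[/eqP ->|th]; last by apply: ltW; apply: before_hit; rewrite t0.
rewrite leNgt; apply/negP => p; rewrite -oppr_gt0 in p.
have [dl d0 H] := phi_ed w (hit w) p.
pose s := Num.max 0 (hit w - dl / 2).
have s1 : 0 <= s < hit w by rewrite /s le_max lexx /= gt_max h0 /=; lra.
have := before_hit s1 => ps.
have : `|phi w (hit w) - phi w s| < - phi w (hit w).
  apply: H; rewrite ger0_norm; last by move: s1 => /andP[_ /ltW]; rewrite subr_ge0.
  have : hit w - dl / 2 <= s by rewrite /s le_max lexx orbT.
  lra.
rewrite ltr_norml => /andP[]; lra.
Qed.

(** A continuous function on [0, t] reaches 0 or below exactly when it gets below every 1/(k+1) at
    fractions of t. Only countably many times, none beyond t, are consulted, so the filtration need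
    not be right-continuous. *)
Lemma hit_grid w t : 0 <= t -> hit w <= t <->
  forall k : nat, exists m j : nat, (j <= m.+1)%N /\ phi w (t * (j%:R / m.+1%:R)) < k.+1%:R^-1.
Proof.
move=> t0; split=> [h k|H].
  have k0 : 0 < (k.+1%:R^-1 : R) by rewrite invr_gt0.
  have [dl d0 Hd] := phi_ed w (hit w) k0.
  have [m tm] : exists m : nat, t / m.+1%:R < dl.
    exists (Num.bound (t / dl)); rewrite ltr_pdivrMr ?ltr0n // mulrC -ltr_pdivrMr //.
    have h1 : t / dl < (Num.bound (t / dl))%:R by apply: archi_boundP; rewrite divr_ge0 // ltW.
    by apply: lt_le_trans h1 _; rewrite ler_nat.
  have ex : exists j : nat, hit w <= t * (j%:R / m.+1%:R).
    by exists m.+1; rewrite divff ?mulr1 // pnatr_eq0.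
  (* The first grid time at or after the hitting time; it is within one mesh t/(m+1) of it. *)
  have [j hj jmin] := ex_minnP ex; exists m, j.
  have jm : (j <= m.+1)%N by apply: jmin; rewrite divff ?mulr1 // pnatr_eq0.
  split => //.
  have : `|phi w (hit w) - phi w (t * (j%:R / m.+1%:R))| < k.+1%:R^-1.
    apply: Hd; rewrite distrC ger0_norm ?subr_ge0 //.
    case: j hj jmin {jm} => [|j] hj jmin; first by have := hit_ge0 w; rewrite mul0r mulr0 in hj *; lra.
    have : ~~ (hit w <= t * (j%:R / m.+1%:R)) by apply/negP => /jmin; rewrite ltnn.
    rewrite -ltNge => lj.
    have -> : t * (j.+1%:R / m.+1%:R) = t * (j%:R / m.+1%:R) + t / m.+1%:R.
      by rewrite -[j.+1%:R]natr1; field; rewrite addrC natr1 pnatr_eq0.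
    by move: lj tm; set a := t * _; set b := t / _ => lj tm; lra.
  rewrite ltr_norml => /andP[a _]; have := at_hit w.
  move: a; set x := phi w _; set y := phi w _; move: (k.+1%:R^-1) => z a b; lra.
rewrite leNgt; apply/negP => th.
have P s : 0 <= s <= t -> 0 < phi w s.
  by move=> /andP[s0 st]; apply: before_hit; rewrite s0 (le_lt_trans st).
have [c cI Hc] := EVT_min t0 (continuous_subspaceT (@cphi w)).
have c0 : 0 < phi w c by apply: P; move: cI; rewrite in_itv.
have [m [j [jm]]] := H (Num.bound (phi w c)^-1).
have kc : (Num.bound (phi w c)^-1).+1%:R^-1 <= phi w c.
  rewrite -[leRHS]invrK lef_pV2 ?posrE ?invr_gt0 //.
  have h1 : (phi w c)^-1 < (Num.bound (phi w c)^-1)%:R by apply: archi_boundP; rewrite invr_ge0 ltW.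
  by apply: le_trans (ltW h1) _; rewrite ler_nat.
have : phi w c <= phi w (t * (j%:R / m.+1%:R)).
  apply: Hc; rewrite in_itv /= mulr_ge0 ?divr_ge0 //= ler_piMr // ler_pdivrMr ?ltr0n // mul1r ler_nat //.
move=> a b; have := le_lt_trans a (lt_le_trans b kc); by rewrite ltxx.
Qed.

Lemma hit_stopping : stopping_time F hit.
Proof.
split=> [w|t t0]; first exact: hit_ge0.
have -> : [set w | hit w <= t] = \bigcap_(k in [set: nat]) \bigcup_(m in [set: nat])
    \bigcup_(j in [set j : nat | (j <= m.+1)%N]) [set w | phi w (t * (j%:R / m.+1%:R)) < k.+1%:R^-1].
  apply/seteqP; split => w /=.
    by move=> /(hit_grid _ t0) H k _; have [m [j [jm h]]] := H k; exists m => //; exists j.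
  by move=> H; apply/(hit_grid _ t0) => k; have [m _ [j jm h]] := H k I; exists m, j.
apply/(FsetP FF _ t0).
apply: (@bigcapT_measurable _ (g_sigma_algebraType (F t))) => k.
apply: (@bigcupT_measurable _ (g_sigma_algebraType (F t))) => m.
apply: (@bigcup_measurable _ (g_sigma_algebraType (F t))) => j jm.
apply/(FsetP FF _ t0).
have q : 0 <= t * (j%:R / m.+1%:R) <= t.
  by rewrite mulr_ge0 ?divr_ge0 //= ler_piMr // ler_pdivrMr ?ltr0n // mul1r ler_nat.
have /andP[q0 q1] := q; apply: (F_mono FF q0 q1).
have -> : [set w | phi w (t * (j%:R / m.+1%:R)) < k.+1%:R^-1] =
    (fun w => phi w (t * (j%:R / m.+1%:R))) @^-1` `]-oo, k.+1%:R^-1[%classic.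
  by apply/seteqP; split => w; rewrite /= in_itv.
by apply: aphi => //; exact: measurable_itv.
Qed.

End HittingTime.

(** * The observable stopped at the exit times *)

Lemma continuous_max0 (R : realType) (f : R -> R) :
  {within `[0, +oo[, continuous f} -> continuous (fun t : R => f (Num.max t 0)).
Proof.
move=> /subspace_continuousP cf t.
have cm : Num.max s 0 @[s --> t] --> Num.max t 0.
  by apply: (@continuous_max _ _ (fun t : R => t) (fun _ => 0)); [exact: cvg_id|exact: cst_continuous].
have t0 : `[0, +oo[%classic (Num.max t 0) by rewrite /= in_itv /= andbT le_max lexx orbT.
apply/cvgrPdist_lt => e e0; have /cvgrPdist_lt/(_ _ e0)/nbhs_ballP[dl /= d0 H] := cf _ t0.
have /cvgrPdist_lt/(_ _ d0) := cm; apply: filterS => s hs; apply: H => //=.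
by rewrite in_itv /= andbT le_max lexx orbT.
Qed.

Lemma min4_gt0 (R : realType) (a b c d : R) : 0 < a -> 0 < b -> 0 < c -> 0 < d ->
  exists2 m : R, 0 < m & [/\ m <= a, m <= b, m <= c & m <= d].
Proof.
move=> a0 b0 c0 d0; exists (Num.min (Num.min a b) (Num.min c d)); first by rewrite !lt_min a0 b0 c0 d0.
by split; rewrite !ge_min lexx ?orbT.
Qed.

Section MinSeq.
Variables (R : realType) (I : eqType).
Implicit Types (s : seq I) (f : I -> R).

Definition minseq s f : R := \big[Num.min/1]_(z <- s) f z.
Lemma minseq_cons z s f : minseq (z :: s) f = Num.min (f z) (minseq s f).
Proof. exact: big_cons. Qed.
Lemma minseq_gt0 s f : (forall z, z \in s -> 0 < f z) -> 0 < minseq s f.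
Proof.
elim: s => [|z s IH] H; first by rewrite /minseq big_nil.
rewrite minseq_cons lt_min H ?mem_head // IH // => y ys; apply: H; by rewrite in_cons ys orbT.
Qed.
Lemma minseq_le s f z : z \in s -> minseq s f <= f z.
Proof.
elim: s => [//|y s IH]; rewrite in_cons minseq_cons => /orP[/eqP ->|/IH h]; first by rewrite ge_min lexx.
by rewrite ge_min h orbT.
Qed.
Lemma minseq_continuous s (f : I -> R -> R) : (forall z, continuous (f z)) ->
  continuous (fun t => minseq s (fun z => f z t)).
Proof.
move=> cf; elim: s => [|z s IH] t.
  by rewrite (_ : (fun u => _) = (fun _ => 1)); [exact: cst_continuous|apply/funext => u; rewrite /minseq big_nil].
rewrite (_ : (fun u => _) = (fun u => Num.min (f z u) (minseq s (fun z => f z u)))); last first.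
  by apply/funext => u; rewrite minseq_cons.
by apply: (@continuous_min _ _ (f z) (fun u => minseq s (fun z => f z u))); [exact: cf|exact: IH].
Qed.
End MinSeq.

Lemma fmeas_min (R : realType) (d : measure_display) (Omega : measurableType d) (F : R -> set (set Omega))
  (FF : filtration F) (t : R) (f g : Omega -> R) : 0 <= t -> fmeas F t f -> fmeas F t g ->
  fmeas F t (fun w => Num.min (f w) (g w)).
Proof. by move=> t0 /(fmeasP FF _ t0) a /(fmeasP FF _ t0) b; apply/(fmeasP FF _ t0); exact: measurable_minr. Qed.

Lemma fmeas_minseq (R : realType) (d : measure_display) (Omega : measurableType d) (F : R -> set (set Omega))
  (FF : filtration F) (I : eqType) (t : R) (s : seq I) (f : I -> Omega -> R) : 0 <= t ->
  (forall z, fmeas F t (f z)) -> fmeas F t (fun w => minseq s (fun z => f z w)).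
Proof.
move=> t0 H; elim: s => [|z s IH].
  by rewrite (_ : (fun u => _) = (fun _ => 1)); [exact: (fmeas_cst FF)|apply/funext => u; rewrite /minseq big_nil].
rewrite (_ : (fun u => _) = (fun u => Num.min (f z u) (minseq s (fun z => f z u)))); last first.
  by apply/funext => u; rewrite minseq_cons.
by apply: (fmeas_min FF).
Qed.

Section LocalMartingale.
Context {R : realType} {d : measure_display} {Omega : measurableType d}.
Variables (P : probability Omega R) (F : R -> set (set Omega)) (B : R -> Omega -> R).
Hypotheses (FF : filtration F) (BM : brownian_motion P F B).
Local Notation C := (Cplx R).
Variables (kappa : R) (X : rooted_vertex R) (w : C -> C) (K : node_logs R) (eps0 : R).
Local Notation ns := (undup (nodes X)).
Hypotheses (k0 : 0 < kappa) (wn : forall z, z \in ns -> nm (w z) < 1).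
Hypothesis neu : rtau X + rtaus X + \sum_(z <- ns) (chg X z + chgs X z) = 0.
Hypotheses (eps00 : 0 < eps0) (eps01 : eps0 < 1).
Hypothesis epsw : forall z, z \in ns -> 2 * eps0 < nm (1 - w z).

(** Frozen at its initial value for negative times, so that the driving function is continuous on
    the whole line. *)
Definition angle (om : Omega) (t : R) : R := Num.sqrt kappa * B (Num.max t 0) om.
Definition eps (n : nat) : R := eps0 / n.+1%:R.
Definition bar (n : nat) : R := n.+1%:R.

Let sk0 : 0 < Num.sqrt kappa. Proof. by rewrite sqrtr_gt0. Qed.

Lemma eps_gt0 n : 0 < eps n. Proof. by rewrite divr_gt0. Qed.
Lemma eps_le n : eps n <= eps0.
Proof. by rewrite ler_pdivrMr ?ltr0n // ler_peMr ?ler1n // ltW. Qed.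
Lemma eps_lt1 n : eps n < 1. Proof. exact: le_lt_trans (eps_le n) eps01. Qed.
Lemma eps_dec n : eps n.+1 < eps n.
Proof. by rewrite ltr_pM2l // ltf_pV2 ?posrE ?ltr0n // ltr_nat. Qed.
Lemma bar_ge0 n : 0 <= bar n. Proof. exact: ler0n. Qed.

Lemma B_max_cont om : continuous (fun t : R => B (Num.max t 0) om).
Proof. by have [_ h _ _ _] := BM; apply: (@continuous_max0 R (fun t => B t om)); exact: h. Qed.
Lemma angle_cont om : continuous (angle om).
Proof. by move=> t; apply: cvgM; [exact: cvg_cst|exact: B_max_cont]. Qed.
Lemma angle0 om : angle om 0 = 0.
Proof. by have [h _ _ _ _] := BM; rewrite /angle maxxx h mulr0. Qed.
Lemma angleE om t : 0 <= t -> angle om t = Num.sqrt kappa * B t om.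
Proof. by move=> t0; rewrite /angle max_l. Qed.
Lemma angle_fmeas t : 0 <= t -> fmeas F t (fun om => angle om t).
Proof.
move=> t0; have [_ _ h _ _] := BM; apply: (fmeasM FF t0); first exact: (fmeas_cst FF).
by rewrite max_l // => A; exact: h.
Qed.

(** The threshold 2 eps, where [alive] asks for eps, keeps every node alive up to and including the
    exit time. *)
Definition guard n om t : R := Num.min (Num.min (bar n - `|angle om t|) (bar n - t))
  (minseq ns (fun z => nm (1 - We (angle om) (eps n) (w z) t) - 2 * eps n)).

Lemma guard_cont n om : continuous (guard n om).
Proof.
have c1 : continuous (fun t => Num.min (bar n - `|angle om t|) (bar n - t)).
  move=> t; apply: (@continuous_min _ _ (fun t => bar n - `|angle om t|) (fun t => bar n - t)).
    by apply: cvgB; [exact: cvg_cst|apply: cvg_norm; exact: angle_cont].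
  by apply: cvgB; [exact: cvg_cst|exact: cvg_id].
have c2 : continuous (fun t => minseq ns (fun z => nm (1 - We (angle om) (eps n) (w z) t) - 2 * eps n)).
  apply: (@minseq_continuous _ _ _ (fun z t => nm (1 - We (angle om) (eps n) (w z) t) - 2 * eps n)) => z t.
  apply: cvgB; last exact: cvg_cst.
  have cW : continuous (fun s => 1 - We (angle om) (eps n) (w z) s).
    apply: continuousCD; first exact: cst_continuous.
    by move=> s; apply: cvgN; exact: (We_continuous (@angle_cont om) (eps_gt0 n)).
  exact: (cvg_comp _ (@nm R) (cW t) (@continuous_nm R _)).
by move=> t; apply: (@continuous_min _ _ (fun t => Num.min (bar n - `|angle om t|) (bar n - t))
  (fun t => minseq ns (fun z => nm (1 - We (angle om) (eps n) (w z) t) - 2 * eps n))); [exact: c1|exact: c2].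
Qed.

Lemma guard_fmeas n t : 0 <= t -> fmeas F t (fun om => guard n om t).
Proof.
move=> t0; have c (k : R) := fmeas_cst FF (t := t) k t0.
apply: (fmeas_min FF t0).
  apply: (fmeas_min FF t0); last exact: c.
  apply: (fmeasB FF t0); first exact: c.
  by apply: (@fmeas_comp _ _ _ _ _ _ (fun x : R => `|x|)); [exact: normr_measurable|exact: angle_fmeas].
apply: (@fmeas_minseq _ _ _ _ FF _ t _ (fun z om => nm (1 - We (angle om) (eps n) (w z) t) - 2 * eps n) t0) => z.
apply: (fmeasB FF t0); last exact: c.
apply: (fmeas_nm FF t0); apply: (cfmB FF t0); first exact: (cfm_cst FF t0).
exact: (cfm_We FF angle_cont angle_fmeas (eps_gt0 n) _ t0).
Qed.

Lemma guard_bar n om : guard n om (bar n) <= 0.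
Proof. by rewrite /guard ge_min ge_min subrr lexx orbT. Qed.

Definition exitn n om : R := hit (guard n) om.

Lemma exitn_stopping n : stopping_time F (exitn n).
Proof. exact: (hit_stopping FF (@guard_cont n) (@guard_fmeas n) (bar_ge0 n) (guard_bar n)). Qed.

Lemma guard_gt0 n om t : `|angle om t| < bar n -> t < bar n ->
  (forall z, z \in ns -> 2 * eps n < nm (1 - We (angle om) (eps n) (w z) t)) -> 0 < guard n om t.
Proof.
move=> a b c; rewrite /guard !lt_min !subr_gt0 a b /=.
by apply: minseq_gt0 => z zn; rewrite subr_gt0; exact: c.
Qed.
Lemma guard_ge0P n om t : 0 <= guard n om t -> [/\ `|angle om t| <= bar n, t <= bar n &
  forall z, z \in ns -> 2 * eps n <= nm (1 - We (angle om) (eps n) (w z) t)].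
Proof.
rewrite /guard !le_min !subr_ge0 => /andP[/andP[a b] c]; split => // z zn.
have := minseq_le (fun z => nm (1 - We (angle om) (eps n) (w z) t) - 2 * eps n) zn.
move=> h; have := le_trans c h; by rewrite subr_ge0.
Qed.

Lemma We0 om n z : We (angle om) (eps n) z 0 = z.
Proof.
have e0 := eps_gt0 n; have VL t x y := @fld_lip R (angle om) (eps n) t x y e0.
have Vc (v : R -> C) (cv : continuous v) := @fld_cont R (angle om) (@angle_cont om) (eps n) v e0 cv.
rewrite /We /Ue (@psol0 R _ _ (Lc_gt0 e0) VL Vc z) /xi angle0.
by rewrite (_ : cst_of 0 = 0) // mulr0 expC0 divr1.
Qed.

Lemma exitn_gt0 n om : 0 < exitn n om.
Proof.
apply: (hit_gt (@guard_cont n) (bar_ge0 n) (guard_bar n)) => // s s0.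
have -> : s = 0 by apply/eqP; rewrite eq_sym eq_le.
apply: guard_gt0; rewrite ?angle0 ?normr0 /bar ?ltr0n // => z zn; rewrite We0.
by apply: le_lt_trans (epsw zn); rewrite ler_pM2l //; exact: eps_le.
Qed.

Lemma until_exitn n om t : 0 <= t <= exitn n om -> [/\ `|angle om t| <= bar n, t <= bar n &
  forall z, z \in ns -> alive (angle om) (eps n) (w z) t].
Proof.
move=> tT; have G s : 0 <= s <= exitn n om -> 0 <= guard n om s.
  by move=> h; exact: (until_hit (@guard_cont n) (bar_ge0 n) (guard_bar n) (exitn_gt0 n om) h).
have [a b _] := guard_ge0P (G _ tT); split => // z zn s /andP[s0 st].
have sT : 0 <= s <= exitn n om by rewrite s0 (le_trans st) //; have /andP[] := tT.
have [_ _ c] := guard_ge0P (G _ sT); apply: lt_le_trans (c _ zn).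
by have := eps_gt0 n; lra.
Qed.

Section Level.
Variable n : nat.
Local Notation e := (eps n).
Local Notation T := (bar n).
Local Notation e0 := (eps_gt0 n).
Local Notation e1 := (eps_lt1 n).
Local Notation th := angle.
Variable c : C.

Definition wgt t om : C := c * expC (Lam kappa X w K e (th om) t - Lam kappa X w K e (th om) 0).
(** The constant c is an arbitrary complex number: the imaginary part of the weight for c is the
    real part of the weight for -i c, so one real statement covers both. *)
Definition obs t om : R := Re (wgt t om).
(** The increment of the angle is sqrt(kappa) dB, which puts sqrt(kappa) here and, as x^2 - kappa h
    = kappa (dB^2 - h), kappa in [obs2]. *)
Definition obs1 t om : R := Num.sqrt kappa * Re (wgt t om * Zc kappa X w e (th om) t).
Definition obs2 t om : R := kappa * Re (wgt t om * Gc kappa X w e (th om) t).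

Lemma wgt_cfm t : 0 <= t -> cfm F t (wgt t).
Proof.
move=> t0; apply: (cfmM FF t0); first exact: (cfm_cst FF t0).
apply: (cfm_exp FF t0); apply: (cfmB FF t0).
  exact: (cfm_Lam FF angle_cont angle_fmeas e0).
apply: (cfm_mono FF (lexx 0) t0).
exact: (cfm_Lam FF angle_cont angle_fmeas e0).
Qed.
Lemma obs_fmeas t : 0 <= t -> fmeas F t (obs t).
Proof. by move=> t0; have [] := wgt_cfm t0. Qed.
Lemma obs1_fmeas t : 0 <= t -> fmeas F t (obs1 t).
Proof.
move=> t0; apply: (fmeasM FF t0); first exact: (fmeas_cst FF).
by have [] := cfmM FF t0 (wgt_cfm t0) (cfm_Zc FF angle_cont angle_fmeas e0 kappa X w t0).
Qed.
Lemma obs2_fmeas t : 0 <= t -> fmeas F t (obs2 t).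
Proof.
move=> t0; apply: (fmeasM FF t0); first exact: (fmeas_cst FF).
by have [] := cfmM FF t0 (wgt_cfm t0) (cfm_Gc FF angle_cont angle_fmeas e0 kappa X w t0).
Qed.

Lemma wgt_bound : exists2 M : R, 0 <= M & forall om t, 0 <= t <= exitn n om -> nm (wgt t om) <= M.
Proof.
have [M M0 HM] := Lam_bound kappa K T wn e0.
exists (nm c * expR (2 * M)); first by rewrite mulr_ge0 ?nm_ge0 ?expR_ge0.
move=> om t tT; rewrite nmM; apply: ler_wpM2l; first exact: nm_ge0.
rewrite nm_expC ler_expR; apply: le_trans (ler_norm _) _; apply: le_trans (Re_le_nm _) _.
apply: le_trans (nmB _ _) _.
have H s : 0 <= s <= exitn n om -> nm (Lam kappa X w K e (th om) s) <= M.
  move=> sT; have [a b A] := until_exitn sT; apply: HM => //; last first.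
  - by have /andP[-> _] := sT.
  - exact: angle_cont.
have z0 : 0 <= (0 : R) <= exitn n om by rewrite lexx ltW // exitn_gt0.
have := H _ tT; have := H _ z0; lra.
Qed.

Local Notation speed := (speed e T).

(** The oscillation eta stays free. The value 2 is always admissible, as xi has modulus 1, and gives
    the uniform bound; small values give the pathwise one. *)
Lemma obs_step : exists2 M : R, 0 <= M & forall om t h eta, 0 <= t < exitn n om -> 0 < h <= 1 ->
  speed * h <= e ^+ 2 / 8 -> 4 * `|Num.sqrt kappa * dB B t h om| <= e ^+ 2 / 8 ->
  `|Num.sqrt kappa * dB B t h om| <= eta -> h <= eta <= 2 ->
  (forall s, t <= s <= t + h -> nm (xi (th om) s - xi (th om) t) <= eta) ->
  [/\ `|obs1 t om| <= M, `|obs2 t om| <= M &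
  `|ito_rem B obs obs1 obs2 t h om| <= M * (`|dB B t h om| ^+ 3 + h * eta)].
Proof.
have [M M0 HM] := @Lam_expansion R kappa X w K wn e T k0 e0 e1 neu.
have [Q Q0 HQ] := wgt_bound; set s3 := Num.sqrt kappa ^+ 3.
have s30 : 0 <= s3 by rewrite exprn_ge0 // ltW.
have q0 : 0 <= Q * M by exact: mulr_ge0.
pose M' := Q * M * (s3 + 1) + Num.sqrt kappa * (Q * M) + kappa * (Q * M).
have m1 : 0 <= Q * M * (s3 + 1) by rewrite mulr_ge0 // addr_ge0.
have m2 : 0 <= Num.sqrt kappa * (Q * M) by rewrite mulr_ge0 // ltW.
have m3 : 0 <= kappa * (Q * M) by rewrite mulr_ge0 // ltW.
exists M'; first by rewrite /M' !addr_ge0.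
move=> om t h eta tT h01 hsp hturn heta1 heta2 hosc.
have /andP[t0 tT'] := tT; have /andP[h0 h1] := h01.
have tT2 : 0 <= t <= exitn n om by rewrite t0 ltW.
have [thb tb A] := until_exitn tT2.
have th0 : 0 <= t + h by rewrite addr_ge0 // ltW.
have dE : th om (t + h) - th om t = Num.sqrt kappa * dB B t h om.
  by rewrite !angleE // /dB mulrBr.
have p1 : 0 <= t <= T by rewrite t0.
have p2 : 0 <= h <= 1 by rewrite (ltW h0).
have p3 : 4 * `|th om (t + h) - th om t| <= e ^+ 2 / 8 by rewrite dE.
have p4 : `|th om (t + h) - th om t| <= eta by rewrite dE.
pose st : step ns w e T := @Step R ns w e T (th om) t h eta (@angle_cont om) p1 p2 hsp p3 p4 heta2 hosc A.
have [z1 z2 z3] := HM st; rewrite /s_x /= in z1 z2 z3.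
have wq := HQ _ _ tT2.
have b1 : `|obs1 t om| <= Num.sqrt kappa * (Q * M).
  rewrite normrM (gtr0_norm sk0); apply: ler_wpM2l; first exact: ltW.
  by apply: le_trans (Re_le_nm _) _; rewrite nmM; apply: ler_pM; rewrite ?nm_ge0.
have b2 : `|obs2 t om| <= kappa * (Q * M).
  rewrite normrM (gtr0_norm k0); apply: ler_wpM2l; first exact: ltW.
  by apply: le_trans (Re_le_nm _) _; rewrite nmM; apply: ler_pM; rewrite ?nm_ge0.
split; [by rewrite /M'; lra|by rewrite /M'; lra|].
set x := dB B t h om in dE z3 *.
rewrite dE in z3.
have xx : (Num.sqrt kappa * x) ^+ 2 - kappa * h = kappa * (x ^+ 2 - h).
  by rewrite exprMn sqr_sqrtr ?(ltW k0) //; ring.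
rewrite xx in z3.
have E : ito_rem B obs obs1 obs2 t h om = Re (wgt t om * (expC (Lam kappa X w K e (th om) (t + h) - Lam kappa X w K e (th om) t) - 1
     - Zc kappa X w e (th om) t * cst_of (Num.sqrt kappa * x) - Gc kappa X w e (th om) t * cst_of (kappa * (x ^+ 2 - h)))).
  have E1 : wgt (t + h) om = wgt t om * expC (Lam kappa X w K e (th om) (t + h) - Lam kappa X w K e (th om) t).
    rewrite /wgt -mulrA -expCD; congr (c * expC _); ring.
  rewrite /ito_rem /obs /obs1 /obs2 -/x E1.
  move: (wgt t om) (expC _) (Zc _ _ _ _ _ _) (Gc _ _ _ _ _ _) => W1 E2 Z G.
  by rewrite !ReImE !mulr0 !subr0; ring.
rewrite E; apply: le_trans (Re_le_nm _) _; rewrite nmM.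
have h3 : `|Num.sqrt kappa * x| ^+ 3 = s3 * `|x| ^+ 3.
  by rewrite normrM exprMn (gtr0_norm sk0).
rewrite h3 in z3.
have x3 : 0 <= `|x| ^+ 3 by exact: exprn_ge0.
have he : 0 <= h * eta by rewrite mulr_ge0 ?(ltW h0) //; have /andP[+ _] := heta2; apply: le_trans; exact: ltW.
apply: (@le_trans _ _ (Q * (M * (s3 * `|x| ^+ 3 + h * eta)))); first by apply: ler_pM; rewrite ?nm_ge0.
apply: (@le_trans _ _ (Q * M * (s3 + 1) * (`|x| ^+ 3 + h * eta))).
  rewrite mulrA -[leRHS]mulrA; apply: ler_wpM2l => //.
  have := mulr_ge0 s30 he; lra.
by apply: ler_wpM2r; [exact: addr_ge0|rewrite /M'; lra].
Qed.

Theorem obs_martingale : martingale P F (fun t om => obs (Num.min t (exitn n om)) om).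
Proof.
have [M1 M10 HM1] := wgt_bound; have [M2 M20 HM2] := obs_step.
have sp0 : 0 < speed + 1 by have := speed_ge0 T e0; lra.
have e2 : 0 < e ^+ 2 by exact: exprn_gt0 e0.
(* h0 and eta0 are what [s_speed] and [s_turn] require of h and of dB. *)
pose h0 := Num.min 1 (e ^+ 2 / 8 / (speed + 1)).
pose eta0 := e ^+ 2 / 8 / (4 * Num.sqrt kappa).
have h00 : 0 < h0 by rewrite /h0 lt_min ltr01 divr_gt0 // divr_gt0.
have eta00 : 0 < eta0 by rewrite /eta0 divr_gt0 // ?divr_gt0 // mulr_gt0.
have hb h : 0 < h <= h0 -> 0 < h <= 1 /\ speed * h <= e ^+ 2 / 8.
  move=> /andP[hp]; rewrite /h0 le_min ler_pdivlMr // => /andP[a b]; split; first by rewrite hp.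
  by apply: le_trans b; rewrite mulrC ler_pM2l //; lra.
have eb x : `|x| <= eta0 -> 4 * `|Num.sqrt kappa * x| <= e ^+ 2 / 8.
  by rewrite /eta0 ler_pdivlMr ?mulr_gt0 // normrM (gtr0_norm sk0) => h; rewrite mulrA mulrC.
have e8 : e ^+ 2 <= 1 by rewrite exprn_ile1 // ltW ?e0 // e1.
have osc2 om t s : nm (xi (th om) s - xi (th om) t : C) <= 2.
  by apply: le_trans (nmB _ _) _; rewrite !nm_xi.
have coarse om t h : 0 <= t < exitn n om -> 0 < h <= h0 -> `|dB B t h om| <= eta0 ->
    [/\ `|obs1 t om| <= M2, `|obs2 t om| <= M2 & `|ito_rem B obs obs1 obs2 t h om| <= M2 * (`|dB B t h om| ^+ 3 + h * 2)].
  move=> tT /hb[h1 h2] /eb h3; apply: (HM2 om t h 2) => //.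
  - by have := normr_ge0 (Num.sqrt kappa * dB B t h om); lra.
  - by rewrite lexx andbT; have /andP[_] := h1; lra.
(* The bounds on the coefficients come attached to a step; a short enough one starting at t always
   exists by continuity of the path. *)
have small om t : 0 <= t < exitn n om -> `|obs1 t om| <= M2 /\ `|obs2 t om| <= M2.
  move=> tT; have /andP[t0 _] := tT.
  have [dl d0 Hd] := unif_cont t (@B_max_cont om) eta00.
  have q0 : 0 < Num.min h0 dl by rewrite lt_min h00.
  have := coarse om t (Num.min h0 dl) tT; rewrite q0 ge_min lexx /= => /(_ isT)[]; last by move=> a b _; split.
  have := Hd t (t + Num.min h0 dl); rewrite t0 lexx => /(_ isT).
  rewrite !max_l // ?addr_ge0 ?(ltW q0) //; apply.
  by rewrite addrAC subrr add0r gtr0_norm // ge_min lexx orbT.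
apply: (@stopped_martingale R d Omega P F B FF BM B_max_cont (exitn n) obs obs1 obs2 (M1 + M2) (2 * M2) h0 eta0) => //.
- exact: exitn_stopping.
- exact: obs_fmeas.
- exact: obs1_fmeas.
- exact: obs2_fmeas.
- exact: addr_ge0.
- exact: mulr_ge0.
- move=> om t tT; apply: le_trans (Re_le_nm _) _; apply: le_trans (HM1 _ _ tT) _; lra.
- move=> om t /small[h _]; lra.
- move=> om t /small[_ h]; lra.
- move=> om t h tT hh0 he0; have [_ _ r] := coarse om t h tT hh0 he0.
  apply: le_trans r _; have /andP[/ltW h1 _] := hh0.
  have x3 : 0 <= `|dB B t h om| ^+ 3 by exact: exprn_ge0.
  have := mulr_ge0 M20 x3; lra.
- move=> om ep ep0.
  (* The oscillation level: at most 2, as a step demands, and with M2 ee <= ep. *)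
  pose ee := Num.min 2 (ep / (M2 + 1)).
  have M21 : 0 < M2 + 1 by rewrite ltr_wpDl.
  have ee0 : 0 < ee by rewrite /ee lt_min ltr0n divr_gt0.
  have ee2 : ee <= 2 by rewrite /ee ge_min lexx.
  have eeM : M2 * ee <= ep.
    apply: (@le_trans _ _ ((M2 + 1) * ee)); first by apply: ler_wpM2r; lra.
    by rewrite mulrC -ler_pdivlMr // /ee ge_min lexx orbT.
  have [d1 d10 H1] := unif_cont T (@angle_cont om) ee0.
  have [d2 d20 H2] := unif_cont_nm T (xi_continuous (@angle_cont om)) ee0.
  have [mm mm0 [g1 g2 g3 g4]] := min4_gt0 h00 ee0 d10 d20.
  exists mm => // t h tT /andP[hp hm] he0.
  have ha := le_trans hm g1; have hb' := le_trans hm g2; have hc := le_trans hm g3; have hd := le_trans hm g4.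
  have hh0 : 0 < h <= h0 by rewrite hp.
  have [h1 h2] := hb h hh0; have h3 := eb _ he0.
  have /andP[t0 tT'] := tT; have tT2 : 0 <= t <= exitn n om by rewrite t0 ltW.
  have [_ tb _] := until_exitn tT2; have tb' : 0 <= t <= T by rewrite t0.
  have [] := HM2 om t h ee tT h1 h2 h3.
  + have := H1 t (t + h) tb'; rewrite addrAC subrr add0r gtr0_norm // !angleE // ?addr_ge0 ?(ltW hp) //.
    by rewrite /dB mulrBr; apply.
  + by rewrite hb' ee2.
  + move=> s /andP[s1 s2]; apply: H2 => //; rewrite ger0_norm ?subr_ge0 //; lra.
  + move=> _ _ r; apply: le_trans r _.
    have x3 : 0 <= `|dB B t h om| ^+ 3 by exact: exprn_ge0.
    have := mulr_ge0 M20 x3; have := ler_wpM2l (ltW hp) eeM; rewrite mulrDr; lra.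
- move=> om t tT ep ep0; have [_ _ A] := until_exitn tT; have /andP[t0 _] := tT.
  have cL : cts (Lam kappa X w K e (th om)) t.
    apply: (@Lam_cont R kappa X w K (th om) (@angle_cont om) e t e0) => z zn.
    have Az := A _ zn; have nw1 := nm_We_lt1 (@angle_cont om) e0 t0 Az (wn zn).
    have tt : 0 <= t <= t by rewrite t0 lexx.
    apply: lt_trans (Re_gap e0 (Az _ tt) nw1); by rewrite divr_gt0.
  have cW : cts (fun s => wgt s om) t.
    apply: ctsM; first exact: cts_cst.
    have cd : cts (fun s => Lam kappa X w K e (th om) s - Lam kappa X w K e (th om) 0) t.
      by apply: ctsD; [exact: cL|exact: cts_cst].
    by apply: (cvg_comp _ (@expC R) cd); exact: continuous_expC.
  have cO : obs s om @[s --> t] --> obs t om.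
    by apply: (cvg_comp _ (@complex.Re R) cW); exact: continuous_Re.
  have /cvgrPdist_lt/(_ _ ep0)/nbhs_ballP[dl /= d0 H] := cO.
  exists (dl / 2); first by rewrite divr_gt0.
  move=> u /andP[u1 u2]; apply: ltW; rewrite distrC; apply: H.
  by rewrite /ball /= distrC ger0_norm ?subr_ge0 //; lra.
Qed.

End Level.
End LocalMartingale.

(** * The theorem *)

Lemma min_quarter (R : realType) (r : R) : 0 < r -> Num.min 1 r / 4 < 1 /\ 2 * (Num.min 1 r / 4) < r.
Proof.
move=> r0; have : Num.min 1 r <= 1 by rewrite ge_min lexx.
have : Num.min 1 r <= r by rewrite ge_min lexx orbT.
have : 0 < Num.min 1 r by rewrite lt_min ltr01.
by move: (Num.min 1 r) => m a b c; split; lra.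
Qed.

Section MartingaleExt.
Context {R : realType} {d : measure_display} {Omega : measurableType d}.
Variables (P : probability Omega R) (F : R -> set (set Omega)).

Lemma martingale_ext (Y Y' : R -> Omega -> R) : (forall t om, 0 <= t -> Y t om = Y' t om) ->
  martingale P F Y -> martingale P F Y'.
Proof.
move=> E; have {}E t : 0 <= t -> Y t = Y' t by move=> t0; apply/funext => om; exact: E.
move=> [a b c]; split.
- by move=> t t0; rewrite -(E t t0); exact: a.
- by move=> t t0; rewrite -(E t t0); exact: b.
- by move=> s t s0 st A FA; have t0 := le_trans s0 st; rewrite -(E t t0) -(E s s0); exact: c.
Qed.
End MartingaleExt.

Section VertexData.
Variable R : realType.
Local Notation C := (Cplx R).
Variables (n : nat) (z : 'I_n -> C) (sigma sigmas : 'I_n -> C) (tau taus : C).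
Local Notation X := (vertex z sigma sigmas tau taus).

Lemma vertex_nodesP y : reflect (exists j, z j = y) (y \in undup (nodes X)).
Proof.
rewrite mem_undup; apply: (iffP mapP) => [[j _ ->]|[j <-]]; first by exists j.
by exists j; rewrite ?mem_enum.
Qed.

Lemma vertex_chg0 y : y \notin nodes X -> chg X y = 0 /\ chgs X y = 0.
Proof.
rewrite -mem_undup => H; have zy j : (z j == y) = false.
  by apply/negbTE; apply: contra H => /eqP E; apply/vertex_nodesP; exists j.
by split; rewrite /= big_pred0.
Qed.

(** Points z_j may coincide; then their charges add up at one node, and exchanging the sums recovers
    the sum over indices. *)
Lemma vertex_neutral : tau + taus + \sum_(j < n) (sigma j + sigmas j) = 0 ->
  rtau X + rtaus X + \sum_(y <- undup (nodes X)) (chg X y + chgs X y) = 0.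
Proof.
move=> H; rewrite -[RHS]H; congr (_ + _).
rewrite (eq_bigr (fun y => \sum_(j | z j == y) (sigma j + sigmas j))); last first.
  by move=> y _; rewrite big_split.
rewrite (exchange_big_dep xpredT) //=; apply: eq_bigr => j _.
have zj : z j \in undup (nodes X) by apply/vertex_nodesP; exists j.
rewrite -big_filter (_ : [seq y <- _ | z j == y] = [:: z j]); first by rewrite big_seq1.
rewrite (eq_filter (a2 := pred1 (z j))); last by move=> y; rewrite /= eq_sym.
by rewrite filter_pred1_uniq // undup_uniq.
Qed.

Lemma exit_timeP (x : R -> C) (W : marked_domain R) (t : R) :
  (t%:E < exit_time x W z)%E <-> forall y, y \in undup (nodes X) -> (t%:E < lifetime x (unif W y))%E.
Proof.
split=> [/bigmin_gtP[_ H] y /vertex_nodesP[j <-]|H]; first exact: H.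
by apply/bigmin_gtP; split=> [|j _]; [rewrite ltry|apply: H; apply/vertex_nodesP; exists j].
Qed.
End VertexData.

(** * The branch along the evolution *)

Section Assembly.
Context {R : realType} {d : measure_display} {Omega : measurableType d}.
Variables (P : probability Omega R) (F : R -> set (set Omega)) (B : R -> Omega -> R).
Hypotheses (FF : filtration F) (BM : brownian_motion P F B).
Local Notation C := (Cplx R).
Variables (D : set C) (q : C) (w : C -> C).
Hypotheses (oD : open D) (Dq : D q) (wder : forall z, D z -> derivable w z 1)
  (winj : {in D &, injective w}) (wD : w @` D = @unit_disc R) (wq : w q = 0).
Variables (kappa : R) (n : nat) (z : 'I_n -> C) (sigma sigmas : 'I_n -> C) (tau taus : C).
Hypotheses (k0 : 0 < kappa) (neu0 : tau + taus + \sum_(j < n) (sigma j + sigmas j) = 0).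
Local Notation X := (vertex z sigma sigmas tau taus).
Local Notation ns := (undup (nodes X)).
Local Notation W0 := (MarkedDomain D q w).
Variable v : C.
Hypothesis Hv : Ehat kappa W0 X v.
Local Notation th := (angle B kappa).
Local Notation dr om := (fun t => driving kappa (B t om)).

Let cth om : continuous (th om). Proof. exact: (@angle_cont _ _ _ P F B BM kappa om). Qed.

Lemma drivingE om t : 0 <= t -> driving kappa (B t om) = xi (th om) t.
Proof.
move=> t0; rewrite /xi angleE // /driving; congr expC.
by apply: eqcx; rewrite !ReImE /=; ring.
Qed.
Let xE om : forall t, 0 <= t -> dr om t = xi (th om) t.
Proof. by move=> t; exact: drivingE. Qed.

Let good0 : good_domain W0 (psi0 D q w).
Proof. exact: (base_good oD wder winj wD wq). Qed.

Lemma nodes_in y : y \in ns -> D y /\ y <> q.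
Proof. by move=> yn; have [H _] := Ehat_nodes good0 Hv; exact: H. Qed.
Lemma nodes_lt1 y : y \in ns -> nm (w y) < 1.
Proof. by move=> /nodes_in[Dy _]; exact: (unif_disc wD Dy). Qed.

Let neu : rtau X + rtaus X + \sum_(y <- ns) (chg X y + chgs X y) = 0.
Proof. exact: vertex_neutral. Qed.

Section Branch.
Variables (K : node_logs R) (g : C).
Hypotheses (KW : node_logs_of X W0 K) (gph : phases kappa X g) (vE : v = expC (tip_value kappa X w K 1) * g).

Lemma Lam_start om e : 0 < e -> Lam kappa X w K e (th om) 0 = tip_value kappa X w K 1.
Proof.
move=> e0; have U0 y : We (th om) e (w y) 0 = w y.
  have VL t x y' := @fld_lip R (th om) e t x y' e0.
  have Vc (u : R -> C) (cu : continuous u) := @fld_cont R (th om) (@cth om) e u e0 cu.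
  by rewrite /We /Ue (@psol0 R _ _ (Lc_gt0 e0) VL Vc) /xi (angle0 BM) (_ : cst_of 0 = 0) // mulr0 expC0 divr1.
have c0 : cst_of 0 = 0 :> C by [].
have E1 : expo kappa X (logs_at w K e (th om) 0) = expo kappa X (tip_logs w K 0 1).
  apply: expo_tip_ext.
  - by rewrite nq_at (angle0 BM) c0 mulr0 subr0 addr0.
  - move=> y yn; apply: And3; first exact: U0.
    + rewrite -[LHS]/(nd K y + ppos (kA (th om) e (w y) (w y)) 0 - iu * cst_of (th om 0)).
      by rewrite ppos0 (angle0 BM) c0 mulr0 subr0 addr0.
    + rewrite -[LHS]/(nw K y + ppos (kA (th om) e (w y) 0) 0 - iu * cst_of (th om 0)).
      by rewrite ppos0 (angle0 BM) c0 mulr0 subr0 addr0.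
  - move=> y y' yn yn' _; split.
      rewrite -[LHS]/(nsb K y y' + ppos (kA (th om) e (w y) (w y')) 0 - iu * cst_of (th om 0)).
      by rewrite ppos0 (angle0 BM) c0 mulr0 subr0 addr0.
    rewrite -[LHS]/(nr K y y' + ppos (kB (th om) e (w y) (w y')) 0).
    by rewrite ppos0 addr0.
have E2 : \sum_(y <- ns) chg X y * chgs X y * cst_of (Re (ppos (kB (th om) e (w y) (w y)) 0)) = 0.
  by rewrite big1 // => y _; rewrite ppos0 (_ : Re 0 = 0) // c0 mulr0.
have -> : Lam kappa X w K e (th om) 0 = expo kappa X (logs_at w K e (th om) 0) + rexpo X w
  + \sum_(y <- ns) chg X y * chgs X y * cst_of (Re (ppos (kB (th om) e (w y) (w y)) 0)) by [].
by rewrite E1 E2 addr0.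
Qed.

Lemma evolved_nodes om e t : 0 < e -> 0 <= t -> (forall y, y \in ns -> alive (th om) e (w y) t) ->
  forall y, y \in ns -> Defs.dom (evolved (dr om) t W0) y /\ y <> Defs.root (evolved (dr om) t W0).
Proof.
move=> e0 t0 A y yn; have [Dy yq] := nodes_in yn; split; last exact: yq.
exact: (alive_evolved q (@cth om) (@xE om) e0 t0 Dy (A _ yn)).
Qed.

Lemma evolved_value om e t : 0 < e -> e < 1 -> 0 <= t -> (forall y, y \in ns -> alive (th om) e (w y) t) ->
  Ehat kappa (evolved (dr om) t W0) X (v * expC (Lam kappa X w K e (th om) t - tip_value kappa X w K 1)).
Proof.
move=> e0 e1 t0 A.
have gt := evolved_good oD wder winj wD wq (@cth om) (@xE om) t0.
have Kt := node_logs_atP Dq wder wq (@cth om) (@xE om) KW nodes_in e0 e1 t0 A.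
have := Ehat_complete (@vertex_chg0 R n z sigma sigmas tau taus) gt (evolved_nodes e0 t0 A) Kt gph.
rewrite (Lam_tip kappa K nodes_lt1 (@cth om) (@xE om) D q e0 t0 A) vE.
have -> : expC (tip_value kappa X w K 1) * g * expC (Lam kappa X w K e (th om) t - tip_value kappa X w K 1) =
   expC (Lam kappa X w K e (th om) t) * g by rewrite mulrAC -expCD addrC subrK.
by [].
Qed.

Lemma evolved_value_sound om e t u : 0 < e -> e < 1 -> 0 <= t -> (forall y, y \in ns -> alive (th om) e (w y) t) ->
  Ehat kappa (evolved (dr om) t W0) X u -> exists2 g', phases kappa X g' & u = expC (Lam kappa X w K e (th om) t) * g'.
Proof.
move=> e0 e1 t0 A.
have gt := evolved_good oD wder winj wD wq (@cth om) (@xE om) t0.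
have Kt := node_logs_atP Dq wder wq (@cth om) (@xE om) KW nodes_in e0 e1 t0 A.
move=> /(Ehat_sound (@vertex_chg0 R n z sigma sigmas tau taus) gt (evolved_nodes e0 t0 A) Kt)[g' ph ->].
by exists g' => //; rewrite (Lam_tip kappa K nodes_lt1 (@cth om) (@xE om) D q e0 t0 A).
Qed.

Variable eps0 : R.
Hypotheses (eps00 : 0 < eps0) (eps01 : eps0 < 1).
Hypothesis epsw : forall y, y \in ns -> 2 * eps0 < nm (1 - w y).
Local Notation T := (exitn B kappa X w eps0).
Local Notation ep := (eps eps0).

Lemma exitn_alive m om t : 0 <= t <= T m om -> forall y, y \in ns -> alive (th om) (ep m) (w y) t.
Proof. by move=> h; have [_ _] := until_exitn BM eps00 epsw h. Qed.

Lemma exitn_lt_exit m om : ((T m om)%:E < exit_time (dr om) W0 z)%E.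
Proof.
have p := ltW (exitn_gt0 BM kappa eps00 epsw m om).
apply/(exit_timeP z sigma sigmas tau taus) => y yn.
have A : alive (th om) (ep m) (w y) (T m om) by apply: exitn_alive yn; rewrite p lexx.
exact: (alive_lifetime (@cth om) (@xE om) (eps_gt0 eps00 m) p A).
Qed.

Lemma exitn_gt m om t : 0 <= t -> (forall s, 0 <= s <= t -> [/\ `|th om s| < bar m, s < bar m &
  forall y, y \in ns -> 2 * ep m < nm (1 - We (th om) (ep m) (w y) s)]) -> t < T m om.
Proof.
move=> t0 H; apply: (hit_gt (@guard_cont _ _ _ P F B BM kappa X w eps0 eps00 m) (bar_ge0 m)
  (guard_bar B kappa X w eps0 m) t0) => s /H[a b c].
exact: guard_gt0.
Qed.

(** Up to the exit time of level m the two regularised flows agree, and the next guard, with smaller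
    eps and larger bar, is still positive there. *)
Lemma exitn_mono m om : T m om <= T m.+1 om.
Proof.
have p := ltW (exitn_gt0 BM kappa eps00 epsw m om); apply: ltW; apply: (exitn_gt p) => s sT.
have [a b A] := until_exitn BM eps00 epsw sT.
have bb : (bar m : R) < bar m.+1 by rewrite /bar ltr_nat.
split; [exact: le_lt_trans bb|exact: le_lt_trans bb|move=> y yn].
have /andP[s0 _] := sT.
have [_ E] := alive_mono (@cth om) (@xE om) (eps_gt0 eps00 m.+1) (ltW (eps_dec eps00 m)) s0 (A _ yn).
have WE : We (th om) (ep m.+1) (w y) s = We (th om) (ep m) (w y) s.
  by rewrite /We E // s0 lexx.
have [_ _ G] := guard_ge0P (until_hit (@guard_cont _ _ _ P F B BM kappa X w eps0 eps00 m) (bar_ge0 m)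
  (guard_bar B kappa X w eps0 m) (exitn_gt0 BM kappa eps00 epsw m om) sT).
have lt2 : 2 * ep m.+1 < 2 * ep m by have := eps_dec eps00 m; move: (ep m) (ep m.+1) => a1 a2; lra.
by rewrite WE; exact: lt_le_trans lt2 (G _ yn).
Qed.

Lemma common_alive om t : 0 <= t -> (t%:E < exit_time (dr om) W0 z)%E ->
  exists e, [/\ 0 < e, e < 1 & forall y, y \in ns -> alive (th om) e (w y) t].
Proof.
move=> t0 /(exit_timeP z sigma sigmas tau taus); elim: ns => [|y s IH] H.
  by exists 2^-1; split; [rewrite invr_gt0 ltr0n|rewrite invf_lt1 ?ltr1n|].
have [e [e0 e1 A]] : exists e, [/\ 0 < e, e < 1 & forall y, y \in s -> alive (th om) e (w y) t].
  by apply: IH => y' ys; apply: H; rewrite in_cons ys orbT.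
have [e' e'0 A'] := lifetime_alive (@cth om) (@xE om) t0 (H y (mem_head y s)).
have m0 : 0 < Num.min e e' by rewrite lt_min e0.
have m1 : Num.min e e' <= e by rewrite ge_min lexx.
have m2 : Num.min e e' <= e' by rewrite ge_min lexx orbT.
exists (Num.min e e'); split; [exact: m0|exact: le_lt_trans e1|].
move=> y'; rewrite in_cons => /orP[/eqP ->|ys].
  by have [] := alive_mono (@cth om) (@xE om) m0 m2 t0 A'.
by have [] := alive_mono (@cth om) (@xE om) m0 m1 t0 (A _ ys).
Qed.

Lemma exitn_exhaust om t : 0 <= t -> (t%:E < exit_time (dr om) W0 z)%E -> exists m, t < T m om.
Proof.
move=> t0 /(common_alive t0)[e [e0 e1 A]].
have [c cI Hc] := EVT_max t0 (continuous_subspaceT (fun s => cvg_norm (@cth om s) : (`|th om y| @[y --> s] --> `|th om s|))).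
(* A level m with m + 1 > M exceeds the angle and the time on [0, t] and satisfies 2 eps0/(m + 1) <
   e. *)
set M := `|th om c| + t + 2 * eps0 / e + 1.
have q0 : 0 <= 2 * eps0 / e by rewrite divr_ge0 ?mulr_ge0 // ltW.
have Mb : M < bar (Num.bound M).
  apply: (@lt_trans _ _ (Num.bound M)%:R); last by rewrite /bar ltr_nat.
  by apply: archi_boundP; rewrite /M !addr_ge0.
exists (Num.bound M); apply: (exitn_gt t0) => s /andP[s0 st].
have hc : `|th om s| <= `|th om c| by apply: Hc; rewrite in_itv /= s0.
have n1 := normr_ge0 (th om c).
have em : 2 * ep (Num.bound M) < e.
  rewrite /eps mulrA ltr_pdivrMr ?ltr0n // -ltr_pdivrMl // [_^-1 * _]mulrC.
  apply: lt_trans Mb; rewrite /M; lra.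
split; [by rewrite /M in Mb; lra|by rewrite /M in Mb; lra|move=> y yn].
have ep0 := eps_gt0 eps00 (Num.bound M).
have le1 : ep (Num.bound M) <= e by move: ep0 em; move: (ep _) => a1; lra.
have [_ E] := alive_mono (@cth om) (@xE om) ep0 le1 t0 (A _ yn).
have ss : 0 <= s <= t by rewrite s0.
have WE : We (th om) (ep (Num.bound M)) (w y) s = We (th om) e (w y) s by rewrite /We E.
by rewrite WE; apply: lt_trans em _; exact: A.
Qed.

Lemma exitn_cvg om : (T m om)%:E @[m --> \oo] --> exit_time (dr om) W0 z.
Proof.
have nd : nondecreasing_seq (fun m => (T m om)%:E).
  by apply/nondecreasing_seqP => m; rewrite lee_fin; exact: exitn_mono.
have := ereal_nondecreasing_cvgn nd.
set S := ereal_sup _; suff -> : S = exit_time (dr om) W0 z by [].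
have T0 := exitn_gt0 BM kappa eps00 epsw 0 om.
have S0 : (0%:E < S)%E.
  apply: (@lt_le_trans _ _ (T 0 om)%:E); first by rewrite lte_fin.
  by apply: ereal_sup_ubound; exists 0%N.
apply/eqP; rewrite eq_le; apply/andP; split.
  by apply: ge_ereal_sup => _ [m _ <-]; apply: ltW; exact: exitn_lt_exit.
rewrite leNgt; apply/negP; case SE: S S0 => [r| |] //=; last by rewrite ltNge leey.
rewrite lte_fin => r0 /(exitn_exhaust (ltW r0))[m rm].
have : ((T m om)%:E <= S)%E by apply: ereal_sup_ubound; exists m.
by rewrite SE lee_fin leNgt rm.
Qed.

Definition branch_at m om t : C := v * expC (Lam kappa X w K (ep m) (th om) t - tip_value kappa X w K 1).

Lemma branch_atE m m' om t : 0 <= t -> t <= T m om -> t <= T m' om -> branch_at m om t = branch_at m' om t.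
Proof.
wlog mm : m m' / (m <= m')%N.
  move=> H t0 h h'; have [mm|mm] := leqP m m'; first exact: H.
  by apply: esym; apply: H => //; exact: ltnW.
move=> t0 h _; rewrite /branch_at.
have -> // : Lam kappa X w K (ep m') (th om) t = Lam kappa X w K (ep m) (th om) t.
have A y : y \in ns -> alive (th om) (ep m) (w y) t by move=> yn; apply: exitn_alive yn; rewrite t0.
apply: (Lam_mono kappa K (@cth om) (@xE om) (eps_gt0 eps00 m') _ t0 A (eps_lt1 eps00 eps01 m)).
elim: m' mm => [|m' IH]; first by rewrite leqn0 => /eqP ->.
rewrite leq_eqVlt => /orP[/eqP <- //|]; rewrite ltnS => /IH; apply: le_trans; apply: ltW; exact: eps_dec.
Qed.

Lemma Lam_cts m om t : 0 <= t <= T m om -> cts (Lam kappa X w K (ep m) (th om)) t.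
Proof.
move=> tT; have /andP[t0 _] := tT; apply: (@Lam_cont R kappa X w K (th om) (@cth om) (ep m) t (eps_gt0 eps00 m)) => y yn.
have e0 := eps_gt0 eps00 m; have Az := exitn_alive tT yn.
have nw1 := nm_We_lt1 (@cth om) e0 t0 Az (nodes_lt1 yn).
have tt : 0 <= t <= t by rewrite t0 lexx.
apply: lt_trans (Re_gap e0 (Az _ tt) nw1); by rewrite divr_gt0 // exprn_gt0.
Qed.

Lemma branch_cts m om t : 0 <= t <= T m om -> cts (branch_at m om) t.
Proof.
move=> tT; apply: ctsM; first exact: cts_cst.
have cd : cts (fun s => Lam kappa X w K (ep m) (th om) s - tip_value kappa X w K 1) t.
  by apply: ctsD; [exact: Lam_cts|exact: cts_cst].
by apply: (cvg_comp _ (@expC R) cd); exact: continuous_expC.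
Qed.

Lemma branch_start m om : branch_at m om 0 = v.
Proof. by rewrite /branch_at (Lam_start om (eps_gt0 eps00 m)) subrr expC0 mulr1. Qed.

(** Pasted over all levels; [branch_atE] makes the choice of the level immaterial. *)
Definition branch t om : C := xget 0 [set u | exists2 m, t < T m om & u = branch_at m om t].
Lemma branchE m om t : 0 <= t -> t < T m om -> branch t om = branch_at m om t.
Proof.
move=> t0 h; rewrite /branch; case: xgetP => [u _ [m' h' ->]|H]; last by case: (H (branch_at m om t)); exists m.
by apply: branch_atE => //; exact: ltW.
Qed.

Local Notation Mobs := (fun W z => Ehat kappa W (vertex z sigma sigmas tau taus)).

Lemma branch_follows : follows Mobs kappa W0 z B v branch.
Proof.
move=> om ex; split.
- by rewrite (branchE (lexx 0) (exitn_gt0 BM kappa eps00 epsw 0 om)) branch_start.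
- apply: within_eps => s /= [s0 /(exitn_exhaust s0)[m sm]] e e0.
  have sT : 0 <= s <= T m om by rewrite s0 ltW.
  have /cvgCP/(_ e e0)/nbhs_ballP[r /= r0 Hr] := branch_cts sT.
  exists (Num.min r (T m om - s)); first by rewrite lt_min r0 subr_gt0.
  move=> s' [s'0 _]; rewrite lt_min => /andP[h1 h2].
  have s'm : s' < T m om by move: h2; rewrite ltr_norml => /andP[]; lra.
  rewrite (branchE s0 sm) (branchE s'0 s'm).
  by apply: Hr; rewrite /ball /= distrC.
- move=> t t0 /(exitn_exhaust t0)[m tm]; rewrite (branchE t0 tm).
  apply: (evolved_value (eps_gt0 eps00 m) (eps_lt1 eps00 eps01 m) t0) => y yn.
  by apply: exitn_alive yn; rewrite t0 ltW.
Qed.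

(** Y exp(-[Lam]) is continuous on [0, t] and takes its values among the phases, hence is
    constant. *)
Lemma follows_unique Y m om t : follows Mobs kappa W0 z B v Y -> 0 <= t <= T m om -> Y t om = branch_at m om t.
Proof.
move=> /(_ om)/= [Y0 cY HY] tT; have /andP[t0 tm] := tT.
have e0 := eps_gt0 eps00 m; have e1 := eps_lt1 eps00 eps01 m.
have inT s : 0 <= s <= t -> 0 <= s <= T m om by move=> /andP[s0 st]; rewrite s0 (le_trans st).
have lt_exit s : 0 <= s <= t -> (s%:E < exit_time (dr om) W0 z)%E.
  by move=> /inT/andP[_ h]; apply: (@le_lt_trans _ _ (T m om)%:E); [rewrite lee_fin|exact: exitn_lt_exit].
pose L s := Lam kappa X w K (ep m) (th om) s.
pose f s := Y s om * expC (- L s).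
have ph s : 0 <= s <= t -> phases kappa X (f s).
  move=> hs; have /andP[s0 _] := hs.
  have A y : y \in ns -> alive (th om) (ep m) (w y) s by move=> yn; exact: exitn_alive (inT _ hs) _ yn.
  have [g' pg E] := evolved_value_sound e0 e1 s0 A (HY s s0 (lt_exit s hs)).
  by rewrite /f E mulrAC -/(L s) -expCD subrr expC0 mul1r.
have cf : {within `[0, t], continuous f}.
  have c1 : {within `[0, t], continuous (Y^~ om)}.
    apply: continuous_subspaceW cY => s; rewrite /= in_itv /= => hs; have /andP[s0 _] := hs.
    by split => //; exact: lt_exit.
  have c2 : {within `[0, t], continuous (fun s => expC (- L s))}.
    apply: within_eps => s; rewrite /= in_itv /= => hs e e'0.
    have cL : cts (fun s => - L s) s by apply: ctsN; exact: Lam_cts (inT _ hs).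
    have cE : cts (fun s => expC (- L s)) s by apply: (cvg_comp _ (@expC R) cL); exact: continuous_expC.
    have /cvgCP/(_ e e'0)/nbhs_ballP[r /= r0 Hr] := cE.
    exists r => // s' _ ss; apply: Hr; by rewrite /ball /= distrC.
  by move=> s; apply: cvgM; [exact: c1|exact: c2].
have E : f 0 = f t.
  exact: (countable_const t0 cf (phases_countable kappa X) ph).
have z0 : 0 <= (0 : R) <= t by rewrite lexx.
have YE : Y t om = f t * expC (L t) by rewrite /f -mulrA -expCD addNr expC0 mulr1.
rewrite YE -E /f Y0 /L (Lam_start om e0) /branch_at -mulrA -expCD; congr (_ * expC _); ring.
Qed.

Lemma follows_local_martingale Y : follows Mobs kappa W0 z B v Y ->
  local_martingale P F (fun om => exit_time (dr om) W0 z) Y.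
Proof.
move=> HY; exists T; split.
- by move=> m; exact: (exitn_stopping FF BM kappa X w eps00 m).
- by move=> m om; exact: exitn_mono.
- by move=> m om; exact: exitn_lt_exit.
- by apply: aeW => om; exact: exitn_cvg.
- move=> m.
  have OM c := obs_martingale FF BM K k0 nodes_lt1 neu eps00 eps01 epsw m c.
  have E t om : 0 <= t -> Y (Num.min t (T m om)) om = wgt B kappa X w K eps0 m v (Num.min t (T m om)) om.
    move=> t0; rewrite (@follows_unique Y m om) //; last first.
      by rewrite le_min t0 (ltW (exitn_gt0 BM kappa eps00 epsw m om)) /= ge_min lexx orbT.
    by rewrite /branch_at /wgt (Lam_start om (eps_gt0 eps00 m)).
  split.
    by apply: (martingale_ext _ (OM v)) => t om t0; rewrite (E t om t0).
  (* The imaginary part, as Re(-i y) = Im y. *)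
  apply: (martingale_ext _ (OM (- iu * v))) => t om t0; rewrite (E t om t0) /obs /wgt.
  move: (expC _) => u; rewrite -mulrA; move: (v * u) => y.
  by rewrite !ReImE; ring.
Qed.

End Branch.

Theorem observable_conclusion :
  (exists Y, follows (fun W z => Ehat kappa W (vertex z sigma sigmas tau taus)) kappa W0 z B v Y) /\
  (forall Y, follows (fun W z => Ehat kappa W (vertex z sigma sigmas tau taus)) kappa W0 z B v Y ->
     local_martingale P F (fun om => exit_time (dr om) W0 z) Y).
Proof.
have [_ [K KW]] := Ehat_nodes good0 Hv.
have [g gph vE] := Ehat_sound (@vertex_chg0 R n z sigma sigmas tau taus) good0 nodes_in KW Hv.
have [y yn|r r0 Hr] := @seq_min_pos R _ ns (fun y => nm (1 - w y)).
  have := nodes_lt1 yn; have := nmD (1 - w y) (w y); rewrite subrK nm1; lra.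
(* eps0 = min(1, r)/4, with r a lower bound for |1 - w y| over the nodes, satisfies eps0 < 1 and 2
   eps0 < r, so that no node is stopped at time 0. *)
have [h1 h2] := min_quarter r0.
have e0 : 0 < Num.min 1 r / 4 by rewrite divr_gt0 // lt_min ltr01.
have ew y : y \in ns -> 2 * (Num.min 1 r / 4) < nm (1 - w y).
  move=> yn; apply: lt_le_trans (Hr _ yn); exact: h2.
split.
  exists (branch K (Num.min 1 r / 4)); exact: (branch_follows KW gph vE e0 h1 ew).
by move=> Y; exact: (follows_local_martingale KW e0 h1 ew).
Qed.

End Assembly.

Unset Implicit Arguments.

Theorem theorem1p2 (R : realType) (kappa : R)
    (D : set (Cplx R)) (p q : Cplx R) (w : Cplx R -> Cplx R)
    (n : nat) (sigma sigmas : 'I_n -> Cplx R) (tau taus : Cplx R) :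
  0 < kappa ->
  open D -> simply_connected D -> D <> setT -> boundary D p -> D q ->
  conformal_to_disc D p q w ->
  tau + taus + \sum_(j < n) (sigma j + sigmas j) = 0 ->
  martingale_observable kappa (MarkedDomain D q w)
    (fun W z => Ehat kappa W (vertex z sigma sigmas tau taus)).
Proof.
move=> k0 oD _ _ _ Dq [wder winj wD wq _] neu d Omega P F B FF BM z v _ Hv.
exact: (observable_conclusion FF BM oD Dq wder winj wD wq k0 neu Hv).
Qed.
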